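(* Let $X$ be a nonempty compact subset of $\mathbb{C}$ and let $G$ be a set of generators of $C(X)$. Then the following conditions are equivalent: (i) $G$ is hyperrigid in $C(X)$; (ii) for every Hilbert space $\mathcal{H}$, every sequence $\{T_n\}_{n=1}^\infty\subseteq\boldsymbol{B}(\mathcal{H})$ of subnormal operators and every normal operator $T\in\boldsymbol{B}(\mathcal{H})$, all with spectrum in $X$: if $f(T_n)\to f(T)$ in the weak operator topology as $n\to\infty$ for all $f\in G$, then $f(T_n)\to f(T)$ in the strong operator topology as $n\to\infty$ for all $f\in C(X)$; (iii) for every Hilbert space $\mathcal{H}$ and all normal operators $T,T_n\in\boldsymbol{B}(\mathcal{H})$ ($n\in\mathbb{N}$) with spectrum in $X$: if $f(T_n)\to f(T)$ in the weak operator topology as $n\to\infty$ for all $f\in G$, then $f(T_n)\to f(T)$ in the strong operator topology as $n\to\infty$ for all $f\in C(X)$. Moreover, conditions (i)-(iii) are still equivalent regardless of whether the Hilbert spaces considered in either of them are separable or not (that is, in each of (i), (ii), (iii), including in the definition of hyperrigidity used in (i), ''Hilbert space'' may independently be replaced by ''separable Hilbert space'', and all the resulting conditions are equivalent).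
   Context: Hilbert spaces are complex; $\boldsymbol{B}(\mathcal{H})$ is the $C^*$-algebra of bounded linear operators on $\mathcal{H}$. $C(X)$ is the $C^*$-algebra of continuous complex functions on $X$ with the supremum norm. A nonempty set $G\subseteq C(X)$ is a set of generators of $C(X)$ if the smallest $C^*$-subalgebra of $C(X)$ containing $G\cup\{1\}$ is $C(X)$. Hyperrigidity: a nonempty subset $G$ of a unital $C^*$-algebra $\mathscr{A}$ is hyperrigid (in $\mathscr{A}$) if for any faithful representation (unital $*$-homomorphism) $\pi\colon\mathscr{A}\to\boldsymbol{B}(\mathcal{H})$ on a Hilbert space $\mathcal{H}$ and any sequence $\Phi_k\colon\boldsymbol{B}(\mathcal{H})\to\boldsymbol{B}(\mathcal{H})$ ($k\in\mathbb{N}$) of unital completely positive linear maps, if $\lim_{k\to\infty}\|\Phi_k(\pi(g))-\pi(g)\|=0$ for all $g\in G$, then $\lim_{k\to\infty}\|\Phi_k(\pi(a))-\pi(a)\|=0$ for all $a\in\mathscr{A}$. Subnormal operators and their functional calculus: $S\in\boldsymbol{B}(\mathcal{H})$ is subnormal if there are a Hilbert space $\mathcal{K}\supseteq\mathcal{H}$ (isometric embedding) and a normal operator $N\in\boldsymbol{B}(\mathcal{K})$ (a normal extension of $S$) with $Sh=Nh$ for all $h\in\mathcal{H}$; $N$ is minimal if $\mathcal{K}$ is the only closed subspace of $\mathcal{K}$ that reduces $N$ and contains $\mathcal{H}$. If $N$ is a minimal normal extension of $S$, $E$ is the spectral measure of $N$ on Borel subsets of $\mathbb{C}$, and $P$ is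 the orthogonal projection of $\mathcal{K}$ onto $\mathcal{H}$, then $F(\Delta)=PE(\Delta)|_{\mathcal{H}}$ is the semispectral measure of $S$ (independent of the choice of $N$). If $\sigma(S)\subseteq X$ with $X\subseteq\mathbb{C}$ compact, then $F$ is supported in $X$ and one sets $f(S)=\int_X f\,\mathrm{d}F$ for $f\in C(X)$, i.e. $\langle f(S)h,h\rangle=\int_X f(x)\,\langle F(\mathrm{d}x)h,h\rangle$ for $h\in\mathcal{H}$; equivalently $f(S)=Pf(N)|_{\mathcal{H}}$. For normal $S$ this is the usual continuous functional calculus. *)

(* Defs.v *)
From HB Require Import structures.
From mathcomp Require Import all_boot all_order all_algebra.
From mathcomp Require Import complex.
From mathcomp Require Import all_classical all_reals all_analysis.

Set Implicit Arguments.
Unset Strict Implicit.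
Unset Printing Implicit Defensive.

Import Order.TTheory GRing.Theory Num.Theory Num.Def.
Import numFieldNormedType.Exports.

Local Open Scope classical_set_scope.
Local Open Scope ring_scope.
Local Open Scope complex_scope.

HB.instance Definition _ (R : realType) :=
  PseudoPointedMetric.copy R[i] (R[i])^o.

Section continuous_functions.
Context (R : realType) (X : topologicalType).
Implicit Types (f g : continuousType X R[i]) (a : R[i]).

Fact addf_continuous f g : continuous (f \+ g).
Proof.
by move=> x; apply: (@cvgD R[i] R[i]^o) => //; exact: (@cts_fun X R[i] _ x).
Qed.

Fact oppf_continuous f : continuous (\- f).
Proof.
by move=> x; apply: (@cvgN R[i] R[i]^o) => //; exact: (@cts_fun X R[i] _ x).
Qed.

Fact mulf_continuous f g : continuous (f \* g).
Proof.
by move=> x; apply: (@cvgM R[i]) => //; exact: (@cts_fun X R[i] _ x).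
Qed.

Fact conjf_continuous f : continuous (fun x => (f x)^*%R).
Proof.
move=> x; apply/(@cvgrPdist_lt R[i] R[i]^o) => e e0.
have /(@cvgrPdist_lt R[i] R[i]^o) /(_ e e0) := @cts_fun X R[i] f x.
by apply: filterS => t; rewrite -rmorphB norm_conjC.
Qed.

Definition cf_add f g : continuousType X R[i] := mkcts (@addf_continuous f g).
Definition cf_opp f : continuousType X R[i] := mkcts (@oppf_continuous f).
Definition cf_mul f g : continuousType X R[i] := mkcts (@mulf_continuous f g).
Definition cf_conj f : continuousType X R[i] := mkcts (@conjf_continuous f).
Definition cf_cst a : continuousType X R[i] := cst a.

Fact cf_addA : associative cf_add.
Proof. by move=> f g h; apply/continuousEP => x; exact: addrA. Qed.
Fact cf_addC : commutative cf_add.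
Proof. by move=> f g; apply/continuousEP => x; exact: addrC. Qed.
Fact cf_add0 : left_id (cf_cst 0) cf_add.
Proof. by move=> f; apply/continuousEP => x; exact: add0r. Qed.
Fact cf_addN : left_inverse (cf_cst 0) cf_opp cf_add.
Proof. by move=> f; apply/continuousEP => x; exact: addNr. Qed.

HB.instance Definition _ := GRing.isZmodule.Build (continuousType X R[i])
  cf_addA cf_addC cf_add0 cf_addN.

Fact cf_mulA : associative cf_mul.
Proof. by move=> f g h; apply/continuousEP => x; exact: mulrA. Qed.
Fact cf_mulC : commutative cf_mul.
Proof. by move=> f g; apply/continuousEP => x; exact: mulrC. Qed.
Fact cf_mul1 : left_id (cf_cst 1) cf_mul.
Proof. by move=> f; apply/continuousEP => x; exact: mul1r. Qed.
Fact cf_mulr1 : right_id (cf_cst 1) cf_mul.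
Proof. by move=> f; apply/continuousEP => x; exact: mulr1. Qed.
Fact cf_mulDl : left_distributive cf_mul +%R.
Proof. by move=> f g h; apply/continuousEP => x; exact: mulrDl. Qed.
Fact cf_mulDr : right_distributive cf_mul +%R.
Proof. by move=> f g h; apply/continuousEP => x; exact: mulrDr. Qed.

HB.instance Definition _ := GRing.Zmodule_isPzRing.Build
  (continuousType X R[i]) cf_mulA cf_mul1 cf_mulr1 cf_mulDl cf_mulDr.
HB.instance Definition _ := GRing.PzRing_hasCommutativeMul.Build
  (continuousType X R[i]) cf_mulC.

Definition cf_scale a f : continuousType X R[i] := cf_mul (cf_cst a) f.

Fact cf_scaleA a b f : cf_scale a (cf_scale b f) = cf_scale (a * b) f.
Proof. by apply/continuousEP => x; exact: mulrA. Qed.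
Fact cf_scale1 : left_id 1 cf_scale.
Proof. by move=> f; apply/continuousEP => x; exact: mul1r. Qed.
Fact cf_scaleDr : right_distributive cf_scale +%R.
Proof. by move=> a f g; apply/continuousEP => x; exact: mulrDr. Qed.
Fact cf_scaleDl f : {morph cf_scale^~ f : a b / a + b}.
Proof. by move=> a b; apply/continuousEP => x; exact: mulrDl. Qed.

HB.instance Definition _ := GRing.Zmodule_isLmodule.Build R[i]
  (continuousType X R[i]) cf_scaleA cf_scale1 cf_scaleDr cf_scaleDl.

(* Meaningful when X is nonempty and compact. *)
Definition sup_norm f : R := sup [set complex.Re `|f x| | x in [set: X]].

Definition cstar_subalgebra (A : set (continuousType X R[i])) : Prop :=
  [/\ A 0,
      forall a f g, A f -> A g -> A (a *: f + g),
      forall f g, A f -> A g -> A (f * g),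
      forall f, A f -> A (cf_conj f) &
      forall f, (forall e : R, 0 < e -> exists2 g, A g & sup_norm (f - g) < e) ->
        A f].

Definition cstar_generated (S : set (continuousType X R[i])) :
    set (continuousType X R[i]) :=
  \bigcap_(A in [set A | cstar_subalgebra A /\ S `<=` A]) A.

Definition generators (G : set (continuousType X R[i])) : Prop :=
  G !=set0 /\ cstar_generated (G `|` [set 1]) = setT.

End continuous_functions.

(* The inner product is linear in its first argument. *)
HB.mixin Record CompleteNormedModule_isHilbert (R : realType) (H : Type)
    of CompleteNormedModule R[i] H := {
  dotp : {dot H for conjC};
  dotp_norm : forall x : H, dotp x x = `|x| ^+ 2
}.

#[short(type="hilbertType")]
HB.structure Definition Hilbert (R : realType) :=
  { H of CompleteNormedModule R[i] H & CompleteNormedModule_isHilbert R H }.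

Definition separable (R : realType) (H : hilbertType R) : Prop :=
  exists2 D : set H, countable D & dense D.

#[short(type="boundedOp")]
HB.structure Definition BoundedOp (R : realType) (H : hilbertType R) :=
  { T of @GRing.Linear R[i] H H *:%R T & @isContinuous H H T }.

Notation "''B(' H )" := (boundedOp H) (format "''B(' H )") : type_scope.

Section bounded_operators.
Context (R : realType) (H : hilbertType R).
Implicit Types (S T P : 'B(H)) (a : R[i]).

Lemma boundedOpP S T : S = T <-> S =1 T.
Proof.
split=> [->//|/funext].
case: S T => [S [[S1] [S2] [S3]]] [T [[T1] [T2] [T3]]] /= ST.
case: _ / ST T1 T2 T3 => T1 T2 T3.
by rewrite (Prop_irrelevance S1 T1) (Prop_irrelevance S2 T2)
  (Prop_irrelevance S3 T3).
Qed.

HB.instance Definition _ := gen_eqMixin 'B(H).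
HB.instance Definition _ := gen_choiceMixin 'B(H).

HB.instance Definition _ := @isContinuous.Build H H (\0 : H -> H)
  (fun=> cvg_cst _).
HB.instance Definition _ S T := @isContinuous.Build H H (S \+ T)
  (fun x => cvgD (cts_fun x) (cts_fun x)).
HB.instance Definition _ S := @isContinuous.Build H H (\- S)
  (fun x => cvgN (cts_fun x)).
HB.instance Definition _ a S := @isContinuous.Build H H (a \*: S)
  (fun x => cvgZ (cvg_cst a) (cts_fun x)).
HB.instance Definition _ := @isContinuous.Build H H (@idfun H) cts_fun.
HB.instance Definition _ S T := @isContinuous.Build H H (S \o T) cts_fun.

Definition op_zero : 'B(H) := (\0 : H -> H).
Definition op_add S T : 'B(H) := S \+ T.
Definition op_opp S : 'B(H) := \- S.
Definition op_scale a S : 'B(H) := a \*: S.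
Definition op_id : 'B(H) := (idfun : H -> H).
Definition op_comp S T : 'B(H) := S \o T.

Fact op_addA : associative op_add.
Proof. by move=> S T U; apply/boundedOpP => x; exact: addrA. Qed.
Fact op_addC : commutative op_add.
Proof. by move=> S T; apply/boundedOpP => x; exact: addrC. Qed.
Fact op_add0 : left_id op_zero op_add.
Proof. by move=> S; apply/boundedOpP => x; exact: add0r. Qed.
Fact op_addN : left_inverse op_zero op_opp op_add.
Proof. by move=> S; apply/boundedOpP => x; exact: addNr. Qed.

HB.instance Definition _ :=
  GRing.isZmodule.Build 'B(H) op_addA op_addC op_add0 op_addN.

Fact op_scaleA a b S : op_scale a (op_scale b S) = op_scale (a * b) S.
Proof. by apply/boundedOpP => x; exact: scalerA. Qed.
Fact op_scale1 : left_id 1 op_scale.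
Proof. by move=> S; apply/boundedOpP => x; exact: scale1r. Qed.
Fact op_scaleDr : right_distributive op_scale +%R.
Proof. by move=> a S T; apply/boundedOpP => x; exact: scalerDr. Qed.
Fact op_scaleDl S : {morph op_scale^~ S : a b / a + b}.
Proof. by move=> a b; apply/boundedOpP => x; exact: scalerDl. Qed.

HB.instance Definition _ := GRing.Zmodule_isLmodule.Build R[i] 'B(H)
  op_scaleA op_scale1 op_scaleDr op_scaleDl.

Fact op_compA : associative op_comp.
Proof. by move=> S T U; apply/boundedOpP. Qed.
Fact op_comp1 : left_id op_id op_comp.
Proof. by move=> S; apply/boundedOpP. Qed.
Fact op_compr1 : right_id op_id op_comp.
Proof. by move=> S; apply/boundedOpP. Qed.
Fact op_compDl : left_distributive op_comp +%R.
Proof. by move=> S T U; apply/boundedOpP. Qed.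
Fact op_compDr : right_distributive op_comp +%R.
Proof. by move=> S T U; apply/boundedOpP => x; exact: linearD. Qed.

HB.instance Definition _ := GRing.Zmodule_isPzRing.Build 'B(H)
  op_compA op_comp1 op_compr1 op_compDl op_compDr.

Definition op_norm T : R :=
  sup [set complex.Re `|T x| | x in [set x : H | `|x| <= 1]].

(* The choice is unique, and it exists by the Riesz representation theorem. *)
Definition adjoint T : 'B(H) :=
  xget 0 [set S : 'B(H) | forall x y, dotp (T x) y = dotp x (S y)].

Definition normal_op T : Prop := T * adjoint T = adjoint T * T.

Definition orthogonal_projection P : Prop := P * P = P /\ adjoint P = P.

Definition spectrum T : set R[i] :=
  [set l : R[i] | let U := T - l *: (1 : 'B(H)) in
     ~ exists S : 'B(H), S * U = 1 /\ U * S = 1].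

Definition wot_cvg (S_ : nat -> 'B(H)) S : Prop :=
  forall x y, dotp (S_ n x) y @[n --> \oo] --> dotp (S x) y.

Definition sot_cvg (S_ : nat -> 'B(H)) S : Prop :=
  forall x, S_ n x @[n --> \oo] --> S x.

(* [A_ij] is positive in M_n(B(H)) = B(H^n); in particular the form is real. *)
Definition positive_mx n (A : 'I_n -> 'I_n -> 'B(H)) : Prop :=
  forall x : 'I_n -> H, 0 <= \sum_i \sum_j dotp (A i j (x j)) (x i).

Definition completely_positive (Phi : 'B(H) -> 'B(H)) : Prop :=
  forall n (A : 'I_n -> 'I_n -> 'B(H)),
    positive_mx A -> positive_mx (fun i j => Phi (A i j)).

Definition ucp (Phi : 'B(H) -> 'B(H)) : Prop :=
  [/\ linear Phi, completely_positive Phi & Phi 1 = 1].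

Definition faithful_representation (X : topologicalType)
    (pi : continuousType X R[i] -> 'B(H)) : Prop :=
  [/\ linear pi, monoid_morphism pi,
      forall f, pi (cf_conj f) = adjoint (pi f) & injective pi].

Local Notation borelC := (g_sigma_algebraType (@open R[i])).

(* [mu] is the scalar measure D |-> <F(D)h, h>. *)
Definition scalar_measure (F : set R[i] -> 'B(H)) (h : H)
    (mu : {measure set borelC -> \bar R}) : Prop :=
  forall D : set borelC, measurable D ->
    mu D \is a fin_num /\ dotp (F D h) h = (fine (mu D))%:C.

Definition complex_integral (mu : {measure set borelC -> \bar R})
    (D : set R[i]) (f : R[i] -> R[i]) : R[i] :=
  (\int[mu]_(z in (D : set borelC)) complex.Re (f z))
  +i* (\int[mu]_(z in (D : set borelC)) complex.Im (f z)).

(* Only the values on Borel sets are constrained. *)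
Definition spectral_measure (E : set R[i] -> 'B(H)) : Prop :=
  [/\ E setT = 1,
      forall D : set borelC, measurable D -> orthogonal_projection (E D) &
      forall h, exists mu, scalar_measure E h mu].

Definition spectral_measure_of (N : 'B(H)) (E : set R[i] -> 'B(H)) : Prop :=
  [/\ spectral_measure E, E (spectrum N) = 1 &
      forall h, exists2 mu, scalar_measure E h mu &
        dotp (N h) h = complex_integral mu (spectrum N) id].

End bounded_operators.

Section subnormal_operators.
Context (R : realType) (H : hilbertType R).
Implicit Types (S : 'B(H)) (F : set R[i] -> 'B(H)).

Local Notation borelC := (g_sigma_algebraType (@open R[i])).

(* [V] embeds [H] isometrically in [K]. *)
Definition normal_extension S (K : hilbertType R) (V : {linear H -> K})
    (N : 'B(K)) : Prop :=
  [/\ forall h, `|V h| = `|h|, normal_op N & forall h, V (S h) = N (V h)].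

Definition subnormal S : Prop :=
  exists (K : hilbertType R) (V : {linear H -> K}) (N : 'B(K)),
    normal_extension S V N.

Definition closed_subspace (K : hilbertType R) (M : set K) : Prop :=
  [/\ M 0, forall a x y, M x -> M y -> M (a *: x + y) & closed M].

Definition reduces (K : hilbertType R) (M : set K) (N : 'B(K)) : Prop :=
  forall x, M x -> M (N x) /\ M (adjoint N x).

Definition minimal_normal_extension S (K : hilbertType R) (V : {linear H -> K})
    (N : 'B(K)) : Prop :=
  normal_extension S V N /\
  forall M : set K, closed_subspace M -> reduces M N -> range V `<=` M ->
    M = setT.

(* F(D) = P E(D)|_H, with H identified with the range of [V]. *)
Definition semispectral_measure_of S F : Prop :=
  exists (K : hilbertType R) (V : {linear H -> K}) (N P : 'B(K))
      (E : set R[i] -> 'B(K)),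
    [/\ minimal_normal_extension S V N, spectral_measure_of N E,
        orthogonal_projection P, range P = range V &
        forall D : set borelC, measurable D ->
          forall h, V (F D h) = P (E D (V h))].

(* f(S) = \int_X f dF in the weak sense. It exists and is unique when S is
   subnormal with spectrum in X. [valL_ 0 f] extends f by 0 outside X. *)
Definition fun_calc (X : set R[i]) S (f : continuousType X R[i]) : 'B(H) :=
  xget 0 [set A : 'B(H) | exists2 F, semispectral_measure_of S F &
    forall h, exists2 mu, scalar_measure F h mu &
      dotp (A h) h = complex_integral mu X (valL_ 0 f)].

End subnormal_operators.

(* In the three conditions, [sep] restricts H to separable Hilbert spaces. *)
Section conditions.
Context (R : realType) (X : set R[i]) (sep : bool).
Variable G : set (continuousType X R[i]).

Definition hyperrigid : Prop :=
  G !=set0 /\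
  forall H : hilbertType R, (sep -> separable H) ->
  forall (pi : continuousType X R[i] -> 'B(H)) (Phi : nat -> 'B(H) -> 'B(H)),
    faithful_representation pi -> (forall k, ucp (Phi k)) ->
    (forall g, G g -> op_norm (Phi k (pi g) - pi g) @[k --> \oo] --> (0 : R)) ->
    forall a, op_norm (Phi k (pi a) - pi a) @[k --> \oo] --> (0 : R).

Definition subnormal_condition : Prop :=
  forall H : hilbertType R, (sep -> separable H) ->
  forall (T_ : nat -> 'B(H)) (T : 'B(H)),
    (forall n, subnormal (T_ n)) -> normal_op T ->
    (forall n, spectrum (T_ n) `<=` X) -> spectrum T `<=` X ->
    (forall f, G f -> wot_cvg (fun n => fun_calc (T_ n) f) (fun_calc T f)) ->
    forall f : continuousType X R[i],
      sot_cvg (fun n => fun_calc (T_ n) f) (fun_calc T f).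

Definition normal_condition : Prop :=
  forall H : hilbertType R, (sep -> separable H) ->
  forall (T_ : nat -> 'B(H)) (T : 'B(H)),
    (forall n, normal_op (T_ n)) -> normal_op T ->
    (forall n, spectrum (T_ n) `<=` X) -> spectrum T `<=` X ->
    (forall f, G f -> wot_cvg (fun n => fun_calc (T_ n) f) (fun_calc T f)) ->
    forall f : continuousType X R[i],
      sot_cvg (fun n => fun_calc (T_ n) f) (fun_calc T f).

End conditions.

(* Main.v *)
From HB Require Import structures.
Require Import Defs.
From mathcomp Require Import all_boot all_order all_algebra.
From mathcomp Require Import complex.
From mathcomp Require Import all_classical all_reals all_analysis.
From mathcomp Require Import ring lra.

(* Every implication goes through one object: a representation rho of C(X) on
   K, a faithful representation pi on H and an isometry V : H -> K, both spaces
   separable, such that V^* rho(g) V = pi(g) for g in G although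
   rho(a) V <> V pi(a) for some a. Call this a defect.

   If one of the conditions fails, it fails through maps phi_n (Phi_n o pi, or
   f |-> f(T_n)), a representation pi and vectors x_n such that
   phi_n(g) - pi(g) tends weakly to 0 on pi(C(X)) x_n for g in G, while
   (phi_n(a) - pi(a)) x_n stays away from 0. The Kolmogorov decompositions of the
   ultrafilter limits of the kernels <phi_n(g^* f) pi(b) x_n, pi(c) x_n> and
   <pi(g^* f) pi(b) x_n, pi(c) x_n>, to which a faithful state of C(X) is added,
   form a defect; monomials in z and its conjugate show separability.

   Conversely, a defect contradicts hyperrigidity on H + K, through the constant
   sequence Phi(A) = V1^* A V1 + V2^* A V2 that replaces pi by V^* rho V. It
   contradicts (iii) on the sum of countably many copies of K: the restriction
   of rho to the complement of V H is moved to the n-th copy, so that it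
   disappears in the weak limit.

   The functional calculus is reduced to representations of C(X): a normal
   operator yields one by Bernstein polynomials of its real and imaginary parts,
   the spectral measure comes from the Riesz representation theorem, and
   polynomial density shows that f(S) depends only on S. *)

Set Implicit Arguments.
Unset Strict Implicit.
Unset Printing Implicit Defensive.

Import Order.TTheory GRing.Theory Num.Theory Num.Def.
Import numFieldNormedType.Exports.

Local Open Scope complex_scope.
Local Open Scope classical_set_scope.
Local Open Scope ring_scope.

(** A defect involves no sequence and no choice of variant, so everything reduces to two claims:
    each condition, even restricted to separable spaces, excludes defects, and without defects each
    condition holds on all spaces. The obstacle is that hyperrigidity fails in norm: the witnesses
    x_n vary and need not converge in H, so no limit operator on H records the failure. Only scalar
    kernels are passed to the limit. The factors pi(b) and pi(c) let convergence on G be tested on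
    all generators of the limit space. The lower bound survives because the Schwarz inequality for
    phi_n gives |(phi_n(a) - pi(a)) x_n|^2 <= <phi_n(a^* a) x_n, x_n> - 2 Re <phi_n(a) x_n, pi(a)
    x_n> + |pi(a) x_n|^2, whose right side is a combination of kernel values. The state enters both
    kernels through the product f b c^* alone, so it cancels in every comparison; it is there
    because hyperrigidity speaks of faithful representations. *)

Lemma half_ltD (R : realFieldType) (e a b : R) : a < e / 2 -> b < e / 2 -> a + b < e.
Proof. lra. Qed.
Lemma half_leltD (R : realFieldType) (e a b : R) : a <= e / 2 -> b < e / 2 -> a + b < e.
Proof. lra. Qed.

(** * Real and complex preliminaries *)

Section real_norm.
Context (R : realType).

(** Norms over [R[i]] take values in [R[i]]; estimates are carried out on this real copy, where
    [lra] and the order lemmas of [R] apply. *)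
Definition nm (V : normedZmodType R[i]) (x : V) : R := complex.Re `|x|.

Section general.
Context (V : normedZmodType R[i]).
Implicit Types x y : V.

Lemma nmE x : `|x| = (nm x)%:C.
Proof. by rewrite /nm RRe_real// ger0_real. Qed.

Lemma nm_ge0 x : 0 <= nm x.
Proof. by rewrite -ler0c -nmE. Qed.

Lemma nmD x y : nm (x + y) <= nm x + nm y.
Proof. by rewrite -lecR rmorphD/= -!nmE ler_normD. Qed.

Lemma nmN x : nm (- x) = nm x.
Proof. by rewrite /nm normrN. Qed.

Lemma nmB x y : nm (x - y) = nm (y - x).
Proof. by rewrite /nm distrC. Qed.

Lemma nm0 : nm (0 : V) = 0.
Proof. by rewrite /nm normr0. Qed.

Lemma nm_eq0 x : nm x = 0 -> x = 0.
Proof. by move=> h; apply/eqP; rewrite -normr_eq0 nmE h. Qed.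

Lemma nm_triB x y z : nm (x - z) <= nm (x - y) + nm (y - z).
Proof. by rewrite (le_trans _ (nmD _ _))// addrA subrK. Qed.

Lemma nm_Bdist x y : nm x - nm y <= nm (x - y).
Proof. by rewrite lerBlDr (le_trans _ (nmD _ _))// subrK. Qed.

Lemma nm_sum (I : Type) (r : seq I) (P : pred I) (F : I -> V) :
  nm (\sum_(i <- r | P i) F i) <= \sum_(i <- r | P i) nm (F i).
Proof.
elim/big_ind2: _ => [|x1 x2 y1 y2 h1 h2|//]; first by rewrite nm0.
by rewrite (le_trans (nmD _ _))// lerD.
Qed.

End general.

Lemma nmM (a b : R[i]) : nm (a * b) = nm a * nm b.
Proof. by apply: complexI; rewrite rmorphM/= -!nmE normrM. Qed.

Lemma nmZ (V : normedModType R[i]) (a : R[i]) (x : V) : nm (a *: x) = nm a * nm x.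
Proof. by apply: complexI; rewrite rmorphM/= -!nmE normrZ. Qed.

Lemma nm_conj (a : R[i]) : nm a^* = nm a.
Proof. by rewrite /nm norm_conjC. Qed.

Lemma nm1 : nm (1 : R[i]) = 1.
Proof. by rewrite /nm normr1. Qed.

Lemma nmC (a : R) : nm (a%:C : R[i]) = `|a|.
Proof. by rewrite /nm normc_def/= expr0n addr0 sqrtr_sqr. Qed.

Lemma mul_conj_nm (a : R[i]) : a * a^* = (nm a ^+ 2)%:C.
Proof. by rewrite -normCK nmE rmorphXn. Qed.

Lemma Re_le_nm (a : R[i]) : complex.Re a <= nm a.
Proof.
by rewrite (le_trans (ler_norm _))// -lecR -nmE normc_ge_Re.
Qed.

Lemma normRe_le_nm (a : R[i]) : `|complex.Re a| <= nm a.
Proof. by rewrite -lecR -nmE normc_ge_Re. Qed.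

Lemma nm_sqr (a : R[i]) : nm a ^+ 2 = complex.Re a ^+ 2 + complex.Im a ^+ 2.
Proof. by apply: complexI; rewrite add_Re2_Im2 nmE rmorphXn. Qed.

Lemma normIm_le_nm (a : R[i]) : `|complex.Im a| <= nm a.
Proof.
rewrite -(@ler_pXn2r _ 2)// ?nnegrE ?nm_ge0// nm_sqr real_normK ?num_real//.
by rewrite lerDr sqr_ge0.
Qed.

Lemma nm_le_ReIm (a : R[i]) : nm a <= `|complex.Re a| + `|complex.Im a|.
Proof.
rewrite -(@ler_pXn2r _ 2)// ?nnegrE ?nm_ge0// ?addr_ge0// nm_sqr.
rewrite sqrrD !real_normK ?num_real// lerD2r lerDl.
by rewrite mulrn_wge0// mulr_ge0.
Qed.

Lemma ReD (a b : R[i]) : complex.Re (a + b) = complex.Re a + complex.Re b.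
Proof. by case: a b => ? ? []. Qed.
Lemma ReN (a : R[i]) : complex.Re (- a) = - complex.Re a.
Proof. by case: a. Qed.
Lemma ReB (a b : R[i]) : complex.Re (a - b) = complex.Re a - complex.Re b.
Proof. by case: a b => ? ? []. Qed.
Lemma ReJ (a : R[i]) : complex.Re a^* = complex.Re a.
Proof. by case: a. Qed.
Lemma ImJ (a : R[i]) : complex.Im a^* = - complex.Im a.
Proof. by case: a. Qed.
Lemma ImD (a b : R[i]) : complex.Im (a + b) = complex.Im a + complex.Im b.
Proof. by case: a b => ? ? []. Qed.
Lemma ImN (a : R[i]) : complex.Im (- a) = - complex.Im a.
Proof. by case: a. Qed.
Lemma ImB (a b : R[i]) : complex.Im (a - b) = complex.Im a - complex.Im b.
Proof. by case: a b => ? ? []. Qed.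
Lemma ReCM (r : R) (a : R[i]) : complex.Re (r%:C * a) = r * complex.Re a.
Proof. by case: a => x y /=; rewrite mul0r subr0. Qed.
Lemma ImCM (r : R) (a : R[i]) : complex.Im (r%:C * a) = r * complex.Im a.
Proof. by case: a => x y /=; rewrite mul0r addr0. Qed.
Lemma ReiM (a : R[i]) : complex.Re ('i * a) = - complex.Im a.
Proof. by case: a => x y /=; rewrite mul0r sub0r mul1r. Qed.
Lemma ImiM (a : R[i]) : complex.Im ('i * a) = complex.Re a.
Proof. by case: a => x y /=; rewrite mul0r add0r mul1r. Qed.
Lemma conjCr (r : R) : (r%:C : R[i])^* = r%:C.
Proof. exact: conjc_real. Qed.
Lemma conji : ('i : R[i])^* = - 'i.
Proof. by apply/eqP; rewrite eq_complex /= oppr0 !eqxx. Qed.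

Lemma ReIm_inj (a b : R[i]) :
  complex.Re a = complex.Re b -> complex.Im a = complex.Im b -> a = b.
Proof. by case: a b => ? ? [? ?] /= -> ->. Qed.

Lemma ge0_Re (a : R[i]) : 0 <= a -> a = (complex.Re a)%:C.
Proof. by move=> a0; rewrite RRe_real// ger0_real. Qed.

Lemma ge0_ReE (a : R[i]) : 0 <= a -> 0 <= complex.Re a.
Proof. by move=> a0; rewrite -ler0c -ge0_Re. Qed.

Lemma cvgP_nm (V : normedModType R[i]) (T : Type) (F : set_system T) {FF : Filter F}
    (f : T -> V) (l : V) :
  (f x @[x --> F] --> l) <-> (forall e : R, 0 < e -> \forall x \near F, nm (f x - l) < e).
Proof.
split=> [/cvgrPdist_lt h e e0|h].
  have e0' : (0 : R[i]) < e%:C by rewrite ltcR.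
  have := h _ e0'; apply: filterS => x.
  by rewrite nmE ltcR nmB.
apply/cvgrPdist_lt => e e0.
have eE : e = (complex.Re e)%:C by apply/ge0_Re/ltW.
have := h (complex.Re e); rewrite -ltcR -eE => /(_ e0).
by apply: filterS => x hx; rewrite nmE nmB eE ltcR.
Qed.

Lemma cvgnP_nm (V : normedModType R[i]) (f : nat -> V) (l : V) :
  (f x @[x --> \oo] --> l) <->
  (forall e : R, 0 < e -> exists N, forall n, (N <= n)%N -> nm (f n - l) < e).
Proof.
rewrite cvgP_nm; split => h e e0; have := h e e0.
  by move=> [N _ hN]; exists N => n Nn; apply: hN.
by move=> [N hN]; exists N => // n Nn; apply: hN.
Qed.

Lemma cauchy_cvgn (V : completeNormedModType R[i]) (f : nat -> V) :
  (forall e : R, 0 < e -> exists N, forall n m, (N <= n)%N -> (N <= m)%N ->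
     nm (f n - f m) < e) ->
  exists l : V, f x @[x --> \oo] --> l.
Proof.
move=> h; apply: (@cvg_ex _ (f x @[x --> \oo])).1; apply: cauchy_cvg.
apply/cauchyP => e e0.
have eE : e = (complex.Re e)%:C by apply/ge0_Re/ltW.
have [|N hN] := h (complex.Re e); first by rewrite -ltcR -eE.
exists (f N), N => // n Nn /=.
by rewrite -ball_normE /= nmE eE ltcR; apply: hN.
Qed.

Lemma cvgR0P (f : nat -> R) (l : R) :
  (f x @[x --> \oo] --> l) <->
  (forall e : R, 0 < e -> exists N, forall n, (N <= n)%N -> `|f n - l| < e).
Proof.
split=> [/cvgrPdist_lt h e e0|h].
  by have [N _ hN] := h e e0; exists N => n Nn; rewrite distrC; apply: hN.
apply/cvgrPdist_lt => e e0; have [N hN] := h e e0.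
by exists N => // n Nn; rewrite distrC; apply: hN.
Qed.

End real_norm.

(** * Hilbert spaces and bounded operators *)

Section hilbert.
Context (R : realType).

Section dot.
Context (H : hilbertType R).
Implicit Types (x y z : H) (a : R[i]).

Lemma ipDl x y z : dotp (x + y) z = dotp x z + dotp y z.
Proof. by rewrite linearDl. Qed.
Lemma ipDr x y z : dotp z (x + y) = dotp z x + dotp z y.
Proof. by rewrite linearDr. Qed.
Lemma ipZl a x z : dotp (a *: x) z = a * dotp x z.
Proof. by rewrite linearZl_LR. Qed.
Lemma ipZr a x z : dotp z (a *: x) = a^* * dotp z x.
Proof. by rewrite linearZr_LR. Qed.
Lemma ipNl x z : dotp (- x) z = - dotp x z.
Proof. by rewrite linearNl. Qed.
Lemma ipNr x z : dotp z (- x) = - dotp z x.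
Proof. by rewrite linearNr. Qed.
Lemma ipBl x y z : dotp (x - y) z = dotp x z - dotp y z.
Proof. by rewrite ipDl ipNl. Qed.
Lemma ipBr x y z : dotp z (x - y) = dotp z x - dotp z y.
Proof. by rewrite ipDr ipNr. Qed.
Lemma ip0l z : dotp 0 z = 0.
Proof. by rewrite linear0l. Qed.
Lemma ip0r z : dotp z 0 = 0.
Proof. by rewrite linear0r. Qed.
Lemma ip_suml (I : Type) (r : seq I) (P : pred I) (F : I -> H) z :
  dotp (\sum_(i <- r | P i) F i) z = \sum_(i <- r | P i) dotp (F i) z.
Proof. by rewrite (big_morph (fun x => dotp x z) (fun x y => ipDl x y z) (ip0l z)). Qed.
Lemma ip_sumr (I : Type) (r : seq I) (P : pred I) (F : I -> H) z :
  dotp z (\sum_(i <- r | P i) F i) = \sum_(i <- r | P i) dotp z (F i).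
Proof. by rewrite (big_morph (fun x => dotp z x) (fun x y => ipDr x y z) (ip0r z)). Qed.
Lemma ipC x y : dotp y x = (dotp x y)^*.
Proof. by rewrite hermC/= expr0 mul1r. Qed.
Lemma ipxx x : dotp x x = (nm x ^+ 2)%:C.
Proof. by rewrite dotp_norm nmE rmorphXn. Qed.
Lemma nm_sqrE x : nm x ^+ 2 = complex.Re (dotp x x).
Proof. by rewrite ipxx. Qed.

Lemma nmD_sqr x y :
  nm (x + y) ^+ 2 = nm x ^+ 2 + 2 * complex.Re (dotp x y) + nm y ^+ 2.
Proof.
rewrite !nm_sqrE ipDl !ipDr !ReD (ipC x y) ReJ; ring.
Qed.

Lemma nmB_sqr x y :
  nm (x - y) ^+ 2 = nm x ^+ 2 - 2 * complex.Re (dotp x y) + nm y ^+ 2.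
Proof. rewrite nmD_sqr ipNr ReN nmN; ring. Qed.

Lemma parallelogram x y :
  nm (x + y) ^+ 2 + nm (x - y) ^+ 2 = 2 * (nm x ^+ 2 + nm y ^+ 2).
Proof. rewrite nmD_sqr nmB_sqr; ring. Qed.

(** Expanding the squared norm of |y|^2 x - <x, y> y, rather than of x - (<x, y> / |y|^2) y, keeps
    the computation free of division. *)
Lemma cauchy_schwarz x y : nm (dotp x y) <= nm x * nm y.
Proof.
have [->|y0] := eqVneq y 0; first by rewrite ip0r !nm0 mulr0.
have ny0 : 0 < nm y.
  by rewrite lt_neqAle nm_ge0 andbT eq_sym; apply: contraNneq y0 => /nm_eq0 ->.
have h : 0 <= nm (((nm y ^+ 2)%:C : R[i]) *: x - (dotp x y) *: y) ^+ 2 by exact: sqr_ge0.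
move: h; rewrite nmB_sqr !nmZ nmC ipZl ipZr ReCM [_^* * _]mulrC.
rewrite mul_conj_nm [complex.Re (_ %:C)]/=.
rewrite ger0_norm ?sqr_ge0// => h.
rewrite -(@ler_pXn2r _ 2)// ?nnegrE ?nm_ge0// ?mulr_ge0 ?nm_ge0//.
have y2 : 0 < nm y ^+ 2 by rewrite exprn_gt0.
rewrite -(ler_pM2l y2) -subr_ge0.
by move: h; congr (_ <= _); rewrite !exprMn; ring.
Qed.

Lemma Re_ip_le x y : complex.Re (dotp x y) <= nm x * nm y.
Proof. exact: le_trans (Re_le_nm _) (cauchy_schwarz _ _). Qed.

Lemma ip_ext x y : (forall z, dotp x z = dotp y z) -> x = y.
Proof.
move=> h; apply/eqP; rewrite -subr_eq0; apply/eqP/nm_eq0/eqP.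
rewrite -sqrf_eq0 nm_sqrE ipBl h subrr; by [].
Qed.

Lemma ip_extr x y : (forall z, dotp z x = dotp z y) -> x = y.
Proof. by move=> h; apply: ip_ext => z; rewrite ipC h -ipC. Qed.

Lemma nm_le_ip x (C : R) : 0 <= C ->
  (forall y, nm (dotp x y) <= C * nm y) -> nm x <= C.
Proof.
move=> C0 /(_ x); have [->|x0] := eqVneq x 0; first by rewrite nm0.
have nx0 : 0 < nm x.
  by rewrite lt_neqAle nm_ge0 andbT eq_sym; apply: contraNneq x0 => /nm_eq0 ->.
by rewrite ipxx nmC ger0_norm ?sqr_ge0// expr2 ler_pM2r.
Qed.

Lemma ip_cvg (T : Type) (F : set_system T) {FF : Filter F} (u v : T -> H) x y :
  u t @[t --> F] --> x -> v t @[t --> F] --> y ->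
  dotp (u t) (v t) @[t --> F] --> dotp x y.
Proof.
move=> /cvgP_nm ux /cvgP_nm vy; apply/(@cvgP_nm R R[i]^o) => e e0.
(* Once |v t| <= |y| + 1, the two error terms add up to at most d (|x| + |y| + 1), strictly less
   than d c. *)
pose c := nm x + nm y + 2.
have c0 : 0 < c by rewrite /c ltr_wpDl ?addr_ge0 ?nm_ge0.
pose d := Num.min 1 (e / c).
have d0 : 0 < d by rewrite lt_min ltr01 divr_gt0.
have := ux _ d0; have := vy _ d0; apply: filterS2 => t h1 h2.
have -> : dotp (u t) (v t) - dotp x y = dotp (u t - x) (v t) + dotp x (v t - y).
  by rewrite ipBl ipBr addrA subrK.
have d1 : d <= 1 by rewrite ge_min lexx.
have h3 : nm (v t) <= nm y + 1.
  rewrite -(subrK y (v t)) (le_trans (nmD _ _))// addrC lerD2l.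
  exact: le_trans (ltW h1) d1.
rewrite (le_lt_trans (nmD _ _))//.
rewrite (@le_lt_trans _ _ (d * (nm y + 1) + nm x * d))//.
  rewrite lerD// (le_trans (cauchy_schwarz _ _))//.
    by rewrite ler_pM ?nm_ge0// ltW.
  by rewrite ler_wpM2l ?nm_ge0// ltW.
rewrite (@lt_le_trans _ _ (d * c))//.
  by rewrite [nm x * d]mulrC -mulrDr ltr_pM2l// /c; lra.
by rewrite -ler_pdivlMr// ge_min lexx orbT.
Qed.

Lemma polar_bound x y : 4 * complex.Re (dotp x y) = nm (x + y) ^+ 2 - nm (x - y) ^+ 2.
Proof. rewrite nmD_sqr nmB_sqr; ring. Qed.

End dot.

Section blin.
Context (H K : hilbertType R).

(** [boundedOp] covers endomorphisms only. Isometries between spaces and their adjoints are handled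
    as bare functions satisfying this predicate. *)
Definition blin (f : H -> K) : Prop :=
  (forall a x y, f (a *: x + y) = a *: f x + f y) /\
  exists2 C : R, 0 <= C & forall x, nm (f x) <= C * nm x.

Section facts.
Context (f : H -> K) (bf : blin f).

Lemma blinP a x y : f (a *: x + y) = a *: f x + f y.
Proof. by case: bf. Qed.
Lemma blinD x y : f (x + y) = f x + f y.
Proof. by rewrite -[x in LHS]scale1r blinP scale1r. Qed.
Lemma blin0 : f 0 = 0.
Proof. by apply: (addIr (f 0)); rewrite -blinD !add0r. Qed.
Lemma blinZ a x : f (a *: x) = a *: f x.
Proof. by rewrite -[a *: x]addr0 blinP blin0 addr0. Qed.
Lemma blinN x : f (- x) = - f x.
Proof. by rewrite -scaleN1r blinZ scaleN1r. Qed.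
Lemma blinB x y : f (x - y) = f x - f y.
Proof. by rewrite blinD blinN. Qed.
Lemma blin_sum (I : Type) (r : seq I) (P : pred I) (F : I -> H) :
  f (\sum_(i <- r | P i) F i) = \sum_(i <- r | P i) f (F i).
Proof. by rewrite (big_morph f blinD blin0). Qed.
Lemma blin_bound : exists2 C : R, 0 < C & forall x, nm (f x) <= C * nm x.
Proof.
case: bf => _ [C C0 hC]; exists (C + 1); first by rewrite ltr_wpDl.
by move=> x; rewrite (le_trans (hC x))// ler_wpM2r ?nm_ge0// lerDl.
Qed.
Lemma blin_cvg (T : Type) (F : set_system T) {FF : Filter F} (u : T -> H) x :
  u t @[t --> F] --> x -> f (u t) @[t --> F] --> f x.
Proof.
have [C C0 hC] := blin_bound; move=> /cvgP_nm ux; apply/cvgP_nm => e e0.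
have := ux (e / C); rewrite divr_gt0// => /(_ isT).
apply: filterS => t h; rewrite -blinB (le_lt_trans (hC _))//.
by rewrite mulrC -ltr_pdivlMr.
Qed.
Lemma blin_continuous : continuous f.
Proof. by move=> x; apply: blin_cvg. Qed.
End facts.

End blin.

Lemma blin_comp (H K L : hilbertType R) (f : K -> L) (g : H -> K) :
  blin f -> blin g -> blin (f \o g).
Proof.
move=> bf bg; split=> [a x y /=|]; first by rewrite (blinP bg) (blinP bf).
have [C C0 hC] := blin_bound bf; have [D D0 hD] := blin_bound bg.
exists (C * D); first by rewrite mulr_ge0 ?ltW.
by move=> x; rewrite /= (le_trans (hC _))// -mulrA ler_pM2l.
Qed.

Lemma blin_op (H : hilbertType R) (T : 'B(H)) : blin T.
Proof.
split=> [a x y|]; first by rewrite linearP.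
have /cvgP_nm /(_ 1 ltr01) := @cts_fun H H T 0.
rewrite linear0 -nbhs_nearE => /nbhs_ballP [e /= e0 he].
have eE : e = (complex.Re e)%:C by apply/ge0_Re/ltW.
set d := complex.Re e in eE.
have d0 : 0 < d by rewrite -ltcR -eE.
exists (2 / d); first by rewrite divr_ge0 ?ltW.
move=> x; have [->|x0] := eqVneq x 0; first by rewrite linear0 !nm0 mulr0.
have nx0 : 0 < nm x.
  by rewrite lt_neqAle nm_ge0 andbT eq_sym; apply: contraNneq x0 => /nm_eq0 ->.
(* Rescaling by [c] brings x to norm d / 2, inside the ball on which T is bounded by 1. *)
pose c := d / 2 / nm x.
have c0 : 0 < c by rewrite !divr_gt0.
have /he /= : ball (0 : H) e (c%:C *: x).
  rewrite -ball_normE /= sub0r normrN normrZ !nmE eE nmC -rmorphM/= ltcR.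
  rewrite gtr0_norm// /c divfK ?gt_eqF//; lra.
have TZ : T (c%:C *: x) = c%:C *: T x by rewrite -[_ *: x]addr0 linearP linear0 addr0.
move=> h0; have : nm (T (c%:C *: x) - 0) < 1 by exact: h0.
rewrite subr0 TZ nmZ nmC gtr0_norm// => h.
rewrite -(ler_pM2l c0) (le_trans (ltW h))// /c.
rewrite le_eqVlt; apply/orP; left; apply/eqP; field.
by rewrite !gt_eqF.
Qed.

(* [toB f] is the zero operator when [f] is not linear and bounded. *)
Definition toB (H : hilbertType R) (f : H -> H) : 'B(H) :=
  xget 0 [set S : 'B(H) | forall x, S x = f x].

Lemma toBE (H : hilbertType R) (f : H -> H) : blin f -> forall x, toB f x = f x.
Proof.
move=> bf.
pose L1 := GRing.isLinear.Build R[i] H H *:%R f (blinP bf).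
pose L2 := isContinuous.Build H H f (blin_continuous bf).
pose S : 'B(H) := HB.pack f L1 L2.
rewrite /toB; case: xgetP => [T _ //|/(_ S) /= hS]; by case: hS.
Qed.

End hilbert.

Lemma closed_seq (V : topologicalType) (M : set V) (u : nat -> V) (l : V) :
  closed M -> (forall n, M (u n)) -> u n @[n --> \oo] --> l -> M l.
Proof.
move=> Mc Mu ul; have h : \forall n \near \oo, M (u n) by apply: nearW.
exact: (@closed_cvg _ _ _ _ u M Mc h l ul).
Qed.

(** Passage to the limit in the projection theorem: b is the distance to the limit of a minimizing
    sequence, q the distance to one of its terms, p the distance between term and limit. The
    contradiction comes from e with e (2 b + 2) = b^2 - D. *)
Lemma sqr_le_approx (R : realFieldType) (b D : R) : 0 <= b ->
  (forall e, 0 < e -> exists p q, [/\ 0 <= p, p < e, 0 <= q, b <= q + p & q ^+ 2 < D + e]) ->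
  b ^+ 2 <= D.
Proof.
move=> b0 h; rewrite leNgt; apply/negP => Db.
pose e := (b ^+ 2 - D) / (2 * b + 2).
have e0 : 0 < e by rewrite divr_gt0//; lra.
have eE : e * (2 * b + 2) = b ^+ 2 - D by rewrite /e divfK//; lra.
have [p [q [p0 pe q0 bq qD]]] := h e e0.
move: e e0 eE pe qD => e e0 eE pe qD.
have [qb|qb] := lerP b q; nra.
Qed.

(** * Orthogonal projection onto a closed subspace and the Riesz representation of functionals *)

Section projection.
Context (R : realType) (H : hilbertType R).
Implicit Types (x y z : H).

Lemma sqr_lt_eps (a e : R) : 0 <= a -> 0 < e -> a ^+ 2 < e ^+ 2 -> a < e.
Proof. by move=> a0 e0; rewrite ltr_pXn2r// nnegrE// ltW. Qed.

Lemma projection_ex (M : set H) x : closed_subspace M ->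
  exists2 m, M m & forall y, M y -> dotp (x - m) y = 0.
Proof.
move=> [M0 Mlin Mc].
have MB u v : M u -> M v -> M (u - v).
  by move=> Mu Mv; rewrite addrC -scaleN1r; apply: Mlin.
have MZ a u : M u -> M (a *: u) by move=> Mu; rewrite -[_ *: _]addr0; apply: Mlin.
have MD u v : M u -> M v -> M (u + v).
  by move=> Mu Mv; rewrite -[u]scale1r; apply: Mlin.
pose S := [set nm (x - m) ^+ 2 | m in M].
have Sinf : has_inf S.
  split; first by exists (nm (x - 0) ^+ 2), 0.
  by exists 0 => _ [m _ <-]; exact: sqr_ge0.
pose D := inf S.
have Dle m : M m -> D <= nm (x - m) ^+ 2.
  by move=> Mm; apply: ge_inf; [exact: Sinf.2|exists m].
have hm n : exists m, M m /\ nm (x - m) ^+ 2 < D + n.+1%:R^-1.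
  have [|_ [m Mm <-] h] := @inf_adherent _ S n.+1%:R^-1 _ Sinf.
    by rewrite invr_gt0.
  by exists m.
have [m_ hm_] := choice hm.
(* Parallelogram identity for x - m_k and x - m_n: half of their sum is x minus a point of M, so its
   squared norm is at least D. *)
have key n k : nm (m_ n - m_ k) ^+ 2 <= 2 * (n.+1%:R^-1 + k.+1%:R^-1).
  have := parallelogram (x - m_ k) (x - m_ n).
  have -> : x - m_ k - (x - m_ n) = m_ n - m_ k by rewrite opprB addrC subrKA.
  have -> : x - m_ k + (x - m_ n) = (2%:R)%:C *: (x - (2^-1)%:C *: (m_ k + m_ n)).
    rewrite scalerBr scalerA -rmorphM/= divff ?pnatr_eq0// scale1r.
    by rewrite rmorph_nat scaler_nat mulr2n addrACA opprD.
  rewrite nmZ nmC exprMn.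
  have := Dle _ (MZ (2^-1)%:C _ (MD _ _ (hm_ k).1 (hm_ n).1)).
  have -> : `|2%:R : R| = 2 by rewrite ger0_norm.
  move: (nm (x - _ *: _) ^+ 2) => a h1 h2.
  have [_ h3] := hm_ n; have [_ h4] := hm_ k.
  move: h2 h3 h4; rewrite -natrX (_ : (2 ^ 2)%:R = 4 :> R)//.
  move: (n.+1%:R^-1) (k.+1%:R^-1) (nm (x - m_ n) ^+ 2) (nm (x - m_ k) ^+ 2).
  by move: (nm (m_ n - m_ k) ^+ 2) => b c d f g; lra.
have [l hl] : exists l : H, m_ n @[n --> \oo] --> l.
  apply: cauchy_cvgn => e e0.
  have e4 : 0 < e ^+ 2 / 4 by rewrite divr_gt0 ?exprn_gt0.
  have [N _ hN] := near_infty_natSinv_lt (PosNum e4).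
  exists N => n k Nn Nk; apply: sqr_lt_eps; rewrite ?nm_ge0//.
  rewrite (le_lt_trans (key n k))//.
  have := hN n Nn; have := hN k Nk; rewrite /=.
  by move: (n.+1%:R^-1) (k.+1%:R^-1) => b c; lra.
have Ml : M l.
  apply: (closed_seq Mc _ hl) => n; exact: (hm_ n).1.
have lD : nm (x - l) ^+ 2 <= D.
  apply: sqr_le_approx => [|e e0]; first exact: nm_ge0.
  have [N1 hN1] := (cvgnP_nm _ _).1 hl _ e0.
  have [N2 _ hN2] := near_infty_natSinv_lt (PosNum e0).
  exists (nm (m_ (maxn N1 N2) - l)), (nm (x - m_ (maxn N1 N2))).
  split; rewrite ?nm_ge0//; first by apply: hN1; rewrite leq_maxl.
    exact: nm_triB.
  rewrite (lt_trans (hm_ _).2)// ltrD2l.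
  by apply: (hN2 (maxn N1 N2)); rewrite /= leq_maxr.
exists l => // y My.
have [->|y0] := eqVneq y 0; first by rewrite ip0r.
have ny0 : 0 < nm y.
  by rewrite lt_neqAle nm_ge0 andbT eq_sym; apply: contraNneq y0 => /nm_eq0 ->.
set z := x - l; set a := dotp z y.
(* Minimality at l is tested against l + (a / |y|^2) y, the best approximation of x on that line; it
   yields |a|^2 / |y|^2 <= 0. *)
have := Dle _ (MD _ _ Ml (MZ (a / (nm y ^+ 2)%:C) _ My)).
have -> : x - (l + (a / (nm y ^+ 2)%:C) *: y) = z - (a / (nm y ^+ 2)%:C) *: y.
  by rewrite opprD addrA.
move=> /(le_trans lD); rewrite -/z nmB_sqr ipZr nmZ -/a.
set c := nm y ^+ 2.
have c0 : 0 < c by rewrite exprn_gt0.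
have -> : (a / c%:C)^* * a = (nm a ^+ 2 / c)%:C.
  by rewrite rmorphM/= mulrAC [_^* * a]mulrC mul_conj_nm -fmorphV/= conjCr -rmorphM.
have -> : nm (a / c%:C) = nm a / c.
  by rewrite -fmorphV/= nmM nmC ger0_norm ?invr_ge0 ?ltW.
have -> : complex.Re (nm a ^+ 2 / c)%:C = nm a ^+ 2 / c by [].
have -> : (nm a / c * nm y) ^+ 2 = nm a ^+ 2 / c.
  by rewrite !exprMn -/c; field; rewrite gt_eqF.
move=> h; apply: nm_eq0; apply/eqP; rewrite -sqrf_eq0.
have h1 : nm a ^+ 2 / c <= 0.
  by move: h; move: (nm z ^+ 2) (nm a ^+ 2 / c) => u v; lra.
rewrite eq_le sqr_ge0 andbT.
by move: h1; rewrite pmulr_lle0// invr_gt0.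
Qed.

Lemma riesz_representation (phi : H -> R[i]) (C : R) :
  (forall a x y, phi (a *: x + y) = a * phi x + phi y) ->
  (forall x, nm (phi x) <= C * nm x) ->
  exists y, forall x, phi x = dotp x y.
Proof.
move=> lphi bphi.
have phi0 : phi 0 = 0.
  by have := lphi (-1) 0 0; rewrite scaler0 addr0 mulN1r addrC subrr.
have phiZ a x : phi (a *: x) = a * phi x.
  by rewrite -[_ *: _]addr0 lphi phi0 addr0.
have phiB u v : phi (u - v) = phi u - phi v.
  by rewrite addrC -scaleN1r lphi mulN1r addrC.
have [[x0 px0]|] := pselect (exists x, phi x != 0); last first.
  move=> /forallNP h; exists 0 => x; rewrite ip0r.
  by apply/eqP; have := h x; move/negP; rewrite negbK.
pose M := [set x | phi x = 0].
have Mc : closed_subspace M.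
  split => //; first by move=> a x y hx hy; rewrite /M/= lphi hx hy mulr0 addr0.
  have -> : M = phi @^-1` [set 0] by [].
  apply: (@closed_comp H R[i]^o); last exact: (accessible_closed_set1 (hausdorff_accessible (@norm_hausdorff _ R[i]^o))).
  move=> x _; apply/(@cvgP_nm R R[i]^o) => e e0.
  have hC : 0 < `|C| + 1 by rewrite ltr_wpDl.
  have /cvgP_nm /(_ (e / (`|C| + 1))) : (y @[y --> x] --> (x : H)) by exact: cvg_id.
  rewrite divr_gt0// => /(_ isT); apply: filterS => y h.
  rewrite -phiB.
  rewrite (le_lt_trans (bphi _))// (@le_lt_trans _ _ ((`|C| + 1) * nm (y - x)))//.
    by rewrite ler_wpM2r ?nm_ge0// (le_trans (ler_norm _))// lerDl.
  by rewrite mulrC -ltr_pdivlMr.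
have [m Mm hm] := projection_ex x0 Mc.
set z := x0 - m in hm.
have pz : phi z = phi x0.
  by rewrite /z addrC -scaleN1r lphi Mm mulr0 add0r.
have z0 : z != 0 by apply: contraNneq px0 => z0; rewrite -pz z0 phi0.
have nz0 : 0 < nm z ^+ 2.
  by rewrite exprn_gt0// lt_neqAle nm_ge0 andbT eq_sym; apply: contraNneq z0 => /nm_eq0 ->.
exists (((phi z)^* / (nm z ^+ 2)%:C) *: z) => x.
(* A combination in the kernel is orthogonal to z; solving this orthogonality for [phi x] gives the
   coefficient of z in the witness. *)
have Mx : M (phi x *: z + (- phi z) *: x).
  by rewrite /M/= lphi phiZ mulNr [phi z * _]mulrC subrr.
have h : (phi x)^* * (nm z ^+ 2)%:C = (phi z)^* * dotp z x.
  have := hm _ Mx; rewrite ipDr !ipZr ipxx rmorphN/= mulNr.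
  by move/eqP; rewrite subr_eq0 => /eqP.
rewrite ipZr rmorphM/= conjCK -fmorphV/= conjCr fmorphV/=.
have h' : phi x * (nm z ^+ 2)%:C = phi z * dotp x z.
  apply: (can_inj conjCK); rewrite rmorphM/= conjCr h rmorphM/=.
  by rewrite -[in RHS]ipC.
rewrite mulrAC -h' mulfK//.
by rewrite -[0]/((0:R)%:C) (inj_eq (@complexI R)) gt_eqF.
Qed.

End projection.

Section adj.
Context (R : realType).

Definition adj (H K : hilbertType R) (f : H -> K) : K -> H :=
  xget (fun=> 0) [set g | forall x y, dotp (f x) y = dotp x (g y)].

Section facts.
Context (H K : hilbertType R) (f : H -> K) (bf : blin f).

Lemma adjP x y : dotp (f x) y = dotp x (adj f y).
Proof.
rewrite /adj; case: xgetP => [g _ //|/=].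
have [C C0 hC] := blin_bound bf.
have h y' : exists z, forall x, dotp (f x) y' = dotp x z.
  apply: (@riesz_representation _ _ (fun x => dotp (f x) y') (C * nm y')).
    by move=> a x' y''; rewrite (blinP bf) ipDl ipZl.
  move=> x'; rewrite (le_trans (cauchy_schwarz _ _))//.
  by rewrite mulrAC ler_wpM2r ?nm_ge0.
have [g hg] := choice h.
by move=> /(_ g) /= []//.
Qed.

Lemma adjPr x y : dotp y (f x) = dotp (adj f y) x.
Proof. by rewrite ipC adjP -ipC. Qed.

Lemma blin_adj : blin (adj f).
Proof.
split=> [a x y|].
  by apply: ip_extr => z; rewrite -adjP ipDr ipZr !adjP -ipZr -ipDr.
have [C C0 hC] := blin_bound bf; exists C; first exact: ltW.
move=> x; apply: nm_le_ip; first by rewrite mulr_ge0 ?nm_ge0 ?ltW.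
move=> y; rewrite -adjPr (le_trans (cauchy_schwarz _ _))//.
by rewrite mulrC mulrAC ler_wpM2r ?nm_ge0.
Qed.

End facts.

Section adjoint.
Context (H : hilbertType R).
Implicit Types (S T : 'B(H)) (x y : H).

Lemma adjointP T x y : dotp (T x) y = dotp x (adjoint T y).
Proof.
rewrite /adjoint; case: xgetP => [g _ //|/=].
move=> /(_ (toB (adj T))) /= [] x' y'.
by rewrite toBE; [exact: adjP (blin_op T) _ _|exact/blin_adj/blin_op].
Qed.

Lemma adjointPr T x y : dotp y (T x) = dotp (adjoint T y) x.
Proof. by rewrite ipC adjointP -ipC. Qed.

Lemma adjoint_uniq S T : (forall x y, dotp (T x) y = dotp x (S y)) -> adjoint T = S.
Proof.
by move=> h; apply/boundedOpP => y; apply: ip_extr => x; rewrite -adjointP h.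
Qed.

Lemma adjointK T : adjoint (adjoint T) = T.
Proof. by apply: adjoint_uniq => x y; rewrite -adjointPr. Qed.

End adjoint.
End adj.

Section operators.
Context (R : realType) (H : hilbertType R).
Implicit Types (S T : 'B(H)) (x y : H).

Lemma opME S T x : (S * T) x = S (T x). Proof. by []. Qed.
Lemma opDE S T x : (S + T) x = S x + T x. Proof. by []. Qed.
Lemma opNE S x : (- S) x = - S x. Proof. by []. Qed.
Lemma opBE S T x : (S - T) x = S x - T x. Proof. by []. Qed.
Lemma opZE a S x : (a *: S) x = a *: S x. Proof. by []. Qed.
Lemma op1E x : (1 : 'B(H)) x = x. Proof. by []. Qed.
Lemma op0E x : (0 : 'B(H)) x = 0. Proof. by []. Qed.
Lemma op_sumE (I : Type) (r : seq I) (P : pred I) (F : I -> 'B(H)) x :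
  (\sum_(i <- r | P i) F i) x = \sum_(i <- r | P i) F i x.
Proof. exact: (big_morph (fun T : 'B(H) => T x) (fun S T => opDE S T x) (op0E x)). Qed.
Definition opE := (opME, opBE, opDE, opNE, opZE, op1E, op0E).

Lemma op_scaleAl a S T : (a *: S) * T = a *: (S * T).
Proof. by apply/boundedOpP. Qed.
Lemma op_scaleAr a S T : S * (a *: T) = a *: (S * T).
Proof. by apply/boundedOpP => x; rewrite !opE (blinZ (blin_op S)). Qed.

Lemma opB T x y : T (x - y) = T x - T y. Proof. exact: blinB (blin_op T) _ _. Qed.
Lemma opD T x y : T (x + y) = T x + T y. Proof. exact: blinD (blin_op T) _ _. Qed.
Lemma opZ T a x : T (a *: x) = a *: T x. Proof. exact: blinZ (blin_op T) _ _. Qed.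
Lemma opN T x : T (- x) = - T x. Proof. exact: blinN (blin_op T) _. Qed.
Lemma op0 T : T 0 = 0. Proof. exact: blin0 (blin_op T). Qed.
Lemma op_sum T (I : Type) (r : seq I) (P : pred I) (F : I -> H) :
  T (\sum_(i <- r | P i) F i) = \sum_(i <- r | P i) T (F i).
Proof. exact: (blin_sum (blin_op T)). Qed.
Lemma op_bound T : exists2 C : R, 0 < C & forall x, nm (T x) <= C * nm x.
Proof. exact: blin_bound (blin_op T). Qed.

Lemma adjointD S T : adjoint (S + T) = adjoint S + adjoint T.
Proof. by apply: adjoint_uniq => x y; rewrite !opE ipDl ipDr !adjointP. Qed.
Lemma adjointN S : adjoint (- S) = - adjoint S.
Proof. by apply: adjoint_uniq => x y; rewrite !opE ipNl ipNr !adjointP. Qed.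
Lemma adjointB S T : adjoint (S - T) = adjoint S - adjoint T.
Proof. by rewrite adjointD adjointN. Qed.
Lemma adjointZ a S : adjoint (a *: S) = a^* *: adjoint S.
Proof. by apply: adjoint_uniq => x y; rewrite !opE ipZl ipZr conjCK !adjointP. Qed.
Lemma adjointM S T : adjoint (S * T) = adjoint T * adjoint S.
Proof. by apply: adjoint_uniq => x y; rewrite !opE !adjointP. Qed.
Lemma adjoint1 : adjoint (1 : 'B(H)) = 1.
Proof. by apply: adjoint_uniq => x y. Qed.
Lemma adjoint0 : adjoint (0 : 'B(H)) = 0.
Proof. by apply: adjoint_uniq => x y; rewrite !op0E ip0l ip0r. Qed.

Lemma normal_nm T x : normal_op T -> nm (adjoint T x) = nm (T x).
Proof.
move=> hT; apply/eqP; rewrite -(@eqrXn2 _ 2) ?nm_ge0// !nm_sqrE.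
have e y : T (adjoint T y) = adjoint T (T y) by rewrite -!opME hT.
by rewrite -adjointP e -adjointPr.
Qed.

Lemma polarization T x y :
  4 * dotp (T x) y = dotp (T (x + y)) (x + y) - dotp (T (x - y)) (x - y)
    + 'i * dotp (T (x + 'i *: y)) (x + 'i *: y)
    - 'i * dotp (T (x - 'i *: y)) (x - 'i *: y).
Proof.
rewrite !opB !opD !opZ !(ipBl, ipBr, ipDl, ipDr, ipZl, ipZr).
have -> : ('i : R[i])^* = - 'i by exact: conji.
have : ('i : R[i]) * 'i = -1 by rewrite -expr2 sqr_i.
move: ('i : R[i]) (dotp _ _) (dotp _ _) (dotp _ _) (dotp _ _) => i a b c d hi.
by ring: hi.
Qed.

(** Serves two purposes: with c = 0 the quadratic form determines the operator, and a Cauchy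
    estimate on quadratic forms becomes one in norm. Polarization and the parallelogram identity
    bound <T x, y> by c (|x|^2 + |y|^2). *)
Lemma numerical_radius T (c : R) : 0 <= c ->
  (forall x, nm (dotp (T x) x) <= c * nm x ^+ 2) ->
  forall x, nm (T x) <= 2 * c * nm x.
Proof.
move=> c0 h x.
have key y : nm (dotp (T x) y) <= c * (nm x ^+ 2 + nm y ^+ 2).
  have h4 : nm (4 : R[i]) = 4.
    by rewrite -[4]/((4%:R : R[i])) -(rmorph_nat (real_complex R)) nmC ger0_norm.
  have hi : nm ('i : R[i]) = 1.
    by rewrite /nm normc_def/= expr0n expr1n add0r sqrtr1.
  rewrite -(@ler_pM2l _ 4)// -[X in X * _]h4 -nmM polarization.
  have e1 := parallelogram x y; have e2 := parallelogram x ('i *: y).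
  rewrite nmZ hi mul1r in e2.
  have := h (x + y); have := h (x - y); have := h (x + 'i *: y).
  have := h (x - 'i *: y); move=> h1 h2 h3 h5.
  have a1 := nmD (dotp (T (x + y)) (x + y) - dotp (T (x - y)) (x - y)
    + 'i * dotp (T (x + 'i *: y)) (x + 'i *: y)) (- ('i * dotp (T (x - 'i *: y)) (x - 'i *: y))).
  have a2 := nmD (dotp (T (x + y)) (x + y) - dotp (T (x - y)) (x - y))
    ('i * dotp (T (x + 'i *: y)) (x + 'i *: y)).
  have a3 := nmD (dotp (T (x + y)) (x + y)) (- dotp (T (x - y)) (x - y)).
  rewrite !nmN !nmM !hi !mul1r in a1 a2 a3.
  rewrite (le_trans a1)//.
  have -> : 4 * (c * (nm x ^+ 2 + nm y ^+ 2)) = c * (nm (x + y) ^+ 2 + nm (x - y) ^+ 2)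
     + c * (nm (x + 'i *: y) ^+ 2 + nm (x - 'i *: y) ^+ 2) by rewrite e1 e2; ring.
  lra.
have [x0|x0] := eqVneq (nm x) 0.
  have -> : x = 0 by exact: nm_eq0.
  by rewrite op0 !nm0 mulr0.
have [->|t0] := eqVneq (nm (T x)) 0; first by rewrite !mulr_ge0 ?nm_ge0.
have xp : 0 < nm x by rewrite lt_neqAle eq_sym x0 nm_ge0.
have tp : 0 < nm (T x) by rewrite lt_neqAle eq_sym t0 nm_ge0.
(* Giving y = T x the norm of x balances the two squares in [key]. *)
have := key ((nm x / nm (T x))%:C *: T x).
rewrite ipZr conjCr ipxx -rmorphM/= nmC nmZ nmC.
rewrite ger0_norm ?mulr_ge0 ?sqr_ge0 ?invr_ge0 ?nm_ge0//.
rewrite ger0_norm ?mulr_ge0 ?sqr_ge0 ?invr_ge0 ?nm_ge0//.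
rewrite divfK//.
have -> : nm x / nm (T x) * nm (T x) ^+ 2 = nm x * nm (T x) by field.
move=> h2; rewrite -(ler_pM2l xp); apply: le_trans h2 _.
by rewrite le_eqVlt; apply/orP; left; apply/eqP; ring.
Qed.

Lemma strong_limit (T_ : nat -> 'B(H)) (C : R) :
  (forall n x, nm (T_ n x) <= C * nm x) ->
  (forall x, exists l : H, T_ n x @[n --> \oo] --> l) ->
  exists T, (forall x, T_ n x @[n --> \oo] --> T x) /\
    forall x, nm (T x) <= C * nm x.
Proof.
move=> hC hl; have [t ht] := choice hl.
have tC x : nm (t x) <= C * nm x.
  apply/ler_addgt0Pr => e e0; have [N hN] := (cvgnP_nm _ _).1 (ht x) _ e0.
  have := hN N (leqnn N); have := hC N x.
  have := nm_Bdist (t x) (T_ N x); rewrite nmB; lra.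
have bt : blin t.
  split.
    move=> a x y; apply: (@cvg_unique H (@norm_hausdorff _ H)) (ht _) _.
    rewrite (_ : (fun n => T_ n (a *: x + y)) = (fun n => a *: T_ n x + T_ n y)).
      by apply: cvgD (ht y); apply: cvgZl_tmp (ht x).
    by apply/funext => n; rewrite opD opZ.
  exists `|C| => // x; rewrite (le_trans (tC x))// ler_wpM2r ?nm_ge0//.
  exact: ler_norm.
by exists (toB t); split => x; rewrite toBE.
Qed.

(** The lower bound makes T injective with closed range. A vector orthogonal to the range is killed
    by the adjoint, hence by T since T is normal, hence is 0. *)
Lemma normal_bounded_below_invertible T (c : R) : normal_op T -> 0 < c ->
  (forall x, c * nm x <= nm (T x)) ->
  exists S, S * T = 1 /\ T * S = 1.
Proof.
move=> nT c0 hc.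
have inj x y : T x = T y -> x = y.
  move=> e; apply/eqP; rewrite -subr_eq0; apply/eqP/nm_eq0/eqP.
  have := hc (x - y); rewrite opB e subrr nm0 => h.
  rewrite eq_le nm_ge0 andbT.
  by rewrite -(ler_pM2l c0) mulr0.
have Mc : closed_subspace (range T).
  split; first by exists 0 => //; exact: op0.
    move=> a _ _ [x _ <-] [y _ <-]; exists (a *: x + y) => //.
    by rewrite opD opZ.
  move=> y hy.
  have hu (n : nat) : exists x, nm (T x - y) < n.+1%:R^-1.
    have /hy : nbhs y [set z | nm (z - y) < n.+1%:R^-1].
      apply/nbhs_ballP; exists (n.+1%:R^-1)%:C => /=; first by rewrite ltcR invr_gt0.
      by move=> z /=; rewrite -ball_normE /= nmE ltcR nmB.
    by move=> [z [[x _ <-] h]]; exists x.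
  have [u hu'] := choice hu.
  have Tu : T (u n) @[n --> \oo] --> y.
    apply/cvgnP_nm => e e0; have [N _ hN] := near_infty_natSinv_lt (PosNum e0).
    by exists N => n Nn; rewrite (lt_trans (hu' n))//; exact: (hN n).
  have [l hl] : exists l : H, u n @[n --> \oo] --> l.
    apply: cauchy_cvgn => e e0.
    have [|N hN] := (cvgnP_nm _ _).1 Tu (c * e / 2); first by rewrite !mulr_gt0.
    exists N => n m Nn Nm; rewrite -(ltr_pM2l c0).
    have := nm_triB (T (u n)) y (T (u m)); rewrite -opB [nm (y - _)]nmB.
    have := hN n Nn; have := hN m Nm; have := hc (u n - u m); lra.
  exists l => //; apply: (@cvg_unique H (@norm_hausdorff _ H) (T (u n) @[n --> \oo])) => //.
  by apply: blin_cvg hl; exact: blin_op.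
have surj y : exists x, T x = y.
  have [_ [x _ <-] h] := projection_ex y Mc.
  exists x; apply/eqP; rewrite eq_sym -subr_eq0; apply/eqP.
  have : adjoint T (y - T x) = 0.
    by apply: ip_extr => z; rewrite -adjointP ip0r ipC h ?conjC0//; exists z.
  move=> h0; have := normal_nm (y - T x) nT; rewrite h0 nm0 => /esym h1.
  by apply: inj; rewrite op0; exact: nm_eq0.
have [s hs] := choice surj.
have bs : blin s.
  split; first by move=> a x y; apply: inj; rewrite opD opZ !hs.
  exists c^-1; first by rewrite invr_ge0 ltW.
  by move=> x; have := hc (s x); rewrite hs mulrC -ler_pdivlMr// mulrC.
exists (toB s); split; apply/boundedOpP => x; rewrite !opE toBE//.
by apply: inj; rewrite hs.
Qed.

Lemma op_norm_has_sup T :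
  has_sup [set complex.Re `|T x| | x in [set x : H | `|x| <= 1]].
Proof.
split; first by exists (nm (T 0)), 0 => //=; rewrite normr0 ler01.
have [C C0 hC] := op_bound T; exists C => _ [x /= x1 <-].
rewrite -/(nm _) (le_trans (hC x))// ler_piMr//; first exact: ltW.
by rewrite -lecR -nmE.
Qed.

Lemma op_normP T x : nm x <= 1 -> nm (T x) <= op_norm T.
Proof.
move=> x1; apply: sup_upper_bound; first exact: op_norm_has_sup.
by exists x => //=; rewrite nmE -[1]/(1%:C : R[i]) lecR.
Qed.

Lemma op_norm_adherent T (e : R) : 0 < e ->
  exists2 x, nm x <= 1 & op_norm T - e < nm (T x).
Proof.
move=> e0; have [_ [x /= x1 <-] h] := sup_adherent e0 (op_norm_has_sup T).
by exists x => //; rewrite -lecR -nmE.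
Qed.

Lemma op_norm_ge0 T : 0 <= op_norm T.
Proof. by rewrite (le_trans (nm_ge0 (T 0)))// op_normP// nm0. Qed.

Lemma op_norm_le T x : nm (T x) <= op_norm T * nm x.
Proof.
have [->|x0] := eqVneq x 0; first by rewrite op0 !nm0 mulr0.
have nx0 : 0 < nm x.
  by rewrite lt_neqAle nm_ge0 andbT eq_sym; apply: contraNneq x0 => /nm_eq0 ->.
have h : nm ((nm x)^-1%:C : R[i]) = (nm x)^-1.
  by rewrite nmC ger0_norm ?invr_ge0 ?ltW.
have := @op_normP T ((nm x)^-1%:C *: x); rewrite opZ !nmZ h mulVf ?gt_eqF//.
by move=> /(_ (lexx 1)); rewrite mulrC ler_pdivrMr.
Qed.

End operators.

(** * Limits of complex sequences *)

Section complex_limits.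
Context (R : realType).

(** An explicit form of convergence, so that scalar limits are computed without moving between the
    structures of [R[i]] and [R[i]^o]. *)
Definition cvgC (u : nat -> R[i]) (l : R[i]) : Prop :=
  forall e : R, 0 < e -> exists N, forall n, (N <= n)%N -> nm (u n - l) < e.

Lemma cvgCP (u : nat -> R[i]) (l : R[i]) :
  cvgC u l <-> (u n @[n --> \oo] --> l).
Proof. by rewrite (@cvgnP_nm R R[i]^o). Qed.

Lemma eq_cvgC (u v : nat -> R[i]) l : u =1 v -> cvgC u l -> cvgC v l.
Proof. by move=> /funext ->. Qed.

Lemma cvgC_cst l : cvgC (fun=> l) l.
Proof. by move=> e e0; exists 0%N => n _; rewrite subrr nm0. Qed.

Lemma cvgCD (u v : nat -> R[i]) a b :
  cvgC u a -> cvgC v b -> cvgC (fun n => u n + v n) (a + b).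
Proof.
move=> hu hv e e0; have e2 : 0 < e / 2 by rewrite divr_gt0.
have [N hN] := hu _ e2; have [M hM] := hv _ e2.
exists (maxn N M) => n; rewrite geq_max => /andP[/hN h1 /hM h2].
rewrite opprD addrACA (le_lt_trans (nmD _ _))//.
by move: h1 h2; move: (nm _) (nm _) => x y; lra.
Qed.

Lemma cvgCM (c : R[i]) (u : nat -> R[i]) a :
  cvgC u a -> cvgC (fun n => c * u n) (c * a).
Proof.
move=> hu e e0; have c1 : 0 < nm c + 1 by rewrite ltr_wpDl ?nm_ge0.
have [|N hN] := hu (e / (nm c + 1)); first by rewrite divr_gt0.
exists N => n /hN; rewrite -mulrBr nmM ltr_pdivlMr// mulrC; apply: le_lt_trans.
by rewrite ler_wpM2r ?nm_ge0// lerDl.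
Qed.

Lemma cvgCN (u : nat -> R[i]) a : cvgC u a -> cvgC (fun n => - u n) (- a).
Proof. by move=> /(cvgCM (-1)); rewrite mulN1r; apply: eq_cvgC => n; rewrite mulN1r. Qed.

Lemma cvgCB (u v : nat -> R[i]) a b :
  cvgC u a -> cvgC v b -> cvgC (fun n => u n - v n) (a - b).
Proof. by move=> ha /cvgCN; exact: cvgCD. Qed.

Lemma cauchy_cvgC (u : nat -> R[i]) :
  (forall e : R, 0 < e -> exists N, forall n m, (N <= n)%N -> (N <= m)%N ->
     nm (u n - u m) < e) ->
  exists l, cvgC u l.
Proof.
move=> h.
have hR (f : nat -> R) : (forall n m, `|f n - f m| <= nm (u n - u m)) ->
    exists l : R, f n @[n --> \oo] --> l.
  move=> hf; apply: (@cvg_ex _ (f n @[n --> \oo])).1; apply: cauchy_cvg.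
  apply/cauchyP => e e0; have [N hN] := h e e0.
  exists (f N), N => // n Nn /=; rewrite -ball_normE /=.
  by rewrite (le_lt_trans (hf _ _))//; apply: hN.
have [a ha] := hR (fun n => complex.Re (u n)) (fun n m => ltac:(by rewrite -ReB normRe_le_nm)).
have [b hb] := hR (fun n => complex.Im (u n)) (fun n m => ltac:(by rewrite -ImB normIm_le_nm)).
exists (a +i* b) => e e0.
have e2 : 0 < e / 2 by rewrite divr_gt0.
have [N hN] := (cvgR0P _ _).1 ha _ e2; have [M hM] := (cvgR0P _ _).1 hb _ e2.
exists (maxn N M) => n; rewrite geq_max => /andP[/hN h1 /hM h2].
rewrite (le_lt_trans (nm_le_ReIm _))// ReB ImB/=.
by move: h1 h2; move: `|_| `|_| => x y; lra.
Qed.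

Lemma cvgC_le (u : nat -> R[i]) (l : R[i]) (C : R) :
  cvgC u l ->
  (exists N, forall n, (N <= n)%N -> nm (u n) <= C) -> nm l <= C.
Proof.
move=> ul [M hM]; apply/ler_addgt0Pr => e e0.
have [N hN] := ul e e0.
have h1 := hN (maxn N M) (leq_maxl _ _); have h2 := hM (maxn N M) (leq_maxr _ _).
have := nm_Bdist l (u (maxn N M)); rewrite nmB.
by move: h1 h2; lra.
Qed.

Lemma cvgC_unique (u : nat -> R[i]) (l l' : R[i]) :
  cvgC u l ->
  cvgC u l' -> l = l'.
Proof.
move=> h1 h2; apply/eqP; rewrite -subr_eq0; apply/eqP/nm_eq0/eqP.
rewrite eq_le nm_ge0 andbT; apply/ler_addgt0Pr => e e0; rewrite add0r.
have e2 : 0 < e / 2 by rewrite divr_gt0.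
have [N hN] := h1 _ e2; have [M hM] := h2 _ e2.
apply/ltW/(le_lt_trans (nm_triB l (u (maxn N M)) l')); rewrite [X in X + _]nmB.
by apply: half_ltD; [exact: hN (leq_maxl _ _)|exact: hM (leq_maxr _ _)].
Qed.

Lemma cvgC_conj (u : nat -> R[i]) (l : R[i]) :
  cvgC u l ->
  cvgC (fun n => (u n)^*) l^*.
Proof.
move=> ul e /ul[N hN].
by exists N => n /hN; rewrite -rmorphB/= nm_conj.
Qed.

Lemma cvgC_Re (u : nat -> R[i]) (l : R[i]) :
  cvgC u l ->
  complex.Re (u n) @[n --> \oo] --> complex.Re l.
Proof.
move=> ul; apply/cvgR0P => e /ul[N hN].
exists N => n /hN; apply: le_lt_trans; rewrite -ReB.
exact: normRe_le_nm.
Qed.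

(** Cauchy-Schwarz for semidefinite forms. Only a = - r z with r real is tested: r = 1 / B when B >
    0, and a large r when B = 0. *)
Lemma discriminant_CS (A B : R) (z : R[i]) : 0 <= A -> 0 <= B ->
  (forall a : R[i], 0 <= A + 2 * complex.Re (a^* * z) + nm a ^+ 2 * B) ->
  nm z ^+ 2 <= A * B.
Proof.
move=> A0 B0 h.
have h' (r : R) : 0 <= A - 2 * r * nm z ^+ 2 + r ^+ 2 * nm z ^+ 2 * B.
  have := h ((- r)%:C * z); rewrite rmorphM/= conjCr -mulrA [_^* * _]mulrC mul_conj_nm.
  rewrite ReCM nmM nmC normrN exprMn real_normK ?num_real//=.
  by move: (nm z ^+ 2) => F; congr (_ <= _); ring.
have F0 : 0 <= nm z ^+ 2 by exact: sqr_ge0.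
move: h' F0; move: (nm z ^+ 2) => F h' F0.
have [B00|Bn0] := eqVneq B 0.
  have [->|Fn0] := eqVneq F 0; first by rewrite mulr_ge0.
  (* This value of r turns the nonnegative expression into -1. *)
  have := h' ((A + 1) / F / 2); rewrite B00 mulr0 addr0.
  have -> : 2 * ((A + 1) / F / 2) * F = A + 1 by field.
  lra.
have Bp : 0 < B by rewrite lt_neqAle eq_sym Bn0.
have := h' B^-1.
have -> : A - 2 * B^-1 * F + B^-1 ^+ 2 * F * B = A - F / B by field.
by rewrite subr_ge0 ler_pdivrMr.
Qed.

End complex_limits.

(* Every normed space in which Cauchy sequences converge is complete: pick a
   point in a set of diameter at most 1/n of the Cauchy filter for each n. *)
Lemma sequentially_complete (R : realType) (V : normedModType R[i]) :
  (forall f : nat -> V,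
    (forall e : R, 0 < e -> exists N, forall n m, (N <= n)%N -> (N <= m)%N ->
       nm (f n - f m) < e) -> exists l : V, f x @[x --> \oo] --> l) ->
  forall F : set_system V, ProperFilter F -> cauchy F -> cvg F.
Proof.
move=> hV F FF /cauchyP hF.
have h (n : nat) : exists x : V, F (ball x (n.+1%:R^-1)%:C).
  by apply: hF; rewrite ltcR invr_gt0.
have [u hu] := choice h.
have close n m : nm (u n - u m) < n.+1%:R^-1 + m.+1%:R^-1.
  have [z []] := filter_ex (filterI (hu n) (hu m)).
  rewrite -!ball_normE /= !nmE !ltcR => h1 h2.
  by rewrite (le_lt_trans (nm_triB _ z _))// ltrD// nmB.
have [l hl] : exists l : V, u n @[n --> \oo] --> l.
  apply: hV => e e0; have e2 : 0 < e / 2 by rewrite divr_gt0.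
  have [N _ hN] := near_infty_natSinv_lt (PosNum e2).
  exists N => n m Nn Nm; have := close n m; have := hN n Nn; have := hN m Nm.
  by rewrite /=; move: (n.+1%:R^-1) (m.+1%:R^-1) => a b; lra.
apply/cvg_ex; exists l; apply/cvgP_nm => e e0.
have e2 : 0 < e / 2 by rewrite divr_gt0.
have [N1 _ hN1] := near_infty_natSinv_lt (PosNum e2).
have [N2 hN2] := (cvgnP_nm _ _).1 hl _ e2.
have := hu (maxn N1 N2); apply: filterS => x.
rewrite -ball_normE /= nmE ltcR nmB => h1.
have := hN1 (maxn N1 N2) (leq_maxl _ _); have := hN2 (maxn N1 N2) (leq_maxr _ _).
rewrite /=; have := nm_triB x (u (maxn N1 N2)) l; move: h1.
by move: (_^-1) => a; lra.
Qed.

(** * Kolmogorov decompositions *)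

Section kernel_form.
Context (R : realType) (I : Type) (k : I -> I -> R[i]).
Implicit Types (s t : seq (R[i] * I)) (a : R[i]) (i j : I).

Definition kform s t : R[i] :=
  \sum_(p <- s) \sum_(q <- t) p.1 * q.1^* * k p.2 q.2.

Definition pd_kernel : Prop := forall s, 0 <= kform s s.

(* The pairing with a formal combination [t] of the functional whose value at
   the generator [i] is [u i]. *)
Definition keval (u : I -> R[i]) t : R[i] := \sum_(q <- t) q.1^* * u q.2.

Definition kscale a s : seq (R[i] * I) := [seq (a * p.1, p.2) | p <- s].

Lemma kform_catl s s' t : kform (s ++ s') t = kform s t + kform s' t.
Proof. by rewrite /kform big_cat. Qed.

Lemma kform_catr s t t' : kform s (t ++ t') = kform s t + kform s t'.
Proof. by rewrite /kform -big_split/=; apply: eq_bigr => p _; rewrite big_cat. Qed.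

Lemma kform_scalel a s t : kform (kscale a s) t = a * kform s t.
Proof.
rewrite /kform /kscale big_map big_distrr/=; apply: eq_bigr => p _.
by rewrite big_distrr/=; apply: eq_bigr => q _; rewrite !mulrA.
Qed.

Lemma kform_scaler a s t : kform s (kscale a t) = a^* * kform s t.
Proof.
rewrite /kform /kscale big_distrr/=; apply: eq_bigr => p _.
rewrite big_map big_distrr/=; apply: eq_bigr => q _.
by rewrite rmorphM/=; ring.
Qed.

Lemma kform_eval s t : kform s t = keval (fun j => kform s [:: (1, j)]) t.
Proof.
rewrite /kform /keval exchange_big/=; apply: eq_bigr => q _.
rewrite big_distrr/=; apply: eq_bigr => p _.
by rewrite big_seq1/= rmorph1; ring.
Qed.

Lemma keval_cat u t t' : keval u (t ++ t') = keval u t + keval u t'.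
Proof. by rewrite /keval big_cat. Qed.

Lemma keval_scale u a t : keval u (kscale a t) = a^* * keval u t.
Proof.
rewrite /keval /kscale big_map big_distrr/=; apply: eq_bigr => q _.
by rewrite rmorphM mulrA.
Qed.

Lemma keval_lin a u v t :
  keval (fun i => a * u i + v i) t = a * keval u t + keval v t.
Proof.
rewrite /keval big_distrr -big_split/=; apply: eq_bigr => q _.
by rewrite mulrDr; ring.
Qed.

Lemma keval_cvg (u_ : nat -> I -> R[i]) u t :
  (forall j, cvgC (u_ ^~ j) (u j)) -> cvgC (fun n => keval (u_ n) t) (keval u t).
Proof.
move=> h; rewrite /keval; elim: t => [|q t IH].
  by rewrite big_nil; apply: eq_cvgC (cvgC_cst 0) => n; rewrite big_nil.
rewrite big_cons; apply: eq_cvgC (cvgCD (cvgCM q.1^* (h q.2)) IH) => n.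
by rewrite big_cons.
Qed.

Section pd.
Context (hk : pd_kernel).

(** Positivity in [R[i]] includes being real. Realness of the form at x i + y j, for (x, y) = (1, 1)
    and ('i, 1), compares the imaginary and the real parts of k i j and k j i. *)
Lemma kform_herm s t : kform t s = (kform s t)^*.
Proof.
have kC i j : k j i = (k i j)^*.
  have e x y := hk ([:: (x, i)] ++ [:: (y, j)]).
  have gI (z : R[i]) : 0 <= z -> complex.Im z = 0 by exact: ger0_Im.
  have f x : kform [:: (x, i)] [:: (x, i)] = x * x^* * k i i.
    by rewrite /kform !big_seq1.
  have kii l : complex.Im (k l l) = 0.
    have := hk [:: (1, l)]; rewrite /kform !big_seq1/= rmorph1 !mul1r.
    exact: gI.
  have im x y : complex.Im (x * y^* * k i j) + complex.Im (y * x^* * k j i) = 0.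
    have := gI _ (e x y); rewrite /kform /= !big_cons !big_nil !addr0/= !ImD.
    rewrite !mul_conj_nm !ImCM !kii !mulr0 add0r addr0.
    by [].
  apply: ReIm_inj; last first.
    by have := im 1 1; rewrite rmorph1 !mul1r ImJ => /eqP; rewrite addrC addr_eq0 => /eqP.
  have := im 'i 1; rewrite rmorph1 !mulr1 mul1r ImiM.
  have -> : ('i : R[i])^* = - 'i by exact: conji.
  rewrite mulNr ImN ImiM ReJ => /eqP; rewrite addr_eq0 opprK => /eqP ->.
  by [].
rewrite /kform exchange_big/= rmorph_sum; apply: eq_bigr => p _ /=.
rewrite rmorph_sum; apply: eq_bigr => q _ /=.
by rewrite kC !rmorphM/= conjCK; ring.
Qed.

Definition knorm2 s : R := complex.Re (kform s s).

Lemma knorm2E s : kform s s = (knorm2 s)%:C.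
Proof. exact: ge0_Re. Qed.

Lemma knorm2_ge0 s : 0 <= knorm2 s.
Proof. by rewrite -ler0c -knorm2E. Qed.

Definition ksub s t := s ++ kscale (-1) t.

Lemma knorm2_comb s a t :
  knorm2 (s ++ kscale a t) =
  knorm2 s + 2 * complex.Re (a^* * kform s t) + nm a ^+ 2 * knorm2 t.
Proof.
rewrite /knorm2 !kform_catl !kform_catr !kform_scalel !kform_scaler.
rewrite (kform_herm s t) !ReD [a * (a^* * _)]mulrA mul_conj_nm ReCM.
have -> : complex.Re (a * (kform s t)^*) = complex.Re (a^* * kform s t).
  by rewrite -ReJ rmorphM/= conjCK.
ring.
Qed.

Lemma kform_CS s t : nm (kform s t) ^+ 2 <= knorm2 s * knorm2 t.
Proof.
apply: discriminant_CS; rewrite ?knorm2_ge0// => a.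
by rewrite -knorm2_comb knorm2_ge0.
Qed.

Lemma kform_bound s t (e : R) : 0 <= e -> knorm2 s <= e ^+ 2 ->
  nm (kform s t) <= e * Num.sqrt (knorm2 t).
Proof.
move=> e0 h; rewrite -(@ler_pXn2r _ 2)// ?nnegrE ?nm_ge0// ?mulr_ge0 ?sqrtr_ge0//.
rewrite (le_trans (kform_CS _ _))// exprMn sqr_sqrtr ?knorm2_ge0//.
by rewrite ler_wpM2r ?knorm2_ge0.
Qed.

Definition kcauchy (S : nat -> seq (R[i] * I)) : Prop :=
  forall e : R, 0 < e -> exists N, forall n m, (N <= n)%N -> (N <= m)%N ->
    knorm2 (ksub (S n) (S m)) <= e ^+ 2.

(** A point of the completion is encoded by the function of its inner products with the generators,
    the limit of those of a seminorm-Cauchy sequence of formal combinations. Equality is then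
    pointwise, and no quotient is taken. *)
Definition krep (S : nat -> seq (R[i] * I)) (u : I -> R[i]) : Prop :=
  kcauchy S /\
  forall j, cvgC (fun n => kform (S n) [:: (1, j)]) (u j).

Lemma kform_subl s s' t : kform (ksub s s') t = kform s t - kform s' t.
Proof. by rewrite kform_catl kform_scalel mulN1r. Qed.

Lemma kcauchy_form S t (e : R) : kcauchy S -> 0 < e -> exists N, forall n m,
  (N <= n)%N -> (N <= m)%N ->
  nm (kform (S n) t - kform (S m) t) <= e * Num.sqrt (knorm2 t).
Proof.
move=> hS e0; have [N hN] := hS e e0; exists N => n m Nn Nm.
by rewrite -kform_subl; apply: kform_bound; [exact: ltW|exact: hN].
Qed.

Lemma kcauchy_rep S : kcauchy S -> exists u, krep S u.
Proof.
move=> hS; have h j : exists l, cvgC (fun n => kform (S n) [:: (1, j)]) l.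
  apply: cauchy_cvgC => e e0; pose c := Num.sqrt (knorm2 [:: (1, j)]).
  have c1 : 0 < c + 1 by rewrite ltr_wpDl// sqrtr_ge0.
  have [|N hN] := kcauchy_form [:: (1, j)] hS (_ : 0 < e / (c + 1)).
    by rewrite divr_gt0.
  exists N => n m Nn Nm; rewrite (le_lt_trans (hN n m Nn Nm))// -/c.
  by rewrite mulrAC ltr_pdivrMr// ltr_pM2l// ltrDl.
by have [u hu] := choice h; exists u.
Qed.

Lemma krep_eval S u t : krep S u ->
  cvgC (fun n => kform (S n) t) (keval u t).
Proof.
by move=> [_ h]; apply: eq_cvgC (keval_cvg t h) => n; rewrite -kform_eval.
Qed.

Lemma krep_lin a S T u v : krep S u -> krep T v ->
  krep (fun n => kscale a (S n) ++ T n) (fun i => a * u i + v i).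
Proof.
move=> [cS hS] [cT hT]; split.
  (* Chosen so that |a| c <= e / 2; the seminorm of the combined difference is then at most |a| c +
     e / 2. *)
  move=> e e0; pose c := e / 2 / (nm a + 1).
  have a1 : 0 < nm a + 1 by rewrite ltr_wpDl ?nm_ge0.
  have c0 : 0 < c by rewrite !divr_gt0.
  have [N hN] := cS c c0; have [M hM] := cT (e / 2) (ltac:(by rewrite divr_gt0)).
  exists (maxn N M) => n m; rewrite !geq_max => /andP[n1 n2] /andP[m1 m2].
  have h1 := hN n m n1 m1; have h2 := hM n m n2 m2.
  set s := ksub (S n) (S m) in h1; set t := ksub (T n) (T m) in h2.
  have -> : knorm2 (ksub (kscale a (S n) ++ T n) (kscale a (S m) ++ T m)) =
            knorm2 (t ++ kscale a s).
    rewrite /knorm2; congr complex.Re.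
    rewrite /ksub !(kform_catl, kform_catr, kform_scalel, kform_scaler); ring.
  rewrite knorm2_comb.
  have CS : complex.Re (a^* * kform t s) <= nm a * (e / 2 * c).
    rewrite (le_trans (Re_le_nm _))// nmM nm_conj ler_wpM2l ?nm_ge0//.
    have e2 : 0 <= e / 2 by rewrite divr_ge0 ?ltW.
    rewrite (le_trans (kform_bound s e2 h2))// ler_wpM2l//.
    by rewrite -[leRHS]gtr0_norm// -sqrtr_sqr ler_wsqrtr.
  have h3 : nm a ^+ 2 * knorm2 s <= nm a ^+ 2 * c ^+ 2 by rewrite ler_wpM2l ?sqr_ge0.
  have h4 : (nm a * c) <= e / 2.
    have e2 : 0 <= e / 2 by rewrite divr_ge0 ?ltW.
    by rewrite /c mulrCA ler_piMr// ler_pdivrMr// mul1r lerDl.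
  have h5 : 0 <= nm a * c by rewrite mulr_ge0 ?nm_ge0 ?ltW.
  have h6 : (nm a * c + e / 2) ^+ 2 <= e ^+ 2.
    by rewrite ler_pXn2r ?nnegrE//; [lra|lra|rewrite ltW].
  have h7 : (nm a * c + e / 2) ^+ 2 = nm a ^+ 2 * c ^+ 2 + 2 * (nm a * (e / 2 * c)) + (e / 2) ^+ 2 by ring.
  move: h1 h2 h3 CS h6 h7; move: (knorm2 t) (_ * knorm2 s) (complex.Re _) (nm a ^+ 2 * c ^+ 2).
  by move=> *; lra.
move=> j; apply: eq_cvgC (cvgCD (cvgCM a (hS j)) (hT j)) => n.
by rewrite kform_catl kform_scalel.
Qed.

Lemma krep0 : krep (fun=> [::]) (fun=> 0).
Proof.
split=> [e e0|j].
  by exists 0 => n m _ _; rewrite /knorm2 /kform big_nil/= sqr_ge0.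
by apply: eq_cvgC (cvgC_cst 0) => n; rewrite /kform big_nil.
Qed.

Lemma krep_cst s : krep (fun=> s) (fun j => kform s [:: (1, j)]).
Proof.
split=> [e e0|j]; last exact: cvgC_cst.
exists 0 => n m _ _; rewrite /ksub knorm2_comb rmorphN rmorph1 mulN1r ReN.
rewrite /knorm2 nmN nm1 expr1n mul1r.
by move: (complex.Re _) => x; have -> : x + 2 * - x + x = 0 by [ring]; rewrite sqr_ge0.
Qed.

End pd.
End kernel_form.

Lemma three_step (R : realFieldType) (e a b c d x : R) :
  a < e / 3 -> b < e / 3 -> c < e / 3 -> x <= b + d -> d <= a + c -> x <= e.
Proof. lra. Qed.

Lemma two_step (R : realFieldType) (e a b x : R) :
  0 < e -> a < e / 3 -> b <= e / 3 -> x <= a + b -> x < e.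
Proof. lra. Qed.

Section kernel_space.
Context (R : realType) (I : Type) (k : I -> I -> R[i]) (hk : pd_kernel k).

Definition kspace_pred : pred (I -> R[i]^o) :=
  fun u => `[< exists S, krep k S u >].

Lemma kspace_pred_closed : subsemimod_closed kspace_pred.
Proof.
split; first split.
- by apply/asboolP; exists (fun=> [::]); exact: krep0.
- move=> u v /asboolP[S hS] /asboolP[T hT]; apply/asboolP.
  exists (fun n => kscale 1 (S n) ++ T n).
  rewrite (_ : u + v = fun i => 1 * u i + v i); first exact: krep_lin.
  by apply/funext => i; rewrite mul1r.
- move=> a u /asboolP[S hS]; apply/asboolP.
  exists (fun n => kscale a (S n) ++ [::]).
  rewrite (_ : a *: u = fun i => a * u i + 0); first exact: krep_lin hS (krep0 _).
  by apply/funext => i; rewrite addr0.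
Qed.

HB.instance Definition _ :=
  GRing.isSubmodClosed.Build R[i] (I -> R[i]^o) kspace_pred kspace_pred_closed.

(** The positivity proof is a parameter of the type because the Hilbert structure depends on it and
    must be inferable from the type alone. *)
Definition kspace of pd_kernel k := {u : I -> R[i]^o | kspace_pred u}.
Notation T := (kspace hk).
HB.instance Definition _ := SubType.copy T {u | kspace_pred u}.
HB.instance Definition _ := gen_eqMixin T.
HB.instance Definition _ := gen_choiceMixin T.
HB.instance Definition _ := [SubChoice_isSubLmodule of T by <:].

Lemma kspaceP (u : T) : exists S, krep k S (val u).
Proof. by case: u => u /= /asboolP. Qed.

Definition kspace_rep (u : T) := projT1 (cid (kspaceP u)).

Lemma kspace_repP (u : T) : krep k (kspace_rep u) (val u).
Proof. by rewrite /kspace_rep; case: cid. Qed.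

Lemma kspaceE (u v : T) : (forall i, val u i = val v i) -> u = v.
Proof. by move=> h; apply: val_inj; apply/funext. Qed.

(** Pairing u with combinations representing v makes linearity in u immediate; symmetry and
    positivity have to go through [kdot_form]. *)
Definition kdot (u v : T) : R[i] :=
  xget 0 [set l | cvgC (fun n => keval (val u) (kspace_rep v n)) l].

Lemma cauchy_keval (u : T) (S : nat -> seq (R[i] * I)) : kcauchy k S ->
  exists l, cvgC (fun n => keval (val u) (S n)) l.
Proof.
move=> hS; have hu := kspace_repP u.
have [B hB] : exists B : R, 0 < B /\ forall t, nm (keval (val u) t) <= B * Num.sqrt (knorm2 k t).
  have [N hN] := hu.1 1 ltr01.
  exists (1 + Num.sqrt (knorm2 k (kspace_rep u N))).
  split; first by rewrite ltr_wpDr// sqrtr_ge0.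
  move=> t; apply: (cvgC_le (krep_eval t hu)); exists N => n Nn.
  have -> : kform k (kspace_rep u n) t = kform k (ksub (kspace_rep u n) (kspace_rep u N)) t +
     kform k (kspace_rep u N) t by rewrite kform_subl subrK.
  rewrite (le_trans (nmD _ _))// mulrDl lerD//.
    by apply: kform_bound => //; apply: hN.
  by apply: kform_bound; rewrite ?sqrtr_ge0// sqr_sqrtr// knorm2_ge0.
apply: cauchy_cvgC => e e0.
have [|N hN] := hS (e / B / 2); first by rewrite !divr_gt0//; case: hB.
exists N => n m Nn Nm.
have -> : keval (val u) (S n) - keval (val u) (S m) = keval (val u) (ksub (S n) (S m)).
  by rewrite /ksub keval_cat keval_scale rmorphN rmorph1 mulN1r.
case: hB => B0 hB; rewrite (le_lt_trans (hB _))// mulrC -ltr_pdivlMr//.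
have eB : 0 < e / B by rewrite divr_gt0.
rewrite (@le_lt_trans _ _ (e / B / 2))//; last lra.
rewrite -[leRHS]gtr0_norm ?divr_gt0// -sqrtr_sqr ler_wsqrtr//.
exact: hN.
Qed.

Lemma kdot_cvg u v : cvgC (fun n => keval (val u) (kspace_rep v n)) (kdot u v).
Proof.
rewrite /kdot; case: xgetP => [l _ //|h].
by have [l hl] := cauchy_keval u (kspace_repP v).1; have := h l hl.
Qed.

Lemma kdot_lin a u v w : kdot (a *: u + v) w = a * kdot u w + kdot v w.
Proof.
apply: cvgC_unique (kdot_cvg _ _) _.
apply: eq_cvgC (cvgCD (cvgCM a (kdot_cvg u w)) (kdot_cvg v w)) => n.
by rewrite -keval_lin.
Qed.

(** The iterated limit defining [kdot] equals the diagonal one, because the representatives of v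
    stay bounded in seminorm. The diagonal form is symmetric in u and v up to conjugation. *)
Lemma kdot_form u v : cvgC (fun n => kform k (kspace_rep u n) (kspace_rep v n)) (kdot u v).
Proof.
have hu := kspace_repP u; have hv := kspace_repP v.
have [N0 hN0] := hv.1 1 ltr01; pose w := kspace_rep v N0.
pose B := 1 + Num.sqrt (knorm2 k w).
have B0 : 0 < B by rewrite ltr_wpDr// sqrtr_ge0.
have vB n : (N0 <= n)%N -> forall s (d : R), 0 <= d -> knorm2 k s <= d ^+ 2 ->
    nm (kform k s (kspace_rep v n)) <= d * B.
  move=> Nn s d d0 hd.
  have -> : kform k s (kspace_rep v n) = kform k s (ksub (kspace_rep v n) w) + kform k s w.
    by rewrite /ksub kform_catr kform_scaler rmorphN rmorph1 mulN1r subrK.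
  rewrite (le_trans (nmD _ _))// mulrDr lerD//; last exact: kform_bound.
  rewrite (le_trans (kform_bound hk _ d0 hd))// ler_wpM2l//.
  rewrite -[leRHS]gtr0_norm// -sqrtr_sqr ler_wsqrtr//.
  exact: hN0.
move=> e e0; have e2 : 0 < e / 2 by rewrite divr_gt0.
have eB : 0 < e / 2 / B / 2 by rewrite !divr_gt0.
have [N1 hN1] := kdot_cvg u v e2; have [N2 hN2] := hu.1 _ eB.
exists (maxn N0 (maxn N1 N2)) => n; rewrite !geq_max => /and3P[n0 n1 n2].
have h1 := hN1 n n1.
have h2 : nm (keval (val u) (kspace_rep v n) - kform k (kspace_rep u n) (kspace_rep v n)) <= e / 2 / B / 2 * B.
  apply: (cvgC_le (cvgCB (krep_eval _ hu) (cvgC_cst _))).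
  by exists N2 => m Nm; rewrite -kform_subl; apply: vB => //; [exact: ltW|exact: hN2].
have h3 : e / 2 / B / 2 * B = e / 4 by field; rewrite gt_eqF.
rewrite h3 in h2; have := nm_triB (kform k (kspace_rep u n) (kspace_rep v n)) (keval (val u) (kspace_rep v n)) (kdot u v).
rewrite [nm (kform _ _ _ - keval _ _)]nmB; lra.
Qed.

Lemma kdot_herm u v : kdot u v = (kdot v u)^*.
Proof.
apply: cvgC_unique (kdot_form _ _) _.
apply: eq_cvgC (cvgC_conj (kdot_form v u)) => n.
by rewrite -kform_herm.
Qed.

Lemma kdot_linr a u v w : kdot w (a *: u + v) = a^* * kdot w u + kdot w v.
Proof.
by rewrite kdot_herm kdot_lin rmorphD/= rmorphM/= -!kdot_herm.
Qed.

Lemma Re_kdot_expand a u v : complex.Re (kdot (a *: v + u) (a *: v + u)) =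
  complex.Re (kdot u u) + 2 * complex.Re (a^* * kdot u v)
  + nm a ^+ 2 * complex.Re (kdot v v).
Proof.
rewrite kdot_lin !kdot_linr mulrDr mulrA mul_conj_nm !ReD ReCM.
rewrite -[complex.Re (a * _)]ReJ rmorphM/= -kdot_herm; ring.
Qed.

Lemma kdot_ge0 u : 0 <= kdot u u.
Proof.
have h := kdot_form u u.
have hC := kdot_herm u u.
have Im0 : complex.Im (kdot u u) = 0.
  by have := congr1 (@complex.Im R) hC; rewrite ImJ => /eqP; rewrite -addr_eq0 -mulr2n mulrn_eq0/= => /eqP.
suff Re0 : 0 <= complex.Re (kdot u u).
  by rewrite lecE/= Im0 eqxx.
rewrite leNgt; apply/negP => hlt.
have := h (- complex.Re (kdot u u)); rewrite oppr_gt0 hlt => /(_ isT)[N /(_ N (leqnn N))].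
apply/negP; rewrite -leNgt (le_trans _ (Re_le_nm _))// ReB lerDr.
exact: knorm2_ge0.
Qed.

Lemma kdot_comb (s : seq (R[i] * I)) : kspace_pred (fun j => kform k s [:: (1, j)]).
Proof. by apply/asboolP; exists (fun=> s); apply: krep_cst. Qed.

Definition kcomb (s : seq (R[i] * I)) : T :=
  @exist _ (fun u => is_true (kspace_pred u)) _ (kdot_comb s).

Lemma kdot_combr u s : kdot u (kcomb s) = keval (val u) s.
Proof.
rewrite kdot_herm; have h := kdot_cvg (kcomb s) u.
rewrite -[RHS]conjCK; congr (_^*); apply: cvgC_unique h _.
apply: eq_cvgC (cvgC_conj (krep_eval s (kspace_repP u))) => n.
by rewrite -kform_herm// kform_eval.
Qed.

Lemma kdot_eq0 u : kdot u u = 0 -> u = 0.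
Proof.
move=> h0; apply: kspaceE => j /=.
have -> : val u j = kdot u (kcomb [:: (1, j)]).
  by rewrite kdot_combr /keval big_seq1 rmorph1 mul1r.
have CS : nm (kdot u (kcomb [:: (1, j)])) ^+ 2 <= 0 * complex.Re (kdot (kcomb [:: (1, j)]) (kcomb [:: (1, j)])).
  apply: discriminant_CS => //; first by apply/ge0_ReE/kdot_ge0.
  by move=> a; rewrite -[X in X + 2 * _](_ : complex.Re (kdot u u) = 0) ?h0// -h0 -Re_kdot_expand ge0_ReE ?kdot_ge0.
move: CS; rewrite mul0r => CS; apply: nm_eq0; apply/eqP; rewrite -sqrf_eq0.
by rewrite eq_le CS sqr_ge0.
Qed.

Definition kn (u : T) : R := Num.sqrt (complex.Re (kdot u u)).

Lemma kn_sqr u : kdot u u = (kn u ^+ 2)%:C.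
Proof. by rewrite sqr_sqrtr; [apply: ge0_Re|apply: ge0_ReE]; exact: kdot_ge0. Qed.

Lemma kn_ge0 u : 0 <= kn u. Proof. exact: sqrtr_ge0. Qed.

Lemma kdot_CS u v : nm (kdot u v) <= kn u * kn v.
Proof.
rewrite -(@ler_pXn2r _ 2)// ?nnegrE ?nm_ge0// ?mulr_ge0 ?sqrtr_ge0// exprMn.
have knE w : kn w ^+ 2 = complex.Re (kdot w w) by rewrite kn_sqr.
apply: discriminant_CS; rewrite ?sqr_ge0// => a.
by rewrite !knE -Re_kdot_expand ge0_ReE ?kdot_ge0.
Qed.

Lemma knD u v : kn (u + v) <= kn u + kn v.
Proof.
rewrite -(@ler_pXn2r _ 2)// ?nnegrE ?addr_ge0 ?sqrtr_ge0//.
have knE w : kn w ^+ 2 = complex.Re (kdot w w) by rewrite kn_sqr.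
rewrite addrC -[v]scale1r knE Re_kdot_expand -!knE scale1r rmorph1 mul1r nm1 expr1n mul1r.
rewrite sqrrD.
have := Re_le_nm (kdot u v); have := kdot_CS u v.
lra.
Qed.

Lemma knZ a u : kn (a *: u) = nm a * kn u.
Proof.
apply/eqP; rewrite -(@eqrXn2 _ 2)// ?kn_ge0 ?mulr_ge0 ?nm_ge0 ?kn_ge0//; apply/eqP.
apply: complexI; rewrite -kn_sqr exprMn rmorphM/= -kn_sqr -mul_conj_nm.
have kl x y : kdot (a *: x) y = a * kdot x y.
  have z0 : kdot 0 y = 0.
    by have := kdot_lin (-1) 0 0 y; rewrite scaler0 addr0 mulN1r addNr.
  by rewrite -[_ *: x]addr0 kdot_lin z0 addr0.
by rewrite kl kdot_herm kl rmorphM/= -kdot_herm mulrA.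
Qed.

Definition kspace_norm (u : T) : R[i] := (kn u)%:C.

Lemma kspace_normD u v : kspace_norm (u + v) <= kspace_norm u + kspace_norm v.
Proof. by rewrite /kspace_norm -rmorphD/= lecR knD. Qed.
Lemma kspace_normZ a u : kspace_norm (a *: u) = `|a| * kspace_norm u.
Proof. by rewrite /kspace_norm knZ nmE rmorphM. Qed.
Lemma kspace_norm_eq0 u : kspace_norm u = 0 -> u = 0.
Proof.
by move=> h; apply: kdot_eq0; rewrite kn_sqr rmorphXn/= -/(kspace_norm u) h expr0n.
Qed.

HB.instance Definition _ := Lmodule_isNormed.Build R[i] T
  kspace_normD kspace_normZ kspace_norm_eq0.

Lemma kspace_nmE (u : T) : nm u = kn u. Proof. by []. Qed.

Lemma kcomb_norm s : kn (kcomb s) ^+ 2 = knorm2 k s.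
Proof.
have : kdot (kcomb s) (kcomb s) = kform k s s by rewrite kdot_combr kform_eval.
by rewrite kn_sqr (knorm2E hk) => /complexI.
Qed.

Lemma kn_B_sqr u v : kn (u - v) ^+ 2 = kn u ^+ 2 - 2 * complex.Re (kdot u v) + kn v ^+ 2.
Proof.
have knE w : kn w ^+ 2 = complex.Re (kdot w w) by rewrite kn_sqr.
rewrite !knE addrC -scaleN1r Re_kdot_expand nmN nm1 expr1n mul1r.
by rewrite rmorphN rmorph1 mulN1r ReN mulrN.
Qed.

(** In |u - s|^2 = |u|^2 - 2 Re <u, s> + |s|^2, both <u, s> and |s|^2 tend to |u|^2 along the
    representatives of u. *)
Lemma kcomb_dense u (e : R) : 0 < e -> exists s, kn (u - kcomb s) < e.
Proof.
move=> e0; have e4 : 0 < e ^+ 2 / 4 by rewrite divr_gt0 ?exprn_gt0.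
have [N hN] := kdot_cvg u u e4; have [M hM] := kdot_form u u e4.
set n := maxn N M; exists (kspace_rep u n).
rewrite -(@ltr_pXn2r _ 2)// ?nnegrE ?kn_ge0 ?ltW// kn_B_sqr kcomb_norm kdot_combr.
have := hN n (leq_maxl _ _); have := hM n (leq_maxr _ _).
rewrite knorm2E// kn_sqr -rmorphB/= nmC.
set x := keval _ _; have := normRe_le_nm (x - (kn u ^+ 2)%:C).
rewrite ReB/=; move: (knorm2 _ _) (kn u ^+ 2) (complex.Re x) (nm _) (e ^+ 2).
move=> a b c d f; rewrite !ler_norml !ltr_norml.
by move=> /andP[? ?] /andP[? ?] ?; lra.
Qed.

(** The norm as a dual norm over combinations, legitimate by density. In this form a bound passes to
    pointwise limits of functionals, which completeness requires. *)
Lemma kn_le_keval u (C : R) : 0 <= C ->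
  (forall t, nm (keval (val u) t) <= C * Num.sqrt (knorm2 k t)) -> kn u <= C.
Proof.
move=> C0 h; have [u0|u0] := eqVneq (kn u) 0; first by rewrite u0.
have up : 0 < kn u by rewrite lt_neqAle eq_sym u0 kn_ge0.
rewrite -(ler_pM2r up); apply/ler_addgt0Pr => e e0.
have uC : 0 < kn u + C by rewrite ltr_wpDr.
have [s hs] := kcomb_dense u (divr_gt0 e0 uC).
rewrite -expr2.
have -> : kn u ^+ 2 = nm (kdot u u).
  by rewrite kn_sqr nmC ger0_norm ?sqr_ge0.
have -> : kdot u u = kdot u (u - kcomb s) + kdot u (kcomb s).
  have := kdot_linr 1 (u - kcomb s) (kcomb s) u.
  by rewrite scale1r subrK rmorph1 mul1r.
rewrite (le_trans (nmD _ _))//.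
have h1 := kdot_CS u (u - kcomb s).
have h2 := h s; rewrite -kdot_combr -kcomb_norm sqrtr_sqr ger0_norm ?kn_ge0// in h2.
have h3 : kn (kcomb s) <= kn u + kn (u - kcomb s).
  by rewrite -{1}(subKr u (kcomb s)) -!kspace_nmE (le_trans (nmD _ _))// nmN.
have h4 : kn (u - kcomb s) * (kn u + C) < e by rewrite -ltr_pdivlMr.
have h5 := kn_ge0 (u - kcomb s); have := ler_wpM2l C0 h3; nra.
Qed.

(** Each term is replaced by a formal combination within 1 / (n + 1). These combinations are Cauchy
    for the seminorm, so their sequence is itself a representative of the limit. *)
Lemma kspace_seq_complete (f : nat -> T) :
  (forall e : R, 0 < e -> exists N, forall n m, (N <= n)%N -> (N <= m)%N ->
     nm (f n - f m) < e) -> exists l : T, f x @[x --> \oo] --> l.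
Proof.
move=> cf.
have h (n : nat) : exists s, kn (f n - kcomb s) < n.+1%:R^-1.
  by apply: kcomb_dense; rewrite invr_gt0.
have [t ht] := choice h.
have subE s s' : knorm2 k (ksub s s') = nm (kcomb s - kcomb s') ^+ 2.
  rewrite kspace_nmE -kcomb_norm; congr (kn _ ^+ 2).
  by apply: kspaceE => j; exact: kform_subl.
have ct : kcauchy k t.
  move=> e e0; have e3 : 0 < e / 3 by rewrite divr_gt0.
  have [N hN] := cf _ e3; have [M _ hM] := near_infty_natSinv_lt (PosNum e3).
  exists (maxn N M) => n m; rewrite !geq_max => /andP[n1 n2] /andP[m1 m2].
  rewrite subE ler_pXn2r ?nnegrE ?nm_ge0 ?(ltW e0)//.
  have g1 := hN n m n1 m1; have g2 := ht n; have g3 := ht m.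
  have g4 : n.+1%:R^-1 < e / 3 := hM n n2; have g5 : m.+1%:R^-1 < e / 3 := hM m m2.
  have g6 := nm_triB (kcomb (t n)) (f n) (kcomb (t m)).
  have g7 := nm_triB (f n) (f m) (kcomb (t m)).
  rewrite -!kspace_nmE in g2 g3; rewrite [nm (kcomb (t n) - f n)]nmB in g6.
  exact: three_step g1 (lt_trans g2 g4) (lt_trans g3 g5) g6 g7.
have [phi hphi] := kcauchy_rep hk ct.
have Pphi : kspace_pred phi by apply/asboolP; exists t.
pose u : T := @exist _ (fun u => is_true (kspace_pred u)) phi Pphi.
exists u; apply/cvgnP_nm => e e0; have e3 : 0 < e / 3 by rewrite divr_gt0.
have [N hN] := ct _ e3; have [M _ hM] := near_infty_natSinv_lt (PosNum e3).
exists (maxn N M) => n; rewrite geq_max => /andP[n1 n2].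
have h1 : nm (u - kcomb (t n)) <= e / 3.
  rewrite kspace_nmE; apply: kn_le_keval; first exact: ltW.
  move=> s; have -> : keval (val (u - kcomb (t n))) s = keval phi s - kform k (t n) s.
    rewrite -[u - _]/(u + - _) addrC -scaleN1r.
    transitivity (keval (fun i => -1 * kform k (t n) [:: (1, i)] + phi i) s); first by [].
    by rewrite keval_lin -kform_eval mulN1r addrC.
  apply: (cvgC_le (cvgCB (krep_eval s hphi) (cvgC_cst (kform k (t n) s)))).
  exists N => m Nm; rewrite -kform_subl; apply: kform_bound => //; first exact: ltW.
  exact: hN.
have g2 := ht n; have g4 : n.+1%:R^-1 < e / 3 := hM n n2.
rewrite -kspace_nmE in g2; have g6 := nm_triB (f n) (kcomb (t n)) u.
rewrite [nm (kcomb _ - u)]nmB in g6.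
exact: two_step e0 (lt_trans g2 g4) h1 g6.
Qed.

HB.instance Definition _ := Uniform_isComplete.Build T
  (sequentially_complete kspace_seq_complete).

Lemma kdot_bilinear : bilinear_for *%R (conjC \; *%R) kdot.
Proof.
by split=> [w a u v|u a v w] /=; rewrite ?kdot_lin// kdot_linr.
Qed.
HB.instance Definition _ := bilinear_isBilinear.Build R[i] T T R[i] *%R (conjC \; *%R) kdot kdot_bilinear.
Lemma kdot_hermitian u v : kdot u v = (-1) ^+ false * (kdot v u)^*.
Proof. by rewrite expr0 mul1r kdot_herm. Qed.
HB.instance Definition _ := isHermitianSesquilinear.Build R[i] T false conjC kdot kdot_hermitian.
Lemma kdot_gt0 u : u != 0 -> 0 < kdot u u.
Proof.
rewrite lt_neqAle kdot_ge0 andbT eq_sym; apply: contra => /eqP h.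
by rewrite eq_sym; apply/eqP/kdot_eq0/esym.
Qed.
HB.instance Definition _ := isDotProduct.Build R[i] T kdot kdot_gt0.

Lemma kdot_norm u : kdot u u = `|u| ^+ 2.
Proof. by rewrite kn_sqr rmorphXn. Qed.
HB.instance Definition _ := CompleteNormedModule_isHilbert.Build R T kdot_norm.

End kernel_space.

Section kolmogorov.
Context (R : realType).

(* [v] is total when its closed linear span is the whole space. *)
Definition total_family (K : hilbertType R) (I : Type) (v : I -> K) : Prop :=
  forall x, (forall i, dotp x (v i) = 0) -> x = 0.

(** Reproducing property: the inner product of x with the vector of generator i is the value of x at
    i, so a vector orthogonal to all of them is the zero function. *)
Theorem kolmogorov_decomposition (I : Type) (k : I -> I -> R[i]) : pd_kernel k ->
  exists (K : hilbertType R) (v : I -> K),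
    (forall i j, dotp (v i) (v j) = k i j) /\ total_family v.
Proof.
move=> hk; exists (kspace hk), (fun i => kcomb hk [:: (1, i)]); split=> [i j|x h].
  transitivity (kdot (kcomb hk [:: (1, i)]) (kcomb hk [:: (1, j)])); first by [].
  by rewrite kdot_combr /keval big_seq1 rmorph1 mul1r /= /kform !big_seq1/= rmorph1 !mul1r.
apply: kspaceE => j; have := h j.
rewrite -[dotp _ _]/(kdot _ _) kdot_combr /keval big_seq1 rmorph1 mul1r/= => ->.
by [].
Qed.

End kolmogorov.

(** * Total families: density of combinations, extension of maps, separability *)

Section total_families.
Context (R : realType).

Definition comb (K : hilbertType R) (I : Type) (v : I -> K) (s : seq (R[i] * I)) : K :=
  \sum_(p <- s) p.1 *: v p.2.

Lemma comb_cat (K : hilbertType R) (I : Type) (v : I -> K) s t :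
  comb v (s ++ t) = comb v s + comb v t.
Proof. by rewrite /comb big_cat. Qed.

Lemma comb_scale (K : hilbertType R) (I : Type) (v : I -> K) a s :
  comb v (kscale a s) = a *: comb v s.
Proof.
rewrite /comb /kscale big_map scaler_sumr; apply: eq_bigr => p _.
by rewrite scalerA.
Qed.

Lemma comb_dot (K : hilbertType R) (I : Type) (v : I -> K) s t :
  dotp (comb v s) (comb v t) = kform (fun i j => dotp (v i) (v j)) s t.
Proof.
rewrite /comb ip_suml /kform; apply: eq_bigr => p _.
rewrite ip_sumr; apply: eq_bigr => q _.
by rewrite ipZl ipZr mulrA.
Qed.

Lemma gram_pd (K : hilbertType R) (I : Type) (v : I -> K) :
  pd_kernel (fun i j => dotp (v i) (v j)).
Proof. by move=> s; rewrite -comb_dot ipxx ler0c sqr_ge0. Qed.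

Lemma closed_subspaceP (K : hilbertType R) (M : set K) :
  M 0 -> (forall a x y, M x -> M y -> M (a *: x + y)) ->
  (forall x, (forall e : R, 0 < e -> exists2 y, M y & nm (x - y) < e) -> M x) ->
  closed_subspace M.
Proof.
move=> M0 Ml Mc; split=> // x hx; apply: Mc => e e0.
have /hx[y [My hy]] : nbhs x [set y | nm (x - y) < e].
  apply/nbhs_ballP; exists e%:C => /=; first by rewrite ltcR.
  by move=> y /=; rewrite -ball_normE /= nmE ltcR.
by exists y.
Qed.

Section total.
Context (K : hilbertType R) (I : Type) (v : I -> K) (tv : total_family v).

Lemma total_closed (M : set K) : closed_subspace M -> (forall i, M (v i)) ->
  forall x, M x.
Proof.
move=> Mc Mv x; have [m Mm hm] := projection_ex x Mc.
have -> : x = m by apply/eqP; rewrite -subr_eq0; apply/eqP/tv => i; exact: hm.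
by [].
Qed.

Lemma comb_dense x (e : R) : 0 < e -> exists s, nm (x - comb v s) < e.
Proof.
move: e; pose M := [set x | forall e : R, 0 < e -> exists s, nm (x - comb v s) < e].
rewrite -[forall e, _]/(M x); move: x; apply: total_closed.
  apply: closed_subspaceP => [e e0|a x y Mx My e e0|x hx e e0].
  - by exists [::]; rewrite /comb big_nil subrr nm0.
  - have a1 : 0 < nm a + 1 by rewrite ltr_wpDl ?nm_ge0.
    have [|s hs] := Mx (e / 2 / (nm a + 1)); first by rewrite !divr_gt0.
    have [|t ht] := My (e / 2); first by rewrite divr_gt0.
    exists (kscale a s ++ t); rewrite comb_cat comb_scale.
    rewrite opprD addrACA -scalerBr (le_lt_trans (nmD _ _))// nmZ.
    have : nm a * nm (x - comb v s) <= e / 2.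
      rewrite ltr_pdivlMr// in hs; apply: le_trans (ltW hs).
      by rewrite mulrC ler_wpM2l ?nm_ge0// lerDl.
    by move=> h; exact: half_leltD h ht.
  - have e2 : 0 < e / 2 by rewrite divr_gt0.
    have [y My hy] := hx _ e2; have [s hs] := My _ e2; exists s.
    exact: le_lt_trans (nm_triB _ y _) (half_ltD hy hs).
move=> i e e0; exists [:: (1, i)].
by rewrite /comb big_seq1 scale1r subrr nm0.
Qed.

Lemma total_blin_ext (K' : hilbertType R) (f g : K -> K') : blin f -> blin g ->
  (forall i, f (v i) = g (v i)) -> f =1 g.
Proof.
move=> bf bg fg x; apply/eqP; rewrite -subr_eq0; apply/eqP; move: x.
apply: (@total_closed [set x | f x - g x = 0]).
  apply: closed_subspaceP => [|a x y /= hx hy|x hx].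
  - by rewrite /= (blin0 bf) (blin0 bg) subrr.
  - by rewrite /= (blinP bf) (blinP bg) opprD addrACA -scalerBr hx hy scaler0 addr0.
  - have [C C0 hC] := blin_bound bf; have [D D0 hD] := blin_bound bg.
    apply/nm_eq0/eqP; rewrite eq_le nm_ge0 andbT; apply/ler_addgt0Pr => e e0.
    have CD : 0 < C + D by rewrite addr_gt0.
    have [y /= yM hy] := hx (e / (C + D)) (divr_gt0 e0 CD).
    have yE : f y = g y by apply/eqP; rewrite -subr_eq0 yM.
    have -> : f x - g x = f (x - y) - g (x - y).
      by rewrite (blinB bf) (blinB bg) yE opprB addrA subrK.
    rewrite add0r (le_trans (nmD _ _))// nmN.
    rewrite ltr_pdivlMr// in hy; apply: le_trans (lerD (hC _) (hD _)) _.
    by rewrite -mulrDl mulrC ltW.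
by move=> i /=; rewrite fg subrr.
Qed.

Lemma total_extension (K' : hilbertType R) (t : I -> K') (C : R) : 0 <= C ->
  (forall s, nm (comb t s) <= C * nm (comb v s)) ->
  exists f : K -> K', [/\ blin f, forall i, f (v i) = t i &
    forall x, nm (f x) <= C * nm x].
Proof.
move=> C0 hC.
have C1 : 0 < C + 1 by rewrite ltr_wpDl.
(* The closure of the graph of comb v s |-> comb t s. The bound on combinations makes it the graph
   of a function, everywhere defined by density and completeness. *)
pose G x y := forall e : R, 0 < e ->
  exists s, nm (x - comb v s) < e /\ nm (y - comb t s) < e.
have subE (L : hilbertType R) (w : I -> L) s s' :
    comb w s - comb w s' = comb w (s ++ kscale (-1) s').
  by rewrite comb_cat comb_scale scaleN1r.
have Gbound x y : G x y -> nm y <= C * nm x.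
  move=> h; apply/ler_addgt0Pr => e e0; have [s [h1 h2]] := h _ (divr_gt0 e0 C1).
  rewrite ltr_pdivlMr// in h1; rewrite ltr_pdivlMr// in h2.
  have h3 := nm_Bdist y (comb t s); have h4 := hC s.
  have h5 : nm (comb v s) <= nm x + nm (x - comb v s).
    by have := nm_Bdist (comb v s) x; rewrite [nm (_ - x)]nmB; lra.
  have h6 := nm_ge0 (x - comb v s); have h7 := nm_ge0 (y - comb t s).
  have h8 := ler_wpM2l C0 h5.
  have h9 : nm (y - comb t s) + C * nm (x - comb v s) <= e.
    have [l|l] := lerP (nm (y - comb t s)) (nm (x - comb v s)); first lra.
    have := ler_wpM2l C0 (ltW l); lra.
  lra.
have Glin a x y x' y' : G x y -> G x' y' -> G (a *: x + x') (a *: y + y').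
  move=> h h' e e0; have a1 : 0 < nm a + 1 by rewrite ltr_wpDl ?nm_ge0.
  have e2 : 0 < e / 2 by rewrite divr_gt0.
  have [s [h1 h2]] := h _ (divr_gt0 e2 a1); have [s' [h3 h4]] := h' _ e2.
  exists (kscale a s ++ s'); rewrite !comb_cat !comb_scale.
  have aux p q : p < e / 2 / (nm a + 1) -> q < e / 2 -> 0 <= p -> nm a * p + q < e.
    by rewrite ltr_pdivlMr// => pe qe p0; lra.
  by split; rewrite opprD addrACA -scalerBr (le_lt_trans (nmD _ _))// nmZ aux ?nm_ge0.
have GZ0 y : G 0 y -> y = 0.
  move=> /Gbound; rewrite nm0 mulr0 => h; apply: nm_eq0; apply/eqP.
  by rewrite eq_le h nm_ge0.
have Guniq x y y' : G x y -> G x y' -> y = y'.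
  move=> h h'; apply/eqP; rewrite -subr_eq0; apply/eqP/GZ0.
  by have := Glin (-1) _ _ _ _ h' h; rewrite !scaleN1r addNr addrC.
have Gex x : exists y, G x y.
  have hs (n : nat) : exists s, nm (x - comb v s) < n.+1%:R^-1.
    by apply: comb_dense; rewrite invr_gt0.
  have [s_ hs_] := choice hs.
  have [y hy] : exists y : K', comb t (s_ n) @[n --> \oo] --> y.
    apply: cauchy_cvgn => e e0.
    have [N _ hN] := near_infty_natSinv_lt (PosNum (divr_gt0 (divr_gt0 e0 C1) (ltr0Sn R 1))).
    exists N => n m Nn Nm; rewrite subE (le_lt_trans (hC _))// -subE.
    have h1 := hN n Nn; have h2 := hN m Nm; rewrite /= in h1 h2.
    have h3 := hs_ n; have h4 := hs_ m.
    have h5 := nm_triB (comb v (s_ n)) x (comb v (s_ m)).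
    rewrite [nm (comb v (s_ n) - x)]nmB in h5.
    have h6 : nm (comb v (s_ n) - comb v (s_ m)) < e / (C + 1).
      by move: h1 h2 h3 h4 h5; move: (n.+1%:R^-1) (m.+1%:R^-1) => p q; lra.
    rewrite ltr_pdivlMr// in h6; apply: le_lt_trans h6.
    by rewrite mulrC ler_wpM2l ?nm_ge0// lerDl.
  exists y => e e0.
  have [N hN] := (cvgnP_nm _ _).1 hy _ e0; have [M _ hM] := near_infty_natSinv_lt (PosNum e0).
  exists (s_ (maxn N M)); split; last by rewrite nmB; apply: hN; rewrite leq_maxl.
  by rewrite (lt_trans (hs_ _))//; apply: (hM (maxn N M)); rewrite /= leq_maxr.
have [f hf] := choice Gex.
have fC x : nm (f x) <= C * nm x by exact: Gbound.
exists f; split => //.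
  split; last by exists C.
  by move=> a x y; apply: Guniq (hf _) (Glin _ _ _ _ _ (hf _) (hf _)).
move=> i; apply: Guniq (hf _) _ => e e0; exists [:: (1, i)].
by rewrite /comb !big_seq1 !scale1r !subrr !nm0.
Qed.

(** Equal Gram matrices give equal norms of combinations, hence an extension. That it preserves
    inner products follows from adj f o f = id, checked on the generators. *)
Lemma total_isometry (K' : hilbertType R) (t : I -> K') :
  (forall i j, dotp (t i) (t j) = dotp (v i) (v j)) ->
  exists f : K -> K', [/\ blin f, forall i, f (v i) = t i &
    forall x y, dotp (f x) (f y) = dotp x y].
Proof.
move=> h.
have hn s : nm (comb t s) <= 1 * nm (comb v s).
  rewrite mul1r -(@ler_pXn2r _ 2)// ?nnegrE ?nm_ge0// !nm_sqrE !comb_dot.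
  by rewrite (_ : (fun i j => dotp (t i) (t j)) = fun i j => dotp (v i) (v j))//;
    apply/funext => i; apply/funext => j.
have [f [bf fv fC]] := total_extension ler01 hn; exists f; split => //.
have e1 : (adj f \o f) =1 idfun.
  have bff := blin_comp (blin_adj bf) bf.
  have bid : blin (@idfun K) by split=> //; exists 1 => // x; rewrite mul1r.
  apply: (total_blin_ext bff bid) => i /=; apply/eqP; rewrite -subr_eq0; apply/eqP/tv => j.
  by rewrite ipBl -adjPr// !fv h subrr.
by move=> x y; rewrite adjPr// -[adj f _]/((adj f \o f) x) e1.
Qed.

End total.

Lemma total_separable (K : hilbertType R) (I : countType) (v : I -> K) :
  total_family v -> separable K.
Proof.
move=> tv.
pose q2C (p : rat * rat) : R[i] := ratr p.1 +i* ratr p.2.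
pose cb (s : seq (rat * rat * I)) : K := \sum_(p <- s) q2C p.1 *: v p.2.
exists (range cb); first exact: sub_countable (card_image_le _ _) (countableP _).
have approx (s : seq (R[i] * I)) (e : R) : 0 < e -> exists s', nm (comb v s - cb s') < e.
  move: e; rewrite /comb /cb; elim: s => [|[c i] s IH] e e0.
    by exists [::]; rewrite !big_nil subrr nm0.
  have e2 : 0 < e / 2 by rewrite divr_gt0.
  have [s' hs'] := IH _ e2.
  pose d := e / 2 / (nm (v i) + 1) / 2.
  have v1 : 0 < nm (v i) + 1 by rewrite ltr_wpDl ?nm_ge0.
  have d0 : 0 < d by rewrite !divr_gt0.
  have ra (x : R) : exists q : rat, `|x - ratr q| < d.
    have [|q] := @rat_in_itvoo R (x - d) (x + d); first lra.
    rewrite in_itv/= => /andP[q1 q2]; exists q.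
    by rewrite ltr_norml; apply/andP; split; lra.
  have [a ha] := ra (complex.Re c); have [b hb] := ra (complex.Im c).
  exists ((a, b, i) :: s'); rewrite !big_cons/= opprD addrACA -scalerBl.
  rewrite (le_lt_trans (nmD _ _))// nmZ.
  have h1 : nm (c - q2C (a, b)) <= 2 * d.
    by rewrite (le_trans (nm_le_ReIm _))// ReB ImB/=; lra.
  have h2 : nm (c - q2C (a, b)) * nm (v i) <= e / 2.
    have := ler_wpM2r (nm_ge0 (v i)) h1; move=> /le_trans; apply.
    have -> : 2 * d * nm (v i) = e / 2 * (nm (v i) / (nm (v i) + 1)).
      by rewrite /d; field; rewrite gt_eqF.
    by rewrite ler_piMr ?(ltW e2)// ler_pdivrMr// mul1r lerDl.
  exact: half_leltD h2 hs'.
move=> O [x Ox]; rewrite openE => /(_ x Ox) /nbhs_ballP[e /= e0 he].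
have eE : e = (complex.Re e)%:C by apply/ge0_Re/ltW.
have r0 : 0 < complex.Re e / 2 by rewrite divr_gt0// -ltcR -eE.
have [s hs] := comb_dense tv x r0; have [s' hs'] := approx s _ r0.
exists (cb s'); split; last by exists s'.
apply: he; rewrite -ball_normE /= nmE eE ltcR.
exact: le_lt_trans (nm_triB _ (comb v s) _) (half_ltD hs hs').
Qed.

End total_families.

(** Supplies the function whose square is M^2 - |f|^2; writing this difference as g^* g turns
    positivity into norm bounds. *)
Lemma continuous_sqrt_diff (R : realType) (T : topologicalType) (M : R) (u : T -> R) :
  continuous u -> continuous (fun x => Num.sqrt (M ^+ 2 - u x ^+ 2)).
Proof.
move=> cu x; apply: (@continuous_comp _ _ _ (fun x => M ^+ 2 - u x ^+ 2) Num.sqrt).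
  apply: (@cvgB R R^o); first exact: cvg_cst.
  by apply: (@cvgM R); exact: cu.
exact: sqrt_continuous.
Qed.

(** * Continuous functions on a compact set and representations *)

Section set_type_topology.
Context (R : realType) (X : set R[i]).

Lemma nbhs_CP (z : R[i]) (U : set R[i]) :
  nbhs z U <-> exists2 d : R, 0 < d & forall w, nm (w - z) < d -> U w.
Proof.
rewrite -[nbhs z U]/(@nbhs R[i]^o R[i]^o z U); split.
  move=> /nbhs_ballP[e /= e0 he].
  have eE : e = (complex.Re e)%:C by apply/ge0_Re/ltW.
  exists (complex.Re e); first by rewrite -ltcR -eE.
  by move=> y hy; apply: he; rewrite -ball_normE /= nmE eE ltcR nmB.
move=> [d d0 h]; apply/nbhs_ballP; exists d%:C => /=; first by rewrite ltcR.
by move=> w; rewrite -ball_normE /= nmE ltcR nmB => /h.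
Qed.

Lemma nbhs_setP (x : X) (U : set X) :
  nbhs x U <-> exists2 d : R, 0 < d & forall y : X, nm (val y - val x) < d -> U y.
Proof.
split.
  rewrite nbhsE => -[V [[W oW <-] Wx] VU].
  have /nbhs_CP[d d0 hd] : nbhs (val x) W by rewrite nbhsE; exists W.
  by exists d => // y hy; apply: VU => /=; apply: hd.
move=> [d d0 h].
have : nbhs (val x) [set z : R[i] | nm (z - val x) < d] by apply/nbhs_CP; exists d.
rewrite nbhsE => -[W [oW Wx] WB].
by rewrite nbhsE; exists (val @^-1` W); [split => //; exists W|move=> y /WB/h].
Qed.

Lemma ctsXP (V : normedModType R[i]) (f : X -> V) :
  continuous f <-> forall (x : X) (e : R), 0 < e ->
    exists2 d : R, 0 < d & forall y : X, nm (val y - val x) < d -> nm (f y - f x) < e.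
Proof.
split=> h x.
  move=> e e0; apply/nbhs_setP.
  by have [+ _] := @cvgP_nm R V X (nbhs x) (nbhs_filter x) f (f x); move=> /(_ (h x)); exact.
have [_] := @cvgP_nm R V X (nbhs x) (nbhs_filter x) f (f x); apply.
by move=> e e0; apply/nbhs_setP; exact: h.
Qed.

Lemma ctsXRP (f : X -> R) :
  continuous f <-> forall (x : X) (e : R), 0 < e ->
    exists2 d : R, 0 < d & forall y : X, nm (val y - val x) < d -> `|f y - f x| < e.
Proof.
split=> h x.
  move=> e e0; apply/nbhs_setP.
  have [+ _] := @cvgrPdist_lt R R^o X (nbhs x) (nbhs_filter x) f (f x).
  move=> /(_ (h x) e e0) hx.
  by apply: (@filterS X (nbhs x) (nbhs_filter x)) hx => y; rewrite distrC.
have [_] := @cvgrPdist_lt R R^o X (nbhs x) (nbhs_filter x) f (f x); apply.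
move=> e e0; apply/nbhs_setP; have [d d0 hd] := h x e e0.
by exists d => // y /hd; rewrite distrC.
Qed.

Lemma ctsRe (f : X -> R[i]) : continuous f -> continuous (fun x => complex.Re (f x)).
Proof.
move=> /(@ctsXP R[i]^o) h; apply/ctsXRP => x e e0; have [d d0 hd] := h x e e0.
by exists d => // y /hd; apply: le_lt_trans; rewrite -ReB normRe_le_nm.
Qed.

Lemma ctsIm (f : X -> R[i]) : continuous f -> continuous (fun x => complex.Im (f x)).
Proof.
move=> /(@ctsXP R[i]^o) h; apply/ctsXRP => x e e0; have [d d0 hd] := h x e e0.
by exists d => // y /hd; apply: le_lt_trans; rewrite -ImB normIm_le_nm.
Qed.

Lemma nm_dist (V : normedZmodType R[i]) (x y : V) : `|nm x - nm y| <= nm (x - y).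
Proof.
rewrite ler_norml; have := nm_Bdist x y; have := nm_Bdist y x; rewrite [nm (y - x)]nmB.
by move=> h1 h2; apply/andP; split; lra.
Qed.

Lemma cts_nm (V : normedModType R[i]) (f : X -> V) :
  continuous f -> continuous (fun x => nm (f x)).
Proof.
move=> /ctsXP h; apply/ctsXRP => x e e0; have [d d0 hd] := h x e e0.
by exists d => // y /hd; apply: le_lt_trans; exact: nm_dist.
Qed.

Lemma ctsC (u : X -> R) : continuous u -> continuous (fun x => (u x)%:C : R[i]).
Proof.
move=> /ctsXRP h; apply/(@ctsXP R[i]^o) => x e e0; have [d d0 hd] := h x e e0.
by exists d => // y /hd; rewrite -rmorphB/= nmC.
Qed.

Lemma cts_val : continuous (val : X -> R[i]).
Proof. exact: (@initial_continuous X R[i] val). Qed.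

(* [toC f] is meaningless when [f] is not continuous. *)
Definition toC (f : X -> R[i]) : continuousType X R[i] :=
  xget 0 [set g : continuousType X R[i] | forall x, g x = f x].

Lemma toCE (f : X -> R[i]) : continuous f -> forall x, toC f x = f x.
Proof.
move=> cf; rewrite /toC; case: xgetP => [g _ //|/(_ (mkcts cf))/= h].
by case: h.
Qed.

Definition cf_id : continuousType X R[i] := toC val.
Lemma cf_idE x : cf_id x = val x. Proof. by rewrite toCE//; exact: cts_val. Qed.

Implicit Types f g : continuousType X R[i].
Lemma cfD f g x : (f + g) x = f x + g x. Proof. by []. Qed.
Lemma cfM f g x : (f * g) x = f x * g x. Proof. by []. Qed.
Lemma cfN f x : (- f) x = - f x. Proof. by []. Qed.
Lemma cfB f g x : (f - g) x = f x - g x. Proof. by []. Qed.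
Lemma cfZ a f x : (a *: f) x = a * f x. Proof. by []. Qed.
Lemma cf1 x : (1 : continuousType X R[i]) x = 1. Proof. by []. Qed.
Lemma cf0 x : (0 : continuousType X R[i]) x = 0. Proof. by []. Qed.
Lemma cfJ f x : cf_conj f x = (f x)^*. Proof. by []. Qed.
Lemma cf_sum (I : Type) (r : seq I) (P : pred I) (F : I -> continuousType X R[i]) x :
  (\sum_(i <- r | P i) F i) x = \sum_(i <- r | P i) F i x.
Proof. exact: (big_morph (fun f : continuousType X R[i] => f x) (fun f g => cfD f g x) (cf0 x)). Qed.
Definition cfE := (cfB, cfD, cfM, cfN, cfZ, cf1, cf0, cfJ, cf_idE).
Lemma cfP f g : (forall x, f x = g x) -> f = g.
Proof. by move=> h; apply/continuousEP. Qed.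
Lemma cf_conj1 : cf_conj (1 : continuousType X R[i]) = 1.
Proof. by apply: cfP => x; rewrite !cfE rmorph1. Qed.
Lemma cf_continuous f : continuous f. Proof. by move=> x; exact: cts_fun. Qed.

Context (hX : compact X).

Lemma compact_set_type : compact [set: X].
Proof.
move=> F FF _; pose G := val @ F.
have GX : G X.
  apply: (@filterS _ F _ setT); last exact: filterT.
  by move=> x _ /=; exact: set_valP.
have [p [Xp hp]] := hX (_ : ProperFilter G) GX.
have [x xE] : exists x : X, val x = p by exists (exist _ p (mem_set Xp)).
exists x; split => // A B FA /nbhs_setP[d d0 hd].
have GA : G (val @` A) by apply: (@filterS _ F) FA => a Aa; exists a.
have nB : nbhs p [set z : R[i] | nm (z - p) < d] by apply/nbhs_CP; exists d.
have [q [[a Aa <-] hq]] := hp _ _ GA nB.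
by exists a; split => //; apply: hd; rewrite xE.
Qed.

Lemma near_coveringX : near_covering [set: X].
Proof. exact/compact_near_coveringP/compact_set_type. Qed.

Lemma cf_bounded (f : X -> R[i]) : continuous f ->
  exists2 M : R, 0 < M & forall x, nm (f x) <= M.
Proof.
move=> /(@ctsXP R[i]^o) cf.
have := @near_coveringX R +oo (fun M x => nm (f x) <= M) _.
have h x : [set: X] x -> \forall x' \near x & M \near +oo, nm (f x') <= M.
  move=> _; have [d d0 hd] := cf x 1 ltr01.
  exists ([set x' : X | nm (val x' - val x) < d], [set M | nm (f x) + 1 <= M]) => /=.
    split; last exact: (nbhs_pinfty_ge (num_real _)).
    by apply/nbhs_setP; exists d.
  move=> [x' M] /= [/hd h1 h2]; apply: le_trans h2.
  have := nm_Bdist (f x') (f x); move: h1.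
  have -> : @nm R R[i]^o (f x' - f x) = nm (f x' - f x) by [].
  by move=> ? ?; lra.
move=> /(_ _ h) hM.
near (pinfty_nbhs R) => M.
exists M; first by near: M; exact: (nbhs_pinfty_gt (num_real _)).
move=> x; have : [set: X] `<=` (fun x => nm (f x) <= M) by near: M.
by move=> /(_ x I).
Unshelve. all: by end_near. Qed.

Lemma cf_unif_continuous (f : X -> R[i]) : continuous f ->
  forall e : R, 0 < e -> exists2 d : R, 0 < d &
    forall x y : X, nm (val x - val y) < d -> nm (f x - f y) < e.
Proof.
move=> /(@ctsXP R[i]^o) cf e e0.
have := @near_coveringX R (0 : R)^'+ (fun d x => forall y : X, nm (val x - val y) < d -> nm (f x - f y) < e) _.
have h x : [set: X] x -> \forall x' \near x & d \near 0^'+,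
    forall y : X, nm (val x' - val y) < d -> nm (f x' - f y) < e.
  move=> _; have e2 : 0 < e / 2 by rewrite divr_gt0.
  have [d d0 hd] := cf x _ e2; have d2 : 0 < d / 2 by rewrite divr_gt0.
  exists ([set x' : X | nm (val x' - val x) < d / 2], [set t | t < d / 2]) => /=.
    split; last exact: nbhs_right_lt.
    by apply/nbhs_setP; exists (d / 2).
  move=> [x' t] /= [h1 h2] y h3.
  have h4 : nm (f x' - f x) < e / 2 by apply: hd; lra.
  have h5 : nm (f y - f x) < e / 2.
    apply: hd; rewrite (le_lt_trans (nm_triB _ (val x') _))//.
    by apply: half_ltD h1; rewrite nmB (lt_trans h3).
  by rewrite (le_lt_trans (nm_triB _ (f x) _))// half_ltD// nmB.
move=> /(_ _ h) hM.
near (0 : R)^'+ => d.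
exists d; first by near: d; exact: nbhs_right_gt.
move=> x; have : [set: X] `<=` (fun x => forall y : X, nm (val x - val y) < d -> nm (f x - f y) < e) by near: d.
by move=> /(_ x I).
Unshelve. all: by end_near. Qed.

End set_type_topology.

(** * Representations and completely positive maps of C(X) *)

Section representations.
Context (R : realType) (X : set R[i]) (H : hilbertType R).
Implicit Types (f g : continuousType X R[i]) (x y h : H).

Definition rep (pi : continuousType X R[i] -> 'B(H)) : Prop :=
  [/\ linear pi, monoid_morphism pi & forall f, pi (cf_conj f) = adjoint (pi f)].

(** Complete positivity in kernel form: finite lists of pairs (f, h) replace matrices over C(X),
    which is the shape needed for Kolmogorov decompositions. *)
Definition cp_map (phi : continuousType X R[i] -> 'B(H)) : Prop :=
  [/\ linear phi, phi 1 = 1 &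
    forall s : seq (continuousType X R[i] * H),
      0 <= \sum_(p <- s) \sum_(q <- s) dotp (phi (cf_conj q.1 * p.1) p.2) q.2].

Section linear_maps.
Context (phi : continuousType X R[i] -> 'B(H)) (lp : linear phi).
Lemma lmD f g : phi (f + g) = phi f + phi g.
Proof. by have := lp 1 f g; rewrite !scale1r. Qed.
Lemma lm0 : phi 0 = 0.
Proof. by apply: (addIr (phi 0)); rewrite -lmD !add0r. Qed.
Lemma lmZ a f : phi (a *: f) = a *: phi f.
Proof. by rewrite -[a *: f in LHS]addr0 lp lm0 addr0. Qed.
Lemma lmN f : phi (- f) = - phi f.
Proof. by rewrite -scaleN1r lmZ scaleN1r. Qed.
Lemma lmB f g : phi (f - g) = phi f - phi g.
Proof. by rewrite lmD lmN. Qed.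
End linear_maps.

Lemma rep_cp pi : rep pi -> cp_map pi.
Proof.
move=> [l [m1 mM] ad]; split => // s.
have -> : \sum_(p <- s) \sum_(q <- s) dotp (pi (cf_conj q.1 * p.1) p.2) q.2 =
    dotp (\sum_(p <- s) pi p.1 p.2) (\sum_(p <- s) pi p.1 p.2).
  rewrite ip_suml; apply: eq_bigr => p _; rewrite ip_sumr; apply: eq_bigr => q _.
  by rewrite mM ad opME -adjointPr.
by rewrite ipxx ler0c sqr_ge0.
Qed.

Section cp_facts.
Context (phi : continuousType X R[i] -> 'B(H)) (cp : cp_map phi).

(** Positivity at the two pairs (f, h) and (1, - phi(f) h), where three of the four terms equal
    |phi(f) h|^2 up to sign. *)
Lemma cp_schwarz f h : nm (phi f h) ^+ 2 <= complex.Re (dotp (phi (cf_conj f * f) h) h).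
Proof.
have [l p1 pp] := cp.
have := pp [:: (f, h); (1, - phi f h)].
rewrite !big_cons !big_nil !addr0 /= cf_conj1 !mul1r mulr1 p1 op1E.
have -> : dotp (phi (cf_conj f) (- phi f h)) h = - (nm (phi f h) ^+ 2)%:C.
  have herm : dotp (phi (cf_conj f) (phi f h)) h = (nm (phi f h) ^+ 2)%:C.
    (* The positive expression at (f, h), (1, a phi(f) h) is real for every scalar a; a = 1 and a =
       'i determine both parts of the mixed term. *)
    have e (a : R[i]) : complex.Im (a^* * dotp (phi f h) (phi f h) + a * dotp (phi (cf_conj f) (phi f h)) h) = 0.
      have := ger0_Im (pp [:: (f, h); (1, a *: phi f h)]).
      rewrite !big_cons !big_nil !addr0 /= cf_conj1 !mul1r mulr1 p1 op1E opZ ipZr ipZl.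
      have i0 : complex.Im (dotp (phi (cf_conj f * f) h) h) = 0.
        by have := ger0_Im (pp [:: (f, h)]); rewrite !big_seq1.
      rewrite ipZl ipZr mulrA mul_conj_nm ipxx !ImD ImCM !i0/= mulr0 add0r addr0.
      by [].

    apply: ReIm_inj; last first.
      by have := e 1; rewrite rmorph1 !mul1r ImD ipxx/= add0r.
    have := e 'i; rewrite ImD ImiM.
    have -> : ('i : R[i])^* = - 'i by exact: conji.
    by rewrite mulNr ImN ImiM ipxx/= => /eqP; rewrite addr_eq0 => /eqP/oppr_inj.
  by rewrite opN ipNl herm.
rewrite !ipNr !ipNl opprK ipxx => /ge0_ReE; rewrite !ReD !ReN/=.
by move: (complex.Re _) (nm _ ^+ 2) => a b; lra.
Qed.

(** With M^2 - f^* f = g^* g, positivity at g gives <phi(f^* f) h, h> <= M^2 |h|^2, and the Schwarz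
    inequality concludes. *)
Lemma cp_bound f (M : R) : 0 <= M -> (forall x : X, nm (f x) <= M) ->
  forall h, nm (phi f h) <= M * nm h.
Proof.
move=> M0 hM h; have [l p1 pp] := cp.
pose u (x : X) := Num.sqrt (M ^+ 2 - nm (f x) ^+ 2).
have cu : continuous u.
  have cn : continuous (fun x : X => nm (f x)) := @cts_nm R X R[i]^o f (@cf_continuous _ _ f).
  exact: continuous_sqrt_diff cn.
pose g := toC (fun z : X => (u z)%:C).
have gE : cf_conj g * g = ((M ^+ 2)%:C *: (1 : continuousType X R[i])) - cf_conj f * f.
  apply: cfP => x; rewrite !cfE toCE; last exact: ctsC.
  rewrite conjCr -rmorphM/= -expr2 sqr_sqrtr ?subr_ge0 ?ler_pXn2r ?nnegrE ?nm_ge0//.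
  by rewrite mulr1 rmorphB/= [_^* * _]mulrC mul_conj_nm.
have := pp [:: (g, h)]; rewrite !big_seq1/= gE (lmB l) (lmZ l) p1.
rewrite opBE opZE op1E ipBl ipZl ipxx => /ge0_ReE.
rewrite ReB ReCM/= subr_ge0 => hh.
rewrite -(@ler_pXn2r _ 2)// ?nnegrE ?nm_ge0 ?mulr_ge0 ?nm_ge0//.
by rewrite exprMn (le_trans (cp_schwarz _ _)).
Qed.

End cp_facts.

End representations.

(** * Density of polynomials *)

Section bernstein.
Context (A : pzRingType).
Implicit Types (t : A) (n i : nat).

(** Defined over an arbitrary ring so that one set of identities serves real numbers, functions and
    self-adjoint operators. *)
Definition bern n i t : A := (t ^+ i * (1 - t) ^+ (n - i)) *+ 'C(n, i).

Lemma comm_1B t : GRing.comm t (1 - t).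
Proof. by rewrite /GRing.comm mulrBr mulrBl mulr1 mul1r. Qed.

Lemma bern_sum n t : \sum_(i < n.+1) bern n i t = 1.
Proof.
have := exprDn_comm n (GRing.commr_sym (comm_1B t)).
rewrite subrK expr1n => ->; apply: eq_bigr => i _; rewrite /bern; congr (_ *+ _).
by apply: commrX; apply/commr_sym/commrX/commr_sym/comm_1B.
Qed.

(** Absorption i C(n + 1, i) = (n + 1) C(n, i - 1). The free weight F gives the first and second
    factorial moments from the same statement. *)
Lemma bern_moment n t (F : nat -> nat) :
  \sum_(i < n.+2) bern n.+1 i t *+ (i * F i) =
  t * (\sum_(j < n.+1) bern n j t *+ F j.+1) *+ n.+1.
Proof.
rewrite big_ord_recl mul0n mulr0n add0r mulr_sumr -sumrMnl; apply: eq_bigr => j _.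
rewrite lift0 /bern subSS exprS -mulrA -!mulrnAr -!mulrnA !mulrnAr; congr (_ *+ _).
by rewrite mulnA [X in (X * _)%N]mulnC -mul_bin_diag [RHS]mulnA [RHS]mulnC mulnA.
Qed.

Lemma bern_mean n t : \sum_(i < n.+1) bern n i t *+ i = t *+ n.
Proof.
case: n => [|n]; first by rewrite big_ord1 !mulr0n.
have := bern_moment n t (fun=> 1%N); rewrite bern_sum mulr1 => <-.
by apply: eq_bigr => i _; rewrite muln1.
Qed.

Lemma bern_second n t : \sum_(i < n.+1) bern n i t *+ (i * i.-1) = t ^+ 2 *+ (n * n.-1).
Proof.
case: n => [|n]; first by rewrite big_ord1 !mulr0n.
by rewrite bern_moment bern_mean mulrnAr -mulrnA mulnC.
Qed.

Lemma bern_comm n i t s : GRing.comm s t -> GRing.comm s (bern n i t).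
Proof.
move=> st; apply: commrMn; apply: commrM; apply: commrX => //.
by apply: commrB => //; exact: commr1.
Qed.

Lemma bern_sqr n t : \sum_(i < n.+1) bern n i t *+ (i * i) = t ^+ 2 *+ (n * n.-1) + t *+ n.
Proof.
rewrite -bern_second -bern_mean -big_split/=; apply: eq_bigr => i _.
by rewrite -mulrnDr; congr (_ *+ _); case: (nat_of_ord i) => //= k; rewrite mulnS addnC.
Qed.

(** The factor i - n t stands on both sides of the Bernstein term so that, for operators, each
    summand is the conjugate of a positive operator. Scaling by n avoids division in the ring. *)
Lemma bern_variance n t :
  \sum_(i < n.+1) (i%:R - t *+ n) * bern n i t * (i%:R - t *+ n) = (t * (1 - t)) *+ n.
Proof.
transitivity (\sum_(i < n.+1) (bern n i t *+ (i * i)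
    - (t *+ n) * (bern n i t *+ i) *+ 2 + (t *+ n) * (t *+ n) * bern n i t)).
  apply: eq_bigr => i _.
  have Tb : bern n i t * (t *+ n) = (t *+ n) * bern n i t.
    exact/commr_sym/bern_comm/commr_sym/commrMn/commr_refl.
  move: (bern n i t) (t *+ n) Tb => b T Tb.
  rewrite mulrBr !mulrBl !mulr_natl !mulr_natr.
  rewrite mulrnAl -[T * b * T]mulrA Tb mulrA mulrnAr -mulrnA mulr2n opprB opprD.
  by rewrite -!addrA; congr (_ + _); congr (_ + _); rewrite addrC.
rewrite big_split sumrB/= bern_sqr sumrMnl -mulr_sumr bern_mean -mulr_sumr bern_sum mulr1.
rewrite mulrnAl mulrnAr -!mulrnA -expr2 mulrBr mulr1 -expr2 mulrnBl.
rewrite mulnA mulrnA mulr2n opprD.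
case: n => [|n]; first by rewrite !mulr0n !subr0 !addr0.
have -> : (n.+1 * n.+1 = n.+1 * n.+1.-1 + n.+1)%N by rewrite /= mulnSr.
rewrite mulrnDr; move: (t ^+ 2 *+ _) (t ^+ 2 *+ _) (t *+ _) => a b c.
by rewrite [_ + (- _ - _)]addrA subrK opprD addrACA subrr add0r.
Qed.

End bernstein.

Section bernstein_real.
Context (R : realFieldType).

Lemma bern_ge0 n i (t : R) : 0 <= t -> t <= 1 -> 0 <= bern n i t.
Proof.
by move=> t0 t1; rewrite mulrn_wge0// mulr_ge0// exprn_ge0// subr_ge0.
Qed.

Lemma bern_variance_real n (t : R) :
  \sum_(i < n.+2) (i%:R / n.+1%:R - t) ^+ 2 * bern n.+1 i t = t * (1 - t) / n.+1%:R.
Proof.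
have n0 : n.+1%:R != 0 :> R by rewrite pnatr_eq0.
apply: (mulfI (mulf_neq0 n0 n0)).
have -> : n.+1%:R * n.+1%:R * (t * (1 - t) / n.+1%:R) = (t * (1 - t)) *+ n.+1 :> R.
  by rewrite -mulr_natl; field.
rewrite -bern_variance mulr_sumr; apply: eq_bigr => i _.
by rewrite -mulr_natl; field.
Qed.

Lemma bern_variance_le n (t : R) : 0 <= t -> t <= 1 ->
  \sum_(i < n.+2) (i%:R / n.+1%:R - t) ^+ 2 * bern n.+1 i t <= n.+1%:R^-1.
Proof.
move=> t0 t1; rewrite bern_variance_real ler_piMl// ?invr_ge0//.
nra.
Qed.

End bernstein_real.

Lemma rmorph_bern (A B : pzRingType) (f : {rmorphism A -> B}) n i t :
  f (bern n i t) = bern n i (f t).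
Proof. by rewrite /bern rmorphMn/= rmorphM/= !rmorphXn/= rmorphB rmorph1. Qed.

Section density.
Context (R : realType) (X : set R[i]) (hX : compact X).
Notation CX := (continuousType X R[i]).
Implicit Types (f g p : CX).

Lemma cfX p n x : (p ^+ n) x = p x ^+ n.
Proof. by elim: n => [//|n IH]; rewrite !exprS cfM IH. Qed.
Lemma cfMn p n x : (p *+ n) x = p x *+ n.
Proof. by elim: n => [|n IH]; rewrite ?mulr0n// !mulrS cfD IH. Qed.
Lemma cf_bern n i p x : (bern n i p) x = bern n i (p x).
Proof. by rewrite /bern cfMn cfM !cfX cfB cf1. Qed.

Implicit Types x : X.

(* Affine coordinates mapping the square [|Re z|, |Im z| <= c] to the unit square. *)
Definition ucoord (c : R) : CX :=
  ((4 * c)^-1)%:C *: (cf_id X + cf_conj (cf_id X)) + (2^-1)%:C *: (1 : CX).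
Definition vcoord (c : R) : CX :=
  (- ((4 * c)^-1)%:C * 'i) *: (cf_id X - cf_conj (cf_id X)) + (2^-1)%:C *: (1 : CX).

Lemma ucoordE c x : 0 < c -> ucoord c x = (complex.Re (val x) / (2 * c) + 2^-1)%:C.
Proof.
move=> c0; rewrite /ucoord !cfE mulr1 addcJ.
rewrite -[2%:R]/(2 : R[i]) -(rmorph_nat (real_complex R)) -!rmorphM -rmorphD/=.
by congr ((_ + _)%:C); field; rewrite gt_eqF.
Qed.

Lemma vcoordE c x : 0 < c -> vcoord c x = (complex.Im (val x) / (2 * c) + 2^-1)%:C.
Proof.
move=> c0; rewrite /vcoord !cfE mulr1 subcJ.
rewrite -[2%:R]/(2 : R[i]) -(rmorph_nat (real_complex R)).
have -> : - ((4 * c)^-1)%:C * 'i * (2%:R%:C * (complex.Im (val x))%:C * 'i) =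
  ((4 * c)^-1)%:C * (2%:R%:C * (complex.Im (val x))%:C) :> R[i].
  have : ('i : R[i]) * 'i = -1 by rewrite -expr2 sqr_i.
  by move: ('i : R[i]) => i hi; ring: hi.
rewrite -!rmorphM -rmorphD/=.
by congr ((_ + _)%:C); field; rewrite gt_eqF.
Qed.

(** An induction principle on continuous functions. Closure under multiplication by the two
    coordinates, rather than under products, lets it apply to properties such as convergence of a
    sequence of operators at f. The proof is bivariate Bernstein approximation. *)
Theorem polynomial_density (A : set CX) : A 1 ->
  (forall a f g, A f -> A g -> A (a *: f + g)) ->
  (forall f, A f -> A (cf_id X * f)) ->
  (forall f, A f -> A (cf_conj (cf_id X) * f)) ->
  (forall f, (forall e : R, 0 < e -> exists2 g, A g & forall x, nm (f x - g x) <= e) -> A f) ->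
  forall f, A f.
Proof.
move=> A1 Al Az Azc Acl f.
have [[x0 _]|X0] := pselect (exists x : X, True); last first.
  by apply: Acl => e e0; exists 1 => // x; case: X0; exists x.
have A0 : A 0 by have := Al (-1) 1 1 A1 A1; rewrite scaleN1r addNr.
have AZ a g : A g -> A (a *: g) by move=> Ag; rewrite -[_ *: _]addr0; exact: Al.
have AD g h : A g -> A h -> A (g + h) by move=> Ag Ah; rewrite -[g]scale1r; exact: Al.
have [c c0 hc] := cf_bounded hX (@cts_val R X).
(* Multipliers of A form an algebra even if A does not; Bernstein polynomials in the coordinates are
   therefore multipliers. *)
pose mult p := forall g, A g -> A (p * g).
have mult1 a : mult (a *: (1 : CX)).
  by move=> g Ag; rewrite (_ : _ * g = a *: g); [exact: AZ|apply: cfP => x; rewrite !cfE mulr1].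
have multD p q : mult p -> mult q -> mult (p + q).
  by move=> hp hq g Ag; rewrite mulrDl; apply: (AD _ _); [exact: hp|exact: hq].
have multM p q : mult p -> mult q -> mult (p * q).
  by move=> hp hq g Ag; rewrite -mulrA; apply/hp/hq.
have multZ a p : mult p -> mult (a *: p).
  move=> hp; rewrite (_ : a *: p = (a *: (1 : CX)) * p); first exact: multM (mult1 a) hp.
  by apply: cfP => x; rewrite !cfE mulr1.
have multu : mult (ucoord c).
  by apply: (multD _ _) => //; apply: (multZ _ _); apply: (multD _ _).
have multv : mult (vcoord c).
  apply: (multD _ _) => //; apply: (multZ _ _); apply: (multD _ _) => //.
  by rewrite -scaleN1r; apply: (multZ _ _).
have mult11 : mult 1 by rewrite -[1 : CX]scale1r.
have multX p n : mult p -> mult (p ^+ n).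
  by move=> hp; elim: n => [|n IH]; rewrite ?expr0// exprS; exact: multM.
have multB n i p : mult p -> mult (bern n i p).
  move=> hp; rewrite /bern -scaler_nat; apply/multZ/multM; apply: (multX _ _) => //.
  by apply: (multD _ _) => //; rewrite -scaleN1r; exact: multZ.
have [M M0 hM] := cf_bounded hX (@cf_continuous R X f).
apply: Acl => e e0; have e2 : 0 < e / 2 by rewrite divr_gt0.
have [d d0 hd] := cf_unif_continuous hX (@cf_continuous R X f) e2.
(* Two points within eta of the same grid coordinate differ by less than 2 eta, that is by less than
   d / 2 after undoing the scaling by 2 c; the two coordinates together stay below d. *)
pose eta := d / (8 * c).
have eta0 : 0 < eta by rewrite divr_gt0// mulr_gt0.
pose u (x : X) := complex.Re (val x) / (2 * c) + 2^-1.
pose v (x : X) := complex.Im (val x) / (2 * c) + 2^-1.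
have c2 : 0 < 2 * c by rewrite mulr_gt0.
have bnd (r : R) : `|r| <= c -> 0 <= r / (2 * c) + 2^-1 /\ r / (2 * c) + 2^-1 <= 1.
  rewrite ler_norml => /andP[r1 r2].
  have h1 : r / (2 * c) <= 2^-1 by rewrite ler_pdivrMr//; lra.
  have h2 : - 2^-1 <= r / (2 * c) by rewrite ler_pdivlMr//; lra.
  split; lra.
have u01 x : 0 <= u x /\ u x <= 1 by apply: (bnd _ (le_trans (normRe_le_nm _) (hc x))).
have v01 x : 0 <= v x /\ v x <= 1 by apply: (bnd _ (le_trans (normIm_le_nm _) (hc x))).
(* A grid point may be far from X, so f is sampled at a point of X near it when there is one. The
   default [x0] is harmless: there the quadratic term of [near_grid] already dominates. *)
pose yy (a b : R) : X := xget x0 [set x : X | `|u x - a| < eta /\ `|v x - b| < eta].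
(* Chebyshev constant: K t^2 >= 2 M, the maximal oscillation of f, as soon as |t| >= eta. *)
pose K := 2 * M / eta ^+ 2.
have K0 : 0 < K by apply: divr_gt0; [exact: mulr_gt0|exact: exprn_gt0].
have near_grid (a b : R) x :
    nm (f (yy a b) - f x) <= e / 2 + K * ((a - u x) ^+ 2 + (b - v x) ^+ 2).
  have far (t : R) : eta <= `|t| -> 2 * M <= K * t ^+ 2.
    move=> ht; have h : eta ^+ 2 <= t ^+ 2.
      rewrite -[t ^+ 2]real_normK ?num_real// ler_pXn2r ?nnegrE//.
      exact: ltW.
    rewrite /K mulrAC ler_pdivlMr ?exprn_gt0// ler_wpM2l//.
    by rewrite mulr_ge0// ltW.
  have f2 : nm (f (yy a b) - f x) <= 2 * M.
    by rewrite (le_trans (nmD _ _))// nmN mulr2n mulrDl mul1r lerD.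
  have sq (t : R) : 0 <= K * t ^+ 2 by rewrite mulr_ge0 ?sqr_ge0 ?ltW.
  rewrite mulrDr.
  have [h1|/far h1] := ltP `|a - u x| eta; last first.
    by have := sq (b - v x); move: h1 f2; lra.
  have [h2|/far h2] := ltP `|b - v x| eta; last first.
    by have := sq (a - u x); move: h2 f2; lra.
  rewrite -[leLHS]addr0 lerD ?addr_ge0//.
  have [g1 g2] : `|u (yy a b) - a| < eta /\ `|v (yy a b) - b| < eta.
    rewrite /yy; case: xgetP => [y _ []//|/(_ x) nx].
    by case: nx; split; rewrite distrC.
  apply/ltW/hd; rewrite (le_lt_trans (nm_le_ReIm _))// ReB ImB.
  have scale (r s t : R) : `|r / (2 * c) + 2^-1 - t| < eta -> `|t - (s / (2 * c) + 2^-1)| < eta ->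
      `|r - s| < d / 2.
    move=> k1 k2; have k3 : `|(r - s) / (2 * c)| < 2 * eta.
      have -> : (r - s) / (2 * c) = (r / (2 * c) + 2^-1 - t) + (t - (s / (2 * c) + 2^-1)) by ring.
      have -> : 2 * eta = eta + eta by ring.
      exact: le_lt_trans (ler_normD _ _) (ltrD k1 k2).
    rewrite normrM [X in _ * X]gtr0_norm ?invr_gt0// ltr_pdivrMr// in k3.
    by move: k3; congr (_ < _); rewrite /eta; field; rewrite gt_eqF.
  by apply: half_ltD; [exact: scale g1 h1|exact: scale g2 h2].
(* Each coordinate has variance at most 1 / (n + 1), so this choice makes 2 K / (n + 1) at most e /
   2. *)
pose n := Num.truncn (4 * K / e).
have hn : 4 * K / e < n.+1%:R by exact: real_truncnS_gt (num_real _).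
pose g := \sum_(i < n.+2) \sum_(j < n.+2)
  f (yy (i%:R / n.+1%:R) (j%:R / n.+1%:R)) *: (bern n.+1 i (ucoord c) * bern n.+1 j (vcoord c)).
exists g.
  rewrite /g; elim/big_ind: _ => // i _; elim/big_ind: _ => // j _.
  by apply: (AZ _ _); rewrite -[X in A X]mulr1; apply: (multM _ _); [exact: multB|exact: multB|].
move=> x; rewrite nmB.
pose B i j := bern n.+1 i (u x) * bern n.+1 j (v x).
have B0 i j : 0 <= B i j.
  by have [? ?] := u01 x; have [? ?] := v01 x; rewrite mulr_ge0 ?bern_ge0.
have B1 : \sum_(i < n.+2) \sum_(j < n.+2) B i j = 1.
  by under eq_bigr do rewrite -mulr_sumr bern_sum mulr1; rewrite bern_sum.
have gE : g x = \sum_(i < n.+2) \sum_(j < n.+2)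
    f (yy (i%:R / n.+1%:R) (j%:R / n.+1%:R)) * (B i j)%:C.
  rewrite /g cf_sum; apply: eq_bigr => i _; rewrite cf_sum; apply: eq_bigr => j _.
  by rewrite cfZ cfM !cf_bern ucoordE// vcoordE// /B rmorphM !rmorph_bern.
have fE : f x = \sum_(i < n.+2) \sum_(j < n.+2) f x * (B i j)%:C.
  under eq_bigr do rewrite -mulr_sumr -rmorph_sum.
  by rewrite -mulr_sumr -rmorph_sum/= B1 mulr1.
rewrite gE {1}fE -sumrB.
under eq_bigr do rewrite -sumrB.
pose W i j := (e / 2 + K * ((i%:R / n.+1%:R - u x) ^+ 2 + (j%:R / n.+1%:R - v x) ^+ 2)) * B i j.
apply: (@le_trans _ _ (\sum_(i < n.+2) \sum_(j < n.+2) W i j)).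
  rewrite (le_trans (nm_sum _ _ _))//; apply: ler_sum => i _.
  rewrite (le_trans (nm_sum _ _ _))//; apply: ler_sum => j _.
  by rewrite -mulrBl nmM nmC ger0_norm// /W ler_wpM2r.
have -> : \sum_(i < n.+2) \sum_(j < n.+2) W i j = e / 2 +
  K * (\sum_(i < n.+2) (i%:R / n.+1%:R - u x) ^+ 2 * bern n.+1 i (u x) +
       \sum_(j < n.+2) (j%:R / n.+1%:R - v x) ^+ 2 * bern n.+1 j (v x)).
  have -> : \sum_(i < n.+2) (i%:R / n.+1%:R - u x) ^+ 2 * bern n.+1 i (u x) =
     \sum_(i < n.+2) \sum_(j < n.+2) (i%:R / n.+1%:R - u x) ^+ 2 * B i j.
    by apply: eq_bigr => i _; rewrite -mulr_sumr -mulr_sumr bern_sum mulr1.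
  have -> : \sum_(j < n.+2) (j%:R / n.+1%:R - v x) ^+ 2 * bern n.+1 j (v x) =
     \sum_(i < n.+2) \sum_(j < n.+2) (j%:R / n.+1%:R - v x) ^+ 2 * B i j.
    rewrite exchange_big; apply: eq_bigr => j _ /=.
    by rewrite -mulr_sumr -mulr_suml bern_sum mul1r.
  have eB : e / 2 = e / 2 * \sum_(i < n.+2) \sum_(j < n.+2) B i j by rewrite B1 mulr1.
  rewrite [X in X + K * _]eB -big_split [K * _]mulr_sumr [e / 2 * _]mulr_sumr.
  rewrite -big_split/=; apply: eq_bigr => i _.
  rewrite -big_split [K * _]mulr_sumr [e / 2 * _]mulr_sumr -big_split/=.
  by apply: eq_bigr => j _; rewrite /W; ring.
have [ua ub] := u01 x; have [va vb] := v01 x.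
have h1 := bern_variance_le n ua ub; have h2 := bern_variance_le n va vb.
have h3 : K * (n.+1%:R^-1 + n.+1%:R^-1) <= e / 2.
  have n0 : 0 < n.+1%:R :> R by [].
  rewrite ltr_pdivrMr// in hn.
  have -> : K * (n.+1%:R^-1 + n.+1%:R^-1) = 2 * K / n.+1%:R by field.
  by rewrite ler_pdivrMr//; lra.
apply: (@le_trans _ _ (e / 2 + e / 2)); last lra.
rewrite lerD2l; apply: le_trans h3; apply: ler_wpM2l; first exact: ltW.
exact: lerD.
Qed.

End density.

(** * The Riesz premeasure *)

Section real_continuity.
Context (R : realType) (T : topologicalType).
Implicit Types u v : T -> R.

Lemma ctsR_cst (c : R) : continuous (fun _ : T => c).
Proof. by move=> x; exact: cvg_cst. Qed.
Lemma ctsR_add u v : continuous u -> continuous v -> continuous (fun x => u x + v x).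
Proof. by move=> cu cv x; apply: (@cvgD R R^o); [exact: cu|exact: cv]. Qed.
Lemma ctsR_sub u v : continuous u -> continuous v -> continuous (fun x => u x - v x).
Proof. by move=> cu cv x; apply: (@cvgB R R^o); [exact: cu|exact: cv]. Qed.
Lemma ctsR_mul u v : continuous u -> continuous v -> continuous (fun x => u x * v x).
Proof. by move=> cu cv x; apply: (@cvgM R); [exact: cu|exact: cv]. Qed.
Lemma ctsR_inv u : (forall x, u x != 0) -> continuous u -> continuous (fun x => (u x)^-1).
Proof. by move=> u0 cu x; apply: (@cvgV R); [exact: u0|exact: cu]. Qed.
Lemma ctsR_max u v : continuous u -> continuous v -> continuous (fun x => Num.max (u x) (v x)).
Proof. by move=> cu cv x; apply: continuous_max; [exact: cu|exact: cv]. Qed.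
Lemma ctsR_min u v : continuous u -> continuous v -> continuous (fun x => Num.min (u x) (v x)).
Proof. by move=> cu cv x; apply: continuous_min; [exact: cu|exact: cv]. Qed.
Lemma ctsR_sum (u : nat -> T -> R) n : (forall i, continuous (u i)) ->
  continuous (fun x => \sum_(i < n) u i x).
Proof.
move=> cu; elim: n => [|n IH].
  by under eq_fun do rewrite big_ord0; exact: ctsR_cst.
by under eq_fun do rewrite big_ord_recr/=; exact: ctsR_add.
Qed.
End real_continuity.

Section distance.
Context (R : realType) (U : set R[i]).

(* The distance to the complement of [U], truncated at 1 so that [U = setT] is allowed. *)
Definition cdist (z : R[i]) : R :=
  inf [set r | r = 1 \/ exists2 w, ~ U w & r = nm (z - w)].

Lemma cdist_has_inf z : has_inf [set r : R | r = 1 \/ exists2 w, ~ U w & r = nm (z - w)].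
Proof.
split; first by exists 1; left.
by exists 0 => _ [->|[w _ ->]]; rewrite ?ler01 ?nm_ge0.
Qed.

Lemma cdist_ge0 z : 0 <= cdist z.
Proof.
apply: lb_le_inf; first by exists 1; left.
by move=> _ [->|[w _ ->]]; rewrite ?ler01 ?nm_ge0.
Qed.

Lemma cdist_le1 z : cdist z <= 1.
Proof. by apply: ge_inf; [exact: (cdist_has_inf z).2|left]. Qed.

Lemma cdist_out z : ~ U z -> cdist z = 0.
Proof.
move=> Uz; apply/eqP; rewrite eq_le cdist_ge0 andbT.
apply: ge_inf; first exact: (cdist_has_inf z).2.
by right; exists z => //; rewrite subrr nm0.
Qed.

Lemma cdist_gt0 z : open U -> U z -> 0 < cdist z.
Proof.
move=> oU Uz; have /nbhs_CP[d d0 hd] : nbhs z U by rewrite nbhsE; exists U.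
have m0 : 0 < Num.min 1 d by rewrite lt_min ltr01.
apply: (lt_le_trans m0); apply: lb_le_inf; first by exists 1; left.
move=> _ [->|[w Uw ->]]; first by rewrite ge_min lexx.
rewrite ge_min; apply/orP; right; rewrite leNgt; apply/negP => h.
by apply/Uw/hd; rewrite nmB.
Qed.

Lemma cdist_lip z w : cdist z <= cdist w + nm (z - w).
Proof.
rewrite -lerBlDr; apply: lb_le_inf; first by exists 1; left.
move=> _ [->|[t Ut ->]]; first by rewrite lerBlDr (le_trans (cdist_le1 z))// lerDl nm_ge0.
rewrite lerBlDr (@le_trans _ _ (nm (z - t)))//.
  by apply: ge_inf; [exact: (cdist_has_inf z).2|right; exists t].
by rewrite [leRHS]addrC nm_triB.
Qed.

Lemma cdist_continuous (X : set R[i]) : continuous (fun x : X => cdist (val x)).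
Proof.
apply/ctsXRP => x e e0; exists e => // y hy; apply: le_lt_trans hy.
rewrite ler_norml; have := cdist_lip (val x) (val y); have := cdist_lip (val y) (val x).
by rewrite [nm (val x - _)]nmB => h1 h2; apply/andP; split; lra.
Qed.
End distance.

Section premeasure.
Context (R : realType) (X : set R[i]) (hX : compact X) (L : (X -> R) -> R).

Definition positive_functional : Prop :=
  [/\ forall u v : X -> R, continuous u -> continuous v -> L (fun x => u x + v x) = L u + L v,
      forall (c : R) (u : X -> R), continuous u -> L (fun x => c * u x) = c * L u &
      forall u : X -> R, continuous u -> (forall x, 0 <= u x) -> 0 <= L u].

Context (LP : positive_functional).
Implicit Types (u v : X -> R) (c : R).

Lemma pfD u v : continuous u -> continuous v -> L (fun x => u x + v x) = L u + L v.
Proof. by case: LP => + _ _; exact. Qed.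
Lemma pfZ c u : continuous u -> L (fun x => c * u x) = c * L u.
Proof. by case: LP => _ + _; exact. Qed.
Lemma pf_ge0 u : continuous u -> (forall x, 0 <= u x) -> 0 <= L u.
Proof. by case: LP => _ _; exact. Qed.
Lemma pf_le u v : continuous u -> continuous v -> (forall x, u x <= v x) -> L u <= L v.
Proof.
move=> cu cv uv.
have cN : continuous (fun x => -1 * u x) by apply: ctsR_mul => //; exact: ctsR_cst.
rewrite -subr_ge0 -mulN1r -pfZ// -pfD//; apply: pf_ge0; first exact: ctsR_add.
by move=> x; rewrite mulN1r subr_ge0.
Qed.
Lemma pf_cst c : L (fun=> c) = c * L (fun=> 1).
Proof. by rewrite -pfZ; [congr L; apply/funext => x; rewrite mulr1|exact: ctsR_cst]. Qed.
Lemma pf_sum (u : nat -> X -> R) n : (forall i, continuous (u i)) ->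
  L (fun x => \sum_(i < n) u i x) = \sum_(i < n) L (u i).
Proof.
move=> cu; elim: n => [|n IH].
  rewrite big_ord0 (_ : (fun x => _) = fun x => 0 * 1).
    by rewrite pfZ ?mul0r//; exact: ctsR_cst.
  by apply/funext => x; rewrite big_ord0 mul0r.
rewrite big_ord_recr/= -IH -pfD//; last exact: ctsR_sum.
by congr L; apply/funext => x; rewrite big_ord_recr.
Qed.

(** Functions vanish off U instead of having support inside U; the supremum is the same, and
    truncations max(u - e, 0) restore the missing margin where it is needed. *)
Definition test_function (U : set R[i]) (u : X -> R) : Prop :=
  continuous u /\ forall x : X, [/\ 0 <= u x, u x <= 1 & ~ U (val x) -> u x = 0].

Definition premeas (U : set R[i]) : R := sup [set L u | u in test_function U].

Lemma test0 U : test_function U (fun=> 0).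
Proof. by split=> [|x]; [exact: ctsR_cst|split => //; rewrite ler01]. Qed.

Lemma premeas_has_sup U : has_sup [set L u | u in test_function U].
Proof.
split; first by exists (L (fun=> 0)), (fun=> 0) => //; exact: test0.
exists (L (fun=> 1)) => _ [u [cu hu] <-]; apply: pf_le => //; first exact: ctsR_cst.
by move=> x; case: (hu x).
Qed.

Lemma premeas_ub U u : test_function U u -> L u <= premeas U.
Proof. by move=> tu; apply: sup_upper_bound; [exact: premeas_has_sup|exists u]. Qed.

Lemma premeas_le U c : (forall u, test_function U u -> L u <= c) -> premeas U <= c.
Proof.
move=> h; apply: ge_sup; first by case: (premeas_has_sup U).
by move=> _ [u tu <-]; exact: h.
Qed.

Lemma premeas_approx U (e : R) : 0 < e -> exists2 u, test_function U u & premeas U - e < L u.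
Proof.
by move=> e0; have [_ [u tu <-] h] := sup_adherent e0 (premeas_has_sup U); exists u.
Qed.

Lemma premeas_ge0 U : 0 <= premeas U.
Proof.
apply: le_trans (premeas_ub (test0 U)); apply: pf_ge0 => //; exact: ctsR_cst.
Qed.

Lemma premeas_mono U V : U `<=` V -> premeas U <= premeas V.
Proof.
move=> UV; apply: premeas_le => u [cu hu]; apply: premeas_ub; split => // x.
by have [a b c] := hu x; split => // nV; apply: c => /UV.
Qed.

(* Exhaustion of an open set: a test function for [U] is dominated, up to a
   small error, by the [n]-th member of the sequence for large [n]. *)
Definition exhaust (d : nat -> X -> R) n (x : X) : R :=
  (\sum_(i < n.+1) d i x) / Num.max (\sum_(i < n.+1) d i x) n.+1%:R^-1.

(** Near a point with u >= e some d i is bounded below, and compactness makes the choice of n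
    uniform. The dichotomy form, unlike the inequality of [exhaustion], applies also to products of
    two members of the sequence. *)
Lemma exhaustion_or (U : set R[i]) (d : nat -> X -> R) u (e : R) :
  (forall i, continuous (d i)) -> (forall i x, 0 <= d i x) ->
  (forall x : X, U (val x) -> exists i, 0 < d i x) ->
  test_function U u -> 0 < e ->
  exists N, forall n, (N <= n)%N -> forall x, u x < e \/ exhaust d n x = 1.
Proof.
move=> cd d0 dU [cu hu] e0.
have := @near_coveringX R X hX nat \oo (fun n x => u x < e \/ n.+1%:R^-1 <= \sum_(i < n.+1) d i x) _.
have sum_ge (i n : nat) x : (i <= n)%N -> d i x <= \sum_(j < n.+1) d j x.
  by rewrite -ltnS => lin; rewrite (bigD1 (Ordinal lin))//= lerDl sumr_ge0.
have h (x : X) : [set: X] x -> \forall x' \near x & n \near \oo,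
   u x' < e \/ n.+1%:R^-1 <= \sum_(i < n.+1) d i x'.
  move=> _; have [xe|xe] := ltP (u x) e.
    have [r r0 hr] := (ctsXRP u).1 cu x (e - u x) (ltac:(by rewrite subr_gt0)).
    exists ([set x' : X | nm (val x' - val x) < r], setT) => /=.
      by split; [apply/nbhs_setP; exists r|exact: filterT].
    move=> [x' n] /= [/hr]; rewrite ltr_norml => /andP[_ h1] _.
    by left; move: h1; rewrite ltrBrDl addrC subrK.
  have Ux : U (val x).
    by apply: contrapT => nU; have [_ _ /(_ nU) u0] := hu x; move: xe; rewrite u0 leNgt e0.
  have [i di] := dU x Ux.
  have d2 : 0 < d i x / 2 by rewrite divr_gt0.
  have [r r0 hr] := (ctsXRP (d i)).1 (cd i) x _ d2.
  exists ([set x' : X | nm (val x' - val x) < r], [set n | (i <= n)%N /\ n.+1%:R^-1 < d i x / 2]) => /=.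
    split; first by apply/nbhs_setP; exists r.
    apply: filterI; first by exists i.
    exact: (near_infty_natSinv_lt (PosNum d2)).
  move=> [x' n] /= [/hr]; rewrite ltr_norml => /andP[h1 _] [lin h2]; right.
  rewrite (le_trans (ltW h2))// (le_trans _ (sum_ge i n x' lin))//.
  by rewrite ltW//; move: h1; lra.
move=> /(_ _ h) [N _ hN]; exists N => n Nn x.
have n0 : 0 < n.+1%:R^-1 :> R by rewrite invr_gt0.
have [h1|h1] := hN n Nn x I; first by left.
by right; rewrite /exhaust max_l// divff// gt_eqF// (lt_le_trans n0).
Qed.

Lemma exhaust_ge0 (d : nat -> X -> R) n x : (forall i x, 0 <= d i x) -> 0 <= exhaust d n x.
Proof.
move=> d0; apply: divr_ge0; first by rewrite sumr_ge0.
by rewrite le_max invr_ge0 ler0n orbT.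
Qed.

Lemma exhaustion (U : set R[i]) (d : nat -> X -> R) u (e : R) :
  (forall i, continuous (d i)) -> (forall i x, 0 <= d i x) ->
  (forall x : X, U (val x) -> exists i, 0 < d i x) ->
  test_function U u -> 0 < e ->
  exists N, forall n, (N <= n)%N -> forall x, u x <= e + exhaust d n x.
Proof.
move=> cd d0 dU tu e0; have [N hN] := exhaustion_or cd d0 dU tu e0.
exists N => n /hN {}hN x; have [h1|->] := hN x.
  by rewrite (le_trans (ltW h1))// lerDl exhaust_ge0.
by have [_ u1 _] := tu.2 x; rewrite (le_trans u1)// lerDr ltW.
Qed.

Lemma exhaust_continuous (d : nat -> X -> R) n :
  (forall i, continuous (d i)) -> continuous (exhaust d n).
Proof.
move=> cd; apply: ctsR_mul; first exact: ctsR_sum.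
apply: ctsR_inv => [x|]; last by apply: ctsR_max; [exact: ctsR_sum|exact: ctsR_cst].
by rewrite gt_eqF// lt_max invr_gt0 ltr0Sn orbT.
Qed.

Lemma premeas_subadditive (U : nat -> set R[i]) u (e : R) : (forall i, open (U i)) ->
  test_function (\bigcup_i U i) u -> 0 < e ->
  exists n, L u <= \sum_(i < n) premeas (U i) + e.
Proof.
move=> oU tu e0; have cu := tu.1.
pose d i (x : X) := cdist (U i) (val x).
have cd i : continuous (d i) by exact: cdist_continuous.
have L1 : 0 < L (fun=> 1) + 1.
  rewrite ltr_wpDl//; apply: pf_ge0; first exact: ctsR_cst.
  by move=> x; exact: ler01.
have [||N hN] := @exhaustion (\bigcup_i U i) d u (e / (L (fun=> 1) + 1)) cd _ _ tu (divr_gt0 e0 L1).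
- by move=> i x; exact: cdist_ge0.
- by move=> x [i _ Ui]; exists i; exact: cdist_gt0.
exists N.+1; have {}hN := hN N (leqnn N).
pose m x := (Num.max (\sum_(i < N.+1) d i x) N.+1%:R^-1)^-1.
have m0 x : 0 < m x by rewrite invr_gt0 lt_max invr_gt0 ltr0Sn orbT.
have cm : continuous m.
  apply: ctsR_inv => [x|]; last by apply: ctsR_max; [exact: ctsR_sum|exact: ctsR_cst].
  by rewrite gt_eqF// lt_max invr_gt0 ltr0Sn orbT.
(* These are the summands of [exhaust d N]; each is a test function for its own [U i], which splits
   u over the cover up to a small constant. *)
pose g i x := d i x * m x.
have cg i : continuous (g i) by exact: ctsR_mul.
have tg (i : 'I_N.+1) : test_function (U i) (g i).
  split=> // x; split; first by rewrite mulr_ge0 ?cdist_ge0 ?ltW.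
    rewrite /g /m ler_pdivrMr; last by rewrite lt_max invr_gt0 ltr0Sn orbT.
    rewrite mul1r le_max; apply/orP; left.
    by rewrite (bigD1 i)//= lerDl sumr_ge0// => j _; exact: cdist_ge0.
  by move=> nU; rewrite /g /d cdist_out ?mul0r.
have : L u <= L (fun x => e / (L (fun=> 1) + 1) + \sum_(i < N.+1) g i x).
  apply: pf_le => //; first by apply: ctsR_add; [exact: ctsR_cst|exact: ctsR_sum].
  by move=> x; rewrite (le_trans (hN x))// lerD2l /exhaust mulr_suml.
move=> /le_trans; apply; rewrite pfD ?pf_sum//; [|exact: ctsR_cst|exact: ctsR_sum].
rewrite addrC lerD//; first by apply: ler_sum => i _; exact: premeas_ub.
by rewrite pf_cst mulrAC ler_pdivrMr// ler_wpM2l ?(ltW e0)// lerDl.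
Qed.

(* The outer-regular splitting behind Caratheodory's criterion for open sets. *)
Lemma premeas_split (U W V : set R[i]) u (e : R) : open U ->
  test_function (W `&` U) u -> 0 < e ->
  V `<=` W -> (forall x : X, V (val x) -> u x <= e) ->
  L u + premeas V <= premeas W + e * L (fun=> 1).
Proof.
move=> oU [cu hu] e0 VW Ve.
(* Truncation makes u' vanish on V, so u' + v stays below 1 for every test function v of V, at the
   price of e L(1). *)
pose u' (x : X) := Num.max (u x - e) 0.
have cu' : continuous u'.
  by apply: ctsR_max; [apply: ctsR_sub => //|]; exact: ctsR_cst.
have h1 : L u <= L u' + e * L (fun=> 1).
  rewrite -pf_cst -pfD//; last exact: ctsR_cst.
  apply: pf_le => //; first by apply: ctsR_add => //; exact: ctsR_cst.
  by move=> x; rewrite -lerBlDr le_max lexx.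
have h2 : premeas V <= premeas W - L u'.
  apply: premeas_le => v [cv hv]; rewrite lerBrDl -pfD//.
  apply: premeas_ub; split; first exact: ctsR_add.
  move=> x; have [a b c] := hu x; have [a' b' c'] := hv x.
  have u'0 : 0 <= u' x by rewrite le_max lexx orbT.
  split; first by rewrite addr_ge0.
  - have [Vx|nV] := pselect (V (val x)).
      have -> : u' x = 0 by rewrite /u' max_r// subr_le0 Ve.
      by rewrite add0r.
    rewrite (c' nV) addr0 /u' ge_max ler01 andbT.
    by rewrite (le_trans _ b)// gerBl ltW.
  - move=> nW; rewrite (c' (fun vx => nW (VW _ vx))) addr0 /u' c; last by case.
    by rewrite max_r// sub0r oppr_le0 ltW.
by rewrite (le_trans (lerD h1 h2))// addrACA -addrA [X in _ + X]addrC; lra.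
Qed.

End premeasure.

(** * Positive operators and limits of representations *)

Lemma Re_sum (R : realType) (I : Type) (r : seq I) (P : pred I) (F : I -> R[i]) :
  complex.Re (\sum_(i <- r | P i) F i) = \sum_(i <- r | P i) complex.Re (F i).
Proof. exact: (big_morph (@complex.Re R) (@ReD R) (erefl _)). Qed.
Lemma Im_sum (R : realType) (I : Type) (r : seq I) (P : pred I) (F : I -> R[i]) :
  complex.Im (\sum_(i <- r | P i) F i) = \sum_(i <- r | P i) complex.Im (F i).
Proof. exact: (big_morph (@complex.Im R) (@ImD R) (erefl _)). Qed.

Section positive_operators.
Context (R : realType) (H : hilbertType R).
Implicit Types (S T X : 'B(H)) (x y h : H).

Definition psd T : Prop := adjoint T = T /\ forall x, 0 <= complex.Re (dotp (T x) x).

Lemma psd1 : psd 1.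
Proof. by split=> [|x]; [exact: adjoint1|rewrite op1E -nm_sqrE sqr_ge0]. Qed.

Lemma psdD S T : psd S -> psd T -> psd (S + T).
Proof.
move=> [aS pS] [aT pT]; split=> [|x]; first by rewrite adjointD aS aT.
by rewrite opDE ipDl ReD addr_ge0.
Qed.

Lemma psd0 : psd 0.
Proof. by split=> [|x]; [exact: adjoint0|rewrite op0E ip0l]. Qed.

Lemma psdMn S n : psd S -> psd (S *+ n).
Proof.
move=> pS; elim: n => [|n IH]; first by rewrite mulr0n; exact: psd0.
by rewrite mulrS; exact: psdD.
Qed.

Lemma psd_conj S T : psd S -> adjoint T = T -> psd (T * S * T).
Proof.
move=> [aS pS] aT; split=> [|x]; first by rewrite !adjointM aS aT mulrA.
by rewrite !opME adjointP aT.
Qed.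

(* With [B_0 = B] and [B_(k+1) = B_k - B_k^2] one has
   [X B = \sum_(k < n) B_k X B_k + X B_n], and [B_n x] is small for some [n]. *)
Lemma psd_mul X B : psd X -> psd B -> psd (1 - B) -> GRing.comm X B -> psd (X * B).
Proof.
move=> pX pB pB1 XB.
pose fix Bs k : 'B(H) := if k is k'.+1 then Bs k' - Bs k' * Bs k' else B.
have inv k : [/\ psd (Bs k), psd (1 - Bs k) & GRing.comm X (Bs k)].
  elim: k => [|k [p q c]]; first by split.
  (* T (1 - T) = T (1 - T) T + (1 - T) T (1 - T) exhibits the next term as a sum of conjugates of
     positive operators. *)
  have e : Bs k.+1 = Bs k * (1 - Bs k) * Bs k + (1 - Bs k) * Bs k * (1 - Bs k).
    rewrite /=; move: (Bs k) => T; rewrite -(comm_1B T).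
    have -> : T - T * T = T * (1 - T) by rewrite mulrBr mulr1.
    rewrite -[LHS]mulr1 -[X in _ * _ * X = _](subrK T 1) mulrDr addrC; congr (_ + _).
  have e1 : 1 - Bs k.+1 = (1 - Bs k) + Bs k * 1 * Bs k.
    by rewrite mulr1 /= opprB addrCA addrC.
  split.
  - by rewrite e; apply: psdD; apply: psd_conj => //; [exact: p.1|exact: q.1].
  - by rewrite e1; apply: psdD => //; apply: psd_conj; [exact: psd1|exact: p.1].
  - by apply: commrB => //; exact: commrM.
have aX := pX.1; split.
  by rewrite adjointM aX pB.1 XB.
move=> x.
have step k : complex.Re (dotp ((X * Bs k) x) x) =
    complex.Re (dotp (X (Bs k x)) (Bs k x)) + complex.Re (dotp ((X * Bs k.+1) x) x).
  have [[ak _] _ ck] := inv k.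
  have -> : dotp (X (Bs k x)) (Bs k x) = dotp ((X * (Bs k * Bs k)) x) x.
    have cx y : X (Bs k y) = Bs k (X y) by rewrite -!opME ck.
    by rewrite adjointPr ak !opME [in RHS]cx.
  by rewrite -ReD -ipDl -opDE -mulrDr /= addrC subrK.
have stepB k : complex.Re (dotp (Bs k x) x) =
    nm (Bs k x) ^+ 2 + complex.Re (dotp (Bs k.+1 x) x).
  have [[ak _] _ ck] := inv k.
  have -> : nm (Bs k x) ^+ 2 = complex.Re (dotp ((Bs k * Bs k) x) x).
    by rewrite nm_sqrE adjointPr ak opME.
  by rewrite -ReD -ipDl -opDE /= addrC subrK.
have lb n : complex.Re (dotp ((X * Bs n) x) x) <= complex.Re (dotp ((X * B) x) x).
  elim: n => // n IH; apply: le_trans IH; rewrite (step n) lerDr.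
  exact: pX.2.
have [C C0 hC] := op_bound X.
(* By [stepB] the sum of all |B_k x|^2 is at most <B x, x>, so these norms cannot all exceed d. *)
have small (d : R) : 0 < d -> exists n, nm (Bs n x) < d.
  move=> d0; apply: contrapT => /forallNP hn.
  have big n : n%:R * d ^+ 2 + complex.Re (dotp (Bs n x) x) <= complex.Re (dotp (B x) x).
    elim: n => [|n IH]; first by rewrite mul0r add0r.
    apply: le_trans IH; rewrite -natr1 mulrDl mul1r -addrA lerD2l (stepB n) lerD2r.
    by rewrite ler_pXn2r ?nnegrE ?nm_ge0 ?(ltW d0)// leNgt; apply/negP/hn.
  have d2 : 0 < d ^+ 2 by rewrite exprn_gt0.
  pose b := complex.Re (dotp (B x) x); pose n := (Num.truncn (b / d ^+ 2)).+1.
  have h1 : b / d ^+ 2 < n%:R by exact: real_truncnS_gt (num_real _).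
  rewrite ltr_pdivrMr// in h1.
  have [[_ h2] _ _] := inv n; have := big n; have := h2 x; rewrite -/b; lra.
rewrite leNgt; apply/negP => hlt.
pose q := - complex.Re (dotp ((X * B) x) x).
have q0 : 0 < q by rewrite oppr_gt0.
have Cx : 0 < C * (nm x + 1) by rewrite mulr_gt0// ltr_wpDl ?nm_ge0.
have [n hn] := small (q / (C * (nm x + 1))) (divr_gt0 q0 Cx).
rewrite ltr_pdivlMr// in hn.
have h1 := lb n.
have h2 : - complex.Re (dotp ((X * Bs n) x) x) <= C * nm (Bs n x) * nm x.
  rewrite (le_trans (ler_norm _))// normrN (le_trans (normRe_le_nm _))//.
  rewrite (le_trans (cauchy_schwarz _ _))// ler_wpM2r ?nm_ge0//.
  exact: hC.
have h3 : C * nm (Bs n x) * nm x <= nm (Bs n x) * (C * (nm x + 1)).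
  have := mulr_ge0 (ltW C0) (nm_ge0 (Bs n x)); lra.
move: h1 h2 h3 hn; rewrite /q; lra.
Qed.

Section povm.
Context (K : finType) (P : K -> 'B(H)) (pP : forall k, psd (P k))
  (sP : \sum_k P k = 1).

(** For each k, positivity of P_k at f_k W_k - y, with y the whole sum, bounds 2 Re <f_k P_k W_k,
    y>; adding up with sum P_k = 1 gives 2 |y|^2 <= M^2 V + |y|^2. The vector varies with k because
    the variance estimate for Bernstein sums needs it. *)
Lemma povm_bound (W : K -> H) (f : K -> R[i]) (M V : R) : 0 <= M ->
  (forall k, nm (f k) <= M) ->
  \sum_k complex.Re (dotp (P k (W k)) (W k)) <= V ->
  nm (\sum_k f k *: P k (W k)) ^+ 2 <= M ^+ 2 * V.
Proof.
move=> M0 hM hV; set y := \sum_k _.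
have each k : 2 * complex.Re (f k * dotp (P k (W k)) y) <=
    M ^+ 2 * complex.Re (dotp (P k (W k)) (W k)) + complex.Re (dotp (P k y) y).
  have [aP posP] := pP k.
  have := posP (f k *: W k - y).
  have sym : dotp (P k y) (W k) = (dotp (P k (W k)) y)^*.
    by rewrite adjointP aP -ipC.
  have -> : dotp (P k (f k *: W k - y)) (f k *: W k - y) =
      (nm (f k) ^+ 2)%:C * dotp (P k (W k)) (W k) - f k * dotp (P k (W k)) y
      - (f k)^* * (dotp (P k (W k)) y)^* + dotp (P k y) y.
    by rewrite opB opZ !(ipBl, ipBr, ipZl, ipZr) sym -mul_conj_nm; ring.
  rewrite ReD !ReB ReCM.
  have -> : complex.Re ((f k)^* * (dotp (P k (W k)) y)^*) = complex.Re (f k * dotp (P k (W k)) y).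
    by rewrite -rmorphM ReJ.
  have h1 := posP (W k).
  have h2 : nm (f k) ^+ 2 * complex.Re (dotp (P k (W k)) (W k)) <=
            M ^+ 2 * complex.Re (dotp (P k (W k)) (W k)).
    by rewrite ler_wpM2r// ler_pXn2r ?nnegrE ?nm_ge0.
  by move: h1 h2; lra.
have hy : \sum_k complex.Re (dotp (P k y) y) = nm y ^+ 2.
  rewrite nm_sqrE -[y in dotp y _]op1E -sP op_sumE ip_suml.
  by rewrite Re_sum.
have : 2 * nm y ^+ 2 <= M ^+ 2 * V + nm y ^+ 2.
  rewrite {1}nm_sqrE {1}/y ip_suml Re_sum mulr_sumr.
  rewrite (@le_trans _ _ (\sum_k (M ^+ 2 * complex.Re (dotp (P k (W k)) (W k)) + complex.Re (dotp (P k y) y))))//.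
    by apply: ler_sum => k _; rewrite ipZl.
  by rewrite big_split hy lerD2r -mulr_sumr ler_wpM2l ?sqr_ge0.
by move: (nm y ^+ 2) (_ * V) => a b; lra.
Qed.

Lemma povm_norm h (f : K -> R[i]) (M : R) : 0 <= M ->
  (forall k, nm (f k) <= M) -> nm (\sum_k f k *: P k h) <= M * nm h.
Proof.
move=> M0 hM; rewrite -(@ler_pXn2r _ 2)// ?nnegrE ?nm_ge0 ?mulr_ge0 ?nm_ge0// exprMn.
apply: (@povm_bound (fun=> h)) => //.
rewrite -Re_sum -ip_suml -op_sumE sP op1E -nm_sqrE.
exact: lexx.
Qed.

End povm.
End positive_operators.

Section limit_of_representations.
Context (R : realType) (X : set R[i]) (hX : compact X) (H : hilbertType R).
Notation CX := (continuousType X R[i]).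
Context (I_ : nat -> CX -> 'B(H)) (C : R).
Hypothesis I_lin : forall n, linear (I_ n).
Hypothesis I_bound : forall n (f : CX) (M : R), 0 <= M -> (forall x : X, nm (f x) <= M) ->
  forall h, nm (I_ n f h) <= C * M * nm h.
Hypothesis I_one : forall n, I_ n 1 = 1.
Hypothesis I_adj : forall n f, I_ n (cf_conj f) = adjoint (I_ n f).
Hypothesis I_cvg : forall f h, exists l : H, I_ n f h @[n --> \oo] --> l.
Hypothesis I_mul : forall f g h, forall e : R, 0 < e -> exists N, forall n, (N <= n)%N ->
  nm (I_ n (f * g) h - I_ n f (I_ n g h)) < e.

Lemma hcvg_unique (K : hilbertType R) (u : nat -> K) (a b : K) :
  u n @[n --> \oo] --> a -> u n @[n --> \oo] --> b -> a = b.
Proof. exact: (@cvg_unique K (@norm_hausdorff _ K)). Qed.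

(** Asymptotic multiplicativity suffices. This covers both the Bernstein sums of a normal operator
    and the Riemann sums of a spectral measure. *)
Lemma limit_rep : exists pi : CX -> 'B(H), rep pi /\
  forall f h, I_ n f h @[n --> \oo] --> pi f h.
Proof.
have ex f : exists T : 'B(H), forall h, I_ n f h @[n --> \oo] --> T h.
  have [M M0 hM] := cf_bounded hX (@cf_continuous R X f).
  have [T [hT _]] := @strong_limit R H (fun n => I_ n f) (C * M)
     (fun n => I_bound n (ltW M0) hM) (I_cvg f).
  by exists T.
have [pi hpi] := choice ex; exists pi; split => //; split.
- move=> a f g; apply/boundedOpP => h; apply: hcvg_unique (hpi _ h) _.
  rewrite (_ : (fun n => _) = (fun n => a *: I_ n f h + I_ n g h)).
    by apply: cvgD (hpi g h); exact: cvgZl_tmp (hpi f h).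
  by apply/funext => n; rewrite I_lin.
- split.
    apply/boundedOpP => h; apply: hcvg_unique (hpi _ h) _.
    by rewrite (_ : (fun n => _) = fun=> h); [exact: cvg_cst|apply/funext => n; rewrite I_one].
  move=> f g; apply/boundedOpP => h; apply: hcvg_unique (hpi _ h) _.
  have [M M0 hM] := cf_bounded hX (@cf_continuous R X f).
  have CM : 0 < `|C| * M + 1 by rewrite ltr_wpDl// mulr_ge0// ltW.
  apply/cvgnP_nm => e e0; have e3 : 0 < e / 3 by rewrite divr_gt0.
  have [N1 hN1] := I_mul f g h e3.
  have [N2 hN2] := (cvgnP_nm _ _).1 (hpi f (pi g h)) _ e3.
  have [N3 hN3] := (cvgnP_nm _ _).1 (hpi g h) _ (divr_gt0 e3 CM).
  exists (maxn N1 (maxn N2 N3)) => n; rewrite !geq_max => /and3P[/hN1 h1 /hN2 h2 /hN3 h3].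
  rewrite opME; have h4 := I_bound n (ltW M0) hM (I_ n g h - pi g h).
  rewrite opB in h4.
  have h5 : nm (I_ n f (I_ n g h) - I_ n f (pi g h)) < e / 3.
    rewrite ltr_pdivlMr// in h3; apply: le_lt_trans h3; apply: le_trans h4 _.
    rewrite mulrC ler_wpM2l ?nm_ge0// (@le_trans _ _ (`|C| * M))//; last by rewrite lerDl.
    by rewrite ler_wpM2r ?(ltW M0)// ler_norm.
  have h6 := nm_triB (I_ n (f * g) h) (I_ n f (I_ n g h)) (pi f (pi g h)).
  have h7 := nm_triB (I_ n f (I_ n g h)) (I_ n f (pi g h)) (pi f (pi g h)).
  apply: le_lt_trans h6 _; apply: (@le_lt_trans _ _ (nm (I_ n (f * g) h - I_ n f (I_ n g h)) +
     (nm (I_ n f (I_ n g h) - I_ n f (pi g h)) + nm (I_ n f (pi g h) - pi f (pi g h))))).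
    by rewrite lerD2l.
  have -> : e = e / 3 + (e / 3 + e / 3) by field.
  by apply: ltrD => //; apply: ltrD.
- move=> f; symmetry; apply: adjoint_uniq => x y.
  apply: cvgC_unique (_ : cvgC (fun n => dotp (I_ n f x) y) _) _; apply/cvgCP.
    by apply: ip_cvg (hpi f x) _; exact: cvg_cst.
  rewrite (_ : (fun n => _) = fun n => dotp x (I_ n (cf_conj f) y)).
    by apply: ip_cvg (hpi _ y); exact: cvg_cst.
  by apply/funext => n; rewrite I_adj -adjointP.
Qed.

End limit_of_representations.

(** * The representation defined by a normal operator *)

Section normal_functional_calculus.
Context (R : realType) (H : hilbertType R) (N : 'B(H)) (nN : normal_op N).
Context (c : R) (c0 : 0 < c) (hc : forall x, nm (N x) <= c * nm x).

Definition square : set R[i] := [set z | `|complex.Re z| <= c /\ `|complex.Im z| <= c].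
Notation Q := square.
Notation CQ := (continuousType Q R[i]).

(** The real part of N, mapped affinely from [-c, c] to [0, 1] exactly as [ucoord] does for
    functions; [imN] does the same for the imaginary part. Bernstein polynomials in them are then
    positive. *)
Definition reN : 'B(H) := ((4 * c)^-1)%:C *: (N + adjoint N) + (2^-1)%:C *: (1 : 'B(H)).
Definition imN : 'B(H) :=
  (- ((4 * c)^-1)%:C * 'i) *: (N - adjoint N) + (2^-1)%:C *: (1 : 'B(H)).

Lemma reN_adj : adjoint reN = reN.
Proof.
rewrite /reN adjointD !adjointZ adjoint1 adjointD adjointK !conjCr.
by rewrite [adjoint N + N]addrC.
Qed.

Lemma imN_adj : adjoint imN = imN.
Proof.
have cj : (- ((4 * c)^-1)%:C * 'i)^* = ((4 * c)^-1)%:C * 'i :> R[i].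
  rewrite rmorphM/= rmorphN/= conjCr.
  have -> : ('i : R[i])^* = - 'i by exact: conji.
  by rewrite mulrNN.
rewrite /imN adjointD !adjointZ adjoint1 adjointB adjointK cj conjCr.
by rewrite -[in LHS](opprB N) scalerN mulNr scaleNr.
Qed.

Lemma comm_scale S T (a : R[i]) : GRing.comm S T -> GRing.comm (S : 'B(H)) (a *: T).
Proof. by rewrite /GRing.comm op_scaleAl op_scaleAr => ->. Qed.

Lemma reNB_comm : GRing.comm reN imN.
Proof.
have nN' : GRing.comm N (adjoint N) by exact: nN.
have h S : GRing.comm S N -> GRing.comm S (adjoint N) -> GRing.comm S imN.
  move=> h1 h2; apply: commrD; apply: comm_scale; last exact: commr1.
  exact: commrB.
have h' S : GRing.comm S N -> GRing.comm S (adjoint N) -> GRing.comm S reN.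
  move=> h1 h2; apply: commrD; apply: comm_scale; last exact: commr1.
  exact: commrD.
apply: h; apply/commr_sym/h' => //; exact/commr_sym.
Qed.

Lemma Re_dot_le T (k : R) x : (forall x, nm (T x) <= k * nm x) ->
  `|complex.Re (@dotp R H (T x) x)| <= k * nm x ^+ 2.
Proof.
move=> hT; rewrite (le_trans (normRe_le_nm _))// (le_trans (cauchy_schwarz _ _))//.
by rewrite expr2 mulrA ler_wpM2r ?nm_ge0.
Qed.

Lemma nm_i : nm ('i : R[i]) = 1.
Proof. by rewrite /nm normc_def/= expr0n expr1n add0r sqrtr1. Qed.

Lemma op01 (a : R[i]) (T : 'B(H)) : nm a = (4 * c)^-1 ->
  (forall x, nm (T x) <= 2 * c * nm x) ->
  let S := a *: T + (2^-1)%:C *: (1 : 'B(H)) in adjoint S = S -> psd S /\ psd (1 - S).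
Proof.
move=> ha hT S aS; have key x : `|complex.Re (dotp (a *: T x) x)| <= 2^-1 * nm x ^+ 2.
  apply: (@Re_dot_le (fun x => a *: T x)) => {}x.
  rewrite nmZ ha; have := ler_wpM2l (_ : 0 <= (4 * c)^-1) (hT x).
  rewrite invr_ge0 mulr_ge0 ?(ltW c0)// => /(_ isT) /le_trans; apply.
  by rewrite le_eqVlt; apply/orP; left; apply/eqP; field; rewrite gt_eqF.
have e x : complex.Re (dotp (S x) x) = complex.Re (dotp (a *: T x) x) + 2^-1 * nm x ^+ 2.
  by rewrite opDE !opZE op1E ipDl ReD [dotp (2^-1%:C *: x) x]ipZl ReCM -nm_sqrE.
split; split; rewrite ?adjointB ?adjoint1 ?aS// => x.
  by rewrite e; have := key x; rewrite ler_norml => /andP[h _]; move: h; lra.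
rewrite opBE op1E ipBl ReB -nm_sqrE e; have := key x; rewrite ler_norml => /andP[_ h].
by move: h; lra.
Qed.

Lemma hcJ x : nm (adjoint N x) <= c * nm x.
Proof. by rewrite normal_nm. Qed.

Lemma reN01 : psd reN /\ psd (1 - reN).
Proof.
apply: op01; [|move=> x|exact: reN_adj].
  by rewrite nmC gtr0_norm// invr_gt0 mulr_gt0.
rewrite opDE (le_trans (nmD _ _))//; have := hc x; have := hcJ x; lra.
Qed.

Lemma imN01 : psd imN /\ psd (1 - imN).
Proof.
apply: op01; [|move=> x|exact: imN_adj].
  by rewrite nmM nmN nm_i mulr1 nmC gtr0_norm// invr_gt0 mulr_gt0.
rewrite opBE (le_trans (nmD _ _))// nmN; have := hc x; have := hcJ x; lra.
Qed.

(** A positive operator weight on the grid, of total mass 1: a discrete substitute for the joint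
    spectral measure of the two commuting operators. *)
Definition bernP n (k : 'I_n.+2 * 'I_n.+2) : 'B(H) := bern n.+1 k.1 reN * bern n.+1 k.2 imN.

Lemma psd_mulX (X B : 'B(H)) k : psd X -> psd B -> psd (1 - B) -> GRing.comm X B ->
  @psd R H (X * B ^+ k).
Proof.
move=> pX pB pB1 XB; elim: k => [|k IH]; first by rewrite expr0 mulr1.
rewrite exprSr mulrA; apply: psd_mul => //; apply/commr_sym/commrM; first exact: commr_sym.
by apply: commrX; exact: commr_refl.
Qed.

Lemma bernP_psd n k : psd (@bernP n k).
Proof.
have [pA pA1] := reN01; have [pB pB1] := imN01.
have AA1 := comm_1B reN; have BB1 := comm_1B imN; have AB := reNB_comm.
have pA1' : @psd R H ((1 : 'B(H)) - (1 - reN)) by rewrite subKr.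
have pB1' : @psd R H ((1 : 'B(H)) - (1 - imN)) by rewrite subKr.
have p1 a : @psd R H (reN ^+ a) by rewrite -[_ ^+ _]mul1r; apply: psd_mulX => //; [exact: psd1|exact/commr_sym/commr1].
have p2 a b : @psd R H (reN ^+ a * (1 - reN) ^+ b).
  by apply: psd_mulX => //; apply/commr_sym/commrX/commr_sym.
have cB a b : GRing.comm imN (reN ^+ a * (1 - reN) ^+ b).
  by apply: commrM; apply: commrX; [exact: commr_sym|apply: commrB; [exact: commr1|exact: commr_sym]].
have p3 a b d : @psd R H (reN ^+ a * (1 - reN) ^+ b * imN ^+ d).
  by apply: psd_mulX => //; exact: commr_sym.
have p4 a b d f : @psd R H (reN ^+ a * (1 - reN) ^+ b * imN ^+ d * (1 - imN) ^+ f).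
  apply: psd_mulX => //; apply/commr_sym/commrM.
    by apply/commr_sym/commrB; [exact: commr1|exact/commr_sym].
  by apply/commrX/commr_sym.
rewrite /bernP /bern mulrnAl mulrnAr -mulrnA mulrA; apply: psdMn; exact: p4.
Qed.

Lemma bernP_sum n : \sum_k @bernP n k = 1.
Proof.
rewrite -(pair_bigA _ (fun i j => @bernP n (i, j)))/= /bernP/=.
by under eq_bigr do rewrite -mulr_sumr bern_sum mulr1; rewrite bern_sum.
Qed.

Definition grid n (k : 'I_n.+2 * 'I_n.+2) : R[i] :=
  (2 * c * (k.1%:R / n.+1%:R) - c) +i* (2 * c * (k.2%:R / n.+1%:R) - c).

Lemma grid_in n k : Q (@grid n k).
Proof.
have h (i : 'I_n.+2) : `|2 * c * (i%:R / n.+1%:R) - c| <= c.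
  have i0 : 0 <= i%:R / n.+1%:R :> R by rewrite divr_ge0.
  have i1 : i%:R / n.+1%:R <= 1 :> R by rewrite ler_pdivrMr// mul1r ler_nat -ltnS.
  have t0 := mulr_ge0 (ltW c0) i0; have t1 := ler_wpM2l (ltW c0) i1.
  move: t0 t1; move: (i%:R / n.+1%:R) => t t0 t1.
  by rewrite ler_norml; apply/andP; split; lra.
by split; exact: h.
Qed.

Definition gpt n (k : 'I_n.+2 * 'I_n.+2) : Q := exist _ (grid k) (mem_set (@grid_in n k)).

(** The bivariate Bernstein polynomial of f evaluated at [reN] and [imN]. *)
Definition beta n (f : CQ) : 'B(H) := \sum_k f (gpt k) *: @bernP n k.

Lemma beta_lin n : linear (beta n).
Proof.
move=> a f g; rewrite /beta scaler_sumr -big_split/=; apply: eq_bigr => k _.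
by rewrite scalerDl scalerA.
Qed.

Lemma betaE n f h : beta n f h = \sum_k f (gpt k) *: @bernP n k h.
Proof. by rewrite /beta op_sumE. Qed.

Lemma beta_bound n (f : CQ) (M : R) : 0 <= M -> (forall x : Q, nm (f x) <= M) ->
  forall h, nm (beta n f h) <= 1 * M * nm h.
Proof.
move=> M0 hM h; rewrite betaE mul1r.
exact: (povm_norm (@bernP_psd n) (bernP_sum n)).
Qed.

Lemma beta_one n : beta n 1 = 1.
Proof. by rewrite /beta -[RHS](bernP_sum n); apply: eq_bigr => k _; rewrite scale1r. Qed.

Lemma beta_adj n f : beta n (cf_conj f) = adjoint (beta n f).
Proof.
rewrite /beta (big_morph _ (@adjointD R H) (@adjoint0 R H)); apply: eq_bigr => k _.
by rewrite adjointZ (bernP_psd k).1.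
Qed.

Lemma compact_square : compact Q.
Proof.
pose f (p : R * R) : R[i] := p.1 +i* p.2.
have -> : Q = f @` (`[(- c), c]%classic `*` `[(- c), c]%classic).
  apply/seteqP; split=> [[x y] [/= h1 h2]|_ [[x y] [/= h1 h2] <-]].
    by exists (x, y) => //=; rewrite !in_itv/= -!ler_norml.
  by rewrite !in_itv/= -!ler_norml in h1 h2.
apply: continuous_compact; last by apply: compact_setX; exact: segment_compact.
apply: continuous_subspaceT => -[x y] U /nbhs_CP[d d0 hd].
have d2 : 0 < d / 2 by rewrite divr_gt0.
exists ([set a | `|x - a| < d / 2], [set b | `|y - b| < d / 2]) => /=.
  split; apply/nbhs_ballP; exists (d / 2) => //= a; rewrite -ball_normE //.
move=> [a b] /= [h1 h2]; apply: hd; apply: le_lt_trans (nm_le_ReIm _) _.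
by rewrite ReB ImB/=; apply: half_ltD; rewrite distrC.
Qed.

(* [Z] behaves asymptotically as multiplication by [p]. *)
Definition asym (p : CQ) (Z : 'B(H)) : Prop := forall (f : CQ) (e : R), 0 < e ->
  exists N0, forall n, (N0 <= n)%N -> forall h,
    nm (beta n (p * f) h - Z (beta n f h)) <= e * nm h.

(** The error is the sum of f_k P_k (a_k - Z) h, so [povm_bound] controls it by the sup norm of f
    and the variance, uniformly in h. *)
Lemma asym_coord (p : CQ) (a : forall n, 'I_n.+2 * 'I_n.+2 -> R) (Z : 'B(H)) :
  adjoint Z = Z -> (forall n k, p (gpt k) = (a n k)%:C) ->
  (forall n k, GRing.comm Z (@bernP n k)) ->
  (forall n h, \sum_k complex.Re (dotp ((((a n k)%:C *: (1 : 'B(H)) - Z) * bernP k * ((a n k)%:C *: (1 : 'B(H)) - Z)) h) h)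
     <= n.+1%:R^-1 * nm h ^+ 2) ->
  asym p Z.
Proof.
move=> aZ pa cZ var f e e0.
have [M M0 hM] := cf_bounded compact_square (@cf_continuous R Q f).
exists (Num.truncn (M ^+ 2 / e ^+ 2)) => n Nn h.
have e2 : 0 < e ^+ 2 by rewrite exprn_gt0.
have hn : M ^+ 2 / e ^+ 2 <= n.+1%:R.
  apply: ltW; apply: lt_le_trans (real_truncnS_gt (num_real _)) _.
  by rewrite ler_nat ltnS.
pose W k := ((a n k)%:C *: (1 : 'B(H)) - Z) h.
have -> : beta n (p * f) h - Z (beta n f h) = \sum_k f (gpt k) *: bernP k (W k).
  rewrite !betaE op_sum -sumrB; apply: eq_bigr => k _.
  rewrite cfM pa /W opBE opZE op1E opB !opZ scalerBr scalerA [_%:C * _]mulrC.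
  by congr (_ - _ *: _); rewrite -!opME cZ.
rewrite -(@ler_pXn2r _ 2)// ?nnegrE ?nm_ge0 ?mulr_ge0 ?nm_ge0 ?(ltW e0)//.
have hV : \sum_k complex.Re (dotp (bernP k (W k)) (W k)) <= n.+1%:R^-1 * nm h ^+ 2.
  apply: le_trans (var n h); rewrite le_eqVlt; apply/orP; left; apply/eqP.
  apply: eq_bigr => k _; rewrite !opME; congr complex.Re.
  rewrite [in RHS]opBE [in RHS]ipBl [in RHS]opZE [in RHS]ipZl [dotp (Z _) _]adjointP aZ.
  by rewrite /W [in LHS]opBE ipBr opZE op1E ipZr conjCr.
have := @povm_bound R H _ _ (@bernP_psd n) (bernP_sum n) W (fun k => f (gpt k)) M _
  (ltW M0) (fun k => hM _) hV.
move=> /le_trans; apply; rewrite mulrA exprMn ler_wpM2r ?sqr_ge0// ler_pdivrMr//.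
by rewrite ler_pdivrMr// in hn; rewrite mulrC.
Qed.

Lemma bern_var_op n (t : 'B(H)) :
  \sum_(i < n.+2) ((i%:R / n.+1%:R : R)%:C *: (1 : 'B(H)) - t) * bern n.+1 i t
     * ((i%:R / n.+1%:R : R)%:C *: (1 : 'B(H)) - t) = (n.+1%:R^-1 : R)%:C *: (t * (1 - t)).
Proof.
have e (i : 'I_n.+2) : (i%:R / n.+1%:R : R)%:C *: (1 : 'B(H)) - t =
    (n.+1%:R^-1 : R)%:C *: (i%:R - t *+ n.+1).
  rewrite scalerBr; congr (_ - _).
    rewrite -[i%:R in RHS](@scaler_nat R[i] _ i (1 : 'B(H))) scalerA.
    by rewrite -(rmorph_nat (real_complex R)) -rmorphM/= mulrC.
  rewrite -(@scaler_nat R[i] _ n.+1 t) scalerA -(rmorph_nat (real_complex R)) -rmorphM/=.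
  by rewrite mulVf ?pnatr_eq0// scale1r.
under eq_bigr => i _ do rewrite !e op_scaleAl op_scaleAr op_scaleAl scalerA.
set Y := t * (1 - t).
have -> : (n.+1%:R^-1)%:C *: Y = (n.+1%:R^-1 * n.+1%:R^-1 : R)%:C *: (Y *+ n.+1).
  rewrite -(@scaler_nat R[i] _ n.+1 Y) scalerA; congr (_ *: _).
  by rewrite -(rmorph_nat (real_complex R)) -!rmorphM/= mulfVK ?pnatr_eq0.
by rewrite -scaler_sumr bern_variance rmorphM.
Qed.

Lemma psd_01_le (t : 'B(H)) h : psd t -> psd (1 - t) ->
  complex.Re (dotp ((t * (1 - t)) h) h) <= nm h ^+ 2.
Proof.
move=> [at0 pt] [_ pt1]; rewrite mulrBr mulr1 opBE opME ipBl ReB.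
have -> : complex.Re (dotp (t (t h)) h) = nm (t h) ^+ 2 by rewrite nm_sqrE adjointP at0.
have := pt1 h; rewrite opBE op1E ipBl ReB -nm_sqrE.
by have := sqr_ge0 (nm (t h)); lra.
Qed.

Lemma commA_bernB i n : GRing.comm reN (bern n i imN).
Proof. exact/bern_comm/reNB_comm. Qed.
Lemma commB_bernA i n : GRing.comm imN (bern n i reN).
Proof. exact/bern_comm/commr_sym/reNB_comm. Qed.

Lemma asymA : asym (ucoord Q c) reN.
Proof.
have commA : forall n i, GRing.comm reN (bern n i reN).
  by move=> n i; exact/bern_comm/commr_refl.
apply: (@asym_coord _ (fun n k => k.1%:R / n.+1%:R)); first exact: reN_adj.
- move=> n k; rewrite ucoordE//=; congr (_%:C); move: (k.1%:R / n.+1%:R) => t.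
  by field; rewrite gt_eqF.
- by move=> n k; apply: commrM; [exact: commA|exact: commA_bernB].
move=> n h; rewrite -Re_sum -ip_suml -op_sumE.
rewrite -(pair_bigA _ (fun i j : 'I_n.+2 => ((i%:R / n.+1%:R : R)%:C *: (1 : 'B(H)) - reN) * @bernP n (i, j)
     * ((i%:R / n.+1%:R : R)%:C *: (1 : 'B(H)) - reN)))/=.
(* The second family of Bernstein operators commutes with [reN] and sums to 1, which leaves a
   variance in one variable. *)
under eq_bigr => i _.
  under eq_bigr => j _.
    have -> : ((i%:R / n.+1%:R : R)%:C *: (1 : 'B(H)) - reN) * @bernP n (i, j)
     * ((i%:R / n.+1%:R : R)%:C *: (1 : 'B(H)) - reN) =
     ((i%:R / n.+1%:R : R)%:C *: (1 : 'B(H)) - reN) * bern n.+1 i reN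
     * ((i%:R / n.+1%:R : R)%:C *: (1 : 'B(H)) - reN) * bern n.+1 j imN.
      rewrite /bernP/= -!mulrA; congr (_ * (_ * _)).
      apply: commrB; first exact/comm_scale/commr1.
      exact/commr_sym/commA_bernB.
    over.
  rewrite -mulr_sumr bern_sum mulr1; over.
rewrite bern_var_op opZE ipZl ReCM ler_wpM2l ?invr_ge0//.
by have [? ?] := reN01; exact: psd_01_le.
Qed.

Lemma asymB : asym (vcoord Q c) imN.
Proof.
have commB : forall n i, GRing.comm imN (bern n i imN).
  by move=> n i; exact/bern_comm/commr_refl.
apply: (@asym_coord _ (fun n k => k.2%:R / n.+1%:R)); first exact: imN_adj.
- move=> n k; rewrite vcoordE//=; congr (_%:C); move: (k.2%:R / n.+1%:R) => t.
  by field; rewrite gt_eqF.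
- by move=> n k; apply: commrM; [exact: commB_bernA|exact: commB].
move=> n h; rewrite -Re_sum -ip_suml -op_sumE.
rewrite -(pair_bigA _ (fun i j : 'I_n.+2 => ((j%:R / n.+1%:R : R)%:C *: (1 : 'B(H)) - imN) * @bernP n (i, j)
     * ((j%:R / n.+1%:R : R)%:C *: (1 : 'B(H)) - imN)))/= exchange_big/=.
under eq_bigr => j _.
  under eq_bigr => i _.
    have -> : ((j%:R / n.+1%:R : R)%:C *: (1 : 'B(H)) - imN) * @bernP n (i, j)
     * ((j%:R / n.+1%:R : R)%:C *: (1 : 'B(H)) - imN) =
     bern n.+1 i reN * (((j%:R / n.+1%:R : R)%:C *: (1 : 'B(H)) - imN) * bern n.+1 j imN
     * ((j%:R / n.+1%:R : R)%:C *: (1 : 'B(H)) - imN)).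
      rewrite /bernP/= !mulrA; congr (_ * _ * _); apply: commr_sym.
      apply: commrB; first exact/comm_scale/commr1.
      exact/commr_sym/commB_bernA.
    over.
  rewrite -mulr_suml bern_sum mul1r; over.
rewrite bern_var_op opZE ipZl ReCM ler_wpM2l ?invr_ge0//.
by have [? ?] := imN01; exact: psd_01_le.
Qed.

Lemma asym1 : asym 1 1.
Proof.
move=> f e e0; exists 0%N => n _ h; rewrite mul1r op1E subrr nm0.
by rewrite mulr_ge0 ?nm_ge0 ?(ltW e0).
Qed.

Lemma asym_lin a p q Y Z : asym p Y -> asym q Z -> asym (a *: p + q) (a *: Y + Z).
Proof.
move=> hp hq f e e0; have a1 : 0 < nm a + 1 by rewrite ltr_wpDl ?nm_ge0.
have e2 : 0 < e / 2 by rewrite divr_gt0.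
have [N1 h1] := hp f _ (divr_gt0 e2 a1); have [N2 h2] := hq f _ e2.
exists (maxn N1 N2) => n; rewrite geq_max => /andP[/h1 k1 /h2 k2] h.
have -> : beta n ((a *: p + q) * f) h - (a *: Y + Z) (beta n f h) =
   a *: (beta n (p * f) h - Y (beta n f h)) + (beta n (q * f) h - Z (beta n f h)).
  have -> : (a *: p + q) * f = a *: (p * f) + q * f.
    by apply: cfP => x; rewrite !cfE mulrDl mulrA.
  by rewrite beta_lin opDE opZE opDE opZE opprD addrACA -scalerBr.
apply: le_trans (nmD _ _) _; rewrite nmZ.
have k3 : nm a * nm (beta n (p * f) h - Y (beta n f h)) <= e / 2 * nm h.
  apply: le_trans (ler_wpM2l (nm_ge0 a) (k1 h)) _.
  have -> : nm a * (e / 2 / (nm a + 1) * nm h) = nm a / (nm a + 1) * (e / 2 * nm h).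
    by field; rewrite gt_eqF.
  have q1 : nm a / (nm a + 1) <= 1 by rewrite ler_pdivrMr// mul1r lerDl.
  by apply: ler_piMl q1; rewrite mulr_ge0 ?nm_ge0 ?(ltW e2).
by have := k2 h; move: k3; lra.
Qed.

Lemma coord_comb (V : lmodType R[i]) (a b g d e z : R[i]) (u w x : V) :
  a *: (b *: (u + w) + g *: x) + (d *: (e *: (u - w) + g *: x) + (z *: x + x)) =
  (a * b + d * e) *: u + (a * b - d * e) *: w + (a * g + d * g + z + 1) *: x.
Proof.
rewrite !scalerDl !scalerDr !scalerN !scalerA scaleNr scale1r.
by rewrite [LHS](AC (3*(3*2)) ((1*4)*(2*5)*(3*6*7*8))).
Qed.

(** The case s = 1 recovers N, and s = -1 its adjoint, from the rescaled real and imaginary parts.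
    The extra -1 in z compensates for the innermost combination z 1 + 1 of the nested [asym_lin]. *)
Lemma coord_scalars (s : R[i]) :
  let a := (2 * c)%:C in let b := ((4 * c)^-1)%:C in let g := (2^-1)%:C in
  let d := s * (2 * c)%:C * 'i in let e := - ((4 * c)^-1)%:C * 'i in
  let z := - (c%:C + s * c%:C * 'i) - 1 in
  [/\ a * b + d * e = (1 + s) / 2, a * b - d * e = (1 - s) / 2 &
     a * g + d * g + z + 1 = 0].
Proof.
move=> a b g d e z.
have ii : ('i : R[i]) * 'i = -1 by rewrite -expr2 sqr_i.
have C0 : c%:C != 0 :> R[i] by rewrite -[0]/((0 : R)%:C) (inj_eq (@complexI R)) gt_eqF.
have aE : a = 2 * c%:C by rewrite /a rmorphM rmorph_nat.
have bE : b = (4 * c%:C)^-1 by rewrite /b fmorphV rmorphM rmorph_nat.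
have gE : g = 2^-1 by rewrite /g fmorphV rmorph_nat.
have ab : a * b = 2^-1 by rewrite aE bE; field.
have de : d * e = s / 2.
  transitivity (- (s / 2) * ('i * 'i)); last by rewrite ii mulrN1 opprK.
  by rewrite /d /e -/a -/b aE bE; field.
split; rewrite ?ab ?de; [by field|by field|].
by rewrite /z /d -/a aE gE; field.
Qed.

Lemma asymN : asym (cf_id Q) N.
Proof.
have [s1 s2 s3] := coord_scalars 1.
have := asym_lin (2 * c)%:C asymA (asym_lin (1 * (2 * c)%:C * 'i) asymB
  (asym_lin (- (c%:C + 1 * c%:C * 'i) - 1) asym1 asym1)).
rewrite /ucoord /vcoord /reN /imN !coord_comb s1 s2 s3 subrr mul0r !scale0r !addr0.
by rewrite -mulr2n divff ?pnatr_eq0// !scale1r.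
Qed.

Lemma asymNJ : asym (cf_conj (cf_id Q)) (adjoint N).
Proof.
have [s1 s2 s3] := coord_scalars (-1).
have := asym_lin (2 * c)%:C asymA (asym_lin (-1 * (2 * c)%:C * 'i) asymB
  (asym_lin (- (c%:C + -1 * c%:C * 'i) - 1) asym1 asym1)).
rewrite /ucoord /vcoord /reN /imN !coord_comb s1 s2 s3 subrr mul0r !scale0r !add0r !addr0.
by rewrite opprK -mulr2n divff ?pnatr_eq0// !scale1r.
Qed.

Lemma beta_cvg_mul p Z f : asym p Z ->
  (forall h, exists l : H, beta n f h @[n --> \oo] --> l) ->
  forall h, exists l : H, beta n (p * f) h @[n --> \oo] --> l.
Proof.
move=> pZ hf h; have [l hl] := hf h; exists (Z l).
have hZ : Z (beta n f h) @[n --> \oo] --> Z l by apply: blin_cvg hl; exact: blin_op.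
apply/cvgnP_nm => e e0; have e2 : 0 < e / 2 by rewrite divr_gt0.
have h1 : 0 < nm h + 1 by rewrite ltr_wpDl ?nm_ge0.
have [N1 hN1] := pZ f _ (divr_gt0 e2 h1).
have [N2 hN2] := (cvgnP_nm _ _).1 hZ _ e2.
exists (maxn N1 N2) => n; rewrite geq_max => /andP[/hN1/(_ h) k1 /hN2 k2].
apply: le_lt_trans (nm_triB _ (Z (beta n f h)) _) _; apply: half_leltD k2.
apply: le_trans k1 _; rewrite mulrAC ler_pdivrMr// ler_wpM2l ?(ltW e2)//.
by rewrite lerDl.
Qed.

(** By [asymN] and [asymNJ] the set of f with a limit at every h is stable under multiplication by z
    and its conjugate; [beta_bound] makes it uniformly closed. *)
Lemma beta_cvg f h : exists l : H, beta n f h @[n --> \oo] --> l.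
Proof.
move: h; move: f.
apply: (polynomial_density compact_square
  (A := [set f | forall h, exists l : H, beta n f h @[n --> \oo] --> l])).
- move=> h; exists h; rewrite (_ : (fun n => _) = fun=> h); first exact: cvg_cst.
  by apply/funext => n; rewrite beta_one.
- move=> a f g hf hg h; have [l hl] := hf h; have [l' hl'] := hg h.
  exists (a *: l + l').
  rewrite (_ : (fun n => _) = (fun n => a *: beta n f h + beta n g h)).
    by apply: cvgD hl'; exact: cvgZl_tmp hl.
  by apply/funext => n; rewrite beta_lin.
- by move=> f; apply: beta_cvg_mul; exact: asymN.
- by move=> f; apply: beta_cvg_mul; exact: asymNJ.
move=> f hf h; apply: cauchy_cvgn => e e0.
have h1 : 0 < nm h + 1 by rewrite ltr_wpDl ?nm_ge0.
have e3 : 0 < e / 3 by rewrite divr_gt0.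
have d0 : 0 < e / 3 / (nm h + 1) by rewrite divr_gt0.
have [g gA fg] := hf _ d0; have [l hl] := gA h.
have [N0 hN] := (cvgnP_nm _ _).1 hl _ (divr_gt0 e3 (ltr0n R 2)).
have near_g n : nm (beta n f h - beta n g h) <= e / 3.
  rewrite -opBE -(lmB (@beta_lin n)).
  apply: le_trans (beta_bound n (ltW d0) _ h) _; first by move=> x; rewrite cfB.
  rewrite mul1r mulrAC ler_pdivrMr// ler_wpM2l ?(ltW e3)//.
  by rewrite lerDl.
exists N0 => n m /hN n1 /hN m1.
have k1 := nm_triB (beta n f h) (beta n g h) (beta m f h).
have k2 := nm_triB (beta n g h) (beta m g h) (beta m f h).
have k3 := nm_triB (beta n g h) l (beta m g h).
rewrite [nm (l - _)]nmB in k3; rewrite [nm (beta m g h - beta m f h)]nmB in k2.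
have k4 := near_g n; have k5 := near_g m.
have k6 : nm (beta n g h - beta m g h) < e / 3.
  apply: le_lt_trans k3 _; exact: half_ltD n1 m1.
have aux (a b x y z t : R) : a <= x + b -> b <= y + z -> x <= t / 3 -> z <= t / 3 ->
  y < t / 3 -> a < t by clear; lra.
exact: aux k1 k2 k4 k5 k6.
Qed.

Lemma beta_mul_asym p Z f : asym p Z ->
  (forall g h (e : R), 0 < e -> exists N0, forall n, (N0 <= n)%N ->
     nm (beta n (f * g) h - beta n f (beta n g h)) < e) ->
  forall g h (e : R), 0 < e -> exists N0, forall n, (N0 <= n)%N ->
     nm (beta n (p * f * g) h - beta n (p * f) (beta n g h)) < e.
Proof.
move=> pZ hf g h e e0; have e3 : 0 < e / 3 by rewrite divr_gt0.
have [M M0 hM] := cf_bounded compact_square (@cf_continuous R Q g).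
have [C C0 hC] := op_bound Z.
have h1 : 0 < nm h + 1 by rewrite ltr_wpDl ?nm_ge0.
have Mh1 : 0 < M * nm h + 1 by rewrite ltr_wpDl// mulr_ge0 ?nm_ge0 ?(ltW M0).
have [N1 k1] := pZ (f * g) _ (divr_gt0 e3 h1).
have [N2 k2] := hf g h _ (divr_gt0 e3 C0).
have [N3 k3] := pZ f _ (divr_gt0 e3 Mh1).
exists (maxn N1 (maxn N2 N3)) => n.
rewrite !geq_max => /and3P[/k1/(_ h) q1 /k2 q2 /k3/(_ (beta n g h)) q3].
have -> : beta n (p * f * g) h - beta n (p * f) (beta n g h) =
  (beta n (p * (f * g)) h - Z (beta n (f * g) h)) +
  (Z (beta n (f * g) h - beta n f (beta n g h)) -
   (beta n (p * f) (beta n g h) - Z (beta n f (beta n g h)))).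
  by rewrite mulrA opB opprB subrKA subrKA.
apply: le_lt_trans (nmD _ _) _.
have -> : e = e / 3 + (e / 3 + e / 3) by field.
apply: ler_ltD.
  apply: le_trans q1 _; rewrite mulrAC ler_pdivrMr// ler_wpM2l ?(ltW e3)//.
  by rewrite lerDl.
apply: le_lt_trans (nmD _ _) _; rewrite nmN; apply: ltr_leD.
  apply: le_lt_trans (hC _) _; rewrite ltr_pdivlMr// in q2.
  by rewrite mulrC.
apply: le_trans q3 _; rewrite mulrAC ler_pdivrMr// ler_wpM2l ?(ltW e3)//.
have := beta_bound n (ltW M0) hM h; rewrite mul1r => /le_trans; apply.
by rewrite lerDl.
Qed.

(** Bernstein sums are not multiplicative at fixed n. With g and h kept universal, the property of f
    is stable under multiplication by the coordinates, so density of polynomials applies. *)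
Lemma beta_mul f g h (e : R) : 0 < e -> exists N0, forall n, (N0 <= n)%N ->
  nm (beta n (f * g) h - beta n f (beta n g h)) < e.
Proof.
move: e; move: g h; move: f.
apply: (polynomial_density compact_square (A := [set f | forall g h (e : R), 0 < e ->
  exists N0, forall n, (N0 <= n)%N -> nm (beta n (f * g) h - beta n f (beta n g h)) < e])).
- move=> g h e e0; exists 0%N => n _.
  by rewrite mul1r beta_one op1E subrr nm0.
- move=> a f f' hf hf' g h e e0; have a1 : 0 < nm a + 1 by rewrite ltr_wpDl ?nm_ge0.
  have e2 : 0 < e / 2 by rewrite divr_gt0.
  have [N1 h1] := hf g h _ (divr_gt0 e2 a1); have [N2 h2] := hf' g h _ e2.
  exists (maxn N1 N2) => n; rewrite geq_max => /andP[/h1 k1 /h2 k2].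
  have -> : beta n ((a *: f + f') * g) h - beta n (a *: f + f') (beta n g h) =
     a *: (beta n (f * g) h - beta n f (beta n g h)) + (beta n (f' * g) h - beta n f' (beta n g h)).
    have -> : (a *: f + f') * g = a *: (f * g) + f' * g.
      by apply: cfP => x; rewrite !cfE mulrDl mulrA.
    by rewrite !beta_lin !opDE !opZE opprD addrACA -scalerBr.
  apply: le_lt_trans (nmD _ _) _; apply: half_leltD k2; rewrite nmZ.
  rewrite ltr_pdivlMr// in k1; apply: le_trans (ltW k1).
  by rewrite [leLHS]mulrC ler_wpM2l ?nm_ge0// lerDl.
- by move=> f; apply: beta_mul_asym; exact: asymN.
- by move=> f; apply: beta_mul_asym; exact: asymNJ.
move=> f hf g h e e0; have e3 : 0 < e / 3 by rewrite divr_gt0.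
have [M M0 hM] := cf_bounded compact_square (@cf_continuous R Q g).
have Mh1 : 0 < M * nm h + 1 by rewrite ltr_wpDl// mulr_ge0 ?nm_ge0 ?(ltW M0).
have d0 := divr_gt0 e3 Mh1.
have [f' f'A ff'] := hf _ d0; have [N0 k0] := f'A g h _ e3.
exists N0 => n /k0 q0; set d := e / 3 / (M * nm h + 1) in d0 ff'.
have b1 : nm (beta n ((f - f') * g) h) <= d * M * nm h.
  rewrite -[d * M]mul1r; apply: beta_bound; first by rewrite mulr_ge0 ?(ltW d0) ?(ltW M0).
  by move=> x; rewrite cfM cfB nmM; apply: ler_pM; rewrite ?nm_ge0.
have b2 : nm (beta n (f - f') (beta n g h)) <= d * (M * nm h).
  apply: le_trans (beta_bound n (ltW d0) _ _) _; first by move=> x; rewrite cfB.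
  rewrite mul1r; apply: ler_wpM2l (ltW d0) _ _ _.
  by have := beta_bound n (ltW M0) hM h; rewrite mul1r.
have dM : d * (M * nm h) < e / 3.
  rewrite /d mulrAC ltr_pdivrMr// ltr_pM2l// ltrDl//.
have -> : beta n (f * g) h - beta n f (beta n g h) =
  (beta n (f' * g) h - beta n f' (beta n g h)) +
  (beta n ((f - f') * g) h - beta n (f - f') (beta n g h)).
  rewrite mulrBl !(lmB (@beta_lin n)) !opBE opprB addrACA addKr.
  by rewrite [beta n (f' * g) h + _]addrC subrK.
rewrite -mulrA in b1.
apply: le_lt_trans (nmD _ _) _.
have -> : e = e / 3 + (e / 3 + e / 3) by field.
apply: ltrD => //; apply: le_lt_trans (nmD _ _) _; rewrite nmN.
by apply: ltrD; [exact: le_lt_trans b1 dM|exact: le_lt_trans b2 dM].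
Qed.

(** A calculus on a square depending only on a norm bound for N. It is cut down to sets containing
    the spectrum later, through the spectral measure. *)
Lemma square_rep : exists pi : CQ -> 'B(H), rep pi /\ pi (cf_id Q) = N.
Proof.
have [pi [rpi hpi]] := limit_rep compact_square beta_lin beta_bound beta_one beta_adj
   beta_cvg beta_mul.
exists pi; split => //; apply/boundedOpP => h; apply: hcvg_unique (hpi _ h) _.
apply/cvgnP_nm => e e0.
have h1 : 0 < nm h + 1 by rewrite ltr_wpDl ?nm_ge0.
have [N0 k0] := asymN 1 (divr_gt0 e0 h1); exists N0 => n /k0/(_ h).
rewrite mulr1 beta_one op1E => /le_lt_trans; apply.
by rewrite mulrAC ltr_pdivrMr// ltr_pM2l// ltrDl.
Qed.

End normal_functional_calculus.

(** * The Riesz representation theorem *)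

Lemma valLE (U : Type) (V : Type) (v : V) (A : set U) (f : A -> V) (x : A) : valL_ v f (val x) = f x.
Proof. exact: (congr1 (fun g => g x) (congr1 (fun g => g f) (@sigL_valL U V v A))). Qed.

Section outer_measure.
Context (R : realType) (X : set R[i]) (hX : compact X) (L : (X -> R) -> R).
Hypothesis LP : positive_functional L.
Notation borelC := (g_sigma_algebraType (@open R[i])).

Definition muR (A : set R[i]) : R := inf [set premeas L U | U in [set U | open U /\ A `<=` U]].

Lemma muR_has_inf A : has_inf [set premeas L U | U in [set U | open U /\ A `<=` U]].
Proof.
split; first by exists (premeas L setT), setT => //; split; [exact: openT|].
by exists 0 => _ [U _ <-]; exact: premeas_ge0.
Qed.

Lemma muR_le A U : open U -> A `<=` U -> muR A <= premeas L U.
Proof. by move=> oU AU; apply: ge_inf; [exact: (muR_has_inf A).2|exists U]. Qed.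

Lemma muR_ge A c : (forall U, open U -> A `<=` U -> c <= premeas L U) -> c <= muR A.
Proof.
move=> h; apply: lb_le_inf; first exact: (muR_has_inf A).1.
by move=> _ [U [oU AU] <-]; exact: h.
Qed.

Lemma muR_ge0 A : 0 <= muR A.
Proof. by apply: muR_ge => U _ _; exact: premeas_ge0. Qed.

Lemma muR_mono A B : A `<=` B -> muR A <= muR B.
Proof. by move=> AB; apply: muR_ge => U oU BU; apply: muR_le => // x /AB/BU. Qed.

Lemma muR_open U : open U -> muR U = premeas L U.
Proof.
move=> oU; apply/eqP; rewrite eq_le muR_le//=; apply: muR_ge => V _.
exact: premeas_mono.
Qed.

Lemma premeas_out U : X `&` U `<=` set0 -> premeas L U = 0.
Proof.
move=> XU; apply/eqP; rewrite eq_le premeas_ge0// andbT.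
apply: premeas_le => // u [cu hu].
have -> : u = fun x => 0 * 1.
  apply/funext => x; rewrite mul0r; have [_ _] := hu x; apply => Ux.
  by apply: (XU (val x)); split => //; exact: set_valP.
by rewrite pfZ ?mul0r//; exact: ctsR_cst.
Qed.

Lemma muR0 : muR set0 = 0.
Proof. by rewrite muR_open; [apply: premeas_out; rewrite setI0|exact: open0]. Qed.

Lemma geometric_sum (e : R) n : 0 <= e -> \sum_(i < n) e / 2 ^+ i.+1 <= e.
Proof.
move=> e0; suff : \sum_(i < n) e / 2 ^+ i.+1 = e - e / 2 ^+ n.
  by move=> ->; rewrite gerBl divr_ge0// exprn_ge0.
elim: n => [|n IH]; first by rewrite big_ord0 expr0 divr1 subrr.
rewrite big_ord_recr/= IH exprS; have p0 : 2 ^+ n != 0 :> R by rewrite expf_neq0.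
by field.
Qed.

Lemma muR_approx A (e : R) : 0 < e -> exists U, [/\ open U, A `<=` U & premeas L U < muR A + e].
Proof.
by move=> e0; have [_ [U [oU AU] <-] h] := inf_adherent e0 (muR_has_inf A); exists U.
Qed.

(** Bounding all partial sums by a real c keeps the argument in [R]; infinite totals are dealt with
    where the outer measure is built. *)
Lemma muR_subadditive (F : nat -> set R[i]) (c : R) :
  (forall n, \sum_(i < n) muR (F i) <= c) -> muR (\bigcup_i F i) <= c.
Proof.
move=> hc; apply/ler_addgt0Pr => e e0; have e2 : 0 < e / 2 by rewrite divr_gt0.
have ex i : exists U, [/\ open U, F i `<=` U & premeas L U < muR (F i) + e / 2 / 2 ^+ i.+1].
  by apply: muR_approx; rewrite divr_gt0// exprn_gt0.
have [U hU] := choice ex.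
have oU i : open (U i) by case: (hU i).
have UU : \bigcup_i F i `<=` \bigcup_i U i by apply: subset_bigcup => i _; case: (hU i).
apply: le_trans (muR_le _ UU) _; first exact: bigcup_open.
apply: premeas_le => // u tu.
have [n hn] := premeas_subadditive hX LP oU tu e2.
apply: le_trans hn _.
have : \sum_(i < n) premeas L (U i) <= \sum_(i < n) muR (F i) + \sum_(i < n) e / 2 / 2 ^+ i.+1.
  by rewrite -big_split/=; apply: ler_sum => i _; case: (hU i) => _ _ /ltW.
by have := @geometric_sum (e / 2) n (ltW e2); have := hc n; lra.
Qed.

(** Functions live on the subtype X, measures on the plane. A superlevel set is extended to an open
    set of the plane as a union of balls. *)
Lemma open_trace (u : X -> R) (a : R) : continuous u ->
  exists V, open V /\ forall x : X, V (val x) <-> a < u x.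
Proof.
move=> cu; exists [set z | exists x : X, exists2 d : R, nm (z - val x) < d &
    forall y : X, nm (val y - val x) < d -> a < u y]; split.
  rewrite openE => z [x [d zx hd]]; apply/nbhs_CP.
  exists (d - nm (z - val x)); first by rewrite subr_gt0.
  move=> w wz; exists x, d => //; have := nm_triB w z (val x); lra.
move=> x; split=> [[y [d xy]]|ax]; first exact.
have [d d0 hd] := (ctsXRP u).1 cu x (u x - a) (ltac:(by rewrite subr_gt0)).
exists x, d; first by rewrite subrr nm0.
by move=> y /hd; rewrite ltr_norml => /andP[h _]; move: h; rewrite opprB ltrBrDr subrK.
Qed.

Let clX : open (~` X).
Proof. by apply: closed_openC; apply: compact_closed => //; exact: (@norm_hausdorff R[i] R[i]^o). Qed.

Lemma muR_split U A : open U -> muR (A `&` U) + muR (A `&` ~` U) <= muR A.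
Proof.
move=> oU; apply: muR_ge => W oW AW; apply/ler_addgt0Pr => e e0.
have e2 : 0 < e / 2 by rewrite divr_gt0.
have [u tu hu] := premeas_approx LP (W `&` U) e2.
have L1 : 0 < L (fun=> 1) + 1.
  rewrite ltr_wpDl//; apply: (pf_ge0 LP); first exact: ctsR_cst.
  by move=> x; exact: ler01.
pose d := e / 2 / (L (fun=> 1) + 1); have d0 : 0 < d by rewrite divr_gt0.
have cNu : continuous (fun x : X => 0 - u x) by apply: ctsR_sub; [exact: ctsR_cst|exact: tu.1].
(* [V0] extends the set u < d. Since u vanishes off U, adding the complement of X gives an open V
   that contains A minus U and on which u <= d. *)
have [V0 [oV0 hV0]] := open_trace (- d) cNu.
pose V := W `&` (V0 `|` ~` X).
have oV : open V by apply: openI => //; exact: openU.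
have sp : L u + premeas L V <= premeas L W + d * L (fun=> 1).
  apply: (premeas_split LP oU tu d0); first exact: subIsetl.
  move=> x [_ [/hV0|]]; last by move=> nX; exfalso; apply: nX; exact: set_valP.
  by rewrite sub0r ltrN2 => /ltW.
have h1 : muR (A `&` U) <= premeas L (W `&` U).
  by apply: muR_le; [exact: openI|exact: setSI].
have h2 : muR (A `&` ~` U) <= premeas L V.
  apply: muR_le => // z [Az nU]; split; first exact: AW.
  have [Xz|nX] := pselect (X z); [left|by right].
  have /= := (hV0 (exist _ z (mem_set Xz))).2; apply.
  have [_ _ ->] := tu.2 (exist _ z (mem_set Xz)); last by case.
  by rewrite subrr oppr_lt0.
have h3 : d * L (fun=> 1) <= e / 2.
  by rewrite /d mulrAC ler_pdivrMr// ler_wpM2l ?(ltW e2)// lerDl.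
move: sp h1 h2 h3 hu; clear; lra.
Qed.

Lemma riesz_outer_exists : exists2 mu : {outer_measure set R[i] -> \bar R},
  (forall A, mu A = (muR A)%:E) & forall U, open U -> mu.-caratheodory U.
Proof.
pose f (A : set R[i]) := (muR A)%:E.
have f0 : f set0 = 0%E by rewrite /f muR0.
have f_ge0 A : (0 <= f A)%E by rewrite lee_fin muR_ge0.
have f_mono : {homo f : A B / A `<=` B >-> (A <= B)%E}.
  by move=> A B AB; rewrite lee_fin muR_mono.
have f_sub : sigma_subadditive f.
  move=> F; have part n : ((\sum_(i < n) muR (F i))%:E <= \sum_(i <oo) f (F i))%E.
    rewrite -sumEFin (le_trans _ (@nneseries_lim_ge R (fun i => f (F i)) xpredT 0 n _))//.
    by rewrite big_mkord.
  have : (0 <= \sum_(i <oo) f (F i))%E by apply: nneseries_ge0 => i _ _.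
  case: (\sum_(i <oo) f (F i))%E part => [c| |] // part _; last by rewrite leey.
  by rewrite lee_fin; apply: muR_subadditive => n; have := part n; rewrite lee_fin.
pose mu := HB.pack_for {outer_measure set R[i] -> \bar R} f
  (isOuterMeasure.Build R R[i] f f0 f_ge0 f_mono f_sub).
exists mu => // U oU; apply: le_caratheodory_measurable => A.
by rewrite -EFinD lee_fin; exact: muR_split.
Qed.

Lemma riesz_measure_exists : exists mu : {measure set borelC -> \bar R},
  forall A, mu A = (muR A)%:E.
Proof.
have [nu nuE nuU] := riesz_outer_exists.
pose f (A : set borelC) := (muR A)%:E.
have sub : @measurable _ borelC `<=` nu.-cara.-measurable.
  apply: smallest_sub; last by move=> U oU; exact: nuU.
  split=> [|A mA|F mF]; [exact: measurable0|by rewrite setTD; exact: measurableC|].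
  exact: bigcupT_measurable.
have f0 : f set0 = 0%E by rewrite /f muR0.
have f_ge0 A : (0 <= f A)%E by rewrite lee_fin muR_ge0.
have f_sig : semi_sigma_additive f.
  move=> F mF tF mUF; have := @caratheodory_measure_sigma_additive R _ nu F
    (fun i => sub _ (mF i)) tF (sub _ mUF).
  by rewrite /f -nuE; under [in X in X -> _]eq_fun do under eq_bigr do rewrite nuE.
pose mu := HB.pack_for {measure set borelC -> \bar R} f
  (isMeasure.Build _ _ _ f f0 f_ge0 f_sig).
by exists mu.
Qed.

End outer_measure.

Lemma valL_in (U V : Type) (v : V) (A : set U) (f : A -> V) (z : U) (Az : A z) :
  valL_ v f z = f (exist _ z (mem_set Az)).
Proof. exact: (valLE v f (exist _ z (mem_set Az))). Qed.

Section borel_plane.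
Context (R : realType).
Notation borelC := (g_sigma_algebraType (@open R[i])).

Lemma open_borel (U : set R[i]) : open U -> measurable (U : set borelC).
Proof. exact: sub_sigma_algebra. Qed.

Lemma closed_borel (U : set R[i]) : closed U -> measurable (U : set borelC).
Proof.
move=> cU; rewrite -[U]setCK; apply: measurableC; apply: open_borel.
exact: closed_openC.
Qed.

Lemma compact_closedC (U : set R[i]) : compact U -> closed U.
Proof. by move=> cU; apply: compact_closed => //; exact: (@norm_hausdorff R[i] R[i]^o). Qed.

Lemma compact_borel (U : set R[i]) : compact U -> measurable (U : set borelC).
Proof. by move=> /compact_closedC/closed_borel. Qed.
End borel_plane.
Arguments compact_borel {R U}.

Section integration.
Context (R : realType) (X : set R[i]) (hX : compact X).
Notation borelC := (g_sigma_algebraType (@open R[i])).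
Context (mu : {measure set borelC -> \bar R}) (mu_fin : (mu setT < +oo)%E).
Let mX := compact_borel hX.

Lemma measurable_valL (u : X -> R) : continuous u ->
  measurable_fun (X : set borelC) (valL_ 0 u : borelC -> R).
Proof.
move=> cu; apply: (measurability _ (measurable_realfun.RGenOInfty.measurableE R)) => _ [_ [a ->] <-].
have [V [oV hV]] := open_trace a cu.
rewrite (_ : _ `&` _ = (X : set borelC) `&` V); first exact: measurableI (open_borel oV).
apply/seteqP; split=> z [Xz]; have := valL_in 0 u Xz;
  rewrite /= in_itv/= andbT => ->.
  by rewrite -hV.
by move=> Vz; split => //; rewrite -hV.
Qed.

Lemma mu_lty (D : set borelC) : measurable D -> (mu D < +oo)%E.
Proof.
move=> mD; apply: le_lt_trans mu_fin; apply: le_measure; rewrite ?inE//.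
Qed.

Lemma bounded_realfun (u : X -> R) : continuous u -> exists2 M : R, 0 < M & forall x, `|u x| <= M.
Proof.
move=> cu; have [M M0 hM] := @cf_bounded R X hX (fun x => (u x)%:C) (ctsC cu).
by exists M => // x; have := hM x; rewrite nmC.

Qed.

Lemma integrable_valL (u : X -> R) : continuous u ->
  mu.-integrable X (EFin \o (valL_ 0 u : borelC -> R)).
Proof.
move=> cu; apply: measurable_bounded_integrable => //; first exact: mu_lty.
  exact: measurable_valL.
have [M M0 hM] := bounded_realfun cu; exists M; split; first exact: num_real.
move=> N /ltW MN z Xz; apply: le_trans MN.
rewrite (valL_in _ _ Xz); exact: hM.
Qed.

Lemma valL_eq (V W : Type) (v : V) (w : W) (f : V -> W) (u : X -> V) (z : R[i]) : X z ->
  f (valL_ v u z) = valL_ w (fun x => f (u x)) z.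
Proof. by move=> Xz; rewrite !(valL_in _ _ Xz). Qed.

Lemma valL_eq2 (V W U : Type) (v : V) (v' : U) (w : W) (f : V -> U -> W) (u : X -> V) (u' : X -> U) (z : R[i]) :
  X z -> f (valL_ v u z) (valL_ v' u' z) = valL_ w (fun x => f (u x) (u' x)) z.
Proof. by move=> Xz; rewrite !(valL_in _ _ Xz). Qed.

Definition int_functional (u : X -> R) : R := \int[mu]_(z in (X : set borelC)) valL_ 0 u z.

Lemma int_functional_positive : positive_functional int_functional.
Proof.
split=> [u v cu cv|c u cu|u cu u0].
- rewrite /int_functional -RintegralD//; [|exact: integrable_valL|exact: integrable_valL].
  by apply: eq_Rintegral => z; rewrite inE => Xz; rewrite (@valL_eq2 _ _ _ _ _ 0 +%R).
- rewrite /int_functional -RintegralZl//; last exact: integrable_valL.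
  by apply: eq_Rintegral => z; rewrite inE => Xz; rewrite (@valL_eq _ _ _ 0 ( *%R c)).
apply: Rintegral_ge0 => z Xz.
by rewrite (valL_in _ _ Xz).
Qed.

Lemma int_functional_ge (u : X -> R) (D : set borelC) : measurable D -> D `<=` X -> continuous u ->
  (forall x, 0 <= u x) -> (forall x : X, D (val x) -> 1 <= u x) -> fine (mu D) <= int_functional u.
Proof.
move=> mD DX cu u0 uD; rewrite -[fine _]mul1r -Rintegral_cst// /int_functional.
have -> : \int[mu]_(_ in D) (1 : R) = \int[mu]_(z in X) (\1_D z : R).
  rewrite -[in LHS](setIidl DX) setIC Rintegral_mkcondr; apply: eq_Rintegral => z _.
  by rewrite patchE indicE; case: (z \in D).
apply: le_Rintegral => //; last 2 first.
- exact: integrable_valL.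
- move=> z Xz; rewrite indicE; case: (boolP (z \in D)) => [|_].
    rewrite inE => Dz; rewrite (valL_in _ _ Xz).
    exact: uD.
  by rewrite (valL_in _ _ Xz).
apply: measurable_bounded_integrable => //; first exact: mu_lty.
exists 1; split; first exact: num_real.
move=> N /ltW N1 z _; apply: le_trans N1; rewrite /= indicE.
by case: (_ \in _); rewrite ?normr1 ?normr0.
Qed.

Lemma int_functional_le (u : X -> R) (D : set borelC) : measurable D -> D `<=` X -> continuous u ->
  (forall x : X, u x <= 1) -> (forall x : X, ~ D (val x) -> u x <= 0) -> int_functional u <= fine (mu D).
Proof.
move=> mD DX cu u1 uD; rewrite -[fine _]mul1r -Rintegral_cst// /int_functional.
have -> : \int[mu]_(_ in D) (1 : R) = \int[mu]_(z in X) (\1_D z : R).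
  rewrite -[in LHS](setIidl DX) setIC Rintegral_mkcondr; apply: eq_Rintegral => z _.
  by rewrite patchE indicE; case: (z \in D).
apply: le_Rintegral => //.
- exact: integrable_valL.
- apply: measurable_bounded_integrable => //; first exact: mu_lty.
  exists 1; split; first exact: num_real.
move=> N /ltW N1 z _; apply: le_trans N1; rewrite /= indicE.
by case: (_ \in _); rewrite ?normr1 ?normr0.
move=> z Xz; rewrite indicE (valL_in _ _ Xz).
case: (boolP (_ \in D)) => [_|]; first exact: u1.
by rewrite notin_setE => nD; exact: uD.
Qed.

Lemma complex_integral_support (D : set R[i]) : measurable (D : set borelC) -> D `<=` X ->
  mu (~` D) = 0%E ->
  complex_integral mu X (valL_ 0 (cf_id X)) = complex_integral mu D id.
Proof.
move=> mD DX nD.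
have key (g : R[i] -> R) : continuous (fun x : X => g (val x)) ->
   \int[mu]_(z in (X : set borelC)) valL_ 0 (fun x : X => g (val x)) z =
   \int[mu]_(z in (D : set borelC)) g z.
  move=> cg; rewrite /Rintegral (@negligible_integral _ _ _ mu (X : set borelC) (~` D))//; last first.
  - exact: integrable_valL.
  - exact: measurableC.
  congr fine; rewrite setDE setCK (setIidr DX); apply: eq_integral => z; rewrite inE => Dz.
  by rewrite (valL_in _ _ (DX z Dz)).
have cR : continuous (fun x : X => complex.Re (val x)) by apply: ctsRe; exact: cts_val.
have cI : continuous (fun x : X => complex.Im (val x)) by apply: ctsIm; exact: cts_val.
rewrite /complex_integral -(key _ cR) -(key _ cI).
congr (_ +i* _); apply: eq_Rintegral => z; rewrite inE => Xz.
  by rewrite (valL_in 0 (cf_id X) Xz) (valL_in 0 (fun x : X => complex.Re (val x)) Xz) cf_idE.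
by rewrite (valL_in 0 (cf_id X) Xz) (valL_in 0 (fun x : X => complex.Im (val x)) Xz) cf_idE.
Qed.

End integration.

Section layers.
Context (R : realType) (X : set R[i]).
Implicit Types (u : X -> R).

(** The part of n u between the heights k and k + 1. *)
Definition layer u n k (x : X) : R := Num.min (Num.max (n%:R * u x - k%:R) 0) 1.

Lemma layer_continuous u n k : continuous u -> continuous (layer u n k).
Proof.
move=> cu; apply: ctsR_min; last exact: ctsR_cst.
apply: ctsR_max; last exact: ctsR_cst.
by apply: ctsR_sub; [apply: ctsR_mul => //; exact: ctsR_cst|exact: ctsR_cst].
Qed.

Lemma layer_ge0 u n k x : 0 <= layer u n k x.
Proof. by rewrite le_min ler01 le_max lexx orbT. Qed.
Lemma layer_le1 u n k x : layer u n k x <= 1.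
Proof. by rewrite ge_min lexx orbT. Qed.

Lemma layer_sum u n K x : 0 <= u x -> n%:R * u x <= K%:R ->
  \sum_(k < K) layer u n k x = n%:R * u x.
Proof.
move=> u0 uK; have nu0 : 0 <= n%:R * u x by rewrite mulr_ge0.
suff -> : \sum_(k < K) layer u n k x = Num.min (n%:R * u x) K%:R by rewrite min_l.
rewrite /layer; move: (n%:R * u x) nu0 => t t0; clear uK.
elim: K => [|K IH]; first by rewrite big_ord0 min_r.
rewrite big_ord_recr/= IH -natr1; have K0 : 0 <= K%:R :> R by [].
move: (K%:R) K0 => a a0; rewrite /Num.min /Num.max.
by case: (ltP t a) => h1; case: (ltP (t - a) 0) => h2; case: ltP => h3; case: ltP => h4; lra.
Qed.

(** Two positive functionals trapped by the same decreasing weights m differ by at most m 0 on n u.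
    As m 0 stays bounded while n grows, they agree. *)
Lemma layer_bounds (L : (X -> R) -> R) u n K (m : nat -> R) : positive_functional L ->
  continuous u -> (forall x, 0 <= u x) -> (forall x, n%:R * u x <= K%:R) ->
  (forall k, m k.+1 <= L (layer u n k) <= m k) -> m K >= 0 ->
  \sum_(k < K) m k - m 0%N <= n%:R * L u <= \sum_(k < K) m k.
Proof.
move=> LP cu u0 uK hm mK.
have -> : n%:R * L u = \sum_(k < K) L (layer u n k).
  rewrite -(pfZ LP)// -(pf_sum LP)//; last by move=> k; exact: layer_continuous.
  by congr L; apply/funext => x; rewrite layer_sum.
apply/andP; split; last by apply: ler_sum => k _; case/andP: (hm k).
apply: (@le_trans _ _ (\sum_(k < K) m k.+1)); last by apply: ler_sum => k _; case/andP: (hm k).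
have : m 0%N + \sum_(k < K) m k.+1 = \sum_(k < K) m k + m K.
  clear; elim: K => [|K IH]; first by rewrite !big_ord0 addrC.
  by rewrite !big_ord_recr/= addrA IH.
by move: mK; move: (m 0%N) (m K) (\sum_(k < K) m k) (\sum_(k < K) m k.+1) => a b d e; lra.
Qed.

End layers.

Section riesz.
Context (R : realType) (X : set R[i]) (hX : compact X) (L : (X -> R) -> R).
Hypothesis LP : positive_functional L.
Notation borelC := (g_sigma_algebraType (@open R[i])).
Let mX := compact_borel hX.

Theorem riesz_representation_measure : exists mu : {measure set borelC -> \bar R},
  [/\ mu (~` X) = 0%E, forall U, open U -> mu U = (premeas L U)%:E &
   forall u : X -> R, continuous u ->
     L u = \int[mu]_(z in (X : set borelC)) valL_ 0 u z].
Proof.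
have [mu muE] := riesz_measure_exists hX LP; exists mu.
have muU U : open U -> mu U = (premeas L U)%:E.
  by move=> oU; rewrite muE (muR_open _ oU).
have mufin : (mu setT < +oo)%E by rewrite muE ltry.
have muX : mu (~` X) = 0%E.
  rewrite muU; last by apply: closed_openC; exact: compact_closedC.
  by rewrite (premeas_out LP)//; rewrite setICr.
have muXV (V : set R[i]) : open V -> mu ((X : set borelC) `&` V) = (premeas L V)%:E.
  move=> oV; rewrite -muU// -[in RHS](setTI V) -[setT](setvU X) setIUl measureU.
  - by rewrite [X in (X + _)%E](_ : _ = 0%E) ?add0e//; apply/eqP; rewrite eq_le measure_ge0 andbT -muX; apply: le_measure; rewrite ?inE; [apply: measurableI => //; [exact: measurableC|exact: open_borel]|exact: measurableC|exact: subIsetl].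
  - by apply: measurableI; [exact: measurableC|exact: open_borel].
  - by apply: measurableI => //; exact: open_borel.
  - by rewrite setIACA setICl set0I.
have IP := int_functional_positive hX mufin.
split => // u cu; rewrite -[RHS]/(int_functional mu u).
have L1_ge0 : 0 <= L (fun=> 1) by apply: (pf_ge0 LP); [exact: ctsR_cst|move=> x; exact: ler01].
have nonneg (v : X -> R) : continuous v -> (forall x, 0 <= v x) -> L v = int_functional mu v.
  move=> cv v0; have [M M0 hM] := bounded_realfun hX cv.
  (* A bound independent of n forces the difference to be 0. *)
  suff key n : n%:R * `|L v - int_functional mu v| <= premeas L setT.
    apply/eqP; rewrite -subr_eq0 -normr_le0 leNgt; apply/negP => d0.
    have := key (Num.truncn (premeas L setT / `|L v - int_functional mu v|)).+1.
    apply/negP; rewrite -ltNge -ltr_pdivrMr//; exact: real_truncnS_gt (num_real _).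
  pose K := (Num.truncn (n%:R * M)).+1.
  have hK x : n%:R * v x <= K%:R.
    apply: (@le_trans _ _ (n%:R * M)); last exact/ltW/real_truncnS_gt/num_real.
    by rewrite ler_wpM2l// (le_trans (ler_norm _)).
  have cnv : continuous (fun x => n%:R * v x) by apply: ctsR_mul => //; exact: ctsR_cst.
  (* On X, [V k] is the set n v > k. The k-th layer is 1 on [V k.+1] and 0 off [V k], so both
     functionals are squeezed between the masses of these two sets. *)
  have [V hV] := choice (fun k : nat => open_trace k%:R cnv).
  have oV k : open (V k) by case: (hV k).
  have lV k x : V k.+1 (val x) -> layer v n k x = 1.
    move=> /(hV k.+1).2; rewrite -natr1 => h.
    by rewrite /layer min_r// le_max lerBrDl ltW.
  have lV0 k x : ~ V k (val x) -> layer v n k x = 0.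
    move=> h; have {}h : n%:R * v x <= k%:R by rewrite leNgt; apply/negP => /(hV k).2.
    by rewrite /layer max_r ?subr_le0// min_l.
  have lc k := @layer_continuous R X v n k cv.
  have h1 k : premeas L (V k.+1) <= L (layer v n k) <= premeas L (V k).
    apply/andP; split.
      apply: (premeas_le LP) => w [cw hw]; apply: (pf_le LP) => // x.
      have [_ w1 w2] := hw x; have [/lV->//|/w2->] := pselect (V k.+1 (val x)).
      exact: layer_ge0.
    apply: (premeas_ub LP); split => // x; split; [exact: layer_ge0|exact: layer_le1|].
    exact: lV0.
  have h2 k : premeas L (V k.+1) <= int_functional mu (layer v n k) <= premeas L (V k).
    have e j : premeas L (V j) = fine (mu ((X : set borelC) `&` V j)) by rewrite muXV.
    have mV j : measurable ((X : set borelC) `&` V j) by apply: measurableI => //; exact: open_borel.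
    rewrite !e; apply/andP; split.
      apply: (int_functional_ge hX mufin (mV k.+1) (@subIsetl _ _ _) (lc k)).
        by move=> x; exact: layer_ge0.
      by move=> x [_ /lV->].
    apply: (int_functional_le hX mufin (mV k) (@subIsetl _ _ _) (lc k)).
      by move=> x; exact: layer_le1.
    move=> x h; rewrite lV0// => Vx; apply: h; split => //; exact: set_valP.
  have mK := premeas_ge0 LP (V K).
  have b1 := layer_bounds LP cv v0 hK h1 mK.
  have b2 := layer_bounds IP cv v0 hK h2 mK.
  have m0 : premeas L (V 0%N) <= premeas L setT by apply: (premeas_mono LP).
  rewrite -[n%:R]ger0_norm// -normrM mulrBr ler_norml.
  move: b1 b2 m0 => /andP[]; move: (n%:R * L v) (n%:R * int_functional mu v) => a b.
  by move=> h3 h4 /andP[h5 h6] h7; apply/andP; split; lra.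
(* A general u is handled by adding a constant that makes it nonnegative. *)
have [M M0 hM] := bounded_realfun hX cu.
have cM : continuous (fun _ : X => M) by exact: ctsR_cst.
have cuM : continuous (fun x => u x + M) by exact: ctsR_add.
have := nonneg _ cuM; rewrite (pfD LP)// (pfD IP)// (nonneg _ cM); last by move=> _; exact: ltW.
move=> /(_ _)/addIr; apply => x.
by have := hM x; rewrite ler_norml => /andP[]; lra.
Qed.

End riesz.

(** * Spectral measures *)

Section dense_sequences.
Context (R : realType).

Definition rational_point (n : nat) : R[i] :=
  if unpickle n is Some (a, b) then ratr a +i* ratr b else 0.

Lemma rational_point_dense (z : R[i]) (e : R) : 0 < e -> exists n, nm (z - rational_point n) < e.
Proof.
move=> e0; have e2 : 0 < e / 2 by rewrite divr_gt0.
have near (t : R) : exists a : rat, `|t - ratr a| < e / 2.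
  have [|a] := @rat_in_itvoo R (t - e / 2) (t + e / 2); first by move: e2; lra.
  rewrite in_itv/= => /andP[h1 h2]; exists a.
  by rewrite ltr_norml; apply/andP; split; lra.
have [a ha] := near (complex.Re z); have [b hb] := near (complex.Im z).
exists (pickle (a, b)); rewrite /rational_point pickleK.
by apply: le_lt_trans (nm_le_ReIm _) _; rewrite ReB ImB; exact: half_ltD.
Qed.

(** One point of X is picked in each ball with rational centre and radius 1 / (k + 1) that meets X,
    since rational points themselves may miss X. *)
Lemma dense_sequence (X : set R[i]) : X !=set0 ->
  exists s : nat -> X, forall (x : X) (e : R), 0 < e -> exists n, nm (val x - val (s n)) < e.
Proof.
move=> [x0 Xx0].
pose Q (p : nat * nat) (y : X) := nm (val y - rational_point p.1) < p.2.+1%:R^-1.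
have ex (n : nat) : exists y : X, forall p : nat * nat, unpickle n = Some p -> (exists y', Q p y') -> Q p y.
  case: (unpickle n) => [p|]; last by exists (exist _ x0 (mem_set Xx0)).
  have [[y hy]|no] := pselect (exists y', Q p y').
    by exists y => _ [<-] _.
  by exists (exist _ x0 (mem_set Xx0)) => _ [<-] /no.
have [s hs] := choice ex; exists s => x e e0.
have e2 : 0 < e / 2 by rewrite divr_gt0.
have [k hk] : exists k : nat, k.+1%:R^-1 < e / 2.
  exists (Num.truncn (e / 2)^-1); rewrite invf_plt ?posrE//.
  exact: real_truncnS_gt (num_real _).
have [m hm] : exists m, nm (val x - rational_point m) < k.+1%:R^-1.
  by apply: rational_point_dense; rewrite invr_gt0.
exists (pickle (m, k)).
have := hs (pickle (m, k)) (m, k) (pickleK _) (ex_intro _ x hm); rewrite /Q/= nmB => h1.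
apply: le_lt_trans (nm_triB _ (rational_point m) _) _.
by apply: half_ltD; [exact: lt_trans hm hk|exact: lt_trans h1 hk].
Qed.

End dense_sequences.

Section projections.
Context (R : realType) (H : hilbertType R).
Implicit Types (P Q S T : 'B(H)) (h x y : H).

Lemma op_quad_ext S T : (forall h, dotp (S h) h = dotp (T h) h) -> S = T.
Proof.
move=> h; apply/boundedOpP => x; apply/eqP; rewrite -subr_eq0; apply/eqP/nm_eq0/eqP.
rewrite eq_le nm_ge0 andbT -opBE.
have := @numerical_radius R H (S - T) 0 (lexx 0) _ x; rewrite mulr0 !mul0r; apply => y.
by rewrite opBE ipBl h subrr nm0 mul0r.
Qed.

Lemma self_adjoint_real T h : adjoint T = T -> dotp (T h) h = (complex.Re (dotp (T h) h))%:C.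
Proof.
move=> aT; apply: ReIm_inj => //=.
have : dotp (T h) h = (dotp (T h) h)^* by rewrite -ipC adjointP aT.
move=> /(congr1 (@complex.Im R)); rewrite ImJ => e.
by apply/eqP; move: e; lra.
Qed.

Lemma projection_nm P h : orthogonal_projection P -> dotp (P h) h = (nm (P h) ^+ 2)%:C.
Proof. by move=> [PP aP]; rewrite -ipxx [RHS]adjointPr aP -[P (P h)]opME PP. Qed.

Lemma projection_nm_le P h : orthogonal_projection P -> nm (P h) <= nm h.
Proof.
move=> pP; have := Re_ip_le (P h) h; rewrite projection_nm//= expr2.
have [->|P0] := eqVneq (nm (P h)) 0; first by rewrite nm_ge0.
by rewrite ler_pM2l// lt_def P0 nm_ge0.
Qed.

Lemma projection_orth P Q : orthogonal_projection P -> orthogonal_projection Q ->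
  (forall h, nm (P h) ^+ 2 + nm (Q h) ^+ 2 <= nm h ^+ 2) -> P * Q = 0.
Proof.
move=> pP [QQ _] hPQ; apply/boundedOpP => x; apply: nm_eq0; rewrite opME.
have := hPQ (Q x); rewrite -[in Q (Q x)]opME QQ gerDr => h.
by apply/eqP; rewrite -sqrf_eq0 eq_le h sqr_ge0.
Qed.

(** The double limit of <T_n h, T_m h> makes T_n h Cauchy. The limit satisfies <P h, P h> = q(h) =
    <P h, h>, which for a self-adjoint P means P^2 = P. *)
Lemma projection_limit (T_ : nat -> 'B(H)) (q : H -> R) :
  (forall n, adjoint (T_ n) = T_ n) -> (forall n h, nm (T_ n h) <= nm h) ->
  (forall h (e : R), 0 < e -> exists N, forall n m, (N <= n)%N -> (N <= m)%N ->
     `|complex.Re (dotp (T_ n h) (T_ m h)) - q h| < e) ->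
  (forall h, complex.Re (dotp (T_ n h) h) @[n --> \oo] --> q h) ->
  exists P, orthogonal_projection P /\ forall h, dotp (P h) h = (q h)%:C.
Proof.
move=> aT bT cT qT.
have Tc h : exists l : H, T_ n h @[n --> \oo] --> l.
  apply: cauchy_cvgn => e e0; have e4 : 0 < e ^+ 2 / 4 by rewrite divr_gt0// exprn_gt0.
  have [N hN] := cT h _ e4; exists N => n m Nn Nm.
  apply: sqr_lt_eps; rewrite ?nm_ge0// nmB_sqr !nm_sqrE.
  have := hN n n Nn Nn; have := hN n m Nn Nm; have := hN m m Nm Nm.
  by rewrite !ltr_norml => /andP[? ?] /andP[? ?] /andP[? ?]; lra.
have [P [hP _]] := @strong_limit R H T_ 1 (fun n x => ltac:(rewrite mul1r; exact: bT)) Tc.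
have aP : adjoint P = P.
  apply: adjoint_uniq => x y; apply: cvgC_unique (_ : cvgC (fun n => dotp (T_ n x) y) _) _; apply/cvgCP.
    by apply: ip_cvg (hP x) _; exact: cvg_cst.
  rewrite (_ : (fun n => _) = fun n => dotp x (T_ n y)).
    by apply: ip_cvg (hP y); exact: cvg_cst.
  by apply/funext => n; rewrite adjointP aT.
have runiq (u : nat -> R) (a b : R) : u n @[n --> \oo] --> a -> u n @[n --> \oo] --> b -> a = b.
  by move=> ha hb; rewrite -(cvg_lim _ ha) -?(cvg_lim _ hb)//; exact: (@norm_hausdorff _ R^o).
have q1 h : complex.Re (dotp (P h) h) = q h.
  apply: runiq (qT h); apply: (cvgC_Re (u := fun n => dotp (T_ n h) h)); apply/cvgCP.
  by apply: ip_cvg (hP h) _; exact: cvg_cst.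
have q2 h : complex.Re (dotp (P h) (P h)) = q h.
  apply: (runiq (fun n => complex.Re (dotp (T_ n h) (T_ n h)))).
    apply: (cvgC_Re (u := fun n => dotp (T_ n h) (T_ n h))); apply/cvgCP.
    exact: ip_cvg (hP h) (hP h).
  by apply/cvgR0P => e e0; have [N hN] := cT h e e0; exists N => n Nn; exact: hN.
exists P; split; last by move=> h; rewrite self_adjoint_real// q1.
split => //; apply: op_quad_ext => h.
by rewrite opME adjointP aP ipxx nm_sqrE q2 self_adjoint_real// q1.
Qed.

End projections.

Section spectra.
Context (R : realType) (H : hilbertType R).
Implicit Types (N S T : 'B(H)) (l : R[i]).

Lemma not_spectrumP T l :
  ~ spectrum T l <-> exists S, S * (T - l *: (1 : 'B(H))) = 1 /\ (T - l *: (1 : 'B(H))) * S = 1.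
Proof. by split=> [|h]; [exact: contrapT|apply]. Qed.

(** If the inverse of N - l is bounded by C, then N - m is bounded below by 1 / (2 C) for |m - l| <
    1 / (2 C), hence invertible by normality. *)
Lemma spectrum_closed N : normal_op N -> closed (spectrum N).
Proof.
move=> nN; rewrite -[spectrum N]setCK; apply: open_closedC; rewrite openE => l.
move=> /not_spectrumP[S [SU _]]; apply/nbhs_CP; have [C C0 hC] := op_bound S.
have C2 : 0 < (2 * C)^-1 by rewrite invr_gt0 mulr_gt0.
exists (2 * C)^-1 => // m ml; apply/not_spectrumP.
apply: (@normal_bounded_below_invertible _ _ _ (2 * C)^-1) => //.
  apply/boundedOpP => x; rewrite adjointB adjointZ adjoint1 !opE !opB !opZ.
  rewrite -[N (adjoint N x)]opME nN opME !scalerBr !scalerA [m * _]mulrC !opprB.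
  by rewrite addrACA [RHS]addrACA; congr (_ + _); exact: addrC.
move=> x; have := hC ((N - l *: (1 : 'B(H))) x); rewrite -[S (_ x)]opME SU op1E => h1.
have h2 : nm ((N - l *: (1 : 'B(H))) x) <= nm ((N - m *: (1 : 'B(H))) x) + (2 * C)^-1 * nm x.
  have -> : (N - l *: (1 : 'B(H))) x = (N - m *: (1 : 'B(H))) x + (m - l) *: x.
    by rewrite !opE scalerBl addrA subrK.
  by rewrite (le_trans (nmD _ _))// lerD2l nmZ ler_wpM2r ?nm_ge0 ?ltW.
have h3 := le_trans h1 (ler_wpM2l (ltW C0) h2).
rewrite mulrDr mulrA in h3.
have e3 : C * (2 * C)^-1 = 2^-1 by field; rewrite gt_eqF.
rewrite e3 in h3; rewrite mulrC ler_pdivrMr ?mulr_gt0//.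
by move: h3; move: (nm x) (nm ((N - m *: (1 : 'B(H))) x)) => a b; lra.
Qed.

End spectra.

(** * Spectra of the operators pi(z) *)

Section representations.
Context (R : realType) (X : set R[i]) (hX : compact X) (K : hilbertType R).
Notation CX := (continuousType X R[i]).
Context (pi : CX -> 'B(K)) (rpi : rep pi).

Lemma rep_mul f g : pi (f * g) = pi f * pi g. Proof. by case: rpi => _ [_ ->]. Qed.
Lemma rep_one : pi 1 = 1. Proof. by case: rpi => _ []. Qed.
Lemma rep_conj f : pi (cf_conj f) = adjoint (pi f). Proof. by case: rpi => _ _ ->. Qed.
Lemma rep_lin : linear pi. Proof. by case: rpi. Qed.

Lemma rep_dot f g h k : dotp (pi f h) (pi g k) = dotp (pi (cf_conj g * f) h) k.
Proof. by rewrite rep_mul rep_conj opME -adjointPr. Qed.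

(** With w the square root of d^2 |f|^2 - |g|^2, the difference of the two squared norms is |pi(w)
    h|^2. *)
Lemma rep_dominated (f g : CX) (d : R) (h : K) : 0 <= d -> (forall x, nm (g x) <= d * nm (f x)) ->
  nm (pi g h) <= d * nm (pi f h).
Proof.
move=> d0 hfg; pose u (x : X) := Num.sqrt ((d * nm (f x)) ^+ 2 - nm (g x) ^+ 2).
have cu : continuous u.
  have c2 (v : X -> R) : continuous v -> continuous (fun x => v x ^+ 2).
    by move=> cv; under eq_fun do rewrite expr2; exact: ctsR_mul.
  have cn (p : CX) : continuous (fun x : X => nm (p x)) := @cts_nm R X R[i]^o p (@cf_continuous _ _ p).
  have cd : continuous (fun x => (d * nm (f x)) ^+ 2 - nm (g x) ^+ 2).
    by apply: ctsR_sub; apply: c2 => //; apply: ctsR_mul => //; exact: ctsR_cst.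
  move=> x; apply: (@continuous_comp _ _ _ (fun x => (d * nm (f x)) ^+ 2 - nm (g x) ^+ 2) Num.sqrt).
    exact: cd.
  exact: sqrt_continuous.
pose w := toC (fun x => (u x)%:C : R[i]).
have e : (d ^+ 2)%:C *: (cf_conj f * f) - cf_conj g * g = cf_conj w * w.
  apply: cfP => x; rewrite !cfE /w toCE; last exact: ctsC.
  rewrite conjCr ![_^* * _]mulrC !mul_conj_nm -!rmorphM -rmorphB/=; congr (_%:C).
  rewrite -expr2 sqr_sqrtr; first by rewrite exprMn.
  by rewrite subr_ge0 ler_pXn2r ?nnegrE ?mulr_ge0 ?nm_ge0.
rewrite -(@ler_pXn2r _ 2)// ?nnegrE ?mulr_ge0 ?nm_ge0// exprMn !nm_sqrE !rep_dot -subr_ge0.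
rewrite -ReCM -ReB -ipZl -ipBl -opZE -(lmZ rep_lin) -opBE -(lmB rep_lin) e -rep_dot.
by rewrite -nm_sqrE sqr_ge0.
Qed.

Lemma rep_id_normal : normal_op (pi (cf_id X)).
Proof. by rewrite /normal_op -rep_conj -!rep_mul mulrC. Qed.

Lemma rep_shift l : pi (cf_id X) - l *: (1 : 'B(K)) = pi (cf_id X - l *: (1 : CX)).
Proof. by rewrite (lmB rep_lin) (lmZ rep_lin) rep_one. Qed.

(* Writing [h = (S - l) h'] repeatedly multiplies the norm of [pi f (V h)] by 1/2 at each step. *)
Lemma rep_bump_zero (H : hilbertType R) (V : H -> K) (S : 'B(H)) l : blin V ->
  (forall h, V (S h) = pi (cf_id X) (V h)) -> ~ spectrum S l ->
  exists2 d : R, 0 < d & forall f : CX, (forall x, d <= nm (val x - l) -> f x = 0) ->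
    forall h, pi f (V h) = 0.
Proof.
move=> bV VS /not_spectrumP[S' [_ SS']]; have [C C0 hC] := op_bound S'.
have d0 : 0 < (2 * C)^-1 by rewrite invr_gt0 mulr_gt0.
exists (2 * C)^-1 => // f hf.
have step h : nm (pi f (V h)) <= (2 * C)^-1 * nm (pi f (V (S' h))).
  have -> : V h = pi (cf_id X - l *: (1 : CX)) (V (S' h)).
    rewrite -rep_shift opBE opZE op1E -VS -(blinZ bV) -(blinB bV).
    by congr V; rewrite -[LHS]op1E -SS' opME opBE opZE op1E.
  rewrite -opME -rep_mul; apply: rep_dominated; first exact: ltW.
  move=> x; rewrite !cfE mulr1 nmM mulrC.
  have [/ltW h1|/hf->] := ltP (nm (val x - l)) (2 * C)^-1; first by rewrite ler_wpM2r ?nm_ge0.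
  by rewrite nm0 !mulr0.
have [M M0 hM] := cf_bounded hX (@cf_continuous R X f).
have [D D0 hD] := blin_bound bV.
have bnd k h : nm (pi f (V h)) <= 2^-1 ^+ k * (M * D * nm h).
  elim: k h => [|k IH] h.
    rewrite expr0 mul1r (le_trans (cp_bound (rep_cp rpi) (ltW M0) hM _))//.
    by rewrite -mulrA ler_wpM2l ?(ltW M0).
  apply: le_trans (step h) _; apply: le_trans (ler_wpM2l (ltW d0) (IH _)) _.
  have -> : 2^-1 ^+ k.+1 * (M * D * nm h) = (2 * C)^-1 * (2^-1 ^+ k * (M * D * (C * nm h))).
    by rewrite exprS; field; rewrite gt_eqF.
  by rewrite !ler_wpM2l ?(ltW d0) ?exprn_ge0 ?invr_ge0 ?mulr_ge0 ?(ltW M0) ?(ltW D0).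
move=> h; apply: nm_eq0; apply/eqP; rewrite eq_le nm_ge0 andbT leNgt; apply/negP => n0.
have B0 : 0 < M * D * nm h + 1 by rewrite ltr_wpDl ?mulr_ge0 ?nm_ge0 ?(ltW M0) ?(ltW D0).
have [k hk] : exists k : nat, 2^-1 ^+ k * (M * D * nm h + 1) < nm (pi f (V h)).
  pose k := (Num.truncn ((M * D * nm h + 1) / nm (pi f (V h)))).+1; exists k.
  rewrite exprVn [ltLHS]mulrC ltr_pdivrMr ?exprn_gt0// [ltRHS]mulrC -ltr_pdivrMr//.
  apply: (@lt_trans _ _ k%:R); first exact: real_truncnS_gt (num_real _).
  by rewrite -natrX ltr_nat ltn_expl.
have := bnd k h; apply/negP; rewrite -ltNge; apply: le_lt_trans hk.
by rewrite ler_wpM2l ?exprn_ge0 ?invr_ge0// lerDl.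
Qed.

(** With p = z - l, the function g = conj p / max(|p|, d)^2 is continuous and 1 - p g vanishes where
    |p| >= d, so pi(g) is the inverse of pi(p). *)
Lemma rep_resolvent l (d : R) : 0 < d ->
  (forall f : CX, (forall x, d <= nm (val x - l) -> f x = 0) -> pi f = 0) ->
  ~ spectrum (pi (cf_id X)) l.
Proof.
move=> d0 hd; apply/not_spectrumP; rewrite rep_shift; set p := cf_id X - _.
have px x : p x = val x - l by rewrite /p !cfE mulr1.
clearbody p.
pose m x := ((Num.max (nm (p x)) d) ^-1) ^+ 2.
have m0 x : 0 < Num.max (nm (p x)) d by rewrite lt_max d0 orbT.
have cm : continuous m.
  have c1 : continuous (fun x => (Num.max (nm (p x)) d)^-1).
    apply: ctsR_inv => [x|]; first by rewrite gt_eqF.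
    apply: ctsR_max; last exact: ctsR_cst.
    exact: (@cts_nm R X R[i]^o p (@cf_continuous _ _ p)).
  exact: ctsR_mul.
pose g := cf_conj p * toC (fun x => (m x)%:C : R[i]).
have gp : pi (p * g) = 1.
  apply/eqP; rewrite eq_sym -subr_eq0 -rep_one -(lmB rep_lin); apply/eqP/hd => x hx.
  rewrite !cfE toCE; last exact: ctsC.
  have e : nm (p x) ^+ 2 * m x = 1.
    rewrite /m max_l ?px// -exprMn mulfV ?expr1n// gt_eqF// (lt_le_trans d0)//.
  by rewrite mulrA mul_conj_nm -rmorphM/= e subrr.
by exists (pi g); rewrite -!rep_mul [g * p]mulrC gp.
Qed.

Lemma rep_spectrum_sub : spectrum (pi (cf_id X)) `<=` X.
Proof.
move=> l; apply: contraPP => nX.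
have clX : closed X by apply: compact_closed => //; exact: (@norm_hausdorff R[i] R[i]^o).
have /nbhs_CP[d d0 hd] : nbhs l (~` X) by apply: open_nbhs_nbhs; split => //; exact: closed_openC.
apply: (rep_resolvent d0) => f hf; rewrite -(lm0 rep_lin); congr pi; apply: cfP => x.
rewrite cf0 hf// leNgt; apply/negP => h; apply: (hd _ h); exact: (set_valP x).
Qed.

End representations.

(** * From a representation to a spectral measure *)

Section real_part_functional.
Context (R : realType) (X : set R[i]) (hX : compact X) (K : hilbertType R).
Notation CX := (continuousType X R[i]).
Notation borelC := (g_sigma_algebraType (@open R[i])).
Context (pi : CX -> 'B(K)) (rpi : rep pi).
Implicit Types (u v : X -> R) (h : K).

Definition rf u : CX := toC (fun x => (u x)%:C : R[i]).

Lemma rfE u x : continuous u -> rf u x = (u x)%:C.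
Proof. by move=> cu; rewrite /rf toCE//; exact: ctsC. Qed.

Lemma rf_conj u : continuous u -> cf_conj (rf u) = rf u.
Proof. by move=> cu; apply: cfP => x; rewrite cfJ !rfE// conjCr. Qed.

Lemma rfM u v : continuous u -> continuous v -> rf (fun x => u x * v x) = rf u * rf v.
Proof.
by move=> cu cv; apply: cfP => x; rewrite cfM !rfE ?rmorphM//; exact: ctsR_mul.
Qed.

Definition rep_functional h u : R := complex.Re (dotp (pi (rf u) h) h).

Lemma rep_functionalM h u v : continuous u -> continuous v ->
  complex.Re (dotp (pi (rf u) h) (pi (rf v) h)) = rep_functional h (fun x => u x * v x).
Proof.
move=> cu cv; rewrite (rep_dot rpi) rf_conj// mulrC -rfM//.
Qed.

Lemma rep_rf_adj u : continuous u -> adjoint (pi (rf u)) = pi (rf u).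
Proof. by move=> cu; rewrite -(rep_conj rpi) rf_conj. Qed.

Lemma rep_functional_positive h : positive_functional (rep_functional h).
Proof.
have rl := rep_lin rpi; split=> [u v cu cv|c u cu|u cu u0].
- have e : rf (fun x => u x + v x) = rf u + rf v.
    by apply: cfP => x; rewrite cfD !rfE ?rmorphD//; exact: ctsR_add.
  by rewrite /rep_functional e (lmD rl) opDE ipDl ReD.
- have e : rf (fun x => c * u x) = c%:C *: rf u.
    by apply: cfP => x; rewrite cfZ !rfE ?rmorphM//; apply: ctsR_mul => //; exact: ctsR_cst.
  by rewrite /rep_functional e (lmZ rl) opZE ipZl ReCM.
have cs : continuous (fun x => Num.sqrt (u x)).
  by move=> x; apply: (@continuous_comp _ _ _ u Num.sqrt); [exact: cu|exact: sqrt_continuous].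
have -> : u = fun x => Num.sqrt (u x) * Num.sqrt (u x).
  by apply/funext => x; rewrite -expr2 sqr_sqrtr.
by rewrite -rep_functionalM// -nm_sqrE sqr_ge0.
Qed.

Lemma rep_functional1 h : rep_functional h (fun=> 1) = nm h ^+ 2.
Proof.
rewrite /rep_functional (_ : rf _ = 1) ?(rep_one rpi) ?op1E ?nm_sqrE//.
by apply: cfP => x; rewrite rfE//; exact: ctsR_cst.
Qed.

Lemma rep_measure_exists : exists mu : K -> {measure set borelC -> \bar R}, forall h,
  [/\ mu h (~` X) = 0%E, forall U, open U -> mu h U = (premeas (rep_functional h) U)%:E &
   forall u : X -> R, continuous u ->
     rep_functional h u = \int[mu h]_(z in (X : set borelC)) valL_ 0 u z].
Proof.
have [mu hmu] := choice (fun h => riesz_representation_measure hX (rep_functional_positive h)).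
by exists mu.
Qed.

Section spectral.
Context (mu : K -> {measure set borelC -> \bar R}).
Hypothesis muX : forall h, mu h (~` X) = 0%E.
Hypothesis muU : forall h U, open U -> mu h U = (premeas (rep_functional h) U)%:E.
Hypothesis muI : forall h (u : X -> R), continuous u ->
   rep_functional h u = \int[mu h]_(z in (X : set borelC)) valL_ 0 u z.

Lemma muT h : mu h setT = (nm h ^+ 2)%:E.
Proof.
rewrite muU; last exact: openT.
congr (_%:E); rewrite -rep_functional1; apply/eqP; rewrite eq_le.
have LP := rep_functional_positive h; have c1 : continuous (fun _ : X => 1 : R) by exact: ctsR_cst.
apply/andP; split.
  by apply: (premeas_le LP) => u [cu hu]; apply: (pf_le LP) => // x; case: (hu x).
by apply: (premeas_ub LP); split=> // x; split => //; rewrite ?ler01 // => /(_ I).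
Qed.

Lemma mu_fin h : (mu h setT < +oo)%E. Proof. by rewrite muT ltry. Qed.

(** The property carried from open to Borel sets by a Dynkin argument; measurability is included so
    that it is stable on its own. *)
Definition has_projection (D : set borelC) : Prop := measurable D /\
  exists P, orthogonal_projection P /\ forall h, dotp (P h) h = (fine (mu h D))%:C.

(** The functions w n tend to the indicator of U, and pi(w n) tends strongly to the projection.
    Products w n w m are estimated because [projection_limit] asks for the double limit. *)
Lemma open_projection U : open U -> has_projection U.
Proof.
move=> oU; split; first exact: open_borel.
pose w n := exhaust (fun=> fun x : X => cdist U (val x)) n.
have cd : continuous (fun x : X => cdist U (val x)) by exact: cdist_continuous.
have cw n : continuous (w n) by apply: exhaust_continuous.
have d0 (x : X) : 0 <= cdist U (val x) by exact: cdist_ge0.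
have w1 n x : w n x <= 1.
  rewrite /w /exhaust ler_pdivrMr ?mul1r ?le_max ?lexx//.
  by rewrite lt_max invr_gt0 ltr0Sn orbT.
have w0 n x : 0 <= w n x by apply: exhaust_ge0.
have tw n : test_function U (w n).
  split => // x; split => // nU; rewrite /w /exhaust big1 ?mul0r// => i _.
  by rewrite cdist_out.
have tww n m : test_function U (fun x => w n x * w m x).
  split=> [|x]; first exact: ctsR_mul.
  split; [by rewrite mulr_ge0|by rewrite mulr_ile1|].
  by move=> nU; have [_ _ ->] := (tw n).2 x; rewrite ?mul0r.
have key h (e : R) : 0 < e -> exists N, forall n m, (N <= n)%N -> (N <= m)%N ->
    premeas (rep_functional h) U - e < rep_functional h (fun x => w n x * w m x).
  move=> e0; have LP := rep_functional_positive h.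
  have e2 : 0 < e / 2 by rewrite divr_gt0.
  have [u tu hu] := premeas_approx LP U e2.
  have n1 : 0 < nm h ^+ 2 + 1 by rewrite ltr_wpDl ?sqr_ge0.
  have [N hN] := exhaustion_or hX (fun=> cd) (fun=> d0)
     (fun (x : X) Ux => ex_intro _ 0%N (cdist_gt0 oU Ux)) tu (divr_gt0 e2 n1).
  exists N => n m /hN hn /hN hm.
  have : rep_functional h u <= rep_functional h (fun x => e / 2 / (nm h ^+ 2 + 1) + w n x * w m x).
    apply: (pf_le LP) => [||x]; first exact: tu.1.
      by apply: ctsR_add; [exact: ctsR_cst|exact: ctsR_mul].
    have ww : 0 <= w n x * w m x by rewrite mulr_ge0.
    have [h1|h1] := hn x; first by rewrite (le_trans (ltW h1))// lerDl.
    have [h2|h2] := hm x; first by rewrite (le_trans (ltW h2))// lerDl.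
    rewrite /w h1 h2 mulr1; have [_ u1 _] := tu.2 x; rewrite (le_trans u1)// lerDr.
    by rewrite divr_ge0 ?ltW.
  pose d := e / 2 / (nm h ^+ 2 + 1); rewrite -/d.
  have cc : continuous (fun _ : X => d) by exact: ctsR_cst.
  rewrite (pfD LP cc (ctsR_mul (cw n) (cw m))) (pf_cst LP d) rep_functional1.
  have h3 : d * nm h ^+ 2 <= e / 2.
    by rewrite /d mulrAC ler_pdivrMr// ler_wpM2l ?(ltW e2)// lerDl.
  move: h3 hu; set a := d * _; set b := rep_functional h u; set c := rep_functional h _.
  by move: (premeas _ _) => t; lra.
have [||||P [pP hP]] := @projection_limit R K (fun n => pi (rf (w n))) (fun h => premeas (rep_functional h) U) _ _ _ _.
- by move=> n; exact: rep_rf_adj.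
- move=> n h; rewrite -[leRHS]mul1r; apply: cp_bound (rep_cp rpi) _ _ ler01 _ _ => x.
  by rewrite rfE// nmC ger0_norm.
- move=> h e e0; have [N hN] := key h e e0; exists N => n m Nn Nm.
  rewrite rep_functionalM// ltr_norml; have h1 := hN n m Nn Nm.
  have h2 := premeas_ub (rep_functional_positive h) (tww n m).
  by move: h1 h2; set a := rep_functional h _; move=> h1 h2; apply/andP; split; lra.
- move=> h; apply/cvgR0P => e e0; have [N hN] := key h e e0; exists N => n Nn.
  have h1 := hN n n Nn Nn; have LP := rep_functional_positive h.
  have h2 := premeas_ub LP (tw n).
  have h3 : rep_functional h (fun x => w n x * w n x) <= rep_functional h (w n).
    by apply: (pf_le LP) => // [|x]; [exact: ctsR_mul|rewrite ler_piMl].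
  rewrite -/(rep_functional h (w n)).
  move: h1 h2 h3; set a := rep_functional h _; set b := rep_functional h _ => h1 h2 h3.
  by rewrite ltr_norml; apply/andP; split; lra.
by exists P; split => // h; rewrite hP muU.
Qed.

Lemma mu_fin_num h (D : set borelC) : measurable D -> mu h D \is a fin_num.
Proof. by move=> mD; rewrite ge0_fin_numE//; apply: (mu_lty (mu_fin h)). Qed.

Lemma borel_projection D : measurable D -> has_projection D.
Proof.
move: D; have GI : setI_closed (@open R[i]) by move=> A B; exact: openI.
change (<<s (@open R[i]) >> `<=` has_projection).
(* Open sets are stable under intersection, so complements and disjoint countable unions suffice. *)
rewrite -(setI_closed_g_dynkin_g_sigma_algebra GI); apply: smallest_sub; last first.
  by move=> U; exact: open_projection.
split; first by apply: open_projection; exact: openT.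
- move=> D [mD [P [[PP aP] hP]]]; split; first exact: measurableC.
  exists (1 - P); split.
    split; last by rewrite adjointB adjoint1 aP.
    by rewrite mulrBr mulr1 mulrBl mul1r PP subrr subr0.
  move=> h; rewrite opBE op1E ipBl hP ipxx -rmorphB/=; congr (_%:C).
  have : (nm h ^+ 2)%:E = (mu h D + mu h (~` D))%E.
    by rewrite -muT -(setUv D); exact: measureU mD (measurableC mD) (setICr D).
  move=> /(congr1 fine)/=; rewrite fineD ?mu_fin_num//; last exact: measurableC.
  by move=> ->; rewrite addrC addKr.
suff key (F : nat -> set borelC) : trivIset setT F ->
    (forall n, has_projection (F n)) -> has_projection (\bigcup_n F n) by exact: key.
move=> tF hF; have mF i : measurable (F i) by case: (hF i).
split; first exact: bigcupT_measurable.
have [P hP] := choice (fun i => (hF i).2).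
have nmP i h : nm (P i h) ^+ 2 = fine (mu h (F i)).
  have [pP e] := hP i; have := e h; rewrite (projection_nm h pP) => /(congr1 (@complex.Re R)).
  by [].
have orth i j : i != j -> P i * P j = 0.
  move=> ij; apply: projection_orth => [||h]; [exact: (hP i).1|exact: (hP j).1|].
  rewrite !nmP -fineD ?mu_fin_num// -measureU//; last first.
    by apply/eqP/negP => /negP/set0P[x [xi xj]]; move/eqP: ij; apply; apply: tF => //; exists x.
  have <- : fine (mu h setT) = nm h ^+ 2 by rewrite muT.
  apply: fine_le; rewrite ?mu_fin_num//; first exact: measurableU.
  by apply: le_measure; rewrite ?inE//; exact: measurableU.
(* Disjoint sets have orthogonal projections, so S n * S m = S (minn n m) and the double limit
   reduces to countable additivity of the scalar measures. *)
pose S n := \sum_(i < n) P i.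
have aS n : adjoint (S n) = S n.
  rewrite /S (big_morph _ (@adjointD R K) (@adjoint0 R K)); apply: eq_bigr => i _.
  exact: (hP i).1.2.
have SS n m : (n <= m)%N -> S m * S n = S n.
  move=> nm; rewrite /S mulr_sumr; apply: eq_bigr => i _; rewrite mulr_suml.
  have im : (i < m)%N by apply: leq_trans nm.
  rewrite (bigD1 (Ordinal im))//= (hP i).1.1 big1 ?addr0// => j ji.
  by apply: orth; apply: contraNN ji => /eqP e; apply/eqP/val_inj.
have SS' n m : S n * S m = S (minn n m).
  have [nm|/ltnW mn] := leqP n m; last by rewrite SS.
  by rewrite -[LHS]adjointK adjointM !aS SS.
have Sq n h : complex.Re (dotp (S n h) h) = \sum_(0 <= i < n) fine (mu h (F i)).
  rewrite /S op_sumE ip_suml Re_sum big_mkord; apply: eq_bigr => i _.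
  by rewrite (hP i).2.
have Sc h : complex.Re (dotp (S n h) h) @[n --> \oo] --> fine (mu h (\bigcup_i F i)).
  have := @measure_semi_sigma_additive _ _ _ (mu h) F mF tF (bigcupT_measurable F mF).
  rewrite -[X in _ --> X]fineK; last by apply: mu_fin_num; exact: bigcupT_measurable.
  move=> /fine_cvg; rewrite (_ : fine \o _ = fun n => complex.Re (dotp (S n h) h)) //.
  apply/funext => n; rewrite Sq /= sum_fine// => i _; exact: mu_fin_num.
apply: (@projection_limit R K S) => // [n h|h e e0].
  apply: projection_nm_le; split; [by rewrite SS' minnn|exact: aS].
have [N hN] := (cvgR0P _ _).1 (Sc h) e e0; exists N => n m Nn Nm.
rewrite adjointPr aS -opME SS'; apply: hN.
by rewrite leq_min Nn Nm.
Qed.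

Lemma ball_mu0 l : ~ spectrum (pi (cf_id X)) l ->
  exists2 d : R, 0 < d & forall h, premeas (rep_functional h) [set z | nm (z - l) < d] = 0.
Proof.
move=> nl; have bid : blin (@idfun K).
  by split=> //; exists 1 => // x; rewrite mul1r.
have [d d0 hd] := @rep_bump_zero R X hX K pi rpi K idfun (pi (cf_id X)) l bid (fun=> erefl) nl.
exists d => // h; apply/eqP; have LP := rep_functional_positive h.
rewrite eq_le (premeas_ge0 LP) andbT; apply: (premeas_le LP) => u [cu hu].
rewrite /rep_functional (hd (rf u)) ?ip0l// => x; rewrite leNgt => /negP hx.
by rewrite rfE//; have [_ _ /(_ hx) ->] := hu x.
Qed.

Lemma open_ball (q : R[i]) (r : R) : open [set z : R[i] | nm (z - q) < r].
Proof.
rewrite openE => z zq; apply/nbhs_CP; exists (r - nm (z - q)); first by rewrite subr_gt0.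
by move=> w wz; have := nm_triB w z q; rewrite /=; lra.
Qed.

(** The complement of the spectrum is covered by balls of measure 0 ([ball_mu0]); shrinking to
    rational centres and radii 1 / (k + 1) makes the cover countable. *)
Lemma spectrum_full h : mu h (~` spectrum (pi (cf_id X))) = 0%E.
Proof.
have ms : measurable (~` spectrum (pi (cf_id X)) : set borelC).
  by apply: measurableC; apply: closed_borel; apply: spectrum_closed; exact: rep_id_normal.
apply/negligibleP => //.
pose B (p : nat * nat) : set borelC := [set z : R[i] | nm (z - rational_point R p.1) < p.2.+1%:R^-1].
pose U i : set borelC := if unpickle i is Some p then
  if `[< mu h (B p) = 0%E >] then B p else set0 else set0.
have nU i : (mu h).-negligible (U i).
  rewrite /U; case: (unpickle i) => [p|]; last exact: negligible_set0.
  case: asboolP => hp; last exact: negligible_set0.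
  by apply/negligibleP => //; apply: open_borel; exact: open_ball.
apply: negligibleS (negligible_bigcup nU) => l /ball_mu0[d d0 hd].
have d2 : 0 < d / 2 by rewrite divr_gt0.
have [k hk] : exists k : nat, k.+1%:R^-1 < d / 2.
  exists (Num.truncn (d / 2)^-1); rewrite invf_plt ?posrE//.
  exact: real_truncnS_gt (num_real _).
have [n hn] : exists n, nm (l - rational_point R n) < k.+1%:R^-1.
  by apply: rational_point_dense; rewrite invr_gt0.
exists (pickle (n, k)) => //; rewrite /U pickleK; case: asboolP => // -[].
have oB : open (B (n, k)) by exact: open_ball.
rewrite muU//; congr (_%:E); apply/eqP; have LP := rep_functional_positive h.
rewrite eq_le (premeas_ge0 LP) andbT -(hd h); apply: (premeas_mono LP) => z /= zB.
apply: le_lt_trans (nm_triB z (rational_point R n) l) _; apply: half_ltD.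
  exact: lt_trans zB hk.
by rewrite nmB; exact: lt_trans hn hk.
Qed.

Lemma rep_integral f h : dotp (pi f h) h = complex_integral (mu h) X (valL_ 0 f).
Proof.
have cf := @cf_continuous R X f; have cR := ctsRe cf; have cI := ctsIm cf.
have e : f = rf (fun x => complex.Re (f x)) + 'i *: rf (fun x => complex.Im (f x)).
  by apply: cfP => x; rewrite cfD cfZ !rfE//; case: (f x) => a b; simpc.
rewrite {1}e (lmD (rep_lin rpi)) (lmZ (rep_lin rpi)) opDE opZE ipDl ipZl.
rewrite (self_adjoint_real h (rep_rf_adj cR)) (self_adjoint_real h (rep_rf_adj cI)).
rewrite -![complex.Re (dotp _ _)]/(rep_functional h _) (muI h cR) (muI h cI).
rewrite /complex_integral.
have eq1 (p : R[i] -> R) :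
    \int[mu h]_(z in (X : set borelC)) p ((valL_ 0 (f : X -> R[i]) : R[i] -> R[i]) z) =
    \int[mu h]_(z in (X : set borelC)) (valL_ 0 (fun x : X => p (f x)) : R[i] -> R) z.
  apply: eq_Rintegral => z; rewrite inE => Xz.
  by rewrite (valL_in 0 (f : X -> R[i]) Xz) (valL_in 0 (fun x : X => p (f x)) Xz).
by rewrite !eq1; apply: ReIm_inj; rewrite ?ReD ?ImD ?ReiM ?ImiM/=; ring.
Qed.

Lemma spectral_of_measures : exists E : set R[i] -> 'B(K), spectral_measure_of (pi (cf_id X)) E /\
  forall h, scalar_measure E h (mu h).
Proof.
pose good (D : set R[i]) := [set P : 'B(K) | orthogonal_projection P /\
   forall h, dotp (P h) h = (fine (mu h D))%:C].
pose E D := xget 0 (good D).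
have EP (D : set borelC) : measurable D -> good D (E D).
  move=> /borel_projection[_ [P hP]]; rewrite /E; case: xgetP => [Q //|/(_ P)]; exact.
have sm h : scalar_measure E h (mu h).
  by move=> D mD; split; [exact: mu_fin_num|exact: (EP D mD).2].
have ms : measurable (spectrum (pi (cf_id X)) : set borelC).
  by apply: closed_borel; apply: spectrum_closed; exact: rep_id_normal.
have full (D : set borelC) : measurable D -> (forall h, mu h (~` D) = 0%E) -> E D = 1.
  move=> mD hD; apply: op_quad_ext => h; rewrite (EP D mD).2 op1E ipxx; congr (_%:C).
  have : (nm h ^+ 2)%:E = (mu h D + mu h (~` D))%E.
    by rewrite -muT -(setUv D); exact: measureU mD (measurableC mD) (setICr D).
  by rewrite hD adde0 => <-.
exists E; split => //; split.
- split; [|by move=> D /EP[]|by move=> h; exists (mu h)].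
  by apply: full => // h; rewrite setCT measure0.
- by apply: full => // h; exact: spectrum_full.
move=> h; exists (mu h) => //; rewrite rep_integral.
by apply: (complex_integral_support hX (mu_fin h)) => //; [exact: rep_spectrum_sub|exact: spectrum_full].
Qed.

End spectral.

Theorem rep_spectral_measure : exists E : set R[i] -> 'B(K),
  spectral_measure_of (pi (cf_id X)) E /\
  forall f h, exists2 mu, scalar_measure E h mu &
    dotp (pi f h) h = complex_integral mu X (valL_ 0 f).
Proof.
have [mu hmu] := rep_measure_exists.
have h1 h : mu h (~` X) = 0%E by case: (hmu h).
have h2 h : forall U, open U -> mu h U = (premeas (rep_functional h) U)%:E by case: (hmu h).
have h3 h : forall u : X -> R, continuous u ->
     rep_functional h u = \int[mu h]_(z in (X : set borelC)) valL_ 0 u z by case: (hmu h).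
have [E [sE sm]] := spectral_of_measures h2 h3.
by exists E; split => // f h; exists (mu h) => //; exact: rep_integral.
Qed.

End real_part_functional.

(** * From a spectral measure to a representation *)

Section integral_representation.
Context (R : realType) (X : set R[i]) (hX : compact X) (X0 : X !=set0) (K : hilbertType R).
Notation CX := (continuousType X R[i]).
Notation borelC := (g_sigma_algebraType (@open R[i])).
Context (E : set R[i] -> 'B(K)) (sE : spectral_measure E) (EX : E X = 1).
Let mX := compact_borel hX.

(** Finitely many balls around a dense sequence cover X by compactness, and are then made disjoint.
    The tag [s i] is within r of every point of [D i] but need not lie in it. *)
Lemma borel_partition (r : R) : 0 < r -> exists (N : nat) (s : nat -> X) (D : nat -> set borelC),
  [/\ forall i, measurable (D i), trivIset setT D, \big[setU/set0]_(i < N) D i = X &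
      forall i z, D i z -> nm (z - val (s i)) < r].
Proof.
move=> r0; have [s hs] := dense_sequence X0.
pose B i : set borelC := (X : set borelC) `&` [set z : R[i] | nm (z - val (s i)) < r].
have mB i : measurable (B i).
  apply: measurableI => //; apply: open_borel; rewrite openE => z zq; apply/nbhs_CP.
  exists (r - nm (z - val (s i))); first by rewrite subr_gt0.
  by move=> w wz; have := nm_triB w z (val (s i)); rewrite /=; lra.
have [N hN] : exists N, forall x : X, exists2 i, (i < N)%N & nm (val x - val (s i)) < r.
  have r2 : 0 < r / 2 by rewrite divr_gt0.
  have h (x : X) : [set: X] x -> \forall x' \near x & N \near \oo,
      exists2 i, (i < N)%N & nm (val x' - val (s i)) < r.
    move=> _; have [i hi] := hs x _ r2.
    exists ([set x' : X | nm (val x' - val x) < r / 2], [set N | (i < N)%N]) => /=.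
      by split; [apply/nbhs_setP; exists (r / 2)|exists i.+1].
    move=> [x' N] /= [h1 iN]; exists i => //.
    by apply: le_lt_trans (nm_triB _ (val x) _) _; exact: half_ltD.
  have [N _ hN] := @near_coveringX R X hX nat \oo _ _ h.
  by exists N => x; exact: (hN N (leqnn N) x I).
exists N, s, (seqDU B); split.
- by move=> i; apply: measurableD => //; apply: bigsetU_measurable.
- exact: trivIset_seqDU.
- rewrite -bigsetU_seqDU -bigcup_mkord; apply/seteqP; split=> z; first by move=> [i _ []].
  by move=> Xz; have [i iN hi] := hN (exist _ z (mem_set Xz)); exists i.
- by move=> i z [[]].
Qed.

Context (mu : K -> {measure set borelC -> \bar R}) (smu : forall h, scalar_measure E h (mu h)).

Lemma smT h : mu h setT = (nm h ^+ 2)%:E.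
Proof.
have [f /(congr1 (@complex.Re R))] := smu h measurableT; have [-> _ _] := sE.
by rewrite op1E ipxx/= => ->; rewrite fineK.
Qed.

Lemma smfin h : (mu h setT < +oo)%E. Proof. by rewrite smT ltry. Qed.

Lemma sm_proj (D : set borelC) : measurable D -> orthogonal_projection (E D).
Proof. by case: sE => _ + _; exact. Qed.

Lemma sm_nm h (D : set borelC) : measurable D -> nm (E D h) ^+ 2 = fine (mu h D).
Proof.
move=> mD; have [_] := smu h mD; rewrite (projection_nm h (sm_proj mD)).
by move=> /(congr1 (@complex.Re R)).
Qed.

Lemma sm_orth (D D' : set borelC) : measurable D -> measurable D' -> D `&` D' = set0 ->
  E D * E D' = 0.
Proof.
move=> mD mD' DD'; apply: projection_orth => [||h]; [exact: sm_proj|exact: sm_proj|].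
have f1 := (smu h mD).1; have f2 := (smu h mD').1.
rewrite !sm_nm// -fineD// -measureU//.
have <- : fine (mu h setT) = nm h ^+ 2 by rewrite smT.
apply: fine_le; [exact: (smu h (measurableU _ _ mD mD')).1|exact: (smu h measurableT).1|].
by apply: le_measure; rewrite ?inE//; exact: measurableU.
Qed.

Lemma sm_X h : fine (mu h X) = nm h ^+ 2.
Proof. by rewrite -sm_nm// EX. Qed.

Lemma sm_psd (D : set borelC) : measurable D -> psd (E D).
Proof.
move=> /sm_proj pD; split; first exact: pD.2.
by move=> x; rewrite projection_nm//= sqr_ge0.
Qed.

Lemma Rintegral_near (nu : {measure set borelC -> \bar R}) (u : X -> R) (D : set borelC) (a e : R) :
  (nu setT < +oo)%E -> continuous u -> measurable D -> D `<=` X ->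
  (forall x : X, D (val x) -> `|u x - a| <= e) ->
  `|a * fine (nu D) - \int[nu]_(z in D) valL_ 0 u z| <= e * fine (nu D).
Proof.
move=> nf cu mD DX hu.
have iu : nu.-integrable D (EFin \o (valL_ 0 u : borelC -> R)).
  by apply: integrableS (integrable_valL hX nf cu).
have ic (c : R) : nu.-integrable D (EFin \o (fun _ : borelC => c)).
  apply: measurable_bounded_integrable => //; first exact: (mu_lty nf).
  by exists `|c|; split; [exact: num_real|move=> N /ltW cN z _; exact: le_trans cN].
have h1 : (a - e) * fine (nu D) <= \int[nu]_(z in D) valL_ 0 u z.
  rewrite -Rintegral_cst//; apply: le_Rintegral => // z Dz; rewrite (valL_in 0 u (DX z Dz)).
  by have := hu (exist _ z (mem_set (DX z Dz))) Dz; rewrite ler_norml => /andP[]; lra.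
have h2 : \int[nu]_(z in D) valL_ 0 u z <= (a + e) * fine (nu D).
  rewrite -Rintegral_cst//; apply: le_Rintegral => // z Dz; rewrite (valL_in 0 u (DX z Dz)).
  by have := hu (exist _ z (mem_set (DX z Dz))) Dz; rewrite ler_norml => /andP[]; lra.
move: h1 h2; move: (\int[nu]_(z in D) _) (fine _) => b c; rewrite ler_norml => h1 h2.
by apply/andP; split; lra.
Qed.

Lemma Rintegral_partition (nu : {measure set borelC -> \bar R}) (u : X -> R) N (s : nat -> X)
    (D : nat -> set borelC) (e : R) :
  (nu setT < +oo)%E -> continuous u -> (forall i, measurable (D i)) -> trivIset setT D ->
  \big[setU/set0]_(i < N) D i = X ->
  (forall i (x : X), D i (val x) -> `|u x - u (s i)| <= e) ->
  `|\sum_(i < N) u (s i) * fine (nu (D i)) - \int[nu]_(z in (X : set borelC)) valL_ 0 u z|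
    <= e * fine (nu X).
Proof.
move=> nf cu mD tD DN hu; pose A n : set borelC := \big[setU/set0]_(i < n) D i.
have mA n : measurable (A n) by apply: bigsetU_measurable.
have AN n : (n <= N)%N -> A n `<=` X.
  by move=> nN; rewrite -DN /A -!bigcup_mkord => z [i /= ni Di]; exists i => //=; exact: leq_trans nN.
have DX i : (i < N)%N -> D i `<=` X.
  by move=> iN; rewrite -DN -bigcup_mkord => z Dz; exists i.
have fin (B : set borelC) : measurable B -> nu B \is a fin_num.
  by move=> mB; rewrite ge0_fin_numE//; exact: (mu_lty nf).
suff key n : (n <= N)%N ->
   `|\sum_(i < n) u (s i) * fine (nu (D i)) - \int[nu]_(z in A n) valL_ 0 u z| <= e * fine (nu (A n)).
  by have := key N (leqnn N); rewrite {1 2}/A DN.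
elim: n => [|n IH] nN.
  by rewrite /A !big_ord0 Rintegral_set0 measure0 mulr0 subrr normr0.
have dAD : A n `&` D n = set0.
  rewrite /A -bigcup_mkord; apply/seteqP; split=> // z [[i /= ni Di] Dn].
  have := tD i n I I (ex_intro _ z (conj Di Dn)) => e1.
  by move: ni; rewrite e1 ltnn.
have -> : A n.+1 = A n `|` D n by rewrite /A big_ord_recr.
have f2 : fine (nu (A n `|` D n)) = fine (nu (A n)) + fine (nu (D n)).
  by rewrite measureU// fineD// fin.
have i2 : \int[nu]_(z in A n `|` D n) valL_ 0 u z =
   \int[nu]_(z in A n) valL_ 0 u z + \int[nu]_(z in D n) valL_ 0 u z.
  apply: Rintegral_setU => //; last by apply/disj_setPS; rewrite dAD.
  apply: integrableS (integrable_valL hX nf cu) => //; first exact: measurableU.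
  by rewrite subUset; split; [exact: AN (ltnW nN)|exact: DX].
rewrite big_ord_recr/= f2 i2 mulrDr opprD addrACA (le_trans (ler_normD _ _))// lerD//.
  exact: IH (ltnW nN).
by apply: (Rintegral_near nf cu (mD n) (DX n nN)) => x; exact: hu.
Qed.

(** The Riemann sums are exactly multiplicative, the projections of a partition being orthogonal.
    They approximate the integral uniformly on quadratic forms, and [numerical_radius] converts this
    into convergence in norm. *)
Lemma spectral_measure_rep_aux : exists rho : CX -> 'B(K), rep rho /\
  forall f h, dotp (rho f h) h = complex_integral (mu h) X (valL_ 0 f).
Proof.
have ex n : exists p : nat * (nat -> X) * (nat -> set borelC),
  [/\ forall i, measurable (p.2 i), trivIset setT p.2, \big[setU/set0]_(i < p.1.1) p.2 i = X &
      forall i z, p.2 i z -> nm (z - val (p.1.2 i)) < n.+1%:R^-1].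
  have [|N [s [D h]]] := @borel_partition n.+1%:R^-1; first by rewrite invr_gt0.
  by exists (N, s, D).
have [p hp] := choice ex.
pose P n (i : 'I_(p n).1.1) := E ((p n).2 i).
have mD n i : measurable ((p n).2 i) by case: (hp n).
have pP n i : psd (P n i) by exact: sm_psd.
have sP n : \sum_i P n i = 1.
  apply: op_quad_ext => h; rewrite op_sumE ip_suml op1E ipxx -sm_X.
  under eq_bigr => i _ do rewrite (smu h (mD n i)).2.
  rewrite -rmorph_sum; congr (_%:C); have [_ tD DX _] := hp n.
  have -> : mu h X = mu h (\big[setU/set0]_(i < (p n).1.1) (p n).2 i) by rewrite DX.
  by rewrite measure_bigsetU// -sum_fine// => i _; exact: (smu h (mD n i)).1.
have orth n i j : i != j -> P n i * P n j = 0.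
  move=> ij; apply: sm_orth => //; apply/eqP/negP => /negP/set0P[x [xi xj]].
  have [_ tD _ _] := hp n; have := tD i j I I (ex_intro _ x (conj xi xj)) => /val_inj e.
  by move: ij; rewrite e eqxx.
pose I_ n (f : CX) : 'B(K) := \sum_i f ((p n).1.2 (val i)) *: P n i.
have IE n f h : I_ n f h = \sum_i f ((p n).1.2 (val i)) *: P n i h by rewrite /I_ op_sumE.
have I_lin n : linear (I_ n).
  move=> a f g; rewrite /I_ scaler_sumr -big_split/=; apply: eq_bigr => k _.
  by rewrite scalerDl scalerA.
have I_bound n (f : CX) (M : R) : 0 <= M -> (forall x : X, nm (f x) <= M) ->
    forall h, nm (I_ n f h) <= 1 * M * nm h.
  by move=> M0 hM h; rewrite IE mul1r; exact: (povm_norm (pP n) (sP n)).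
have I_one n : I_ n 1 = 1.
  by rewrite /I_ -[RHS](sP n); apply: eq_bigr => k _; rewrite scale1r.
have I_adj n f : I_ n (cf_conj f) = adjoint (I_ n f).
  rewrite /I_ (big_morph _ (@adjointD R K) (@adjoint0 R K)); apply: eq_bigr => k _.
  by rewrite adjointZ (pP n k).1.
have I_mul0 n f g : I_ n (f * g) = I_ n f * I_ n g.
  rewrite /I_ mulr_suml; apply: eq_bigr => i _; rewrite mulr_sumr (bigD1 i)//= big1 ?addr0.
    by rewrite op_scaleAl op_scaleAr scalerA cfM (sm_proj (mD n i)).1.
  by move=> j ji; rewrite op_scaleAl op_scaleAr orth ?scaler0// eq_sym.
have I_int f (e : R) : 0 < e -> exists N, forall n, (N <= n)%N -> forall h,
    nm (dotp (I_ n f h) h - complex_integral (mu h) X (valL_ 0 f)) <= e * nm h ^+ 2.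
  move=> e0; have e2 : 0 < e / 2 by rewrite divr_gt0.
  have [d d0 hd] := cf_unif_continuous hX (@cf_continuous R X f) e2.
  exists (Num.truncn d^-1) => n Nn h.
  have nd : n.+1%:R^-1 < d.
    rewrite invf_plt ?posrE//; apply: lt_le_trans (real_truncnS_gt (num_real _)) _.
    by rewrite ler_nat ltnS.
  have [_ tD DN hD] := hp n; set s := (p n).1.2 in hD *; set D := (p n).2 in tD DN hD *.
  have near i (x : X) : D i (val x) -> nm (f x - f (s i)) < e / 2.
    by move=> /hD h1; apply: hd; exact: lt_trans h1 nd.
  have cR := ctsRe (@cf_continuous R X f); have cI := ctsIm (@cf_continuous R X f).
  have dR i (x : X) : D i (val x) -> `|complex.Re (f x) - complex.Re (f (s i))| <= e / 2.
    by move=> Dx; rewrite -ReB; exact: le_trans (normRe_le_nm _) (ltW (near i x Dx)).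
  have dI i (x : X) : D i (val x) -> `|complex.Im (f x) - complex.Im (f (s i))| <= e / 2.
    by move=> Dx; rewrite -ImB; exact: le_trans (normIm_le_nm _) (ltW (near i x Dx)).
  have hR := Rintegral_partition (smfin h) cR (mD n) tD DN dR.
  have hI := Rintegral_partition (smfin h) cI (mD n) tD DN dI.
  have eq1 (q : R[i] -> R) :
     \int[mu h]_(z in (X : set borelC)) q ((valL_ 0 (f : X -> R[i]) : R[i] -> R[i]) z) =
     \int[mu h]_(z in (X : set borelC)) (valL_ 0 (fun x : X => q (f x)) : R[i] -> R) z.
    apply: eq_Rintegral => z; rewrite inE => Xz.
    by rewrite (valL_in 0 (f : X -> R[i]) Xz) (valL_in 0 (fun x : X => q (f x)) Xz).
  have ipE : dotp (I_ n f h) h = \sum_(i < (p n).1.1) (fine (mu h (D i)))%:C * f (s i).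
    rewrite IE ip_suml; apply: eq_bigr => i _.
    by rewrite ipZl (smu h (mD n i)).2 mulrC.
  apply: le_trans (nm_le_ReIm _) _; rewrite ipE ReB ImB Re_sum Im_sum /complex_integral/= !eq1.
  under eq_bigr do rewrite ReCM mulrC; under [X in _ + `|X - _|]eq_bigr do rewrite ImCM mulrC.
  rewrite sm_X in hR hI; apply: le_trans (lerD hR hI) _.
  by move: (nm h ^+ 2) => t; lra.
have I_cvg f h : exists l : K, I_ n f h @[n --> \oo] --> l.
  apply: cauchy_cvgn => e e0.
  have h1 : 0 < 4 * (nm h + 1) by rewrite mulr_gt0// ltr_wpDl ?nm_ge0.
  have d0 := divr_gt0 e0 h1; have [N hN] := I_int f _ d0.
  exists N => n m Nn Nm; set d := e / _ in d0 hN.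
  have num x : nm (dotp ((I_ n f - I_ m f) x) x) <= 2 * d * nm x ^+ 2.
    rewrite opBE ipBl; have := hN n Nn x; have := hN m Nm x.
    have := nm_triB (dotp (I_ n f x) x) (complex_integral (mu x) X (valL_ 0 f)) (dotp (I_ m f x) x).
    rewrite [nm (complex_integral _ _ _ - _)]nmB.
    by move: (nm _) (nm _) (nm _) (nm _ ^+ 2) => a b c t; lra.
  have d2 : 0 <= 2 * d by rewrite mulr_ge0 ?(ltW d0).
  have := numerical_radius d2 num h; rewrite opBE => /le_lt_trans; apply.
  have -> : 2 * (2 * d) * nm h = e * (nm h / (nm h + 1)).
    by rewrite /d; field; rewrite gt_eqF// ltr_wpDl ?nm_ge0.
  by rewrite gtr_pMr// ltr_pdivrMr ?mul1r ?ltrDl// ltr_wpDl ?nm_ge0.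
have I_mul f g h (e : R) : 0 < e -> exists N, forall n, (N <= n)%N ->
    nm (I_ n (f * g) h - I_ n f (I_ n g h)) < e.
  by move=> e0; exists 0%N => n _; rewrite I_mul0 opME subrr nm0.
have [rho [rrho hrho]] := limit_rep hX I_lin I_bound I_one I_adj I_cvg I_mul.
exists rho; split => // f h; apply: (cvgC_unique (u := fun n => dotp (I_ n f h) h)).
  by apply/cvgCP; apply: ip_cvg (hrho f h) _; exact: cvg_cst.
move=> e e0; have h1 : 0 < nm h ^+ 2 + 1 by rewrite ltr_wpDl ?sqr_ge0.
have [N hN] := I_int f _ (divr_gt0 e0 h1); exists N => n /hN/(_ h) /le_lt_trans; apply.
by rewrite mulrAC ltr_pdivrMr// ltr_pM2l// ltrDl.
Qed.

End integral_representation.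

Lemma scalar_measure_integral (R : realType) (K : hilbertType R) (X : set R[i])
    (E : set R[i] -> 'B(K)) (h : K)
    (mu nu : {measure set (g_sigma_algebraType (@open R[i])) -> \bar R}) (g : R[i] -> R[i]) :
  scalar_measure E h mu -> scalar_measure E h nu ->
  complex_integral mu X g = complex_integral nu X g.
Proof.
move=> smu snu; rewrite /complex_integral /Rintegral.
have e (A : set (g_sigma_algebraType (@open R[i]))) : measurable A -> A `<=` X -> mu A = nu A.
  move=> mA _; have [f1 e1] := smu A mA; have [f2 e2] := snu A mA.
  rewrite -[LHS]fineK// -[RHS]fineK//; congr (_%:E).
  by have := etrans (esym e1) e2 => /(congr1 (@complex.Re R)).
by congr (fine _ +i* fine _); exact: eq_measure_integral.
Qed.

Theorem spectral_measure_rep (R : realType) (X : set R[i]) (K : hilbertType R)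
    (E : set R[i] -> 'B(K)) : compact X -> X !=set0 -> spectral_measure E -> E X = 1 ->
  exists rho : continuousType X R[i] -> 'B(K), rep rho /\
    forall f h mu, scalar_measure E h mu -> dotp (rho f h) h = complex_integral mu X (valL_ 0 f).
Proof.
move=> hX X0 sE EX; have [_ _ /choice[mu smu]] := sE.
have [rho [rrho hrho]] := spectral_measure_rep_aux hX X0 sE EX smu.
exists rho; split => // f h nu snu; rewrite hrho; exact: scalar_measure_integral (smu h) snu.
Qed.

(** * The functional calculus of subnormal operators *)

Section isometries.
Context (R : realType).

Definition iso (H K : hilbertType R) (V : H -> K) : Prop :=
  blin V /\ forall x y, dotp (V x) (V y) = dotp x y.

Lemma iso_id (H : hilbertType R) : iso (@idfun H).
Proof. by split=> //; split=> //; exists 1 => // x; rewrite mul1r. Qed.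

Lemma iso_nm (H K : hilbertType R) (V : H -> K) x : iso V -> nm (V x) = nm x.
Proof.
move=> [_ h]; apply/eqP; rewrite -(@eqrXn2 _ 2) ?nm_ge0//; apply/eqP.
by rewrite !nm_sqrE h.
Qed.

Lemma iso_adj (H K : hilbertType R) (V : H -> K) x : iso V -> adj V (V x) = x.
Proof. by move=> [bV h]; apply: ip_ext => y; rewrite ipC -(adjP bV) h -ipC. Qed.

Lemma linear_isometry (H K : hilbertType R) (V : {linear H -> K}) :
  (forall h, `|V h| = `|h|) -> iso V.
Proof.
move=> hV; have nV h : nm (V h) = nm h by rewrite /nm hV.
have bV : blin V.
  by split=> [a x y|]; [rewrite linearP|exists 1 => // x; rewrite mul1r nV].
split=> // x y.
have re a b : complex.Re (dotp (V a) (V b)) = complex.Re (dotp a b).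
  have := polar_bound (V a) (V b); rewrite -(blinD bV) -(blinB bV) !nV -polar_bound.
  by lra.
apply: ReIm_inj; first exact: re.
have := re ('i *: x) y; rewrite (blinZ bV) !ipZl !ReiM => /eqP.
by rewrite eqr_opp => /eqP.
Qed.

Lemma iso_linear (H K : hilbertType R) (V : H -> K) : iso V ->
  exists V' : {linear H -> K}, V' =1 V /\ forall h, `|V' h| = `|h|.
Proof.
move=> iV; pose L1 := GRing.isLinear.Build R[i] H K *:%R V (blinP iV.1).
pose V' : {linear H -> K} := HB.pack V L1.
by exists V'; split => // h; rewrite !nmE; congr (_%:C); exact: iso_nm.
Qed.

End isometries.

(** On a monomial z^n conj(z)^m both sides equal <S^n h, S^m k>. Hence the compression to H depends
    on S only, not on the extension. *)
Lemma rep_moments_unique (R : realType) (X : set R[i]) (H K K' : hilbertType R)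
    (S : 'B(H)) (V : H -> K) (V' : H -> K') (rho : continuousType X R[i] -> 'B(K))
    (rho' : continuousType X R[i] -> 'B(K')) :
  compact X -> iso V -> iso V' -> rep rho -> rep rho' ->
  (forall h, V (S h) = rho (cf_id X) (V h)) -> (forall h, V' (S h) = rho' (cf_id X) (V' h)) ->
  forall f h k, dotp (rho f (V h)) (V k) = dotp (rho' f (V' h)) (V' k).
Proof.
move=> hX iV iV' rr rr' VS VS'.
apply: (polynomial_density hX
  (A := [set f | forall h k, dotp (rho f (V h)) (V k) = dotp (rho' f (V' h)) (V' k)])).
- by move=> h k; rewrite (rep_one rr) (rep_one rr') !op1E iV.2 iV'.2.
- move=> a f g hf hg h k.
  by rewrite (rep_lin rr) (rep_lin rr') !opDE !opZE !ipDl !ipZl hf hg.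
- move=> f hf h k; rewrite mulrC (rep_mul rr) (rep_mul rr') !opME -VS -VS'; exact: hf.
- move=> f hf h k; rewrite (rep_mul rr) (rep_mul rr') !opME (rep_conj rr) (rep_conj rr').
  by rewrite -!adjointPr -VS -VS'; exact: hf.
move=> f hf h k; apply/eqP; rewrite -subr_eq0; apply/eqP/nm_eq0/eqP.
rewrite eq_le nm_ge0 andbT; apply/ler_addgt0Pr => e e0; rewrite add0r.
have c0 : 0 < 2 * (nm h * nm k + 1) by rewrite mulr_gt0// ltr_wpDl ?mulr_ge0 ?nm_ge0.
have d0 := divr_gt0 e0 c0; have [g gA fg] := hf _ d0; set d := e / _ in d0 fg.
have bnd (K1 : hilbertType R) (W : H -> K1) (r : continuousType X R[i] -> 'B(K1)) : iso W -> rep r ->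
    nm (dotp (r f (W h)) (W k) - dotp (r g (W h)) (W k)) <= d * (nm h * nm k).
  move=> iW rr1; rewrite -ipBl -opBE -(lmB (rep_lin rr1)).
  apply: le_trans (cauchy_schwarz _ _) _; rewrite (iso_nm k iW) mulrA ler_wpM2r ?nm_ge0//.
  rewrite -(iso_nm h iW); apply: cp_bound (rep_cp rr1) _ _ (ltW d0) _ _ => x.
  by rewrite cfB.
have b1 := bnd _ _ _ iV rr; have b2 := bnd _ _ _ iV' rr'; rewrite -gA nmB in b2.
have b3 := nm_triB (dotp (rho f (V h)) (V k)) (dotp (rho g (V h)) (V k)) (dotp (rho' f (V' h)) (V' k)).
apply: le_trans b3 _; apply: le_trans (lerD b1 b2) _.
have -> : d * (nm h * nm k) + d * (nm h * nm k) = e * (nm h * nm k / (nm h * nm k + 1)).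
  by rewrite /d; field; rewrite gt_eqF// ltr_wpDl ?mulr_ge0 ?nm_ge0.
apply: ler_piMr; first exact: ltW.
by rewrite ler_pdivrMr ?mul1r ?lerDl// ltr_wpDl ?mulr_ge0 ?nm_ge0.
Qed.

Lemma closed_kernel (R : realType) (K : hilbertType R) (T : 'B(K)) :
  closed_subspace [set x | T x = 0].
Proof.
apply: closed_subspaceP => [|a x y /= hx hy|x hx] /=; first exact: op0.
  by rewrite opD opZ hx hy scaler0 addr0.
have [C C0 hC] := op_bound T; apply: nm_eq0; apply/eqP; rewrite eq_le nm_ge0 andbT.
apply/ler_addgt0Pr => e e0; rewrite add0r; have [y /= Ty xy] := hx _ (divr_gt0 e0 C0).
rewrite -[T x]subr0 -Ty -opB; apply: le_trans (hC _) _.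
by rewrite mulrC -ler_pdivlMr// ltW.
Qed.

Section normal_extensions.
Context (R : realType) (H : hilbertType R) (S : 'B(H)).

(** If S - l is invertible, functions supported near l annihilate the range of V. The kernel of pi f
    is closed and reduces N, so by minimality it is everything, and N - l is invertible. *)
Lemma minimal_spectrum (K : hilbertType R) (V : {linear H -> K}) (N : 'B(K)) :
  minimal_normal_extension S V N -> spectrum N `<=` spectrum S.
Proof.
move=> [[nV nN VS] minV]; have [bV iV] := linear_isometry nV.
have [c c0 hc] := op_bound N; have [pi [rpi piN]] := square_rep nN c0 hc.
have hQ : compact (square c) by exact: compact_square.
move=> l; apply: contraPP => nSl.
have VS' h : V (S h) = pi (cf_id _) (V h) by rewrite piN VS.
have [d d0 hd] := rep_bump_zero hQ rpi bV VS' nSl.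
rewrite -piN; apply: (rep_resolvent rpi d0) => f hf.
apply/boundedOpP => x; rewrite op0E; pose M := [set x : K | pi f x = 0].
have Nf y : pi f (N y) = N (pi f y) by rewrite -piN -!opME -!(rep_mul rpi) mulrC.
have Nf' y : pi f (adjoint N y) = adjoint N (pi f y).
  by rewrite -piN -(rep_conj rpi) -!opME -!(rep_mul rpi) mulrC.
have : M = setT.
  apply: minV; first exact: closed_kernel.
    by move=> y /= My; split; rewrite /M/= ?Nf ?Nf' My op0.
  by move=> _ [h _ <-]; exact: hd.
by move=> /seteqP[_ /(_ x I)].
Qed.

(** The span of the vectors N0^{*n} V0 h reduces N0. It is realised as an abstract Kolmogorov space
    with an isometry U into K0 instead of as a subspace of K0. *)
Lemma minimal_extension_exists : subnormal S ->
  exists (K : hilbertType R) (V : {linear H -> K}) (N : 'B(K)), minimal_normal_extension S V N.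
Proof.
move=> [K0 [V0 [N0 [nV0 nN0 VS0]]]]; have [bV0 iV0] := linear_isometry nV0.
pose t (p : nat * H) : K0 := iter p.1 (adjoint N0) (V0 p.2).
have [K [v [hv tv]]] := kolmogorov_decomposition (gram_pd t).
have [U [bU Uv iU]] := total_isometry tv (fun i j => esym (hv i j)).
have isoU : iso U by [].
(* Invariance of the range of U under T, written with the projection U adj U; it is enough to check
   it on the generators. *)
pose cls (T : 'B(K0)) := forall x, U (adj U (T (U x))) = T (U x).
have blinUTU (T : 'B(K0)) : blin (adj U \o (T \o U)).
  by apply: blin_comp (blin_adj bU) _; apply: blin_comp (blin_op T) bU.
have clsP (T : 'B(K0)) : (forall i, exists j, T (U (v i)) = U (v j)) -> cls T.
  move=> hT; apply: (total_blin_ext tv (f := U \o (adj U \o (T \o U))) (g := T \o U)).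
  - exact: blin_comp.
  - exact: blin_comp (blin_op T) bU.
  by move=> i; have [j /= ->] := hT i; rewrite iso_adj.
have commN n x : N0 (iter n (adjoint N0) x) = iter n (adjoint N0) (N0 x).
  by elim: n => //= n <-; rewrite -opME nN0.
have cN : cls N0.
  by apply: clsP => -[n h]; exists (n, S h); rewrite !Uv /t/= commN VS0.
have cN' : cls (adjoint N0).
  by apply: clsP => -[n h]; exists (n.+1, h); rewrite !Uv.
pose N : 'B(K) := toB (adj U \o (N0 \o U)).
have UN x : U (N x) = N0 (U x) by rewrite /N toBE//; exact: cN.
have N'E : adjoint N = toB (adj U \o (adjoint N0 \o U)).
  apply: adjoint_uniq => x y; rewrite toBE//= -(adjP bU) -iU UN.
  by rewrite adjointP.
have UN' x : U (adjoint N x) = adjoint N0 (U x) by rewrite N'E toBE//; exact: cN'.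
have UadjV h : U (adj U (V0 h)) = V0 h.
  have -> : V0 h = U (v (0%N, h)) by rewrite Uv.
  by rewrite iso_adj.
have isoV : iso (adj U \o V0).
  split; first exact: blin_comp (blin_adj bU) bV0.
  by move=> x y /=; rewrite -iU !UadjV iV0.
have [V [VE nV]] := iso_linear isoV.
have Uinj x y : U x = U y -> x = y by move=> e; rewrite -(iso_adj x isoU) e iso_adj.
exists K, V, N; split; first split => //.
- by apply/boundedOpP => x; apply: Uinj; rewrite !opME !(UN, UN') -!opME nN0.
- by move=> h; apply: Uinj; rewrite UN !VE /= !UadjV VS0.
move=> M cM rM VM; apply/seteqP; split => // x _; apply: (total_closed tv cM) => -[n h].
suff -> : v (n, h) = iter n (adjoint N) (V h).
  elim: n => [|n IH] /=; first by apply: VM; exists h.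
  by have [] := rM _ IH.
apply: Uinj; rewrite Uv /t/=; elim: n => [|n IH] /=; first by rewrite VE/= UadjV.
by rewrite IH UN'.
Qed.

End normal_extensions.

Section functional_calculus.
Context (R : realType) (X : set R[i]) (hX : compact X) (X0 : X !=set0).
Notation CX := (continuousType X R[i]).
Notation borelC := (g_sigma_algebraType (@open R[i])).

Lemma spectral_measure_supset (K : hilbertType R) (N : 'B(K)) (E : set R[i] -> 'B(K))
    (D D' : set borelC) :
  spectral_measure E -> measurable D -> measurable D' -> D `<=` D' -> E D = 1 -> E D' = 1.
Proof.
move=> [ET pE mE] mD mD' DD' ED; apply: op_quad_ext => h; have [mu smu] := mE h.
have [f1 e1] := smu _ mD; have [f2 e2] := smu _ mD'; have [f3 e3] := smu _ measurableT.
rewrite op1E e2 ipxx; congr (_%:C); apply/eqP; rewrite eq_le.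
move: e1 e3; rewrite ED ET op1E ipxx.
move=> /(congr1 (@complex.Re R))/= e1 /(congr1 (@complex.Re R))/= e3.
rewrite {1}e3 e1; apply/andP; split; apply: fine_le => //; apply: le_measure; rewrite ?inE//.
Qed.

Lemma spectral_measure_of_rep (K : hilbertType R) (N : 'B(K)) (E : set R[i] -> 'B(K)) :
  normal_op N -> spectral_measure_of N E -> spectrum N `<=` X ->
  exists rho : CX -> 'B(K), [/\ rep rho, rho (cf_id X) = N &
    forall f h mu, scalar_measure E h mu -> dotp (rho f h) h = complex_integral mu X (valL_ 0 f)].
Proof.
move=> nN [sE EN NE] NX.
have mN : measurable (spectrum N : set borelC) by apply: closed_borel; exact: spectrum_closed.
have EX : E X = 1 by apply: (spectral_measure_supset N sE mN (compact_borel hX) NX EN).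
have [rho [rrho hrho]] := spectral_measure_rep hX X0 sE EX.
exists rho; split => //; apply: op_quad_ext => h; have [mu smu ->] := NE h.
rewrite (hrho _ _ _ smu).
have [f1 e1] := smu _ measurableT; have [f2 e2] := smu _ mN.
have mufin : (mu setT < +oo)%E by rewrite ltey_eq f1.
apply: (complex_integral_support hX mufin) => //.
have [ET _ _] := sE; move: e1 e2; rewrite ET EN !op1E => ->.
move=> /(congr1 (@complex.Re R))/= e1.
have : mu setT = (mu (spectrum N) + mu (~` spectrum N))%E.
  by rewrite -(setUv (spectrum N)); exact: measureU mN (measurableC mN) (setICr _).
have f3 := (smu _ (measurableC mN)).1.
move=> /(congr1 fine); rewrite fineD// e1 => e2.
rewrite -[LHS]fineK//; congr (_%:E).
by apply: (addrI (fine (mu (spectrum N)))); rewrite addr0 -e2.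
Qed.

(** Replaces the choice in [fun_calc] by a compression of a representation; all later use of the
    functional calculus of subnormal operators goes through it. *)
Theorem fun_calcP (H : hilbertType R) (S : 'B(H)) : subnormal S -> spectrum S `<=` X ->
  exists (K : hilbertType R) (V : H -> K) (rho : CX -> 'B(K)),
    [/\ iso V, rep rho, forall h, V (S h) = rho (cf_id X) (V h) &
      forall f h k, dotp (fun_calc S f h) k = dotp (rho f (V h)) (V k)].
Proof.
move=> sS SX.
have ext (K : hilbertType R) (V : {linear H -> K}) (N : 'B(K)) E :
    minimal_normal_extension S V N -> spectral_measure_of N E ->
    exists rho : CX -> 'B(K), [/\ iso V, rep rho, forall h, V (S h) = rho (cf_id X) (V h) &
      forall f h mu, scalar_measure E h mu -> dotp (rho f h) h = complex_integral mu X (valL_ 0 f)].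
  move=> mV sN; have [[nV nN VS] _] := mV.
  have NX : spectrum N `<=` X by apply: subset_trans SX; exact: minimal_spectrum mV.
  have [rho [rrho rN hrho]] := spectral_measure_of_rep nN sN NX.
  by exists rho; split => //; [exact: linear_isometry|move=> h; rewrite rN VS].
have [K [V [N mV]]] := minimal_extension_exists sS.
have [[nV nN VS] _] := mV.
have [c c0 hc] := op_bound N; have [pi [rpi piN]] := square_rep nN c0 hc.
have hQ : compact (square c) by exact: compact_square.
have [E [sE _]] := rep_spectral_measure hQ rpi; rewrite piN in sE.
have [rho [iV rrho VS' hrho]] := ext _ _ _ _ mV sE.
exists K, V, rho; split => // f h k.
have [bV iV'] := iV.
pose cmp (T : 'B(K)) : 'B(H) := toB (adj V \o (T \o V)).
have cmpE T x y : dotp (cmp T x) y = dotp (T (V x)) (V y).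
  rewrite /cmp toBE /=; last by apply: blin_comp (blin_adj bV) _; apply: blin_comp (blin_op T) bV.
  by rewrite ipC -(adjP bV) -ipC.
suff -> : fun_calc S f = cmp (rho f) by rewrite cmpE.
(* The chosen operator may come from another minimal extension and is identified by uniqueness of
   moments. The second branch shows that a choice was possible. *)
rewrite /fun_calc; case: xgetP => [A _ [F [K' [V' [N' [P' [E' [mV' sE' pP' rP' hF]]]]]] hA]|].
  have [rho' [iV1 rrho' VS1 hrho']] := ext _ _ _ _ mV' sE'.
  apply: op_quad_ext => x; rewrite cmpE.
  rewrite (rep_moments_unique hX iV iV1 rrho rrho' VS' VS1).
  have [mu smu ->] := hA x; symmetry; apply: hrho' => D mD.
  have [f1 e1] := smu D mD; split => //; rewrite -e1 -iV1.2 hF//.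
  have [y Py] : exists y, P' y = V' x.
    have : range V' (V' x) by exists x.
    by rewrite -rP' => -[y _ <-]; exists y.
  by rewrite [RHS]adjointP pP'.2 -Py -[P' (P' y)]opME pP'.1.
pose F (D : set R[i]) := cmp (E D).
pose P : 'B(K) := toB (V \o adj V).
have PE x : P x = V (adj V x) by rewrite /P toBE//; apply: blin_comp => //; exact: blin_adj.
move=> /(_ (cmp (rho f))) []; exists F.
  exists K, V, N, P, E; split => //.
  - split; first by apply/boundedOpP => x; rewrite opME !PE iso_adj.
    by apply: adjoint_uniq => x y; rewrite !PE (adjP bV) (adjPr bV).
  - apply/seteqP; split=> [_ [x _ <-]|_ [x _ <-]]; first by rewrite PE; exists (adj V x).
    by exists (V x) => //; rewrite PE iso_adj.
  move=> D mD x; rewrite PE /F /cmp toBE//=.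
  by apply: blin_comp (blin_adj bV) _; apply: blin_comp (blin_op _) bV.
move=> x; have [[_ _ sE'] _ _] := sE; have [mu smu] := sE' (V x).
exists mu; last by rewrite cmpE; exact: hrho.
by move=> D mD; have [f1 e1] := smu D mD; split => //; rewrite /F cmpE.
Qed.

Lemma fun_calc_rep (H : hilbertType R) (rho : CX -> 'B(H)) f : rep rho ->
  fun_calc (rho (cf_id X)) f = rho f.
Proof.
move=> rr; set S := rho (cf_id X).
have [V [VE nV]] := iso_linear (iso_id H).
have sS : subnormal S.
  by exists H, V, S; split => //; [exact: rep_id_normal|move=> h; rewrite !VE].
have [K [W [r [iW rr' WS hW]]]] := fun_calcP sS (rep_spectrum_sub hX rr).
apply: op_quad_ext => h; rewrite hW.
by rewrite (rep_moments_unique hX iW (iso_id H) rr' rr WS (fun=> erefl)).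
Qed.

Lemma normal_subnormal (H : hilbertType R) (T : 'B(H)) : normal_op T -> subnormal T.
Proof.
move=> nT; have [V [VE nV]] := iso_linear (iso_id H).
by exists H, V, T; split => // h; rewrite !VE.
Qed.

Lemma normal_rep (H : hilbertType R) (T : 'B(H)) : normal_op T -> spectrum T `<=` X ->
  exists rho : CX -> 'B(H), rep rho /\ rho (cf_id X) = T.
Proof.
move=> nT TX; have [c c0 hc] := op_bound T; have [pi [rpi piN]] := square_rep nT c0 hc.
have hQ : compact (square c) by exact: compact_square.
have [E [sE _]] := rep_spectral_measure hQ rpi; rewrite piN in sE.
by have [rho [rrho rN _]] := spectral_measure_of_rep nT sE TX; exists rho.
Qed.

End functional_calculus.

(** * Ultrafilter limits and dilations *)

Section ultralimit.
Context (R : realType) (F : set_system nat) (UF : UltraFilter F).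
Hypothesis Foo : (\oo : set_system nat) `<=` F.
Implicit Types (u w : nat -> R[i]) (l : R[i]).

Definition ucvg u l : Prop := forall e : R, 0 < e -> F [set n | nm (u n - l) < e].

Definition nbounded u : Prop := exists M : R, forall n, nm (u n) <= M.

Lemma ucvg_ex u : nbounded u -> exists l, ucvg u l.
Proof.
move=> [M hM]; have FM : F [set n | square M (u n)].
  apply: filterS filterT => n _; split; apply: le_trans (hM n).
    exact: normRe_le_nm.
  exact: normIm_le_nm.
have [l [_ hl]] : square M `&` cluster (u @ F) !=set0.
  by apply: (@compact_square R M).
exists l => e e0; have [//|nF] := in_ultra_setVsetC [set n | nm (u n - l) < e] UF.
have nl : nbhs l [set z | nm (z - l) < e] by apply/nbhs_CP; exists e.
have := hl (~` [set z | nm (z - l) < e]) _ nF nl.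
by move=> [z []].
Qed.

Lemma ucvg_witness u l w l' (e : R) : 0 < e -> ucvg u l -> ucvg w l' ->
  exists n, nm (u n - l) < e /\ nm (w n - l') < e.
Proof.
move=> e0 /(_ e e0) h1 /(_ e e0) h2; have [n [a b]] := filter_ex (filterI h1 h2).
by exists n.
Qed.

Lemma ucvg_unique u l l' : ucvg u l -> ucvg u l' -> l = l'.
Proof.
move=> h1 h2; apply/eqP; rewrite -subr_eq0; apply/eqP/nm_eq0/eqP.
rewrite eq_le nm_ge0 andbT; apply/ler_addgt0Pr => e e0; rewrite add0r.
have [n [a b]] := ucvg_witness (divr_gt0 e0 (ltr0n R 2)) h1 h2.
apply/ltW/(le_lt_trans (nm_triB l (u n) l')).
by apply: half_ltD; rewrite // nmB.
Qed.

Lemma ucvgD u w l l' : ucvg u l -> ucvg w l' -> ucvg (fun n => u n + w n) (l + l').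
Proof.
move=> h1 h2 e e0; have e2 := divr_gt0 e0 (ltr0n R 2).
apply: filterS (filterI (h1 _ e2) (h2 _ e2)) => n [a b] /=.
by rewrite opprD addrACA; apply: le_lt_trans (nmD _ _) _; exact: half_ltD.
Qed.

Lemma ucvgZ a u l : ucvg u l -> ucvg (fun n => a * u n) (a * l).
Proof.
move=> h1 e e0; have a1 : 0 < nm a + 1 by rewrite ltr_wpDl ?nm_ge0.
apply: filterS (h1 _ (divr_gt0 e0 a1)) => n /=; rewrite -mulrBr nmM ltr_pdivlMr//.
by apply: le_lt_trans; rewrite mulrC ler_wpM2l ?nm_ge0// lerDl.
Qed.

Lemma ucvgB u w l l' : ucvg u l -> ucvg w l' -> ucvg (fun n => u n - w n) (l - l').
Proof.
move=> h1 h2; rewrite -[- l']mulN1r.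
by under eq_fun do rewrite -[- w _]mulN1r; exact: ucvgD h1 (ucvgZ _ h2).
Qed.

Lemma ucvg_cst l : ucvg (fun=> l) l.
Proof. by move=> e e0; apply: filterS filterT => n _ /=; rewrite subrr nm0. Qed.

Lemma ucvg_ge0 u l : ucvg u l -> (forall n, 0 <= u n) -> 0 <= l.
Proof.
move=> h u0; have key (e : R) : 0 < e -> `|complex.Im l| <= e /\ - e <= complex.Re l.
  move=> e0; have [n [a _]] := ucvg_witness e0 h h.
  have := u0 n; rewrite lecE/= => /andP[/eqP i0 r0].
  have := le_lt_trans (normIm_le_nm _) a; have := le_lt_trans (normRe_le_nm _) a.
  rewrite ReB ImB i0 sub0r normrN ltr_norml => /andP[_ h1] h2; split; first exact: ltW.
  by move: r0 h1; lra.
rewrite lecE/=; apply/andP; split.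
  rewrite -normr_le0 leNgt; apply/negP => i0.
  have [] := key _ (divr_gt0 i0 (ltr0n R 2)); move: i0; move: `|_| => t; lra.
rewrite leNgt; apply/negP => r0; have [|_] := key (- complex.Re l / 2).
  by rewrite divr_gt0 ?oppr_gt0.
by move: r0; lra.
Qed.

Lemma ucvg_le u l (C : R) : ucvg u l -> (forall n, nm (u n) <= C) -> nm l <= C.
Proof.
move=> h uC; apply/ler_addgt0Pr => e e0; have [n [a _]] := ucvg_witness e0 h h.
have := nm_Bdist l (u n); have := uC n; rewrite nmB in a; lra.
Qed.

Lemma ucvg_cvgC u l : cvgC u l -> ucvg u l.
Proof. by move=> h e /h[N hN]; apply: Foo; exists N. Qed.

Definition ulim u : R[i] := xget 0 [set l | ucvg u l].

Lemma ulimP u : nbounded u -> ucvg u (ulim u).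
Proof. by move=> /ucvg_ex[l hl]; rewrite /ulim; case: xgetP => [m _ //|/(_ l)]. Qed.

Lemma ulimE u l : ucvg u l -> ulim u = l.
Proof.
by move=> h; rewrite /ulim; case: xgetP => [m _ hm|/(_ l)//]; exact: ucvg_unique hm h.
Qed.

Lemma ucvg_sum (I : Type) (r : seq I) (U : I -> nat -> R[i]) (L : I -> R[i]) :
  (forall i, ucvg (U i) (L i)) -> ucvg (fun n => \sum_(i <- r) U i n) (\sum_(i <- r) L i).
Proof.
move=> h; elim: r => [|i r IH].
  by rewrite big_nil; under eq_fun do rewrite big_nil; exact: ucvg_cst.
by rewrite big_cons; under eq_fun do rewrite big_cons; exact: ucvgD.
Qed.

End ultralimit.

Lemma total_eq (R : realType) (K : hilbertType R) (I : Type) (v : I -> K) x y :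
  total_family v -> (forall i, dotp x (v i) = dotp y (v i)) -> x = y.
Proof.
move=> tv h; apply/eqP; rewrite -subr_eq0; apply/eqP/tv => i.
by rewrite ipBl h subrr.
Qed.

Lemma total_op_ext (R : realType) (K : hilbertType R) (I : Type) (v : I -> K) (S T : 'B(K)) :
  total_family v -> (forall i, S (v i) = T (v i)) -> S = T.
Proof.
by move=> tv h; apply/boundedOpP; exact: (total_blin_ext tv (blin_op S) (blin_op T) h).
Qed.

(** Implies separability, and is easier to transport to direct sums and dilations than a countable
    dense set. *)
Definition ctotal (R : realType) (K : hilbertType R) : Prop :=
  exists d : nat -> K, total_family d.

Lemma total_ctotal (R : realType) (K : hilbertType R) (I : countType) (v : I -> K) :
  total_family v -> ctotal K.
Proof.
move=> tv; exists (fun n => if unpickle n is Some i then v i else 0) => x hx.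
by apply: tv => i; have := hx (pickle i); rewrite pickleK.
Qed.

Lemma ctotal_separable (R : realType) (K : hilbertType R) : ctotal K -> separable K.
Proof. by move=> [d]; exact: total_separable. Qed.

(** * Dilation of a positive form on pairs of functions *)

Section dilation.
Context (R : realType) (X : set R[i]) (hX : compact X).
Notation CX := (continuousType X R[i]).
Context (B : CX -> CX -> CX -> R[i]) (C : R).
Hypothesis Bf : forall a f g b c, B (a *: f + g) b c = a * B f b c + B g b c.
Hypothesis Bb : forall a f b b' c, B f (a *: b + b') c = a * B f b c + B f b' c.
Hypothesis Bpd : pd_kernel (fun p q : CX * CX => B (cf_conj q.1 * p.1) p.2 q.2).
Hypothesis C0 : 0 <= C.
Hypothesis Bbound : forall (f b : CX) (M Mb : R), 0 <= M -> 0 <= Mb ->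
  (forall x, nm (f x) <= M) -> (forall x, nm (b x) <= Mb) -> nm (B f b b) <= C * M * Mb ^+ 2.

Context (K : hilbertType R) (v : CX * CX -> K).
Hypothesis vB : forall p q, dotp (v p) (v q) = B (cf_conj q.1 * p.1) p.2 q.2.
Hypothesis tv : total_family v.

Lemma dil_linl a (f g b : CX) : v (a *: f + g, b) = a *: v (f, b) + v (g, b).
Proof.
apply: (total_eq tv) => p; rewrite ipDl ipZl !vB/= -Bf; congr (B _ _ _).
by apply: cfP => x; rewrite !(cfD, cfM, cfZ, cfJ); ring.
Qed.

Lemma dil_linr a (f b c : CX) : v (f, a *: b + c) = a *: v (f, b) + v (f, c).
Proof. by apply: (total_eq tv) => p; rewrite ipDl ipZl !vB/= Bb. Qed.

Lemma dil_bound (f b : CX) (M Mb : R) : 0 <= M -> 0 <= Mb ->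
  (forall x, nm (f x) <= M) -> (forall x, nm (b x) <= Mb) -> nm (v (f, b)) <= (C + 1) * M * Mb.
Proof.
move=> M0 Mb0 hM hMb.
have C1 : 0 <= C + 1 by rewrite addr_ge0.
rewrite -(@ler_pXn2r _ 2)// ?nnegrE ?nm_ge0 ?mulr_ge0// nm_sqrE vB/=.
apply: le_trans (Re_le_nm _) _; apply: le_trans (Bbound (sqr_ge0 M) Mb0 _ hMb) _.
  by move=> x; rewrite !cfE nmM nm_conj expr2 ler_pM ?nm_ge0.
have -> : ((C + 1) * M * Mb) ^+ 2 = (C + 1) ^+ 2 * (M ^+ 2 * Mb ^+ 2) by ring.
rewrite -mulrA; apply: ler_wpM2r; first by rewrite mulr_ge0 ?sqr_ge0.
have := sqr_ge0 C; rewrite sqrrD1 mulr2n; lra.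
Qed.

Definition dil_shift (g : CX) (p : CX * CX) : K := v (g * p.1, p.2).

(** Since |g|^2 + |u|^2 = M^2 on X, the shifts by g and by u share out M^2 times the norm square; in
    particular the shift by g is bounded by M. *)
Lemma dil_shift_norm (g u : CX) (M : R) s : cf_conj g * g + cf_conj u * u = (M ^+ 2)%:C *: (1 : CX) ->
  nm (comb (dil_shift g) s) ^+ 2 + nm (comb (dil_shift u) s) ^+ 2 = M ^+ 2 * nm (comb v s) ^+ 2.
Proof.
move=> e; rewrite !nm_sqrE !comb_dot -ReD -ReCM; congr complex.Re.
rewrite /kform -big_split mulr_sumr; apply: eq_bigr => p _ /=.
rewrite -big_split mulr_sumr; apply: eq_bigr => q _ /=.
rewrite /dil_shift -mulrDr !vB [RHS]mulrCA; congr (_ * _).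
change (B (cf_conj (g * q.2.1) * (g * p.2.1)) p.2.2 q.2.2 +
    B (cf_conj (u * q.2.1) * (u * p.2.1)) p.2.2 q.2.2 =
  (M ^+ 2)%:C * B (cf_conj q.2.1 * p.2.1) p.2.2 q.2.2).
have -> : B (cf_conj (g * q.2.1) * (g * p.2.1)) p.2.2 q.2.2 +
    B (cf_conj (u * q.2.1) * (u * p.2.1)) p.2.2 q.2.2 =
  B ((cf_conj g * g + cf_conj u * u) * (cf_conj q.2.1 * p.2.1)) p.2.2 q.2.2.
  have := Bf 1 (cf_conj (g * q.2.1) * (g * p.2.1)) (cf_conj (u * q.2.1) * (u * p.2.1)) p.2.2 q.2.2.
  rewrite mul1r => <-; congr (B _ _ _); rewrite scale1r.
  by apply: cfP => x; rewrite !(cfD, cfM, cfZ, cfJ) !rmorphM/=; ring.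
rewrite e; have B0 b c : B 0 b c = 0.
  by have := Bf (-1) 0 0 b c; rewrite scaler0 addr0 mulN1r addNr.
have := Bf (M ^+ 2)%:C (cf_conj q.2.1 * p.2.1) 0 p.2.2 q.2.2.
rewrite B0 !addr0 => <-; congr (B _ _ _).
by apply: cfP => x; rewrite !(cfD, cfM, cfZ, cfJ, cf1); ring.
Qed.

Lemma dil_op (g : CX) : exists T : 'B(K), forall p, T (v p) = dil_shift g p.
Proof.
have [M M0 hM] := cf_bounded hX (@cf_continuous R X g).
have cn : continuous (fun x : X => nm (g x)) := @cts_nm R X R[i]^o g (@cf_continuous _ _ g).
pose u := toC (fun x : X => (Num.sqrt (M ^+ 2 - nm (g x) ^+ 2))%:C : R[i]).
have e : cf_conj g * g + cf_conj u * u = (M ^+ 2)%:C *: (1 : CX).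
  apply: cfP => x; rewrite !cfE toCE; last by apply: ctsC; exact: continuous_sqrt_diff.
  rewrite conjCr -rmorphM/= -expr2 sqr_sqrtr ?subr_ge0 ?ler_pXn2r ?nnegrE ?nm_ge0 ?(ltW M0)//.
  by rewrite mulr1 rmorphB/= [_^* * _]mulrC mul_conj_nm addrC subrK.
have [s|f [bf fv _]] := total_extension tv (t := dil_shift g) (ltW M0).
  rewrite -(@ler_pXn2r _ 2)// ?nnegrE ?nm_ge0 ?mulr_ge0 ?nm_ge0 ?(ltW M0)//.
  by rewrite exprMn -(dil_shift_norm s e) lerDl sqr_ge0.
by exists (toB f) => p; rewrite toBE.
Qed.

Lemma dil_rep : exists rho : CX -> 'B(K), rep rho /\ forall g p, rho g (v p) = v (g * p.1, p.2).
Proof.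
have [rho hr] := choice dil_op; exists rho; split; last by move=> g p; rewrite hr.
rewrite /dil_shift in hr; split.
- move=> a f g; apply: (total_op_ext tv) => -[p q].
  rewrite opDE opZE !hr -dil_linl/=; congr (v (_, _)).
  by apply: cfP => x; rewrite !(cfD, cfM, cfZ, cfJ); ring.
- split; first by apply: (total_op_ext tv) => -[p q]; rewrite hr mul1r op1E.
  by move=> f g; apply: (total_op_ext tv) => -[p q]; rewrite opME !hr/= mulrA.
move=> g; apply: (total_op_ext tv) => p; apply: (total_eq tv) => q.
rewrite -adjointPr !hr !vB/=; congr (B _ _ _).
by apply: cfP => x; rewrite !(cfD, cfM, cfZ, cfJ) !rmorphM/=; ring.
Qed.

Definition cf_monomial (p : nat * nat) : CX := cf_id X ^+ p.1 * cf_conj (cf_id X) ^+ p.2.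

(** Strengthening the statement to all products of f with monomials supplies the stability under
    multiplication by the coordinates that A itself lacks. *)
Lemma monomial_density (A : set CX) :
  (forall a f g, A f -> A g -> A (a *: f + g)) ->
  (forall f : CX, (forall e : R, 0 < e -> exists2 g, A g & forall x, nm (f x - g x) <= e) -> A f) ->
  (forall p, A (cf_monomial p)) -> forall f, A f.
Proof.
move=> Al Ac Am f; suff : forall p, A (cf_monomial p * f).
  by move=> /(_ (0, 0)%N); rewrite /cf_monomial !expr0 !mul1r.
move: f; apply: (polynomial_density hX (A := [set f | forall p, A (cf_monomial p * f)])).
- by move=> p; rewrite mulr1.
- move=> a f g hf hg p.
  have -> : cf_monomial p * (a *: f + g) = a *: (cf_monomial p * f) + cf_monomial p * g.
    by apply: cfP => x; rewrite !(cfD, cfM, cfZ, cfJ); ring.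
  exact: Al.
- move=> f hf p; have := hf (p.1.+1, p.2); rewrite /cf_monomial/= exprSr.
  by rewrite -!mulrA [cf_id X * (_ * _)]mulrCA.
- move=> f hf p; have := hf (p.1, p.2.+1); rewrite /cf_monomial/= exprSr.
  by rewrite -!mulrA.
move=> f hf p; apply: Ac => e e0.
have [M M0 hM] := cf_bounded hX (@cf_continuous R X (cf_monomial p)).
have [g gA fg] := hf _ (divr_gt0 e0 M0); exists (cf_monomial p * g); first exact: gA.
move=> x; rewrite !cfM -mulrBr nmM; apply: le_trans (ler_pM _ _ (hM x) (fg x)) _; rewrite ?nm_ge0//.
by rewrite mulrC divfK// gt_eqF.
Qed.

(** By [dil_bound], v is continuous in each argument for the sup norm, so orthogonality to all v (f,
    b) can be tested on monomials, first in b fixed, then in f fixed. *)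
Lemma dil_ctotal : ctotal K.
Proof.
apply: (@total_ctotal _ _ _ (fun p : (nat * nat) * (nat * nat) =>
   v (cf_monomial p.1, cf_monomial p.2))) => x hx.
have dl (f g b : CX) : v (f - g, b) = v (f, b) - v (g, b).
  by rewrite addrC -scaleN1r dil_linl scaleN1r addrC.
have dr (f b c : CX) : v (f, b - c) = v (f, b) - v (f, c).
  by rewrite addrC -scaleN1r dil_linr scaleN1r addrC.
have small (y z : K) : dotp x z = 0 -> (forall e : R, 0 < e -> exists2 z, dotp x z = 0 & nm (y - z) <= e) ->
   dotp x y = 0.
  move=> _ h; apply: nm_eq0; apply/eqP; rewrite eq_le nm_ge0 andbT.
  apply/ler_addgt0Pr => e e0; rewrite add0r.
  have x1 : 0 < nm x + 1 by rewrite ltr_wpDl ?nm_ge0.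
  have [t xt yt] := h _ (divr_gt0 e0 x1).
  rewrite -[dotp x y]subr0 -xt -ipBr; apply: le_trans (cauchy_schwarz _ _) _.
  apply: le_trans (ler_wpM2l (nm_ge0 x) yt) _; rewrite mulrCA ler_piMr ?(ltW e0)//.
  by rewrite ler_pdivrMr// mul1r lerDl.
apply: tv => -[f b].
have h1 p : dotp x (v (f, cf_monomial p)) = 0.
  move: f; apply: monomial_density => [a f g|f hf|q]; last exact: (hx (q, p)).
    by move=> hf hg; rewrite dil_linl ipDr ipZr hf hg mulr0 addr0.
  apply: (small _ 0); first exact: ip0r.
  move=> e e0; have [M M0 hM] := cf_bounded hX (@cf_continuous R X (cf_monomial p)).
  have c0 : 0 < (C + 1) * M by rewrite mulr_gt0// ltr_wpDl.
  have d0 := divr_gt0 e0 c0; have [g gA fg] := hf _ d0; exists (v (g, cf_monomial p)) => //.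
  rewrite -dl; apply: le_trans (dil_bound (ltW d0) (ltW M0) _ hM) _; first by move=> y; rewrite cfB.
  by rewrite le_eqVlt; apply/orP; left; apply/eqP; field; rewrite !gt_eqF// ltr_wpDl.
move: b; apply: monomial_density => [a b c|b hb|q]; last exact: h1.
  by move=> hb hc; rewrite dil_linr ipDr ipZr hb hc mulr0 addr0.
apply: (small _ 0); first exact: ip0r.
move=> e e0; have [M M0 hM] := cf_bounded hX (@cf_continuous R X f).
have c0 : 0 < (C + 1) * M by rewrite mulr_gt0// ltr_wpDl.
have d0 := divr_gt0 e0 c0; have [c cA bc] := hb _ d0; exists (v (f, c)) => //.
rewrite -dr; apply: le_trans (dil_bound (ltW M0) (ltW d0) hM _) _; first by move=> y; rewrite cfB.
by rewrite le_eqVlt; apply/orP; left; apply/eqP; field; rewrite !gt_eqF// ltr_wpDl.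
Qed.

End dilation.

(** * Defects and the three conditions *)

Definition defect (R : realType) (X : set R[i]) (G : set (continuousType X R[i])) : Prop :=
  exists (H K : hilbertType R) (V : H -> K) (rho : continuousType X R[i] -> 'B(K))
    (pi : continuousType X R[i] -> 'B(H)),
  [/\ ctotal H /\ ctotal K, iso V, rep rho, rep pi /\ injective pi &
   (forall g, G g -> forall h k, dotp (rho g (V h)) (V k) = dotp (pi g h) k) /\
   exists a h, rho a (V h) != V (pi a h)].

Section hermitian.
Context (R : realType) (X : set R[i]) (H : hilbertType R).
Context (phi : continuousType X R[i] -> 'B(H)) (cp : cp_map phi).

Lemma cp_herm f x y : dotp (phi (cf_conj f) y) x = (dotp (phi f x) y)^*.
Proof.
have [l p1 pp] := cp.
have e (a : R[i]) : complex.Im (a^* * dotp (phi f x) y + a * dotp (phi (cf_conj f) y) x) = 0.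
  have := ger0_Im (pp [:: (f, x); (1, a *: y)]).
  rewrite !big_cons !big_nil !addr0 /= cf_conj1 !mul1r mulr1 p1 op1E opZ ipZr ipZl.
  have i0 : complex.Im (dotp (phi (cf_conj f * f) x) x) = 0.
    by have := ger0_Im (pp [:: (f, x)]); rewrite !big_seq1.
  by rewrite ipZl ipZr mulrA mul_conj_nm ipxx !ImD ImCM !i0/= mulr0 add0r addr0.
apply: ReIm_inj; last first.
  have := e 1; rewrite rmorph1 !mul1r ImD ImJ => /eqP; rewrite addr_eq0 => /eqP ->.
  by rewrite opprK.
have := e 'i; rewrite ImD ImiM.
have -> : ('i : R[i])^* = - 'i by exact: conji.
by rewrite mulNr ImN ImiM ReJ => /eqP; rewrite addrC subr_eq0 => /eqP.
Qed.
End hermitian.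

(** * The defect built from limits of kernels *)

Section ultraproduct_form.
Context (R : realType) (X : set R[i]) (hX : compact X) (H : hilbertType R).
Notation CX := (continuousType X R[i]).
Context (F : set_system nat) (UF : UltraFilter F).
Hypothesis Foo : (\oo : set_system nat) `<=` F.
Context (s : nat -> X) (pi : CX -> 'B(H)) (rpi : rep pi) (x_ : nat -> H).
Hypothesis x1 : forall n, nm (x_ n) <= 1.

(** A truncation of the state sum f(s i) / 2^(i+1), faithful because s is dense. The truncation
    index is that of the ultralimit, so no infinite sum has to be formed. *)
Definition tau n (f : CX) : R[i] := \sum_(i < n) (1 / 2 ^+ i.+1 : R)%:C * f (s i).

Lemma tau_bound n (f : CX) (M : R) : 0 <= M -> (forall x, nm (f x) <= M) -> nm (tau n f) <= M.
Proof.
move=> M0 hM; apply: le_trans (nm_sum _ _ _) _; apply: le_trans (geometric_sum n M0).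
apply: ler_sum => i _; have p0 : 0 < 2 ^+ i.+1 :> R by rewrite exprn_gt0.
rewrite nmM nmC ger0_norm; last by rewrite divr_ge0// ltW.
by rewrite mul1r mulrC ler_pM2r ?invr_gt0.
Qed.

Lemma tau_nm_sqr n (d : CX) : tau n (cf_conj d * d * 1 * cf_conj 1) =
  (\sum_(i < n) nm (d (s i)) ^+ 2 / 2 ^+ i.+1)%:C.
Proof.
rewrite /tau rmorph_sum; apply: eq_bigr => i _.
by rewrite cf_conj1 !mulr1 cfM cfJ [_^* * _]mulrC mul_conj_nm -rmorphM/= mul1r mulrC.
Qed.

Lemma tau_lin n a f g : tau n (a *: f + g) = a * tau n f + tau n g.
Proof.
rewrite /tau mulr_sumr -big_split; apply: eq_bigr => i _ /=.
by rewrite !cfE mulrDr mulrCA.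
Qed.

Section form.
Context (psi : nat -> CX -> 'B(H)) (cpsi : forall n, cp_map (psi n)).

(** The argument f is the one dilated, b and c move the base vector. The term [tau] sees only the
    product of the three, so it is the same for phi and for pi. *)
Definition kap (f b c : CX) n : R[i] :=
  dotp (psi n f (pi b (x_ n))) (pi c (x_ n)) + tau n (f * b * cf_conj c).

Lemma kap_bound (f b c : CX) (M Mb Mc : R) n : 0 <= M -> 0 <= Mb -> 0 <= Mc ->
  (forall x, nm (f x) <= M) -> (forall x, nm (b x) <= Mb) -> (forall x, nm (c x) <= Mc) ->
  nm (kap f b c n) <= 2 * (M * Mb * Mc).
Proof.
move=> M0 Mb0 Mc0 hM hMb hMc; apply: le_trans (nmD _ _) _.
have bx (g : CX) (N : R) : 0 <= N -> (forall x, nm (g x) <= N) -> nm (pi g (x_ n)) <= N.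
  move=> N0 hN; apply: le_trans (cp_bound (rep_cp rpi) N0 hN _) _.
  by rewrite ler_piMr.
have h1 : nm (dotp (psi n f (pi b (x_ n))) (pi c (x_ n))) <= M * Mb * Mc.
  apply: le_trans (cauchy_schwarz _ _) _; apply: ler_pM; rewrite ?nm_ge0 ?bx//.
  apply: le_trans (cp_bound (cpsi n) M0 hM _) _.
  by rewrite ler_wpM2l// bx.
have h2 : nm (tau n (f * b * cf_conj c)) <= M * Mb * Mc.
  apply: tau_bound; first by rewrite !mulr_ge0.
  move=> y; rewrite !cfE !nmM nm_conj; apply: ler_pM; rewrite ?mulr_ge0 ?nm_ge0//.
  by apply: ler_pM; rewrite ?nm_ge0.
by move: h1 h2; move: (M * Mb * Mc) => t; lra.
Qed.

Definition uform f b c : R[i] := ulim F (kap f b c).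

Lemma uformP f b c : ucvg F (kap f b c) (uform f b c).
Proof.
apply: ulimP.
have [M M0 hM] := cf_bounded hX (@cf_continuous R X f).
have [N N0 hN] := cf_bounded hX (@cf_continuous R X b).
have [L L0 hL] := cf_bounded hX (@cf_continuous R X c).
by exists (2 * (M * N * L)) => n; apply: kap_bound => //; exact: ltW.
Qed.

Lemma uform_lin1 a f g b c : uform (a *: f + g) b c = a * uform f b c + uform g b c.
Proof.
apply: (ulimE UF); have := ucvgD UF (ucvgZ UF a (uformP f b c)) (uformP g b c).
congr (ucvg F _ _); apply/funext => n; have [l _ _] := cpsi n.
rewrite /kap l opDE opZE ipDl ipZl.
have -> : (a *: f + g) * b * cf_conj c = a *: (f * b * cf_conj c) + g * b * cf_conj c.
  by apply: cfP => y; rewrite !(cfD, cfM, cfZ, cfJ); ring.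
by rewrite tau_lin; ring.
Qed.

Lemma uform_lin2 a f b b' c : uform f (a *: b + b') c = a * uform f b c + uform f b' c.
Proof.
apply: (ulimE UF); have := ucvgD UF (ucvgZ UF a (uformP f b c)) (uformP f b' c).
congr (ucvg F _ _); apply/funext => n.
rewrite /kap (rep_lin rpi) opDE opZE opD opZ ipDl ipZl.
have -> : f * (a *: b + b') * cf_conj c = a *: (f * b * cf_conj c) + f * b' * cf_conj c.
  by apply: cfP => y; rewrite !(cfD, cfM, cfZ, cfJ); ring.
by rewrite tau_lin; ring.
Qed.

Lemma kap_pd n : pd_kernel (fun p q : CX * CX => kap (cf_conj q.1 * p.1) p.2 q.2 n).
Proof.
move=> t; rewrite /kform /kap.
under eq_bigr => p _ do under eq_bigr => q _ do rewrite mulrDr.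
under eq_bigr => p _ do rewrite big_split.
rewrite big_split/=; apply: addr_ge0.
  have [_ _ pp] := cpsi n.
  have := pp [seq (p.2.1, p.1 *: pi p.2.2 (x_ n)) | p <- t].
  rewrite big_map; congr (0 <= _); apply: eq_bigr => p _; rewrite big_map; apply: eq_bigr => q _ /=.
  by rewrite opZ ipZl ipZr mulrA.
have -> : \sum_(p <- t) \sum_(q <- t) p.1 * q.1^* * tau n (cf_conj q.2.1 * p.2.1 * p.2.2 * cf_conj q.2.2) =
   \sum_(i < n) (1 / 2 ^+ i.+1 : R)%:C * ((\sum_(p <- t) p.1 * (p.2.1 (s i) * p.2.2 (s i))) *
     (\sum_(p <- t) p.1 * (p.2.1 (s i) * p.2.2 (s i)))^*).
  under eq_bigr => p _.
    under eq_bigr => q _ do rewrite /tau mulr_sumr.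
    rewrite exchange_big; over.
  rewrite exchange_big; apply: eq_bigr => i _; rewrite mulr_suml mulr_sumr; apply: eq_bigr => p _.
  rewrite rmorph_sum !mulr_sumr; apply: eq_bigr => q _.
  by rewrite !(cfD, cfM, cfZ, cfJ) !rmorphM/=; ring.
apply: sumr_ge0 => i _; apply: mulr_ge0; first by rewrite ler0c divr_ge0// exprn_ge0.
by rewrite mul_conj_nm ler0c sqr_ge0.
Qed.

Lemma uform_pd : pd_kernel (fun p q : CX * CX => uform (cf_conj q.1 * p.1) p.2 q.2).
Proof.
move=> t; pose U (p : R[i] * (CX * CX)) n := \sum_(q <- t)
   p.1 * q.1^* * kap (cf_conj q.2.1 * p.2.1) p.2.2 q.2.2 n.
apply: (ucvg_ge0 UF (u := fun n => \sum_(p <- t) U p n)); last by move=> n; exact: kap_pd.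
apply: (ucvg_sum UF) => p; rewrite /U.
by apply: (ucvg_sum UF) => q; apply: (ucvgZ UF); exact: uformP.
Qed.

Lemma uform_bound (f b : CX) (M Mb : R) : 0 <= M -> 0 <= Mb ->
  (forall x, nm (f x) <= M) -> (forall x, nm (b x) <= Mb) ->
  nm (uform f b b) <= 2 * M * Mb ^+ 2.
Proof.
move=> M0 Mb0 hM hMb; apply: (ucvg_le UF (uformP f b b)) => n.
by rewrite expr2 -!mulrA [M * (Mb * Mb)]mulrA; exact: kap_bound.
Qed.

Lemma uform_dilation : exists (K : hilbertType R) (v : CX * CX -> K) (rho : CX -> 'B(K)),
  [/\ forall p q, dotp (v p) (v q) = uform (cf_conj q.1 * p.1) p.2 q.2, total_family v,
      ctotal K, rep rho & forall g p, rho g (v p) = v (g * p.1, p.2)].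
Proof.
have [K [v [hv tv]]] := kolmogorov_decomposition uform_pd.
have [rho [rr hr]] := dil_rep hX uform_lin1 hv tv.
exists K, v, rho; split => //.
exact: (dil_ctotal hX uform_lin1 uform_lin2 (ler0n R 2) uform_bound hv tv).
Qed.

End form.

Context (phi : nat -> CX -> 'B(H)) (cphi : forall n, cp_map (phi n)) (G : set CX).
Hypothesis sd : forall (x : X) (e : R), 0 < e -> exists n, nm (val x - val (s n)) < e.
Hypothesis hG : forall g, G g -> forall b c, cvgC (fun n =>
  dotp (phi n g (pi b (x_ n))) (pi c (x_ n)) - dotp (pi g (pi b (x_ n))) (pi c (x_ n))) 0.
Context (a : CX) (eps : R) (eps0 : 0 < eps).
Hypothesis bad : forall n, eps <= nm (phi n a (x_ n) - pi a (x_ n)).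

Lemma uform_defect : defect G.
Proof.
have cpi (n : nat) : cp_map pi := rep_cp rpi.
have [K [v [rho [hv tv sK rr hr]]]] := uform_dilation cphi.
have [L [w [sig [hw tw sL rs hs]]]] := uform_dilation cpi.
(* The generator (f, b) of the space of pi stands for pi(f) pi(b) x_n = pi(f b) x_n, which in the
   space of phi is the generator (1, f b). *)
have [|V [bV Vw iV]] := total_isometry tw (t := fun p => v (1, p.1 * p.2)).
  move=> p q; rewrite hv hw/=; congr (ulim F _); apply/funext => n; rewrite /kap.
  have [_ p1 _] := cphi n; rewrite cf_conj1 mul1r p1 op1E; congr (_ + _).
    by rewrite !(rep_mul rpi) !opME (rep_conj rpi) -adjointPr.
  by congr (tau n _); apply: cfP => y; rewrite !(cfD, cfM, cfZ, cfJ) !rmorphM/=; ring.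
have isoV : iso V by [].
(* The vector w (1, 1) is separating: |sig(d) w(1, 1)|^2 dominates |d(s i)|^2 / 2^(i+1) for every i,
   once n > i. *)
have faith : injective sig.
  move=> f g fg; apply/eqP; rewrite -subr_eq0.
  have : sig (f - g) (w (1, 1)) = 0 by rewrite (lmB (rep_lin rs)) fg subrr op0E.
  move: (f - g) => d.
  rewrite hs mulr1 => wd; have : uform (fun=> pi) (cf_conj d * d) 1 1 = 0.
    by have := hw (d, 1) (d, 1) => /= <-; rewrite wd ip0l.
  move=> u0; have ds i : d (s i) = 0.
    apply: nm_eq0; apply/eqP; rewrite -sqrf_eq0 eq_le sqr_ge0 andbT leNgt; apply/negP => di.
    have p0 : 0 < 2 ^+ i.+1 :> R by rewrite exprn_gt0.
    have e0 : 0 < nm (d (s i)) ^+ 2 / 2 ^+ i.+1 by rewrite divr_gt0.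
    have Fi : F [set n | (i < n)%N] by apply: Foo; exists i.+1.
    have := uformP cpi (cf_conj d * d) 1 1 e0; rewrite u0 => /filterI/(_ Fi)/filter_ex[n [/= h1 ni]].
    move: h1; rewrite subr0 => /(le_lt_trans (Re_le_nm _)); apply/negP; rewrite -leNgt.
    rewrite /kap ReD (rep_one rpi) op1E -(rep_dot rpi) -nm_sqrE; apply: ler_wpDl; first exact: sqr_ge0.
    rewrite tau_nm_sqr /= (bigD1 (Ordinal ni))//= lerDl.
    by apply: sumr_ge0 => k _; rewrite divr_ge0 ?sqr_ge0// exprn_ge0.
  apply/eqP/cfP => y; rewrite cf0; apply: nm_eq0; apply/eqP; rewrite eq_le nm_ge0 andbT.
  apply/ler_addgt0Pr => e e0; rewrite add0r.
  have [r r0 hr'] := (@ctsXP R X R[i]^o d).1 (@cf_continuous R X d) y e e0.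
  have [i hi] := sd y r0; have := hr' (s i); rewrite ds [nm (val (s i) - _)]nmB sub0r nmN.
  by move=> /(_ hi)/ltW.
exists L, K, V, rho, sig; split => //; split.
  move=> g Gg.
  have key p q : dotp (rho g (V (w p))) (V (w q)) = dotp (sig g (w p)) (w q).
    rewrite !Vw hr hs hv hw/=.
    have h1 := uformP cpi (cf_conj q.1 * (g * p.1)) p.2 q.2.
    have h2 := ucvgD UF h1 (ucvg_cvgC Foo (hG Gg (p.1 * p.2) (q.1 * q.2))).
    rewrite addr0 in h2; apply: (ucvg_unique UF _ h2).
    have := uformP cphi (cf_conj 1 * (g * 1)) (p.1 * p.2) (q.1 * q.2).
    congr (ucvg F _ _); apply/funext => n; rewrite /kap cf_conj1 mul1r mulr1.
    have -> : cf_conj q.1 * (g * p.1) * p.2 * cf_conj q.2 = g * (p.1 * p.2) * cf_conj (q.1 * q.2).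
      by apply: cfP => y; rewrite !(cfD, cfM, cfZ, cfJ) !rmorphM/=; ring.
    have -> : dotp (pi (cf_conj q.1 * (g * p.1)) (pi p.2 (x_ n))) (pi q.2 (x_ n)) =
        dotp (pi g (pi (p.1 * p.2) (x_ n))) (pi (q.1 * q.2) (x_ n)).
      by rewrite !(rep_mul rpi) !opME (rep_conj rpi) -adjointPr.
    by rewrite addrAC [_ + (_ - _)]addrC subrK.
  have e1 p k : dotp (rho g (V (w p))) (V k) = dotp (sig g (w p)) k.
    rewrite (adjPr bV); congr (dotp _ k).
    by apply: (total_eq tw) => q; rewrite -(adjPr bV) key.
  have bT : blin (adj V \o (rho g \o V)).
    by apply: blin_comp (blin_adj bV) _; apply: blin_comp (blin_op _) bV.
  have e2 p : (adj V \o (rho g \o V)) (w p) = sig g (w p).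
    by apply: ip_ext => z; rewrite /= -(adjPr bV) e1.
  move=> h k; rewrite (adjPr bV); congr (dotp _ k).
  exact: (total_blin_ext tw bT (blin_op (sig g)) e2).
(* The two vectors to be separated are v (a, 1) and v (1, a). *)
exists a, (w (1, 1)); apply/negP => /eqP; rewrite hs !Vw hr/= !mulr1 => vv.
have : dotp (v (a, 1) - v (1, a)) (v (a, 1) - v (1, a)) = 0 by rewrite vv subrr ip0l.
rewrite ipBl !ipBr !hv/= => u0.
(* The expansion of the squared distance of v (a, 1) and v (1, a) before the limit. By the Schwarz
   inequality its real part is at least |(phi_n(a) - pi(a)) x_n|^2, hence at least eps^2. *)
pose D n := kap phi (cf_conj a * a) 1 1 n - kap phi (cf_conj 1 * a) 1 a n -
  (kap phi (cf_conj a * 1) a 1 n - kap phi (cf_conj 1 * 1) a a n).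
have : ucvg F D 0.
  have P f b c : ucvg F (kap phi f b c) (uform phi f b c) by exact: uformP.
  by rewrite -u0; apply: (ucvgB UF); apply: (ucvgB UF); exact: P.
have e2 : 0 < eps ^+ 2 by rewrite exprn_gt0.
move=> /(_ _ e2)/filter_ex[n /=]; rewrite subr0 => /(le_lt_trans (Re_le_nm _)).
apply/negP; rewrite -leNgt.
apply: (@le_trans _ _ (nm (phi n a (x_ n) - pi a (x_ n)) ^+ 2)).
  by rewrite ler_pXn2r ?nnegrE ?nm_ge0 ?(ltW eps0).
have [_ p1 _] := cphi n.
have -> : D n = dotp (phi n (cf_conj a * a) (x_ n)) (x_ n) - dotp (phi n a (x_ n)) (pi a (x_ n)) -
  (dotp (phi n (cf_conj a) (pi a (x_ n))) (x_ n) - dotp (pi a (x_ n)) (pi a (x_ n))).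
  have t1 : tau n (cf_conj a * a * 1 * cf_conj 1) = tau n (cf_conj a * 1 * a * cf_conj 1).
    by rewrite [_ * a * 1]mulrAC.
  have t2 : tau n (cf_conj 1 * a * 1 * cf_conj a) = tau n (cf_conj 1 * 1 * a * cf_conj a).
    by rewrite [_ * a * 1]mulrAC.
  rewrite /D /kap t1 t2 (rep_one rpi) cf_conj1 !mul1r !mulr1 p1 !op1E; ring.
rewrite (cp_herm (cphi n)) !ReB ReJ nmB_sqr -!nm_sqrE.
have := cp_schwarz (cphi n) a (x_ n).
by move: (nm (phi n a (x_ n)) ^+ 2) (complex.Re (dotp (phi n _ _) _)) => t t'; lra.
Qed.

End ultraproduct_form.

(** * Without defects the conditions hold *)

Section failures.
Context (R : realType) (X : set R[i]) (hX : compact X) (X0 : X !=set0).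
Notation CX := (continuousType X R[i]).
Context (G : set CX).

Lemma defect_of_failure (H : hilbertType R) (pi : CX -> 'B(H)) (phi : nat -> CX -> 'B(H))
    (x_ : nat -> H) (a : CX) (eps : R) : rep pi -> (forall n, cp_map (phi n)) ->
  (forall n, nm (x_ n) <= 1) ->
  (forall g, G g -> forall b c, cvgC (fun n =>
    dotp (phi n g (pi b (x_ n))) (pi c (x_ n)) - dotp (pi g (pi b (x_ n))) (pi c (x_ n))) 0) ->
  0 < eps -> (forall n, eps <= nm (phi n a (x_ n) - pi a (x_ n))) -> defect G.
Proof.
move=> rpi cphi x1 hG e0 bad; have [s sd] := dense_sequence X0.
have [F [UF Foo]] := @ultraFilterLemma nat \oo _.
exact: (uform_defect hX UF Foo rpi x1 cphi sd hG e0 bad).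
Qed.

Lemma ucp_cp_map (H : hilbertType R) (pi : CX -> 'B(H)) (Phi : 'B(H) -> 'B(H)) :
  rep pi -> ucp Phi -> cp_map (fun f => Phi (pi f)).
Proof.
move=> rpi [lP cP P1]; split.
- by move=> a f g; rewrite (rep_lin rpi) lP.
- by rewrite (rep_one rpi).
move=> t; pose A (i j : 'I_(size t)) : 'B(H) :=
  pi (cf_conj (tnth (in_tuple t) i).1 * (tnth (in_tuple t) j).1).
have pA : positive_mx A.
  move=> y; rewrite /A exchange_big.
  have -> : \sum_j \sum_i dotp (pi (cf_conj (tnth (in_tuple t) i).1 * (tnth (in_tuple t) j).1) (y j)) (y i) =
     dotp (\sum_j pi (tnth (in_tuple t) j).1 (y j)) (\sum_i pi (tnth (in_tuple t) i).1 (y i)).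
    rewrite ip_suml; apply: eq_bigr => j _; rewrite ip_sumr; apply: eq_bigr => i _.
    by rewrite (rep_dot rpi).
  by rewrite ipxx ler0c sqr_ge0.
have := cP _ _ pA (fun i => (tnth (in_tuple t) i).2); rewrite exchange_big.
by congr (0 <= _); rewrite [RHS]big_tnth; apply: eq_bigr => j _; rewrite [RHS]big_tnth.
Qed.

Lemma frequently (P : nat -> Prop) : (forall N, exists n, (N <= n)%N /\ P n) ->
  exists k : nat -> nat, forall N, (N <= k N)%N /\ P (k N).
Proof. by move=> h; have [k hk] := choice h; exists k. Qed.

Lemma op_norm_cvg0 (H : hilbertType R) (T_ : nat -> 'B(H)) :
  op_norm (T_ k) @[k --> \oo] --> (0 : R) <->
  forall e : R, 0 < e -> exists N, forall n, (N <= n)%N -> op_norm (T_ n) < e.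
Proof.
split=> [/cvgR0P h e /h[N hN]|h].
  by exists N => n /hN; rewrite subr0 ger0_norm// op_norm_ge0.
by apply/cvgR0P => e /h[N hN]; exists N => n /hN; rewrite subr0 ger0_norm// op_norm_ge0.
Qed.

Lemma hyperrigid_of_no_defect : G !=set0 -> ~ defect G -> hyperrigid false G.
Proof.
move=> G0 nd; split => // H _ pi Phi [l m ad inj] uP hG a.
have rpi : rep pi by [].
apply: contrapT => /op_norm_cvg0 na; apply: nd.
have [e e0 he] : exists2 e : R, 0 < e & forall N, exists n, (N <= n)%N /\ e <= op_norm (Phi n (pi a) - pi a).
  apply: contrapT => h; apply: na => e e0; apply: contrapT => h2; apply: h; exists e => // N.
  apply: contrapT => h3; apply: h2; exists N => n Nn; rewrite ltNge; apply/negP => en.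
  by apply: h3; exists n.
have [k hk] := frequently he.
have e2 : 0 < e / 2 by rewrite divr_gt0.
(* Almost norming vectors turn the failure in operator norm into one at vectors of the unit ball, at
   the cost of half of e. *)
have ex n : exists x, nm x <= 1 /\ e / 2 <= nm ((Phi (k n) (pi a) - pi a) x).
  have [x x1 hx] := op_norm_adherent (Phi (k n) (pi a) - pi a) e2; exists x; split => //.
  by have := (hk n).2; move: hx; move: (op_norm _) (nm _) => t t'; lra.
have [x_ hx] := choice ex.
apply: (@defect_of_failure H pi (fun n f => Phi (k n) (pi f)) x_ a (e / 2)) => //.
- by move=> n; exact: ucp_cp_map.
- by move=> n; case: (hx n).
- move=> g Gg b c d d0.
  have [M M0 hM] := cf_bounded hX (@cf_continuous R X b).
  have [N N0 hN] := cf_bounded hX (@cf_continuous R X c).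
  have MN : 0 < M * N by rewrite mulr_gt0.
  have [n0 hn0] := (op_norm_cvg0 _).1 (hG g Gg) _ (divr_gt0 d0 MN).
  exists n0 => n n0n; rewrite subr0 -ipBl -opBE.
  have := hn0 (k n) (leq_trans n0n (hk n).1); rewrite ltr_pdivlMr//; apply: le_lt_trans.
  have bx (f : CX) (L : R) : 0 <= L -> (forall x, nm (f x) <= L) -> nm (pi f (x_ n)) <= L.
    move=> L0 hL; apply: le_trans (cp_bound (rep_cp rpi) L0 hL _) _.
    by rewrite ler_piMr//; case: (hx n).
  apply: le_trans (cauchy_schwarz _ _) _; rewrite mulrA.
  apply: ler_pM; rewrite ?nm_ge0//; last by apply: bx => //; exact: ltW.
  apply: le_trans (op_norm_le _ _) _; apply: ler_wpM2l; first exact: op_norm_ge0.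
  by apply: bx => //; exact: ltW.
by move=> n; have [_] := hx n; rewrite opBE.
Qed.

Lemma fun_calc_cp (H : hilbertType R) (T : 'B(H)) : subnormal T -> spectrum T `<=` X ->
  cp_map (@fun_calc R H X T).
Proof.
move=> sT TX; have [K [V [rho [iV rr VT hV]]]] := fun_calcP hX X0 sT TX.
split.
- move=> a f g; apply/boundedOpP => h; apply: ip_ext => y; rewrite opDE opZE ipDl ipZl !hV.
  by rewrite (rep_lin rr) opDE opZE ipDl ipZl.
- apply/boundedOpP => h; apply: ip_ext => y; rewrite hV (rep_one rr) !op1E.
  exact: iV.2.
move=> t; have [_ _ pp] := rep_cp rr.
have := pp [seq (p.1, V p.2) | p <- t]; rewrite big_map; congr (0 <= _).
by apply: eq_bigr => p _; rewrite big_map; apply: eq_bigr => q _ /=; rewrite hV.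
Qed.

(** Strong convergence fails at a single vector x, so the base vectors are constant, x being scaled
    into the unit ball. *)
Lemma subnormal_of_no_defect : ~ defect G -> subnormal_condition false G.
Proof.
move=> nd H _ T_ T sT nT TX_ TX hG f x.
have [rho [rr rz]] := normal_rep hX X0 nT TX.
have fT g : fun_calc T g = rho g by rewrite -rz (fun_calc_rep hX X0).
apply: contrapT => nx; apply: nd.
have [e e0 he] : exists2 e : R, 0 < e & forall N, exists n, (N <= n)%N /\
    e <= nm (fun_calc (T_ n) f x - fun_calc T f x).
  apply: contrapT => h; apply: nx; apply/cvgnP_nm => e e0.
  apply: contrapT => h2; apply: h; exists e => // N.
  apply: contrapT => h3; apply: h2; exists N => n Nn; rewrite ltNge; apply/negP => en.
  by apply: h3; exists n.
have [k hk] := frequently he.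
have x1 : 0 < nm x + 1 by rewrite ltr_wpDl ?nm_ge0.
pose c : R[i] := ((nm x + 1)^-1)%:C.
have cE : nm c = (nm x + 1)^-1 by rewrite nmC ger0_norm// invr_ge0 ltW.
apply: (@defect_of_failure H rho (fun n => @fun_calc R H X (T_ (k n))) (fun=> c *: x) f (e / (nm x + 1))) => //.
- by move=> n; exact: fun_calc_cp.
- by move=> n; rewrite nmZ cE mulrC ler_pdivrMr// mul1r lerDl.
- move=> g Gg b b' d d0.
  have [N hN] := (cvgCP _ _).2 (hG g Gg (rho b (c *: x)) (rho b' (c *: x))) d d0.
  exists N => n Nn; rewrite subr0 -(fT g); apply: hN.
  exact: leq_trans Nn (hk n).1.
- by rewrite divr_gt0.
move=> n; rewrite -(fT f) !opZ -scalerBr nmZ cE mulrC ler_wpM2l ?invr_ge0 ?(ltW x1)//.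
exact: (hk n).2.
Qed.

End failures.

Section easy_implications.
Context (R : realType) (X : set R[i]) (G : set (continuousType X R[i])).

Lemma hyperrigid_separable : hyperrigid false G -> hyperrigid true G.
Proof. by move=> [G0 h]; split => // H _; exact: h. Qed.

Lemma subnormal_condition_separable :
  subnormal_condition false G -> subnormal_condition true G.
Proof. by move=> h H _; exact: h. Qed.

Lemma normal_condition_separable : normal_condition false G -> normal_condition true G.
Proof. by move=> h H _; exact: h. Qed.

Lemma subnormal_normal_condition sep : subnormal_condition sep G -> normal_condition sep G.
Proof.
by move=> h H sH T_ T nT_; apply: h => // n; exact: normal_subnormal.
Qed.

End easy_implications.

(* The vector [rho a (V h) - V (pi a h)] has norm 0 because [V^* rho V] is multiplicative. *)
Lemma compression_intertwines (R : realType) (X : set R[i]) (H K : hilbertType R) (V : H -> K)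
    (rho : continuousType X R[i] -> 'B(K)) (pi : continuousType X R[i] -> 'B(H)) :
  iso V -> rep rho -> rep pi ->
  (forall f h k, dotp (rho f (V h)) (V k) = dotp (pi f h) k) ->
  forall a h, rho a (V h) = V (pi a h).
Proof.
move=> [bV iV] rr rp hc a h; apply/eqP; rewrite -subr_eq0; apply/eqP/nm_eq0/eqP.
rewrite -sqrf_eq0; apply/eqP; rewrite nmB_sqr hc !nm_sqrE iV (rep_dot rr) hc -(rep_dot rp).
by move: (complex.Re _) => t; ring.
Qed.

(** * The conditions exclude defects *)

Section direct_sum.
Context (R : realType) (H K : hilbertType R).

Lemma direct_sum_exists : exists (L : hilbertType R) (A : H -> L) (B : K -> L),
  [/\ iso A, iso B, forall h k, dotp (A h) (B k) = 0,
      forall u, u = A (adj A u) + B (adj B u) & ctotal H -> ctotal K -> ctotal L].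
Proof.
pose k (p q : H * K) := dotp p.1 q.1 + dotp p.2 q.2.
have pk : pd_kernel k.
  move=> s; have h1 := @gram_pd R H (H * K) fst s; have h2 := @gram_pd R K (H * K) snd s.
  have := addr_ge0 h1 h2; congr (0 <= _); rewrite /kform -big_split; apply: eq_bigr => p _ /=.
  by rewrite -big_split; apply: eq_bigr => q _ /=; rewrite -mulrDr.
have [L [v [hv tv]]] := kolmogorov_decomposition pk.
have lin a p q : v (a *: p.1 + q.1, a *: p.2 + q.2) = a *: v p + v q.
  apply: (total_eq tv) => r; rewrite ipDl ipZl !hv /k/= !ipDl !ipZl; ring.
pose A h := v (h, 0); pose B k := v (0, k).
have iA x y : dotp (A x) (A y) = dotp x y by rewrite hv /k/= ip0l addr0.
have iB x y : dotp (B x) (B y) = dotp x y by rewrite hv /k/= ip0l add0r.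
have nmA x : nm (A x) = nm x.
  by apply/eqP; rewrite -(@eqrXn2 _ 2) ?nm_ge0// !nm_sqrE iA.
have nmB x : nm (B x) = nm x.
  by apply/eqP; rewrite -(@eqrXn2 _ 2) ?nm_ge0// !nm_sqrE iB.
have isoA : iso A.
  split=> //; split=> [a x y|]; last by exists 1 => // x; rewrite mul1r nmA.
  by rewrite /A -lin/= scaler0 addr0.
have isoB : iso B.
  split=> //; split=> [a x y|]; last by exists 1 => // x; rewrite mul1r nmB.
  by rewrite /B -lin/= scaler0 addr0.
have AB h k' : dotp (A h) (B k') = 0 by rewrite hv /k/= ip0l ip0r addr0.
have vE p : v p = A p.1 + B p.2.
  by rewrite -[A _]scale1r -lin/= scale1r addr0 scale1r add0r; case: p.
have orth u : (forall h, dotp u (A h) = 0) -> (forall k, dotp u (B k) = 0) -> u = 0.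
  by move=> h1 h2; apply: tv => p; rewrite vE ipDr h1 h2 addr0.
exists L, A, B; split => //.
  move=> u; apply/eqP; rewrite -subr_eq0; apply/eqP; have BA k' h : dotp (B k') (A h) = 0.
    by rewrite ipC AB rmorph0.
  apply: orth => z; rewrite ipBl ipDl.
    by rewrite iA BA addr0 -(adjPr isoA.1) subrr.
  by rewrite iB AB add0r -(adjPr isoB.1) subrr.
move=> [d td] [e te]; apply: (@total_ctotal _ _ _ (fun i : nat + nat =>
  match i with inl n => A (d n) | inr n => B (e n) end)) => u hu.
apply: orth => z; rewrite ?(adjPr isoA.1) ?(adjPr isoB.1).
  have -> : adj A u = 0 by apply: td => n; rewrite -(adjPr isoA.1); exact: (hu (inl n)).
  exact: ip0l.
have -> : adj B u = 0 by apply: te => n; rewrite -(adjPr isoB.1); exact: (hu (inr n)).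
exact: ip0l.
Qed.

End direct_sum.

Section hyperrigidity_obstruction.
Context (R : realType) (X : set R[i]) (G : set (continuousType X R[i])).

Lemma hyperrigid_no_defect : hyperrigid true G -> ~ defect G.
Proof.
move=> [_ hyp] [H [K [V [rho [pi [[cH cK] iV rr [rp ip] [hG [a [h /eqP]]]]]]]]]; apply.
have [L [A [B [iA iB AB AAB cL]]]] := direct_sum_exists H K.
have bA := iA.1; have bB := iB.1; have bV := iV.1.
have aA := blin_adj bA; have aB := blin_adj bB; have aV := blin_adj bV.
have BA k h' : dotp (B k) (A h') = 0 by rewrite ipC AB rmorph0.
have AadjB k : adj A (B k) = 0 by apply: ip_ext => z; rewrite -(adjPr bA) BA ip0l.
have BadjA h' : adj B (A h') = 0 by apply: ip_ext => z; rewrite -(adjPr bB) AB ip0l.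
have [P PE] : exists P : continuousType X R[i] -> 'B(L),
    forall f u, P f u = A (pi f (adj A u)) + B (rho f (adj B u)).
  exists (fun f => toB (A \o (pi f \o adj A)) + toB (B \o (rho f \o adj B))) => f u.
  rewrite opDE !toBE //.
    by apply: blin_comp bB _; apply: blin_comp (blin_op _) aB.
  by apply: blin_comp bA _; apply: blin_comp (blin_op _) aA.
have adjAP f u : adj A (P f u) = pi f (adj A u).
  by rewrite PE (blinD aA) iso_adj// AadjB addr0.
have adjBP f u : adj B (P f u) = rho f (adj B u).
  by rewrite PE (blinD aB) iso_adj// BadjA add0r.
have dP f u w : dotp (P f u) w = dotp (pi f (adj A u)) (adj A w) + dotp (rho f (adj B u)) (adj B w).
  by rewrite PE ipDl (adjP bA) (adjP bB).
have repP : rep P.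
  split.
  - move=> c f g; apply/boundedOpP => u; apply: ip_ext => w; rewrite opDE opZE ipDl ipZl !dP.
    by rewrite (rep_lin rp) (rep_lin rr) !opDE !opZE !ipDl !ipZl; ring.
  - split; first by apply/boundedOpP => u; rewrite PE (rep_one rp) (rep_one rr) !op1E -AAB.
    move=> f g; apply/boundedOpP => u; rewrite opME [RHS]PE adjAP adjBP PE.
    by rewrite (rep_mul rp) (rep_mul rr).
  move=> f; symmetry; apply: adjoint_uniq => u w.
  by rewrite dP [RHS]ipC dP [RHS]rmorphD/= -!ipC (rep_conj rp) (rep_conj rr) -!adjointP.
have injP : injective P.
  move=> f g fg; apply: ip; apply/boundedOpP => x; have := congr1 (fun T : 'B(L) => adj A (T (A x))) fg.
  by rewrite !adjAP iso_adj.
have faith : faithful_representation P by case: repP => [l m ad].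
(* On h + k, V1 gives 0 + V h and V2 gives 0 + k, so V1^* V1 + V2^* V2 = 1. The resulting map keeps
   the corner rho and replaces the corner pi by V^* rho V. *)
have [V1 V1E] : exists V1 : 'B(L), forall u, V1 u = B (V (adj A u)).
  exists (toB (B \o (V \o adj A))) => u.
  by rewrite toBE//; apply: blin_comp bB _; exact: blin_comp bV aA.
have [V2 V2E] : exists V2 : 'B(L), forall u, V2 u = B (adj B u).
  by exists (toB (B \o adj B)) => u; rewrite toBE//; exact: blin_comp bB aB.
have [Phi PhiE] : exists Phi : 'B(L) -> 'B(L), forall T u w,
    dotp (Phi T u) w = dotp (T (V1 u)) (V1 w) + dotp (T (V2 u)) (V2 w).
  exists (fun T => adjoint V1 * T * V1 + adjoint V2 * T * V2) => T u w.
  by rewrite opDE !opME ipDl -!adjointPr.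
have PhiP f u w : dotp (Phi (P f) u) w =
    dotp (rho f (V (adj A u))) (V (adj A w)) + dotp (rho f (adj B u)) (adj B w).
  by rewrite PhiE !dP !V1E !V2E !AadjB !op0 !ip0l !add0r !iso_adj.
have uPhi : ucp Phi.
  split.
  - move=> c S T; apply/boundedOpP => u; apply: ip_ext => w.
    by rewrite opDE opZE ipDl ipZl !PhiE !opDE !opZE !ipDl !ipZl; ring.
  - move=> n M pM x; have := addr_ge0 (pM (fun i => V1 (x i))) (pM (fun i => V2 (x i))).
    congr (0 <= _); rewrite -big_split; apply: eq_bigr => i _ /=.
    by rewrite -big_split; apply: eq_bigr => j _ /=; rewrite PhiE.
  apply/boundedOpP => u; apply: ip_ext => w; rewrite PhiE !op1E !V1E !V2E !iB.2 iV.2.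
  by rewrite -(adjP bA) -(adjP bB) -ipDl -AAB.
have fixG g : G g -> Phi (P g) = P g.
  by move=> Gg; apply/boundedOpP => u; apply: ip_ext => w; rewrite PhiP dP hG.
have fixA f : Phi (P f) = P f.
  have h0 g : G g -> op_norm (Phi (P g) - P g) @[k --> \oo] --> (0 : R).
    move=> Gg; rewrite fixG// subrr; apply/op_norm_cvg0 => e e0; exists 0%N => n _.
    by have [x _] := op_norm_adherent (0 : 'B(L)) e0; rewrite op0E nm0 subr_lt0.
  have := hyp L (fun=> ctotal_separable (cL cH cK)) P (fun=> Phi) faith (fun=> uPhi) h0 f.
  move=> /op_norm_cvg0 hn; apply/eqP; rewrite -subr_eq0; apply/eqP/boundedOpP => u.
  have : op_norm (Phi (P f) - P f) = 0.
    apply/eqP; rewrite eq_le op_norm_ge0 andbT; apply/ler_addgt0Pr => e /hn[N hN].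
    by rewrite add0r ltW// (hN N).
  move=> n0; apply: nm_eq0; apply/eqP; rewrite eq_le nm_ge0 andbT.
  by have := op_norm_le (Phi (P f) - P f) u; rewrite n0 mul0r.
apply: (compression_intertwines iV rr rp) => f x y.
by have := PhiP f (A x) (A y); rewrite fixA dP !BadjA !op0 !ip0l !addr0 !iso_adj.
Qed.

End hyperrigidity_obstruction.

Section copies.
Context (R : realType) (K : hilbertType R).

Lemma copies_exist : exists (L : hilbertType R) (J : nat -> K -> L),
  [/\ forall n, iso (J n), forall n m x y, n != m -> dotp (J n x) (J m y) = 0,
      forall u, (forall n x, dotp u (J n x) = 0) -> u = 0 & ctotal K -> ctotal L].
Proof.
pose k (p q : nat * K) := if p.1 == q.1 then dotp p.2 q.2 else 0.
have pk : pd_kernel k.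
  move=> s; pose N := (\max_(p <- s) p.2.1).+1.
  have sN p : p \in s -> (p.2.1 < N)%N.
    by move=> ps; rewrite ltnS; apply: (@leq_bigmax_seq _ s xpredT (fun p => p.2.1)).
  pose w (n : nat) (p : nat * K) : K := if p.1 == n then p.2 else 0.
  have -> : kform k s s = \sum_(n < N) kform (fun p q => dotp (w n p) (w n q)) s s.
    rewrite /kform [RHS]exchange_big; apply: eq_big_seq => p ps.
    rewrite [RHS]exchange_big; apply: eq_bigr => q _; rewrite -mulr_sumr; congr (_ * _).
    rewrite (bigD1 (Ordinal (sN p ps)))//= big1 ?addr0; last first.
      move=> n np; rewrite {1}/w ifF ?ip0l//.
      by apply: contraNF np => /eqP e; apply/eqP/val_inj.
    by rewrite /k /w eqxx eq_sym; case: eqP => _; rewrite ?ip0r.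
  by apply: sumr_ge0 => n _; exact: gram_pd.
have [L [v [hv tv]]] := kolmogorov_decomposition pk.
pose J n x := v (n, x).
have lin a n x y : J n (a *: x + y) = a *: J n x + J n y.
  apply: (total_eq tv) => r; rewrite ipDl ipZl !hv /k/=.
  by case: eqP => _; rewrite ?ipDl ?ipZl ?mulr0 ?addr0.
have iJ n x y : dotp (J n x) (J n y) = dotp x y by rewrite hv /k eqxx.
have nmJ n x : nm (J n x) = nm x.
  by apply/eqP; rewrite -(@eqrXn2 _ 2) ?nm_ge0// !nm_sqrE iJ.
have isoJ n : iso (J n).
  split=> //; split=> [a x y|]; last by exists 1 => // x; rewrite mul1r nmJ.
  exact: lin.
exists L, J; split => //.
- by move=> n m x y nm; rewrite hv /k/= (negbTE nm).
- by move=> u hu; apply: tv => -[n x]; exact: hu.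
move=> [d td]; apply: (@total_ctotal _ _ _ (fun p : nat * nat => J p.1 (d p.2))) => u hu.
apply: tv => -[n x]; rewrite -[v _]/(J n x) (adjPr (isoJ n).1).
have -> : adj (J n) u = 0 by apply: td => m; rewrite -(adjPr (isoJ n).1); exact: (hu (n, m)).
exact: ip0l.
Qed.

End copies.

Section extension.
Context (R : realType) (X : set R[i]) (K L : hilbertType R) (J : K -> L) (iJ : iso J).
Context (r : continuousType X R[i] -> 'B(K)) (rr : rep r) (x0 : X).
Let bJ := iJ.1.

(** On the complement of the range of J, functions act as scalars through evaluation at a point of
    X, which keeps the extension a unital representation. *)
Lemma rep_extend : exists P : continuousType X R[i] -> 'B(L), rep P /\
  forall f u, P f u = J (r f (adj J u)) + f x0 *: (u - J (adj J u)).
Proof.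
have aJ := blin_adj bJ.
have [Q QE] : exists Q : 'B(L), forall u, Q u = u - J (adj J u).
  exists (1 - toB (J \o adj J)) => u; rewrite opBE op1E toBE//; exact: blin_comp bJ aJ.
have [P PE] : exists P : continuousType X R[i] -> 'B(L),
    forall f u, P f u = J (r f (adj J u)) + f x0 *: (u - J (adj J u)).
  exists (fun f => toB (J \o (r f \o adj J)) + f x0 *: Q) => f u.
  rewrite opDE opZE QE toBE//; apply: blin_comp bJ _; exact: blin_comp (blin_op _) aJ.
have adjP' f u : adj J (P f u) = r f (adj J u).
  by rewrite PE (blinD aJ) (blinZ aJ) (blinB aJ) !iso_adj// subrr scaler0 addr0.
have dP f u w : dotp (P f u) w = dotp (r f (adj J u)) (adj J w) +
    f x0 * (dotp u w - dotp (adj J u) (adj J w)).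
  by rewrite PE ipDl ipZl ipBl !(adjP bJ).
exists P; split => //; split.
- move=> c f g; apply/boundedOpP => u; apply: ip_ext => w; rewrite opDE opZE ipDl ipZl !dP.
  by rewrite (rep_lin rr) opDE opZE ipDl ipZl cfD cfZ; ring.
- split; first by apply/boundedOpP => u; apply: ip_ext => w; rewrite dP (rep_one rr) !op1E cf1 mul1r addrC subrK.
  move=> f g; apply/boundedOpP => u; apply: ip_ext => w; rewrite opME !dP adjP' (rep_mul rr) opME cfM.
  by ring.
move=> f; symmetry; apply: adjoint_uniq => u w.
rewrite dP [RHS]ipC dP [RHS]rmorphD/= [X in _ = _ + X]rmorphM/= rmorphB/= -!ipC (rep_conj rr) -adjointP.
by rewrite cfJ conjCK.
Qed.

End extension.

Section wot_obstruction.
Context (R : realType) (X : set R[i]) (hX : compact X) (X0 : X !=set0).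
Context (G : set (continuousType X R[i])).

Lemma normal_condition_no_defect : normal_condition true G -> ~ defect G.
Proof.
move=> hyp [H [K [V [rho [pi [[cH cK] iV rr [rp ip] [hG [a [h /negP]]]]]]]]]; apply; apply/eqP.
have [z0 Xz0] := X0; pose x0 : X := exist _ z0 (mem_set Xz0).
have [L [I_ [iI II tI cL]]] := copies_exist K.
have bI n := (iI n).1; have bV := iV.1; have aV := blin_adj bV; have aI n := blin_adj (bI n).
have adjII n m x : n != m -> adj (I_ n) (I_ m x) = 0.
  by move=> nm; apply: ip_ext => z; rewrite -(adjPr (bI n)) II ?ip0l// eq_sym.
pose P x := V (adj V x).
have bP : blin P by exact: blin_comp bV aV.
have PV x : P (V x) = V x by rewrite /P iso_adj.
have PP x : P (P x) = P x by rewrite /P iso_adj.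
have sP x y : dotp (P x) y = dotp x (P y) by rewrite /P (adjP bV) (adjPr bV).
(* V H goes to copy 0 for every n and its complement to copy n + 1. The J n therefore agree on V H,
   while J n^* tends strongly to V W^*, by [J0] below. *)
pose J n x := I_ 0%N (P x) + I_ n.+1 (x - P x).
have bJ n : blin (J n).
  split=> [c x y|].
    rewrite /J (blinP bP) (blinP (bI 0%N)).
    have -> : c *: x + y - (c *: P x + P y) = c *: (x - P x) + (y - P y).
      by rewrite scalerBr opprD addrACA.
    by rewrite (blinP (bI n.+1)) scalerDr addrACA.
  have [C C0 hC] := blin_bound bP; exists (C + (1 + C)); first by rewrite !addr_ge0// ltW.
  move=> x; rewrite /J; apply: le_trans (nmD _ _) _; rewrite !(iso_nm _ (iI _)) mulrDl.
  apply: lerD; first exact: hC.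
  by apply: le_trans (nmD _ _) _; rewrite nmN mulrDl mul1r lerD2l.
have iJ n : iso (J n).
  split=> // x y; rewrite /J ipDl !ipDr (II 0%N n.+1)// (II n.+1 0%N)// addr0 add0r !(iI _).2 ipBl !ipBr.
  by rewrite !sP !PP; ring.
pose W x := I_ 0%N (V x).
have iW : iso W by split=> [|x y]; [exact: blin_comp (bI _) bV|rewrite (iI _).2 iV.2].
have adjJ n u : adj (J n) u = P (adj (I_ 0%N) u) + (adj (I_ n.+1) u - P (adj (I_ n.+1) u)).
  apply: ip_extr => x; rewrite -(adjP (bJ n)) /J ipDl !(adjP (bI _)) ipDr ipBr ipBl sP.
  by rewrite [dotp (P x) (adj _ u)]sP.
have adjW u : V (adj W u) = P (adj (I_ 0%N) u).
  congr V; apply: ip_extr => x; rewrite -(adjP iW.1) /W (adjP (bI 0%N)) (adjP bV).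
  by [].
have cI n u : nm (adj (I_ n) u) <= nm u.
  apply: nm_le_ip (nm_ge0 _) _ => y; rewrite -(adjPr (bI n)).
  by apply: le_trans (cauchy_schwarz _ _) _; rewrite (iso_nm _ (iI n)).
(* On a fixed copy the sequence is eventually 0; the uniform bound [cI] extends this to the closed
   span. *)
have I0 u : adj (I_ n) u @[n --> \oo] --> (0 : K).
  move: u; have tIf : total_family (fun p : nat * K => I_ p.1 p.2).
    by move=> u hu; apply: tI => n x; exact: (hu (n, x)).
  apply: (total_closed tIf (M := [set u | adj (I_ n) u @[n --> \oo] --> (0 : K)])).
    apply: closed_subspaceP => [|c x y /= hx hy|x hx] /=.
    - rewrite (_ : (fun n => _) = fun=> 0); first exact: cvg_cst.
      by apply/funext => n; exact: blin0.
    - rewrite (_ : (fun n => _) = fun n => c *: adj (I_ n) x + adj (I_ n) y).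
        by rewrite -[0 in X in _ --> X](addr0 0) -{1}(scaler0 _ c); apply: cvgD hy; exact: cvgZl_tmp hx.
      by apply/funext => n; exact: blinP.
    apply/cvgnP_nm => e e0; have e2 : 0 < e / 2 by rewrite divr_gt0.
    have [y /= /cvgnP_nm/(_ _ e2)[N hN] xy] := hx _ e2; exists N => n /hN; rewrite !subr0 => h1.
    have -> : adj (I_ n) x = adj (I_ n) (x - y) + adj (I_ n) y by rewrite (blinB (aI n)) subrK.
    apply: le_lt_trans (nmD _ _) _; apply: half_ltD h1.
    exact: le_lt_trans (cI _ _) xy.
  move=> [m x] /=; apply/cvgnP_nm => e e0; exists m.+1 => n mn.
  by rewrite adjII ?subr0 ?nm0// gtn_eqF.
have bQ : blin (fun x => x - P x).
  split=> [c x y|]; first by rewrite (blinP bP) scalerBr opprD addrACA.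
  have [C C0 hC] := blin_bound bP; exists (1 + C); first by rewrite addr_ge0// ltW.
  by move=> x; apply: le_trans (nmD _ _) _; rewrite nmN mulrDl mul1r lerD2l.
have J0 u : adj (J n) u @[n --> \oo] --> V (adj W u).
  rewrite adjW -[X in _ --> X]addr0; under eq_fun do rewrite adjJ.
  apply: cvgD; first exact: cvg_cst.
  rewrite -[X in _ --> X](blin0 bQ); apply: (blin_cvg bQ (u := fun n => adj (I_ n.+1) u)).
  by have := I0 u; rewrite -cvg_shiftS.
have [Rn hRn] := choice (fun n => rep_extend (iJ n) rr x0).
have [Ro [rRo Ro']] := rep_extend iW rp x0.
have rRn n := (hRn n).1; have Rn' n := (hRn n).2.
have fc n f : fun_calc (Rn n (cf_id X)) f = Rn n f by exact: fun_calc_rep.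
have fco f : fun_calc (Ro (cf_id X)) f = Ro f by exact: fun_calc_rep.
have := hyp L (fun=> ctotal_separable (cL cK)) (fun n => Rn n (cf_id X)) (Ro (cf_id X))
  (fun n => rep_id_normal (rRn n)) (rep_id_normal rRo) (fun n => rep_spectrum_sub hX (rRn n))
  (rep_spectrum_sub hX rRo) _ a (W h).
move=> /(_ _)/cvgnP_nm hc.
have wot g : G g -> wot_cvg (fun n => fun_calc (Rn n (cf_id X)) g) (fun_calc (Ro (cf_id X)) g).
  move=> Gg u w; rewrite fco; under eq_fun do rewrite fc.
  rewrite (_ : (fun n => _) = fun n => dotp (rho g (adj (J n) u)) (adj (J n) w) +
     g x0 * (dotp u w - dotp (adj (J n) u) (adj (J n) w))); last first.
    by apply/funext => n; rewrite Rn' ipDl ipZl ipBl !(adjP (bJ n)).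
  have -> : dotp (Ro g u) w = dotp (rho g (V (adj W u))) (V (adj W w)) +
     g x0 * (dotp u w - dotp (V (adj W u)) (V (adj W w))).
    by rewrite Ro' ipDl ipZl ipBl !(adjP iW.1) hG// iV.2.
  apply/cvgCP; apply: cvgCD.
    by apply/cvgCP; apply: ip_cvg (J0 w); apply: blin_cvg (J0 u); exact: blin_op.
  apply: cvgCM; apply: cvgCB; first exact: cvgC_cst.
  by apply/cvgCP; apply: ip_cvg (J0 u) (J0 w).
have {}hc := hc wot.
have adjJW n : adj (J n) (W h) = V h.
  by rewrite adjJ /W iso_adj// adjII// PV (blin0 bP) subrr addr0.
have JV n x : J n (V x) = W x by rewrite /J PV subrr (blin0 (bI _)) addr0.
(* For every n the two operators send W h to J n (rho(a) V h) and J n (V pi(a) h). The norm of the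
   difference does not depend on n, so strong convergence forces it to be 0. *)
apply/eqP; rewrite -subr_eq0; apply/eqP/nm_eq0/eqP; rewrite eq_le nm_ge0 andbT.
apply/ler_addgt0Pr => e /hc[N /(_ N (leqnn N))]; rewrite add0r fc fco Rn' Ro' adjJW JV.
rewrite subrr scaler0 addr0 iso_adj// subrr scaler0 addr0 -[W (pi a h)](JV N).
by rewrite -(blinB (bJ N)) (iso_nm _ (iJ N)) => /ltW.
Qed.

End wot_obstruction.

Theorem theorem3p1 (R : realType) (X : set R[i])
    (X_neq0 : X !=set0) (X_compact : compact X)
    (G : set (continuousType X R[i])) (G_generators : generators G) :
  [/\ hyperrigid false G <-> subnormal_condition false G,
      subnormal_condition false G <-> normal_condition false G &
      forall sep1 sep2 sep3 : bool,
        (hyperrigid sep1 G <-> subnormal_condition sep2 G) /\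
        (subnormal_condition sep2 G <-> normal_condition sep3 G)].
Proof.
have hF : ~ defect G -> hyperrigid false G.
  by move=> nd; apply: (hyperrigid_of_no_defect X_compact X_neq0) nd; case: G_generators.
have sF : ~ defect G -> subnormal_condition false G by move=> nd; apply: (subnormal_of_no_defect X_compact X_neq0) nd.
have hD sep : hyperrigid sep G -> ~ defect G.
  by case: sep => [|/hyperrigid_separable]; exact: hyperrigid_no_defect.
have nD sep : normal_condition sep G -> ~ defect G.
  by case: sep => [|/normal_condition_separable]; exact: normal_condition_no_defect.
have sD sep : subnormal_condition sep G -> ~ defect G.
  by move=> /subnormal_normal_condition; exact: nD.
have hS sep : ~ defect G -> hyperrigid sep G.
  by move=> /hF; case: sep => // /hyperrigid_separable.
have sS sep : ~ defect G -> subnormal_condition sep G.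
  by move=> /sF; case: sep => // /subnormal_condition_separable.
have nS sep : ~ defect G -> normal_condition sep G.
  by move=> /(sS sep)/subnormal_normal_condition.
have HS sep1 sep2 : hyperrigid sep1 G <-> subnormal_condition sep2 G.
  by split=> [/hD/sS|/sD/hS]; exact.
have SN sep1 sep2 : subnormal_condition sep1 G <-> normal_condition sep2 G.
  by split=> [/sD/nS|/nD/sS]; exact.
by split; [exact: HS|exact: SN|move=> s1 s2 s3; split; [exact: HS|exact: SN]].
Qed.
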